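(* Let $\mathcal L$ be the directed landscape and let $\pi:[0,1]\to\mathbb R$ be the almost surely unique $\mathcal L$-geodesic from $(0,0)$ to $(0,1)$. Then almost surely $\pi$ is not H\''older-$2/3$ on $[0,1]$.
   Context: A function $f:[0,1]\to\mathbb R$ is H\''older-$\alpha$ if $\sup_{s\ne t\in[0,1]}|f(t)-f(s)|/|t-s|^\alpha<\infty$. Directed landscape. Let $\mathbb R^4_\uparrow=\{(x,s;y,t)\in\mathbb R^4:s<t\}$. Let $(W_j)_{j\in\mathbb Z}$ be independent standard two-sided Brownian motions and $$\mathcal L_n(x,s;y,t)=n^{1/6}\Big(\sup\sum_{j=\lfloor ns\rfloor+1}^{\lfloor nt\rfloor}\big(W_j(z_j)-W_j(z_{j-1})\big)-2(t-s)\sqrt n-2(y-x)n^{1/6}\Big),$$ the sup over nondecreasing sequences $z_{\lfloor ns\rfloor}\le\dots\le z_{\lfloor nt\rfloor}$ with $z_{\lfloor ns\rfloor}=s+2xn^{-1/3}$, $z_{\lfloor nt\rfloor}=t+2yn^{-1/3}$. The directed landscape $\mathcal L:\mathbb R^4_\uparrow\to\mathbb R$ is the random continuous function which is the limit in distribution of $\mathcal L_n$ as $n\to\infty$ with respect to uniform convergence on compact subsets of $\mathbb R^4_\uparrow$. Geodesics. A path is a continuous function $\gamma:[s,t]\to\mathbb R$; its length is $\ell(\gamma)=\inf_{k\in\mathbb N}\inf_{s=t_0<t_1<\dots<t_k=t}\sum_{i=1}^k\mathcal L(\gamma(t_{i-1}),t_{i-1};\gamma(t_i),t_i)$. A path $\gamma$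 is an ($\mathcal L$-)geodesic from $(\gamma(s),s)$ to $(\gamma(t),t)$ if $\ell(\gamma)=\mathcal L(\gamma(s),s;\gamma(t),t)$. *)

(* Defs.v *)
From HB Require Import structures.
From mathcomp Require Import all_boot all_order all_algebra.
From mathcomp Require Import finmap.
From mathcomp Require Import all_classical all_reals all_analysis.

Set Implicit Arguments.
Unset Strict Implicit.
Unset Printing Implicit Defensive.

Import Order.TTheory GRing.Theory Num.Theory numFieldNormedType.Exports.
Local Open Scope classical_set_scope.
Local Open Scope ring_scope.

(* (x, s; y, t) is written ((x, s), (y, t)): space coordinate first, then time *)
Notation R4 R := ((R * R) * (R * R))%type.

Definition R4up (R : realType) : set (R4 R) := [set p | p.1.2 < p.2.2].

(* The functions R^4_up -> R are represented by functions on R^4 whose values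
   off R^4_up are irrelevant: in {family compacts_R4up, R4 R -> R}, i.e., for
   uniform convergence on the compact subsets of R^4_up, two functions which
   agree on R^4_up are topologically indistinguishable. *)
Definition compacts_R4up (R : realType) : set (set (R4 R)) :=
  [set K | compact K /\ K `<=` @R4up R].

Section brownian.
Context {R : realType} {d : measure_display} {T : measurableType d}.
Variable P : probability T R.

Definition sigma_process (I : Type) (X : T -> I -> R) : set (set T) :=
  <<s \bigcup_(i in [set: I])
        preimage_set_system setT (fun w => X w i) measurable >>.

Definition sigma_rv (X : T -> R) : set (set T) :=
  preimage_set_system setT X measurable.

Definition mutually_independent (I : choiceType) (S : I -> set (set T)) :=
  forall (J : {fset I}) (A : I -> set T), (forall i, i \in J -> S i (A i)) ->
    P (\bigcap_(i in [set` J]) A i) = (\prod_(i <- J) P (A i))%E.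

(* [normal_prob m s] takes the standard deviation s, not the variance *)
Definition standard_two_sided_BM (B : T -> R -> R) :=
  [/\ forall t, measurable_fun setT (fun w => B w t),
      forall w, continuous (B w),
      forall w, B w 0 = 0,
      (forall (n : nat) (t : nat -> R), (forall i, t i < t i.+1) ->
        mutually_independent
          (fun i : 'I_n => sigma_rv (fun w => B w (t i.+1) - B w (t i))))
    & (forall s t : R, s < t -> forall A, measurable A ->
        P ((fun w => B w t - B w s) @^-1` A)
        = normal_prob 0 (Num.sqrt (t - s)) A)].

Definition independent_BMs (W : int -> T -> R -> R) :=
  (forall j, standard_two_sided_BM (W j)) /\
  mutually_independent (fun j => sigma_process (W j)).

End brownian.

Section prelimit.
Context {R : realType}.

(* [W] is one realisation of the environment.  The sequence z_a <= ... <= z_b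
   is given by the values on {a, ..., b} of a function z on the integers. *)
Definition lpp_value (W : int -> R -> R) (a b : int) (z : int -> R) : R :=
  \sum_(i < `|b - a|%N)
    (W (a + i.+1%:Z) (z (a + i.+1%:Z)) - W (a + i.+1%:Z) (z (a + i%:Z))).

Definition lpp_values (W : int -> R -> R) (a b : int) (u v : R) : set R :=
  [set lpp_value W a b z | z in
    [set z : int -> R | [/\ z a = u, z b = v &
      forall j : int, a <= j < b -> z j <= z (j + 1)]]].

(* The supremum is real-valued and [sup set0 = 0]. Every compact subset of
   R^4_up only meets the points where the set is nonempty as soon as n is large
   enough, and then the set is bounded above since the W_j are continuous. *)
Definition landscape_n (W : int -> R -> R) (n : nat) (p : R4 R) : R :=
  let: ((x, s), (y, t)) := p in
  let N : R := n%:R in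
  N `^ (1 / 6) *
    (sup (lpp_values W (Num.floor (N * s)) (Num.floor (N * t))
            (s + 2 * x * N `^ (- (1 / 3))) (t + 2 * y * N `^ (- (1 / 3))))
     - 2 * (t - s) * Num.sqrt N - 2 * (y - x) * N `^ (1 / 6)).

End prelimit.

(* Convergence in distribution of X_n (on (T', Q)) to X (on (T, P)) for the
   topology of uniform convergence on compact subsets of R^4_up. *)
Definition cvg_in_distribution {R : realType}
    {d' : measure_display} {T' : measurableType d'} (Q : probability T' R)
    (X_ : nat -> T' -> R4 R -> R)
    {d : measure_display} {T : measurableType d} (P : probability T R)
    (X : T -> R4 R -> R) :=
  forall F : {family @compacts_R4up R, R4 R -> R} -> R,
    continuous F -> (exists M : R, forall f, `|F f| <= M) ->
    ('E_Q[fun w => F (X_ n w)] @[n --> \oo] --> 'E_P[fun w => F (X w)])%E.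

(* The expectations of F(L_n) in [cvg_in_distribution] are genuine: the floors
   jump at deterministic times, so that F(L_n) is a measurable function of the
   paths W_j. *)
Definition directed_landscape {R : realType}
    {d : measure_display} {T : measurableType d} (P : probability T R)
    (L : T -> R4 R -> R) :=
  [/\ forall w p, @R4up R p -> {for p, continuous (L w)},
      forall p, @R4up R p -> measurable_fun setT (fun w => L w p)
    & exists (d' : measure_display) (T' : measurableType d')
        (Q : probability T' R) (W : int -> T' -> R -> R),
        independent_BMs Q W /\
        cvg_in_distribution Q
          (fun n w => landscape_n (fun j => W j w) n) P L].

Section geodesics.
Context {R : realType}.
Variable L : R4 R -> R.

Definition path_length (s t : R) (g : R -> R) : \bar R :=
  ereal_inf [set x : \bar R | exists (k : nat) (r : nat -> R),
    [/\ r 0%N = s, r k = t, (forall i, (i < k)%N -> r i < r i.+1)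
      & x = (\sum_(i < k) L ((g (r i), r i), (g (r i.+1), r i.+1)))%:E]].

(* Paths [s, t] -> R are functions R -> R of which only the restriction to
   [s, t] matters. *)
Definition is_geodesic (p q : R * R) (g : R -> R) :=
  [/\ {within `[p.2, q.2], continuous g}, g p.2 = p.1, g q.2 = q.1
    & path_length p.2 q.2 g = (L (p, q))%:E].

Definition is_unique_geodesic (p q : R * R) (g : R -> R) :=
  is_geodesic p q g /\
  forall h, is_geodesic p q h -> {in `[p.2, q.2], h =1 g}.

End geodesics.

Definition hoelder01 {R : realType} (alpha : R) (f : R -> R) :=
  (ereal_sup [set x : \bar R | exists s t : R,
     [/\ s \in `[0%R, 1%R], t \in `[0%R, 1%R], s != t
       & x = (`|f t - f s| / `|t - s| `^ alpha)%:E]] < +oo)%E.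

(* Main.v *)
(* Let X = L(0, 0; 0, 1).  A discrete Burke property of the Gaussian increments bounds
   exponential moments in the prelimit and shows that X < 0 with positive probability.

   By superadditivity between the times -1, 0, 1, 2, a path from (w, 0) to (w, 1) whose
   length is nearly optimal stays in a tube around w.  Splitting it at time 1/2, the
   1:2:3 scaling shows that an almost surely constant X = k would satisfy
   k <= 2^(2/3) k, hence k >= 0, which is excluded; so P(X <= c1) > 0 and P(X > c2) > 0
   for some c1 < c2.  As paths in disjoint tubes are independent, the lengths
   L(iS, 0; iS, 1), i < k, are all at most c2 with probability at most rho^k, rho < 1.

   By positive association, the lengths L(x, 0; y, 1) with |x| <= N and |y - x| <= M are
   all at most c1 with probability at least q^(2N+1), so that with positive probability
   this happens although L(w, 0; w, 1) >= c2 for some w = O(N).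

   Seen at the scale (nu^2, nu^3), a Hoelder-2/3 path with constant M that starts at
   (0, 0) stays in |x| <= 4 M nu^2 up to time 4 nu^3 and moves by at most M in a unit of
   time.  If each unit slice of [2 nu^3, 3 nu^3] is as above with the same w, the detour
   through w gains nu^3 (c2 - c1) and costs O(nu), so that no such path is a geodesic.
   This event has positive probability, and its copies scaled to the time intervals
   [8^-j, 4 8^-j] are independent: almost surely one of them occurs, for every M. *)
Require Import Defs.
From HB Require Import structures.
From mathcomp Require Import all_boot all_order all_algebra.
From mathcomp Require Import finmap.
From mathcomp Require Import all_classical all_reals all_analysis.
From mathcomp Require Import measurable_realfun.
From mathcomp Require Import ring lra zify.
Import Order.TTheory GRing.Theory Num.Theory numFieldNormedType.Exports.
Local Open Scope classical_set_scope.
Local Open Scope ring_scope.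

Set Implicit Arguments.
Unset Strict Implicit.
Unset Printing Implicit Defensive.

(** * Expectations of bounded random variables *)

Section expectation_toolkit.
Context {R : realType} {d : measure_display} {T : measurableType d}.
Variable P : probability T R.

Definition Ev (X : T -> R) : R := \int[P]_w X w.

Definition bmeas (X : T -> R) :=
  measurable_fun setT X /\ exists B : R, forall w, `|X w| <= B.

Lemma bmeas_cst c : bmeas (fun=> c).
Proof. by split; [exact: measurable_cst | exists `|c|]. Qed.

Lemma bmeasD X Y : bmeas X -> bmeas Y -> bmeas (fun w => X w + Y w).
Proof.
move=> [mX [B hB]] [mY [C hC]]; split; first exact: measurable_funD.
by exists (B + C) => w; apply: le_trans (ler_normD _ _) _; exact: lerD.
Qed.

Lemma bmeasM X Y : bmeas X -> bmeas Y -> bmeas (fun w => X w * Y w).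
Proof.
move=> [mX [B hB]] [mY [C hC]]; split; first exact: measurable_funM.
by exists (B * C) => w; rewrite normrM ler_pM.
Qed.

Lemma bmeasZ c X : bmeas X -> bmeas (fun w => c * X w).
Proof. by move=> bX; apply: bmeasM => //; exact: bmeas_cst. Qed.

Lemma bmeasB X Y : bmeas X -> bmeas Y -> bmeas (fun w => X w - Y w).
Proof.
move=> bX bY; rewrite (_ : (fun w => _) = fun w => X w + -1 * Y w).
  by apply: bmeasD => //; exact: bmeasZ.
by apply/funext => w; rewrite mulN1r.
Qed.

Lemma bmeas_indic (A : set T) : measurable A -> bmeas (\1_A : T -> R).
Proof.
move=> mA; split; first exact: measurable_indic.
by exists 1 => w; rewrite indicE; case: (w \in A); rewrite ?normr1 ?normr0.
Qed.

Lemma bmeas_integrable X : bmeas X -> P.-integrable setT (EFin \o X).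
Proof.
move=> [mX [B hB]].
apply: (@le_integrable _ _ _ P setT measurableT _ (EFin \o cst B)).
- exact/measurable_EFinP.
- by move=> w _ /=; rewrite lee_fin (le_trans (hB w))// ler_norm.
- by apply: finite_measure_integrable_cst.
Qed.
Hint Resolve bmeas_cst : core.

Lemma EvE X : bmeas X -> (Ev X)%:E = (\int[P]_w (X w)%:E)%E.
Proof.
by move=> bX; rewrite /Ev /Rintegral fineK//; apply: integrable_fin_num => //;
  exact: bmeas_integrable.
Qed.

Lemma Ev_cst c : Ev (fun=> c) = c.
Proof. by rewrite /Ev Rintegral_cst// [X in fine X](probability_setT P) mulr1. Qed.

Lemma EvD X Y : bmeas X -> bmeas Y -> Ev (fun w => X w + Y w) = Ev X + Ev Y.
Proof. by move=> bX bY; rewrite /Ev RintegralD//; exact: bmeas_integrable. Qed.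

Lemma EvB X Y : bmeas X -> bmeas Y -> Ev (fun w => X w - Y w) = Ev X - Ev Y.
Proof. by move=> bX bY; rewrite /Ev RintegralB//; exact: bmeas_integrable. Qed.

Lemma EvZ c X : bmeas X -> Ev (fun w => c * X w) = c * Ev X.
Proof. by move=> bX; rewrite /Ev RintegralZl//; exact: bmeas_integrable. Qed.

Lemma bmeas_sum n (F : nat -> T -> R) : (forall k, bmeas (F k)) ->
  bmeas (fun w => \sum_(k < n) F k w).
Proof.
move=> bF; elim: n => [|n IH]; first by under eq_fun do rewrite big_ord0.
by under eq_fun do rewrite big_ord_recr/=; exact: bmeasD.
Qed.

Lemma Ev_sum n (F : nat -> T -> R) : (forall k, bmeas (F k)) ->
  Ev (fun w => \sum_(k < n) F k w) = \sum_(k < n) Ev (F k).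
Proof.
move=> bF; elim: n => [|n IH].
  by rewrite big_ord0; under eq_fun do rewrite big_ord0; rewrite Ev_cst.
rewrite big_ord_recr/= -IH -EvD//; last exact: bmeas_sum.
by congr Ev; apply/funext => w; rewrite big_ord_recr.
Qed.

Lemma Ev_le X Y : bmeas X -> bmeas Y -> (forall w, X w <= Y w) -> Ev X <= Ev Y.
Proof.
by move=> bX bY XY; apply: le_Rintegral => //; exact: bmeas_integrable.
Qed.

Lemma Ev_ge0 X : (forall w, 0 <= X w) -> 0 <= Ev X.
Proof. by move=> X0; apply: Rintegral_ge0. Qed.

Lemma Ev_norm_le X c : bmeas X -> (forall w, `|X w| <= c) -> `|Ev X| <= c.
Proof.
move=> bX Xc; rewrite ler_norml; apply/andP; split.
  rewrite -(Ev_cst (- c)); apply: Ev_le => // w.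
  by have := Xc w; rewrite ler_norml => /andP[].
rewrite -[leRHS](Ev_cst c); apply: Ev_le => // w.
by have := Xc w; rewrite ler_norml => /andP[].
Qed.

Lemma Ev_dist_le X Y c : bmeas X -> bmeas Y -> (forall w, `|X w - Y w| <= c) ->
  `|Ev X - Ev Y| <= c.
Proof.
move=> bX bY XY; rewrite -EvB//; apply: Ev_norm_le => //.
exact: bmeasB.
Qed.

Lemma Ev_indic (A : set T) : measurable A -> Ev \1_A = fine (P A).
Proof. by move=> mA; rewrite /Ev /Rintegral integral_indic// setIT. Qed.

Lemma eq_Ev X Y : X =1 Y -> Ev X = Ev Y.
Proof. by move=> /funext ->. Qed.

Lemma Ev_cvg (X_ : nat -> T -> R) X B :
  (forall n, measurable_fun setT (X_ n)) -> (forall n w, `|X_ n w| <= B) ->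
  (forall w, X_ n w @[n --> \oo] --> X w) ->
  [/\ bmeas X, forall w, `|X w| <= B & Ev (X_ n) @[n --> \oo] --> Ev X].
Proof.
move=> mX hB cX.
have hX w : `|X w| <= B.
  have /(@cvg_lim _ _ _) <- // : `|X_ n w| @[n --> \oo] --> `|X w|.
    exact: cvg_norm.
  apply: limr_le; first by apply/cvg_ex; eexists; apply: cvg_norm; exact: cX.
  by apply: nearW => n; exact: hB.
have mX' : measurable_fun setT X.
  by apply: (measurable_fun_cvg mX) => w _; exact: cX.
have bX : bmeas X by split => //; exists B.
split => //.
have H : ((\int[P]_x (X_ n x)%:E)%E @[n --> \oo] --> (Ev X)%:E)%E.
  rewrite EvE//.
  apply: (@dominated_cvg _ _ _ P setT measurableT _ _ (cst B%:E)) => //.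
  - by move=> n; exact/measurable_EFinP.
  - by move=> w _; apply/fine_cvgP; split; [exact: nearW | exact: cX].
  - exact: finite_measure_integrable_cst.
  - by move=> n w _; rewrite lee_fin.
by move/fine_cvgP : H => [].
Qed.

End expectation_toolkit.
#[export] Hint Resolve bmeas_cst : core.

Section Ev_swap.
Context {R : realType} {d1 d2 : measure_display}
  {T1 : measurableType d1} {T2 : measurableType d2}.
Variables (P1 : probability T1 R) (P2 : probability T2 R).

Lemma Ev_swap (f : T1 -> T2 -> R) : bmeas (fun z : T1 * T2 => f z.1 z.2) ->
  Ev P1 (fun x => Ev P2 (f x)) = Ev P2 (fun y => Ev P1 (f ^~ y)).
Proof.
move=> [mf [B hB]].
have bf1 x : bmeas (f x).
  split; last by exists B => y; exact: (hB (x, y)).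
  by have := measurableT_comp mf (pair1_measurable x).
have bf2 y : bmeas (f ^~ y).
  split; last by exists B => x; exact: (hB (x, y)).
  by have := measurableT_comp mf (pair2_measurable y).
pose g z := (f z.1 z.2 + B)%:E.
have mg : measurable_fun setT (g : T1 * T2 -> \bar R).
  by apply/measurable_EFinP; apply: measurable_funD.
have g0 z : (0 <= g z)%E.
  rewrite lee_fin -lerBlDr sub0r.
  by have := hB z; rewrite ler_norml => /andP[].
have := @fubini_tonelli _ _ _ _ _ P1 P2 g mg g0.
have e1 x : (\int[P2]_y g (x, y))%E = (Ev P2 (f x) + B)%:E.
  rewrite /g /= -[in RHS](Ev_cst P2 B) -EvD// EvE//.
  by apply: bmeasD.
have e2 y : (\int[P1]_x g (x, y))%E = (Ev P1 (f ^~ y) + B)%:E.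
  rewrite /g /= -[in RHS](Ev_cst P1 B) -EvD// EvE//.
  by apply: bmeasD.
have b1 : bmeas (fun x => Ev P2 (f x)).
  split; last first.
    by exists B => x; apply: Ev_norm_le => // y; exact: (hB (x, y)).
  have := @measurable_fun_fubini_tonelli_F _ _ _ _ _ P2 g mg g0.
  rewrite /fubini_F; under eq_fun do rewrite e1.
  move/measurable_EFinP => H.
  rewrite (_ : (fun x => _) = fun x => Ev P2 (f x) + B + (- B)).
    by apply: measurable_funD.
  by apply/funext => x; rewrite addrK.
have b2 : bmeas (fun y => Ev P1 (f ^~ y)).
  split; last first.
    by exists B => y; apply: Ev_norm_le => // x; exact: (hB (x, y)).
  have := @measurable_fun_fubini_tonelli_G _ _ _ _ _ P1 g mg g0.
  rewrite /fubini_G; under eq_fun do rewrite e2.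
  move/measurable_EFinP => H.
  rewrite (_ : (fun x => _) = fun y => Ev P1 (f ^~ y) + B + (- B)).
    by apply: measurable_funD.
  by apply/funext => y; rewrite addrK.
under eq_integral do rewrite e1.
under [X in _ = X -> _]eq_integral do rewrite e2.
rewrite -!EvE; [|by apply: bmeasD..].
by rewrite !EvD// !Ev_cst => -[] /addIr.
Qed.

End Ev_swap.

#[global] Opaque Ev.

(** * Gaussian integrals of functionals of finitely many coordinates *)

Section lipschitz_functionals.
Context {R : realType} {J : eqType}.
Implicit Types (l : seq J) (G H : (J -> R) -> R).

Definition lipK l (K : R) G := 0 <= K /\
  forall u v : J -> R, `|G u - G v| <= K * \sum_(c <- l) `|u c - v c|.

Definition flip l G := exists K, lipK l K G.

Definition blip l G := flip l G /\ exists B : R, forall u, `|G u| <= B.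

Definition upd (u : J -> R) (c : J) (x : R) : J -> R :=
  fun c' => if c' == c then x else u c'.

Lemma lipK_sub l l' K G : {subset l <= l'} -> lipK l K G ->
  lipK l' (K * (size l)%:R) G.
Proof.
move=> ll' [K0 hG]; split; first by rewrite mulr_ge0.
move=> u v; apply: le_trans (hG u v) _; rewrite -mulrA ler_wpM2l//.
elim: l ll' {hG} => [|c l IH] ll'; first by rewrite big_nil mul0r.
rewrite big_cons /= -natr1 mulrDl mul1r addrC lerD//.
  by apply: IH => x xl; apply: ll'; rewrite inE xl orbT.
have cl' : c \in l' by apply: ll'; rewrite mem_head.
by rewrite (big_rem c cl')/= lerDl sumr_ge0.
Qed.

Lemma flip_sub l l' G : {subset l <= l'} -> flip l G -> flip l' G.
Proof. by move=> ll' [K hG]; exists (K * (size l)%:R); exact: lipK_sub hG. Qed.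

Lemma blip_sub l l' G : {subset l <= l'} -> blip l G -> blip l' G.
Proof. by move=> ll' [fG bG]; split => //; exact: flip_sub fG. Qed.

Lemma flip_cst l a : flip l (fun=> a).
Proof.
by exists 0; split => // u v; rewrite subrr normr0 mul0r.
Qed.

Lemma flip_eval c : flip [:: c] (fun u => u c).
Proof. by exists 1; split => // u v; rewrite big_seq1 mul1r. Qed.

Lemma flipD l G H : flip l G -> flip l H -> flip l (fun u => G u + H u).
Proof.
move=> [K [K0 hG]] [K' [K'0 hH]]; exists (K + K'); split; first exact: addr_ge0.
move=> u v; rewrite mulrDl opprD addrACA.
by apply: le_trans (ler_normD _ _) _; exact: lerD.
Qed.

Lemma flip_comp l (phi : R -> R) G k : 0 <= k ->
  (forall x y, `|phi x - phi y| <= k * `|x - y|) ->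
  flip l G -> flip l (fun u => phi (G u)).
Proof.
move=> k0 hphi [K [K0 hG]]; exists (k * K); split; first exact: mulr_ge0.
move=> u v; apply: le_trans (hphi _ _) _; rewrite -mulrA.
by apply: ler_wpM2l.
Qed.

Lemma flipZ l a G : flip l G -> flip l (fun u => a * G u).
Proof.
apply: (@flip_comp _ _ _ `|a|) => // x y.
by rewrite -mulrBr normrM.
Qed.

Lemma flipB l G H : flip l G -> flip l H -> flip l (fun u => G u - H u).
Proof.
move=> fG fH; rewrite (_ : (fun u => _) = fun u => G u + (-1) * H u).
  by apply: flipD => //; exact: flipZ.
by apply/funext => u; rewrite mulN1r.
Qed.

Lemma distr_max (a b x y : R) :
  `|Num.max a b - Num.max x y| <= `|a - x| + `|b - y|.
Proof.
rewrite ler_norml; apply/andP.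
have /ler_normlP [h1 h2] := lexx `|a - x|.
have /ler_normlP [h3 h4] := lexx `|b - y|.
have := normr_ge0 (a - x); have := normr_ge0 (b - y).
rewrite /Num.max; do 2 case: ltP => ?; split; lra.
Qed.

Lemma distr_min (a b x y : R) :
  `|Num.min a b - Num.min x y| <= `|a - x| + `|b - y|.
Proof.
rewrite ler_norml; apply/andP.
have /ler_normlP [h1 h2] := lexx `|a - x|.
have /ler_normlP [h3 h4] := lexx `|b - y|.
have := normr_ge0 (a - x); have := normr_ge0 (b - y).
rewrite /Num.min; do 2 case: ltP => ?; split; lra.
Qed.

Lemma flip_max l G H : flip l G -> flip l H ->
  flip l (fun u => Num.max (G u) (H u)).
Proof.
move=> [K [K0 hG]] [K' [K'0 hH]]; exists (K + K'); split; first exact: addr_ge0.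
move=> u v; rewrite mulrDl.
by apply: le_trans (distr_max _ _ _ _) _; exact: lerD.
Qed.

Lemma blipM l G H : blip l G -> blip l H -> blip l (fun u => G u * H u).
Proof.
move=> [[K [K0 hG]] [B hB]] [[K' [K'0 hH]] [B' hB']]; split; last first.
  by exists (B * B') => u; rewrite normrM ler_pM.
have B0 : 0 <= B by apply: le_trans (hB (fun=> 0)).
have B'0 : 0 <= B' by apply: le_trans (hB' (fun=> 0)).
exists (B * K' + B' * K); split; first by rewrite addr_ge0 ?mulr_ge0.
move=> u v.
rewrite (_ : _ - _ = G u * (H u - H v) + H v * (G u - G v)); last by ring.
apply: le_trans (ler_normD _ _) _; rewrite mulrDl !normrM -!mulrA.
by apply: lerD; apply: ler_pM.
Qed.

Lemma blip_cst l a : blip l (fun=> a).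
Proof. by split; [exact: flip_cst | exists `|a|]. Qed.

Lemma blip_comp l (phi : R -> R) G k B : 0 <= k ->
  (forall x y, `|phi x - phi y| <= k * `|x - y|) -> (forall x, `|phi x| <= B) ->
  flip l G -> blip l (fun u => phi (G u)).
Proof.
by move=> k0 h1 h2 fG; split; [exact: flip_comp h1 fG | exists B].
Qed.

Lemma flip_upd l c x G : flip (c :: l) G -> flip l (fun u => G (upd u c x)).
Proof.
move=> [K [K0 hG]]; exists K; split => // u v; apply: le_trans (hG _ _) _.
rewrite ler_wpM2l// big_cons {1 2}/upd eqxx subrr normr0 add0r.
by apply: ler_sum => i _; rewrite /upd; case: eqP => // _; rewrite subrr normr0.
Qed.

Lemma flip_agree l G u v : flip l G -> (forall c, c \in l -> u c = v c) ->
  G u = G v.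
Proof.
move=> [K [K0 hG]] uv; apply/eqP; rewrite -subr_eq0 -normr_eq0 eq_le normr_ge0.
rewrite andbT (le_trans (hG u v))// big_seq big1 ?mulr0// => c cl.
by rewrite uv// subrr normr0.
Qed.

Lemma dist_upd l G K u c x : lipK l K G ->
  `|G (upd u c x) - G u| <= K * (size l)%:R * `|x - u c|.
Proof.
move=> [K0 hG]; apply: le_trans (hG _ _) _; rewrite -mulrA ler_wpM2l//.
elim: l {hG} => [|c' l IH]; first by rewrite big_nil mul0r.
rewrite big_cons/= -natr1 mulrDl mul1r addrC lerD// /upd.
by case: eqP => [->|_] //; rewrite subrr normr0.
Qed.

Lemma flip_measurable {d : measure_display} {T : measurableType d}
    (Y : T -> J -> R) l G : flip l G ->
  (forall c, c \in l -> measurable_fun setT (fun w => Y w c)) ->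
  measurable_fun setT (fun w => G (Y w)).
Proof.
elim: l G => [|c l IH] G fG mY.
  rewrite (_ : (fun w => _) = fun=> G (fun=> 0)); first exact: measurable_cst.
  by apply/funext => w; apply: flip_agree fG _.
pose rnd (m : nat) (x : R) : R := (Num.floor (x * m.+1%:R))%:~R / m.+1%:R.
pose Gm (m : nat) (w : T) := G (upd (Y w) c (rnd m (Y w c))).
have mYc : measurable_fun setT (fun w => Y w c) by apply: mY; rewrite mem_head.
have mGm m : measurable_fun setT (Gm m).
  move=> _ B mB; rewrite setTI.
  rewrite (_ : Gm m @^-1` B = \bigcup_(k in [set: int])
     (((fun w => Y w c * m.+1%:R) @^-1` `[k%:~R, (k + 1)%:~R[%classic) `&`
     ((fun w => G (upd (Y w) c (k%:~R / m.+1%:R))) @^-1` B))); last first.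
    apply/seteqP; split => [w Bw|w [k _ [/= hk Bw]]].
      exists (Num.floor (Y w c * m.+1%:R)) => //; split => //=.
      by rewrite in_itv/= floor_itv.
    rewrite /Gm /rnd (_ : Num.floor _ = k)//.
    by apply: floor_def; move: hk; rewrite in_itv.
  apply: countable_bigcupT_measurable; first exact: countableP.
  move=> k; apply: measurableI.
    rewrite -[X in measurable X]setTI.
    by apply: measurable_funM => //; exact: measurable_itv.
  rewrite -[X in measurable X]setTI.
  apply: (IH (fun u => G (upd u c (k%:~R / m.+1%:R)))) => //.
    exact: flip_upd.
  by move=> c' c'l; apply: mY; rewrite inE c'l orbT.
apply: (measurable_fun_cvg mGm) => w _.
have [K hG] := fG.
apply/cvgrPdist_le => e e0.
pose M := K * (size (c :: l))%:R.
have M0 : 0 <= M by rewrite mulr_ge0//; case: hG.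
near=> m.
rewrite distrC (le_trans (dist_upd _ _ _ hG))// -/M.
have hr : `|rnd m (Y w c) - Y w c| <= m.+1%:R^-1.
  have m0 : 0 < (m.+1%:R : R) by [].
  rewrite -(ler_pM2r m0) mulVf ?gt_eqF// -[X in _ * X](gtr0_norm m0) -normrM mulrBl.
  rewrite /rnd divfK ?gt_eqF// ler_norml.
  have := floor_le (Y w c * m.+1%:R); have := floorD1_gt (Y w c * m.+1%:R).
  rewrite intrD; lra.
apply: le_trans (ler_wpM2l M0 hr) _.
rewrite ler_pdivrMr//.
have : M / e <= m.+1%:R.
  apply: (@le_trans _ _ m%:R); last by rewrite ler_nat.
  by near: m; exact: nbhs_infty_ger.
by rewrite ler_pdivrMr// mulrC.
Unshelve. all: by end_near. Qed.

End lipschitz_functionals.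

Section iterated_integral.
Context {R : realType} {J : eqType}.
Variable N : probability R R.
Implicit Types (l : seq J) (G H : (J -> R) -> R) (u : J -> R).

Fixpoint Ex l G u : R :=
  if l is c :: l' then Ev N (fun x => Ex l' G (upd u c x)) else G u.

Lemma bmeas_upd l G u c : blip l G -> bmeas (fun x => G (upd u c x)).
Proof.
move=> [fG [B hB]]; split; last by exists B => x; exact: hB.
apply: (flip_measurable (Y := fun x => upd u c x)) fG _ => c' _.
rewrite /upd; case: eqP => _; first exact: measurable_id.
exact: measurable_cst.
Qed.

Lemma Ex_lip l l0 K B G : lipK l0 K G -> (forall u, `|G u| <= B) ->
  lipK l0 K (Ex l G) /\ forall u, `|Ex l G u| <= B.
Proof.
move=> hG hB; elim: l => [|c l [IH1 IH2]] //=.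
have bm u : bmeas (fun x => Ex l G (upd u c x)).
  by apply: (@bmeas_upd l0); split; [exists K | exists B].
split; last first.
  by move=> u; apply: Ev_norm_le => // x; exact: IH2.
have [K0 hK] := IH1; split => // u v.
apply: Ev_dist_le => // x; apply: le_trans (hK _ _) _.
rewrite ler_wpM2l//; apply: ler_sum => i _; rewrite /upd; case: eqP => // _.
by rewrite subrr normr0.
Qed.

Lemma Ex_blip l l0 G : blip l0 G -> blip l0 (Ex l G).
Proof.
move=> [[K hG] [B hB]]; have [h1 h2] := Ex_lip l hG hB.
by split; [exists K | exists B].
Qed.

Lemma Ex_bmeas l l0 G u c : blip l0 G -> bmeas (fun x => Ex l G (upd u c x)).
Proof. by move=> bG; apply: (@bmeas_upd l0); exact: Ex_blip. Qed.

Lemma Ex_cst l a u : Ex l (fun=> a) u = a.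
Proof.
by elim: l u => [//|c l IH] u /=; under eq_fun do rewrite IH; rewrite Ev_cst.
Qed.

Lemma Ex_agree l (G G' : (J -> R) -> R) u v (D : pred J) :
  (forall u v, (forall c, D c -> u c = v c) -> G u = G' v) ->
  (forall c, D c -> c \notin l -> u c = v c) ->
  Ex l G u = Ex l G' v.
Proof.
move=> dG; elim: l u v => [|c l IH] u v uv /=; first by apply: dG => c Dc; exact: uv.
apply: eq_Ev => x; apply: IH => c' Dc' c'l; rewrite /upd; case: eqP => // /eqP cc'.
by apply: uv => //; rewrite inE negb_or cc'.
Qed.

Lemma Ex_prod l l1 l2 G H u : blip l1 G -> blip l2 H ->
  (forall c, c \in l1 -> c \in l2 -> False) ->
  Ex l (fun v => G v * H v) u = Ex l G u * Ex l H u.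
Proof.
move=> bG bH dis; elim: l u => [|c l IH] u //=.
under eq_fun do rewrite IH.
have aG (l' : seq J) G' : blip l' G' -> forall x, c \notin l' ->
    Ex l G' (upd u c x) = Ex l G' u.
  move=> [fG' _] x cl'; apply: (@Ex_agree _ _ _ _ _ (fun c => c \in l')).
    by move=> u' v' uv'; apply: flip_agree fG' _.
  by move=> c' c'l' _; rewrite /upd; case: eqP => // c'c; rewrite -c'c c'l' in cl'.
have [cl1|cl1] := boolP (c \in l1).
  have cl2 : c \notin l2 by apply/negP => cl2; exact: dis cl1 cl2.
  under [X in _ = _ * X]eq_Ev do rewrite (aG l2 H)//.
  rewrite Ev_cst.
  under eq_Ev => x do rewrite (aG l2 H)// mulrC.
  rewrite EvZ; last by apply: Ex_bmeas; exact: bG.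
  by rewrite mulrC.
under [X in _ = X * _]eq_Ev do rewrite (aG l1 G)//.
rewrite Ev_cst.
under eq_Ev => x do rewrite (aG l1 G)//.
by rewrite EvZ//; apply: Ex_bmeas; exact: bH.
Qed.

Lemma Ev_chebyshev (a b : R -> R) : bmeas a -> bmeas b ->
  {homo a : x y / x <= y >-> y <= x} -> {homo b : x y / x <= y >-> y <= x} ->
  Ev N a * Ev N b <= Ev N (fun x => a x * b x).
Proof.
move=> ba bb ma mb.
have bab := bmeasM ba bb.
have h y : 0 <= Ev N (fun x => a x * b x) - a y * Ev N b - b y * Ev N a + a y * b y.
  rewrite -(EvZ N (a y) bb) -(EvZ N (b y) ba) -(Ev_cst N (a y * b y)).
  rewrite -EvB//; last exact: bmeasZ.
  rewrite -EvB//; [|by apply: bmeasB => //; exact: bmeasZ | exact: bmeasZ].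
  rewrite -EvD//; last by do 2 (apply: bmeasB; last exact: bmeasZ).
  apply: Ev_ge0 => x.
  rewrite (_ : _ + _ = (a x - a y) * (b x - b y)); last by ring.
  have [xy|/ltW yx] := leP x y.
    by rewrite mulr_ge0// subr_ge0; [exact: ma | exact: mb].
  by rewrite mulr_le0// subr_le0; [exact: ma | exact: mb].
pose c := Ev N (fun x => a x * b x).
have h2 : 0 <= Ev N (fun y => c - Ev N b * a y - Ev N a * b y + a y * b y).
  apply: Ev_ge0 => y; have := h y; rewrite -/c; lra.
rewrite EvD// in h2; last by do 2 (apply: bmeasB; last exact: bmeasZ).
rewrite EvB// in h2; [|by apply: bmeasB => //; exact: bmeasZ | exact: bmeasZ].
rewrite EvB// in h2; last exact: bmeasZ.
rewrite !EvZ// Ev_cst -/c in h2.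
rewrite -/c; have := mulrC (Ev N a) (Ev N b); lra.
Qed.

Definition antitone G := forall u v : J -> R, (forall c, u c <= v c) -> G v <= G u.

Lemma Ex_antitone l l0 G : blip l0 G -> antitone G -> antitone (Ex l G).
Proof.
move=> bG aG; elim: l => [//|c l IH] u v uv /=.
apply: Ev_le => [||x]; [by apply: Ex_bmeas; exact: bG..|].
by apply: IH => c'; rewrite /upd; case: eqP.
Qed.

Lemma Ex_harris l l1 l2 G H u : blip l1 G -> blip l2 H ->
  (forall v, 0 <= G v) -> (forall v, 0 <= H v) ->
  antitone G -> antitone H ->
  Ex l G u * Ex l H u <= Ex l (fun v => G v * H v) u.
Proof.
move=> bG bH G0 H0 aG aH; elim: l u => [|c l IH] u //=.
apply: le_trans (Ev_chebyshev _ _ _ _) _.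
- by apply: Ex_bmeas; exact: bG.
- by apply: Ex_bmeas; exact: bH.
- by move=> x y xy; apply: Ex_antitone bG aG _ _ _ => c'; rewrite /upd; case: eqP.
- by move=> x y xy; apply: Ex_antitone bH aH _ _ _ => c'; rewrite /upd; case: eqP.
apply: Ev_le => //.
- by apply: bmeasM; apply: Ex_bmeas; eassumption.
- apply: (@Ex_bmeas l (l1 ++ l2)); apply: blipM.
    by apply: blip_sub bG => x; rewrite mem_cat => ->.
  by apply: blip_sub bH => x; rewrite mem_cat orbC => ->.
Qed.

End iterated_integral.

Section step_functions.
Context {R : realType}.
Implicit Types (h : R -> R) (x : R) (m : nat).

Definition stepi m (k : nat) : int := k%:Z - (m.+1 ^ 2)%:Z.
Definition cell m k : set R := [set x | Num.floor (x * m.+1%:R) = stepi m k].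
Definition step m h x : R :=
  \sum_(k < (m.+1 ^ 2).*2) \1_(cell m k) x * h ((stepi m k)%:~R / m.+1%:R).

Lemma measurable_cell m k : measurable (cell m k).
Proof.
rewrite (_ : cell m k =
  (fun x => x * m.+1%:R) @^-1` `[(stepi m k)%:~R, (stepi m k + 1)%:~R[%classic).
  by rewrite -[X in measurable X]setTI; exact: measurable_funM.
apply/seteqP; split => x /=.
  by move=> <-; rewrite in_itv/= floor_itv.
by rewrite in_itv /=; exact: floor_def.
Qed.

Lemma stepE m h x : step m h x =
  let k := Num.floor (x * m.+1%:R) in
  if (- (m.+1 ^ 2)%:Z <= k < (m.+1 ^ 2)%:Z) then h (k%:~R / m.+1%:R) else 0.
Proof.
rewrite /step /=; set f := Num.floor _; case: ifPn => hf.
  have [k hk] : exists k : 'I_((m.+1 ^ 2).*2), stepi m k = f.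
    have hk : (absz (f + (m.+1 ^ 2)%:Z)%R < (m.+1 ^ 2).*2)%N.
      move: hf; rewrite -addnn; move: (m.+1 ^ 2)%N => a; clearbody f; lia.
    by exists (Ordinal hk); rewrite /stepi /=; move: hf; clearbody f; lia.
  rewrite (bigD1 k)//= big1 ?addr0.
    by rewrite indicE mem_set ?mul1r /cell/= hk.
  move=> i ik; rewrite indicE memNset ?mul0r// /cell/= -/f -hk /stepi => ik'.
  by move/eqP: ik; apply; apply/val_inj => /=; move: ik'; lia.
rewrite big1// => i _; rewrite indicE memNset ?mul0r// /cell/= -/f => fi.
move: hf; rewrite fi /stepi; have := ltn_ord i; rewrite -[X in (_ < X)%N]addnn; lia.
Qed.

Lemma step_bound m h B x : (forall y, `|h y| <= B) -> `|step m h x| <= B.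
Proof.
move=> hB; rewrite stepE/=; case: ifP => // _.
by rewrite normr0 (le_trans _ (hB 0)).
Qed.

Lemma step_cvg h K x : (forall y z, `|h y - h z| <= K * `|y - z|) ->
  step m h x @[m --> \oo] --> h x.
Proof.
move=> hK; apply/cvgrPdist_le => e e0.
have K0 : 0 <= K.
  by have := hK 1 0; rewrite subr0 normr1 mulr1; exact: le_trans.
near=> m; rewrite stepE /=.
have m0 : 0 < (m.+1%:R : R) by [].
have xm : `|x| < m.+1%:R.
  apply: (@lt_trans _ _ m%:R); last by rewrite ltr_nat.
  by near: m; exact: nbhs_infty_gtr.
have /andP[f1 f2] := floor_itv (x * m.+1%:R).
rewrite ifT; last first.
  move: xm; rewrite ltr_norml => /andP[x1 x2].
  rewrite floor_ge_int floor_lt_int mulrNz.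
  have -> : (((m.+1 ^ 2)%N%:Z)%:~R : R) = m.+1%:R * m.+1%:R.
    by rewrite -pmulrn natrX expr2.
  by rewrite -mulNr ltr_pM2r// x2 andbT ler_pM2r// ltW.
apply: le_trans (hK _ _) _.
have hd : `|x - (Num.floor (x * m.+1%:R))%:~R / m.+1%:R| <= m.+1%:R^-1.
  rewrite -(ler_pM2r m0) mulVf ?gt_eqF// -[X in _ * X](gtr0_norm m0) -normrM.
  by rewrite mulrBl divfK ?gt_eqF// ler_norml; move: f1 f2; rewrite intrD; lra.
apply: le_trans (ler_wpM2l K0 hd) _.
rewrite ler_pdivrMr//.
have : K / e <= m.+1%:R.
  apply: (@le_trans _ _ m%:R); last by rewrite ler_nat.
  by near: m; exact: nbhs_infty_ger.
by rewrite ler_pdivrMr// mulrC.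
Unshelve. all: by end_near. Qed.

End step_functions.

Section law_of_independent_family.
Context {R : realType} {J : eqType} {d : measure_display} {T : measurableType d}.
Variables (Q : probability T R) (N : probability R R) (Y : T -> J -> R).

Definition cyl (A : set T) (l : seq J) (B : J -> set R) : set T :=
  [set w | A w /\ forall c, c \in l -> B c (Y w c)].

Definition merge (u : J -> R) (l : seq J) (y : J -> R) : J -> R :=
  fun c => if c \in l then y c else u c.

Lemma Ev_independent_event (A : set T) l l0 G u : uniq l ->
  (forall c, c \in l -> measurable_fun setT (fun w => Y w c)) ->
  measurable A ->
  (forall B, (forall c, measurable (B c)) ->
    fine (Q (cyl A l B)) = fine (Q A) * \prod_(c <- l) fine (N (B c))) ->
  blip l0 G ->
  Ev Q (fun w => \1_A w * G (merge u l (Y w))) = fine (Q A) * Ex N l G u.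
Proof.
move=> ul mY mA hA bG; elim: l u A ul mY mA hA => [|c l IH] u A.
  move=> _ _ mA _ /=.
  have -> : (fun w => \1_A w * G (merge u [::] (Y w))) = fun w => G u * \1_A w.
    by apply/funext => w; rewrite mulrC.
  by rewrite EvZ ?Ev_indic 1?mulrC//; exact: bmeas_indic.
move=> /= /andP[cl ul] mY mA hA.
have mYc : measurable_fun setT (fun w => Y w c) by apply: mY; rewrite mem_head.
have mYl c' : c' \in l -> measurable_fun setT (fun w => Y w c').
  by move=> c'l; apply: mY; rewrite inE c'l orbT.
pose g x w := G (merge (upd u c x) l (Y w)).
have gE w : G (merge u (c :: l) (Y w)) = g (Y w c) w.
  congr G; apply/funext => c'; rewrite /merge /upd inE.
  by case: eqP => [->|] //=; rewrite (negbTE cl).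
have [[K [K0 hG]] [B hB]] := bG.
have glip w x y : `|g x w - g y w| <= K * (size l0)%:R * `|x - y|.
  have -> : g x w = G (upd (merge (upd u c y) l (Y w)) c x).
    congr G; apply/funext => c'; rewrite /merge /upd.
    by case: eqP => [->|] //; rewrite (negbTE cl).
  apply: le_trans (@dist_upd _ _ l0 _ K _ _ _ _) _; first by split.
  by rewrite /merge (negbTE cl) /upd eqxx.
have bA' : bmeas (\1_A : T -> R) by exact: bmeas_indic.
have mg x : measurable_fun setT (g x).
  apply: (flip_measurable (Y := fun w => merge (upd u c x) l (Y w)) bG.1) => c' _.
  by rewrite /merge; case E : (c' \in l); [exact: mYl | exact: measurable_cst].
have bg x : bmeas (g x) by split => //; exists B => w; exact: hB.
pose f m w := \1_A w * step m (g ^~ w) (Y w c).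
pose E x := Ex N l G (upd u c x).
have bE : bmeas E by apply: Ex_bmeas; exact: bG.
have Elip x y : `|E x - E y| <= K * (size l0)%:R * `|x - y|.
  have [hE _] := Ex_lip N l (conj K0 hG : lipK l0 K G) hB.
  rewrite /E (_ : upd u c x = upd (upd u c y) c x); last first.
    by apply/funext => c'; rewrite /upd; case: eqP.
  by apply: le_trans (dist_upd _ _ _ hE) _; rewrite /upd eqxx.
have mcellY m k : measurable ((fun w => Y w c) @^-1` cell m k).
  rewrite -[X in measurable X]setTI; apply: mYc => //; exact: measurable_cell.
pose Ak m k := A `&` (fun w => Y w c) @^-1` cell m k.
have mAk m k : measurable (Ak m k) by exact: measurableI.
have fE m w : f m w = \sum_(k < (m.+1 ^ 2).*2)
    \1_(Ak m k) w * g ((stepi m k)%:~R / m.+1%:R) w.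
  rewrite /f /step mulr_sumr; apply: eq_bigr => k _; rewrite mulrA; congr (_ * _).
  by rewrite /Ak indicI.
have QAk m k : forall B, (forall c', measurable (B c')) ->
    fine (Q (cyl (Ak m k) l B)) =
    fine (Q A) * fine (N (cell m k)) * \prod_(c' <- l) fine (N (B c')).
  move=> B0 mB0.
  have := hA (fun c' => if c' == c then cell m k else B0 c').
  rewrite big_cons eqxx mulrA.
  have -> : cyl A (c :: l) (fun c' => if c' == c then cell m k else B0 c') =
      cyl (Ak m k) l B0.
    apply/seteqP; split => w /=.
      move=> [Aw h]; split.
        by split => //=; have := h c (mem_head _ _); rewrite eqxx.
      move=> c' c'l; have := h c'; rewrite inE c'l orbT => /(_ isT).
      by case: eqP => // cc'; rewrite -cc' c'l in cl.
    move=> [[Aw Yw] h]; split => // c'; rewrite inE.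
    by case: eqP => [-> //|_ /=]; exact: h.
  have -> : \prod_(j <- l) fine (N (if j == c then cell m k else B0 j)) =
      \prod_(j <- l) fine (N (B0 j)).
    rewrite big_seq [RHS]big_seq; apply: eq_bigr => j jl.
    by case: eqP => // jc; rewrite -jc jl in cl.
  by apply => c'; case: ifP => // _; exact: measurable_cell.
have QAkE m k : fine (Q (Ak m k)) = fine (Q A) * fine (N (cell m k)).
  have := QAk m k (fun=> setT) (fun=> measurableT).
  rewrite big1 ?mulr1; last by move=> j _; rewrite probability_setT.
  by move=> <-; congr (fine (Q _)); apply/seteqP; split => w //= [].
have Ef m : Ev Q (f m) = fine (Q A) * Ev N (step m E).
  have -> : f m = fun w => \sum_(k < (m.+1 ^ 2).*2)
    \1_(Ak m k) w * g ((stepi m k)%:~R / m.+1%:R) w by apply/funext => w; exact: fE.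
  rewrite (@Ev_sum _ _ _ Q _ (fun k w => \1_(Ak m k) w *
    g ((stepi m k)%:~R / m.+1%:R) w)); last first.
    by move=> k; apply: bmeasM => //; exact: bmeas_indic.
  rewrite (@Ev_sum _ _ _ N _ (fun k x => \1_(cell m k) x *
    E ((stepi m k)%:~R / m.+1%:R))); last first.
    by move=> k; apply: bmeasM => //; apply: bmeas_indic; exact: measurable_cell.
  rewrite mulr_sumr; apply: eq_bigr => k _.
  rewrite IH//; last by move=> B0 mB0; rewrite QAkE QAk.
  rewrite QAkE.
  under [X in _ = _ * X]eq_Ev do rewrite mulrC.
  rewrite EvZ; last by apply: bmeas_indic; exact: measurable_cell.
  by rewrite Ev_indic; [rewrite /E; ring | exact: measurable_cell].
have [_ _ c1] : [/\ bmeas (fun w => \1_A w * g (Y w c) w),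
    forall w, `|\1_A w * g (Y w c) w| <= B &
    Ev Q (f m) @[m --> \oo] --> Ev Q (fun w => \1_A w * g (Y w c) w)].
  apply: Ev_cvg.
  - move=> m; rewrite (_ : f m = fun w => \sum_(k < (m.+1 ^ 2).*2)
      \1_(Ak m k) w * g ((stepi m k)%:~R / m.+1%:R) w).
      exact: (@bmeas_sum _ _ _ _ (fun k w => \1_(Ak m k) w *
        g ((stepi m k)%:~R / m.+1%:R) w)
        (fun k => bmeasM (bmeas_indic (mAk m k)) (bg _))).1.
    by apply/funext => w; exact: fE.
  - move=> m w; rewrite normrM -[leRHS]mul1r ler_pM//.
      by rewrite indicE; case: (w \in A); rewrite ?normr1 ?normr0.
    by apply: step_bound => y; exact: hB.
  - move=> w; apply: cvgMr; apply: step_cvg => x y; exact: glip.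
have [_ _ c2] : [/\ bmeas E, forall x, `|E x| <= B &
    Ev N (step m E) @[m --> \oo] --> Ev N E].
  apply: Ev_cvg.
  - move=> m.
    exact: (@bmeas_sum _ _ _ _ (fun k x => \1_(cell m k) x *
        E ((stepi m k)%:~R / m.+1%:R))
        (fun k => bmeasM (bmeas_indic (measurable_cell m k)) (bmeas_cst _))).1.
  - move=> m x; apply: step_bound => y.
    exact: (Ex_lip N l (conj K0 hG : lipK l0 K G) hB).2.
  - by move=> x; apply: step_cvg => y z; exact: Elip.
under eq_Ev do rewrite gE.
apply: (cvg_unique _ c1) => //.
rewrite (_ : (fun m => Ev Q (f m)) = fun m => fine (Q A) * Ev N (step m E)).
  by apply: cvgMr.
by apply/funext => m; exact: Ef.
Qed.

End law_of_independent_family.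

(** * Brownian environments *)

Section gauss_measure.
Context {R : realType}.

(* [idfun] from the type carrying the Lebesgue sigma-algebra [measurableTypeR R]
   of the library's densities to [R] with its Borel structure *)
Definition idR : measurableTypeR R -> R := idfun.

Let measurable_idR : measurable_fun setT idR.
Proof. by move=> _ A mA; rewrite setTI. Qed.

HB.instance Definition _ := isMeasurableFun.Build _ _ _ _ idR measurable_idR.

Definition gauss (h : R) : probability R R :=
  distribution (normal_prob 0 (Num.sqrt h)) idR.

End gauss_measure.

Section gaussian_environments.
Context {R : realType} {d : measure_display} {T : measurableType d}.
Variable Q : probability T R.

Definition incr (W : int -> R -> R) (A h : R) : int * nat -> R :=
  fun c => W c.1 (A + h * c.2.+1%:R) - W c.1 (A + h * c.2%:R).

Record genv (W : int -> T -> R -> R) : Prop := Genv {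
  genv_meas : forall j u, measurable_fun setT (fun w => W j w u);
  genv_cont : forall j w, continuous (W j w);
  genv_law : forall A h l l0 G u, 0 < h -> uniq l -> {subset l0 <= l} ->
    blip l0 G ->
    Ev Q (fun w => G (incr (fun j => W j w) A h)) =
    Ex (gauss h) l G u }.

Lemma Ev_independent_family (J : eqType) (Y : T -> J -> R)
    (N : probability R R) l l0 G u : uniq l -> {subset l0 <= l} ->
  (forall c, measurable_fun setT (fun w => Y w c)) ->
  (forall B, (forall c, measurable (B c)) ->
    fine (Q (cyl Y setT l B)) = \prod_(c <- l) fine (N (B c))) ->
  blip l0 G -> Ev Q (fun w => G (Y w)) = Ex N l G u.
Proof.
move=> ul l0l mY hB bG.
have := @Ev_independent_event _ _ _ _ Q N Y setT l l0 G u ul (fun c _ => mY c)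
  measurableT _ bG.
rewrite probability_setT mul1r => <-; last first.
  by move=> B mB; rewrite mul1r; exact: hB.
apply: eq_Ev => w; rewrite indicE in_setT mul1r.
by apply: flip_agree bG.1 _ => c /l0l cl; rewrite /merge cl.
Qed.

Lemma fine_prode (I : Type) (s : seq I) (F : I -> \bar R) :
  (forall i, F i \is a fin_num) ->
  fine (\prod_(i <- s) F i)%E = \prod_(i <- s) fine (F i) /\
  (\prod_(i <- s) F i)%E \is a fin_num.
Proof.
move=> hF; elim: s => [|i s [IH1 IH2]]; first by rewrite !big_nil.
by rewrite !big_cons fineM// IH1 fin_numM.
Qed.

Lemma sigma_process_line (B : T -> R -> R) (n : nat) (A h : R)
    (S : nat -> set R) : (forall k, measurable (S k)) ->
  sigma_process B [set w | forall k, (k < n)%N ->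
    S k (B w (A + h * k.+1%:R) - B w (A + h * k%:R))].
Proof.
move=> mS; rewrite /sigma_process; set GG := \bigcup_(_ in _) _.
pose T' := g_sigma_algebraType GG.
have mB u : measurable_fun setT (fun w : T' => B w u).
  move=> _ V mV; rewrite setTI; apply: sub_gen_smallest.
  by exists u => //; exists V => //; rewrite setTI.
suff : @measurable _ T' [set w : T' | forall k, (k < n)%N ->
    S k (B w (A + h * k.+1%:R) - B w (A + h * k%:R))] by [].
rewrite (_ : mkset _ = \bigcap_(k in [set: nat]) (if (k < n)%N then
   (fun w : T' => B w (A + h * k.+1%:R) - B w (A + h * k%:R)) @^-1` S k
   else setT)).
  apply: bigcapT_measurable => k; case: ifP => // _.
  by rewrite -[X in measurable X]setTI; apply: measurable_funB.
apply/seteqP; split => w /= hw k.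
  by move=> _; case: ifP => // kn; exact: hw.
by move=> kn; have := hw k Logic.I; rewrite kn.
Qed.

Lemma independent_BMs_genv (W : int -> T -> R -> R) :
  independent_BMs Q W -> genv W.
Proof.
move=> [hW indW]; split.
- by move=> j u; have [+ _ _ _ _] := hW j; exact.
- by move=> j w; have [_ + _ _ _] := hW j; exact.
move=> A h l l0 G u h0 ul l0l bG.
apply: (@Ev_independent_family _ (fun w => incr (fun j => W j w) A h) _ l l0 G u ul l0l _ _ bG).
  by move=> c; have [mW _ _ _ _] := hW c.1; exact: measurable_funB.
move=> B mB; pose N : probability R R := gauss h.
pose n := (\max_(c <- l) c.2).+1.
pose js := undup (map fst l).
pose B' c := if c \in l then B c else setT.
have mB' c : measurable (B' c) by rewrite /B'; case: ifP.
pose E j := [set w | forall k, (k < n)%N -> B' (j, k)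
  (W j w (A + h * k.+1%:R) - W j w (A + h * k%:R))].
have Nfin c : N (B' c) \is a fin_num.
  by rewrite fin_num_measure.
have QE j : Q (E j) = (\prod_(k < n) N (B' (j, nat_of_ord k)))%E.
  have [mW _ _ iW nW] := hW j.
  have := iW n (fun k => A + h * k%:R) _ [fset i in enum 'I_n]%fset
    (fun i => (fun w => W j w (A + h * i.+1%:R) - W j w (A + h * i%:R)) @^-1`
      B' (j, nat_of_ord i)).
  have -> : \bigcap_(i in [set` [fset i in enum 'I_n]%fset]) ((fun w =>
      W j w (A + h * i.+1%:R) - W j w (A + h * i%:R)) @^-1`
      B' (j, nat_of_ord i)) = E j.
    apply/seteqP; split => w /=.
      move=> hw k kn; have := hw (Ordinal kn); apply => /=.
      by rewrite inE mem_enum.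
    by move=> hw i _ /=; exact: hw.
  move=> ->; last 2 first.
  - by move=> i; rewrite ltrD2l ltr_pM2l// ltr_nat.
  - by move=> i _; exists (B' (j, nat_of_ord i)) => //; rewrite setTI.
  rewrite (perm_big (enum 'I_n)) /=; last first.
    apply: uniq_perm; [exact: fset_uniq | exact: enum_uniq | move=> i].
    by rewrite inE.
  rewrite big_enum /=; apply: eq_bigr => i _.
  have lti : A + h * i%:R < A + h * i.+1%:R by rewrite ltrD2l ltr_pM2l// ltr_nat.
  rewrite (nW _ _ lti _ (mB' _)).
  have -> : A + h * i.+1%:R - (A + h * i%:R) = h by rewrite -natr1; ring.
  exact: erefl.
have QI : Q (\bigcap_(j in [set` [fset j in js]%fset]) E j) =
    (\prod_(j <- js) \prod_(k < n) N (B' (j, nat_of_ord k)))%E.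
  rewrite indW; last first.
    move=> j _; apply: (@sigma_process_line (W j) n A h (fun k => B' (j, k))) => k.
    exact: mB'.
  rewrite (perm_big js) /=; last first.
    apply: uniq_perm; [exact: fset_uniq | exact: undup_uniq | move=> i].
    by rewrite !inE.
  by apply: eq_bigr => j _; exact: QE.
have -> : cyl (fun w => incr (fun j => W j w) A h) setT l B =
    \bigcap_(j in [set` [fset j in js]%fset]) E j.
  apply/seteqP; split => w /=.
    move=> [_ hw] j _ k kn; rewrite /B'; case: ifP => // jkl.
    exact: (hw _ jkl).
  move=> hw; split => // -[j k] jkl.
  have kn : (k < n)%N by rewrite ltnS; apply: (leq_bigmax_seq (F := snd)) jkl _.
  have := hw j; rewrite /= !inE mem_undup => /(_ _ k kn).
  rewrite /B' jkl; apply.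
  by apply/mapP; exists (j, k).
rewrite QI.
have h1 (j : int) := fine_prode (index_enum 'I_n) (fun k : 'I_n => Nfin (j, nat_of_ord k)).
rewrite (fine_prode js (fun j => (h1 j).2)).1.
under eq_bigr do rewrite (h1 _).1.
rewrite (eq_bigr (fun j => \prod_(k <- iota 0 n) fine (N (B' (j, k))))); last first.
  move=> j _; rewrite -(big_mkord xpredT (fun k => fine (N (B' (j, k))))).
  by rewrite /index_iota subn0.
pose l' := [seq (j, k) | j <- js, k <- iota 0 n].
have -> : \prod_(j <- js) \prod_(k <- iota 0 n) fine (N (B' (j, k))) =
    \prod_(c <- l') fine (N (B' c)) by rewrite big_allpairs_dep.
have l'l : perm_eq [seq c <- l' | c \in l] l.
  apply: uniq_perm; [|exact: ul|].
    rewrite filter_uniq// allpairs_uniq//; [exact: undup_uniq | exact: iota_uniq |].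
    by move=> [a b] [a' b'].
  move=> [j k]; rewrite mem_filter; case jkl : (_ \in l) => //=.
  apply/allpairsP; exists (j, k); split => //.
    by rewrite mem_undup; apply/mapP; exists (j, k).
  by rewrite mem_iota add0n ltnS; apply: (leq_bigmax_seq (F := snd)) jkl _.
rewrite -(perm_big _ l'l)/= big_filter [RHS]big_mkcond/=.
apply: eq_bigr => c _; rewrite /B'; case: ifP => // _.
by rewrite probability_setT.
Qed.

End gaussian_environments.

(** * The discrete Burke property *)

Section densities.
Context {R : realType}.
Local Notation mu := (@lebesgue_measure R).
Local Open Scope ereal_scope.
Import HBNNSimple.

Lemma ge0_integral_density (nu : {measure set (measurableTypeR R) -> \bar R})
    (p : R -> R) (f : measurableTypeR R -> \bar R) :
  (forall A, measurable A -> nu A = \int[mu]_(x in A) (p x)%:E) ->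
  (forall x, (0 <= p x)%R) -> measurable_fun setT p ->
  measurable_fun setT f -> (forall x, 0 <= f x) ->
  \int[nu]_x f x = \int[mu]_x (f x * (p x)%:E).
Proof.
move=> nuE p0 mp mf f0.
have mp' : measurable_fun setT (fun x : measurableTypeR R => (p x)%:E).
  exact/measurable_EFinP.
pose f_ := nnsfun_approx measurableT mf.
have f_f x : (f_ n x)%:E @[n --> \oo] --> f x by exact: cvg_nnsfun_approx.
transitivity (limn (fun n => \int[nu]_x (f_ n x)%:E)).
  rewrite -monotone_convergence//.
  - by apply: eq_integral => y _; apply/esym/cvg_lim => //; exact: f_f.
  - by move=> n; exact/measurable_EFinP/measurable_funP.
  - by move=> n y _; rewrite lee_fin.
  - by move=> y _ m n mn; rewrite lee_fin; exact/lefP/nd_nnsfun_approx.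
rewrite [X in limn X](_ : _ =
    (fun n => \int[mu]_x ((f_ n x)%:E * (p x)%:E))).
  rewrite -monotone_convergence//; last 3 first.
    - move=> n /=; apply: emeasurable_funM => //.
      exact/measurable_EFinP/measurable_funP.
    - by move=> n x _ /=; rewrite mule_ge0// lee_fin.
    - move=> x _ m n mn; apply: lee_wpmul2r; rewrite lee_fin//.
      exact/lefP/nd_nnsfun_approx.
  apply: eq_integral => x _ /=; apply/cvg_lim => //.
  by apply: cvgeMr => //; exact: f_f.
apply/funext => n.
have mfn r : measurable (f_ n @^-1` [set r]) by exact: measurable_funPTI.
transitivity (\sum_(k \in range (f_ n))
    \int[mu]_x ((k * \1_(f_ n @^-1` [set k]) x)%:E * (p x)%:E)).
  under eq_integral do rewrite fimfunE -fsumEFin//.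
  rewrite ge0_integral_fsum//; last 2 first.
  - by move=> y; exact/measurable_EFinP/measurable_funM.
  - by move=> y x _; rewrite nnfun_muleindic_ge0.
  apply: eq_fsbigr => r /[!inE] -[x _ rE].
  have r0 : (0 <= r)%R by rewrite -rE.
  rewrite integralZl_indic_nnsfun// integral_indic//= setIT nuE//.
  under [RHS]eq_integral do rewrite EFinM -muleA.
  rewrite ge0_integralZl//; last first.
  - by move=> y _; rewrite mule_ge0// lee_fin.
  - apply: emeasurable_funM => //; exact/measurable_EFinP/measurable_indic.
  congr (_ * _); rewrite [LHS]integral_mkcond; apply: eq_integral => y _.
  rewrite patchE indicE; case: (y \in _); by rewrite ?mul1e ?mul0e.
rewrite -ge0_integral_fsum//.
- apply: eq_integral => x _; rewrite fimfunE -fsumEFin//.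
  rewrite ge0_mule_fsuml//.
  by move=> i; rewrite nnfun_muleindic_ge0.
- by move=> r; apply: emeasurable_funM => //; exact/measurable_EFinP/measurable_funM.
- by move=> r x _; rewrite mule_ge0 ?lee_fin// -lee_fin nnfun_muleindic_ge0.
Qed.

Lemma lebesgue_integral_shift (c : R) (f : R -> \bar R) :
  measurable_fun setT f -> (forall x, 0 <= f x) ->
  \int[mu]_x f (x + c)%R = \int[mu]_x f x.
Proof.
move=> mf f0.
have mc : measurable_fun setT (fun x : measurableTypeR R => (x + c)%R : measurableTypeR R).
  exact: measurable_funD.
rewrite -(@ge0_integral_pushforward _ _ _ _ _ _ mc mu setT f)//=.
apply: eq_measure_integral => //= A mA _.
apply/esym/lebesgue_measure_unique => //= _ [[a b]] _ <-.
rewrite /pushforward (_ : _ @^-1` _ = `](a - c)%R, (b - c)%R]%classic).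
  rewrite !lebesgue_measure_itv/= !lte_fin ltrD2r.
  by case: ifP => // _; rewrite -!EFinD; congr EFin; lra.
by apply/seteqP; split => x /=; rewrite !in_itv/= lerBrDr ltrBlDr.
Qed.

End densities.

Section gaussian_and_exponential_laws.
Context {R : realType}.
Local Notation mu := (@lebesgue_measure R).

Definition expo (l : R) (l0 : 0 < l) : probability R R :=
  distribution (exponential_distribution_exponential_prob__canonical__probability_measure_Probability l0) (@idR R).

Lemma Ev_gauss h (g : R -> R) : 0 < h -> bmeas g -> (forall x, 0 <= g x) ->
  ((Ev (gauss h) g)%:E = \int[mu]_x (g x * normal_pdf 0 (Num.sqrt h) x)%:E)%E.
Proof.
move=> h0 bg g0; rewrite EvE//.
rewrite [LHS]ge0_integral_distribution//; last by apply/measurable_EFinP; case: bg.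
rewrite (@ge0_integral_density _ _ (normal_pdf 0 (Num.sqrt h)))//=.
- by move=> x; exact: normal_pdf_ge0.
- exact: measurable_normal_pdf.
- by apply/measurable_EFinP; case: bg.
Qed.

Lemma Ev_expo l (l0 : 0 < l) (g : R -> R) : bmeas g -> (forall x, 0 <= g x) ->
  ((Ev (expo l0) g)%:E = \int[mu]_x (g x * exponential_pdf l x)%:E)%E.
Proof.
move=> bg g0; rewrite EvE//.
rewrite [LHS]ge0_integral_distribution//; last by apply/measurable_EFinP; case: bg.
rewrite (@ge0_integral_density _ _ (exponential_pdf l))//=.
- by move=> x; apply: exponential_pdf_ge0; exact: ltW.
- exact: measurable_exponential_pdf.
- by apply/measurable_EFinP; case: bg.
Qed.

#[global] Opaque gauss expo.

Lemma normal_pdf_scale (h k x : R) : 0 < h -> 0 < k ->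
  k * normal_pdf 0 (Num.sqrt h) (k * x) =
  normal_pdf 0 (Num.sqrt (h / k ^+ 2)) x.
Proof.
move=> h0 k0.
have hk0 : 0 < h / k ^+ 2 by rewrite divr_gt0// exprn_gt0.
rewrite !normal_pdfE ?gt_eqF ?sqrtr_gt0// /normal_peak /normal_fun !sqr_sqrtr ?ltW//.
rewrite mulrA; congr (_ * expR _); last first.
  by field; rewrite !gt_eqF.
have -> : h / k ^+ 2 * pi *+ 2 = k ^- 2 * (h * pi *+ 2).
  by field; rewrite gt_eqF.
rewrite sqrtrM ?invr_ge0 ?exprn_ge0 ?ltW// invfM; congr (_ * _).
by rewrite sqrtrV ?exprn_ge0 ?ltW// sqrtr_sqr gtr0_norm// invrK.
Qed.

Lemma Ev_gauss_scale (h k : R) (f : R -> R) : 0 < h -> 0 < k -> continuous f ->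
  (exists B, forall x, `|f x| <= B) ->
  Ev (gauss (h / k ^+ 2)) (fun x => f (k * x)) = Ev (gauss h) f.
Proof.
move=> h0 k0 cf [B hB].
have hk0 : 0 < h / k ^+ 2 by rewrite divr_gt0// exprn_gt0.
have ckx : continuous (fun x : R => k * x) by move=> x; exact: mulrl_continuous.
have bf : bmeas f by split; [exact: continuous_measurable_fun | exists B].
have bfk : bmeas (fun x => f (k * x)).
  split; last by exists B.
  apply: continuous_measurable_fun => x; apply: continuous_comp; [exact: ckx|exact: cf].
have pos x : 0 <= f x + B.
  by have := hB x; rewrite ler_norml => /andP[h1 _]; rewrite -lerBlDr sub0r.
suff : Ev (gauss (h / k ^+ 2)) (fun x => f (k * x) + B) =
       Ev (gauss h) (fun x => f x + B).
  have e1 := EvD (gauss (h / k ^+ 2)) bfk (bmeas_cst B).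
  have e2 := EvD (gauss h) bf (bmeas_cst B).
  rewrite Ev_cst in e1; rewrite Ev_cst in e2 => e3.
  have e5 := etrans (esym e1) (etrans e3 e2).
  exact: (@addIr _ B).
apply: EFin_inj.
apply: etrans (Ev_gauss hk0 (bmeasD bfk (bmeas_cst B)) (fun x => pos (k * x))) _.
apply: etrans _ (esym (Ev_gauss h0 (bmeasD bf (bmeas_cst B)) pos)).
have s0 : Num.sqrt h != 0 by rewrite gt_eqF// sqrtr_gt0.
pose F (x : R^o) := k * x.
have F' : (F^`())%classic = cst k.
  by apply/funext => x; rewrite /F derive1Ml// derive1_id mulr1.
rewrite [RHS](@increasing_ge0_integration_by_substitutionT _ F).
- apply: eq_integral => x _; congr EFin; rewrite F' !fctE /= /F.
  by rewrite -normal_pdf_scale//; ring.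
- by move=> x y xy; rewrite /F ltr_pM2l.
- by rewrite F' => x; exact: cst_continuous.
- by rewrite F'; exact: is_cvg_cst.
- by rewrite F'; exact: is_cvg_cst.
- by move=> x; rewrite /F; exact: derivableM.
- by apply: gt0_cvgMrNy => //; exact: cvg_id.
- by apply: gt0_cvgMry => //; exact: cvg_id.
- move=> x; apply: cvgM; last exact: continuous_normal_pdf.
  by apply: cvgD; [exact: cf | exact: cvg_cst].
- by move=> x; rewrite mulr_ge0// normal_pdf_ge0.
Qed.

End gaussian_and_exponential_laws.

Lemma lip2_measurable {R : realType} {d : measure_display} {T : measurableType d}
    (f : R -> R -> R) (K : R) (u v : T -> R) : 0 <= K ->
  (forall x y x' y', `|f x y - f x' y'| <= K * (`|x - x'| + `|y - y'|)) ->
  measurable_fun setT u -> measurable_fun setT v ->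
  measurable_fun setT (fun z => f (u z) (v z)).
Proof.
move=> K0 hf mu mv.
apply: (@flip_measurable R bool _ _ (fun z (i : bool) => if i then u z else v z)
   [:: true; false] (fun y => f (y true) (y false))).
  exists K; split => // y y'; rewrite big_cons big_seq1; exact: hf.
by move=> [].
Qed.

Section burke_step.
Context {R : realType}.
Local Notation mu := (@lebesgue_measure R).
Variables (h l : R) (h0 : 0 < h) (l0 : 0 < l).
Let phi (x : R) : R := normal_pdf 0 (Num.sqrt h) x.
Let e (r : R) : R := exponential_pdf l r.
Let Nh := gauss h.
Let X := expo l0.

Let phi0 x : 0 <= phi x. Proof. exact: normal_pdf_ge0. Qed.
Let e0 r : 0 <= e r. Proof. by apply: exponential_pdf_ge0; exact: ltW. Qed.
Let mphi : measurable_fun setT phi. Proof. exact: measurable_normal_pdf. Qed.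
Let me : measurable_fun setT e. Proof. exact: measurable_exponential_pdf. Qed.

Let Ev_height_gap (g : R -> R -> R) (K B : R) : 0 <= K ->
  (forall x y x' y', `|g x y - g x' y'| <= K * (`|x - x'| + `|y - y'|)) ->
  (forall x y, 0 <= g x y <= B) ->
  ((Ev X (fun r : R => Ev Nh (fun w : R => g (l * h + w - r) r)))%:E =
   \int[mu]_b \int[mu]_r (g b r * (phi (b + r - l * h) * e r))%:E)%E.
Proof.
move=> K0 gl g0.
have gB x y : `|g x y| <= B by have /andP[a b] := g0 x y; rewrite ger0_norm.
have bw r : bmeas (fun w : R => g (l * h + w - r) r).
  split; last by exists B.
  apply: (@lip2_measurable _ _ _ g K (fun w : R => l * h + w - r) (fun=> r)) => //.
  by apply: measurable_funB => //; exact: measurable_funD.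
have lipE r r' : `|Ev Nh (fun w : R => g (l * h + w - r) r) -
    Ev Nh (fun w : R => g (l * h + w - r') r')| <= (K *+ 2) * `|r - r'|.
  apply: Ev_dist_le => // w; apply: le_trans (gl _ _ _ _) _.
  rewrite mulrnAl -mulrnAr ler_wpM2l// (_ : _ - _ - _ = r' - r); last by ring.
  by rewrite [X in X + _]distrC mulr2n.
have bE : bmeas (fun r : R => Ev Nh (fun w : R => g (l * h + w - r) r)).
  split; last by exists B => r; exact: Ev_norm_le.
  apply: (@lip2_measurable _ _ _ (fun r _ => Ev Nh (fun w : R => g (l * h + w - r) r))
     (K *+ 2) id (fun=> 0 : R)) => //; first exact: mulrn_wge0.
  move=> x y x' y'; apply: le_trans (lipE _ _) _.
  by rewrite ler_wpM2l ?mulrn_wge0// lerDl.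
rewrite Ev_expo//; last by move=> r; apply: Ev_ge0 => w; have /andP[] := g0 (l * h + w - r) r.
pose F (z : measurableTypeR R * measurableTypeR R) :=
  (g z.1 z.2 * (phi (z.1 + z.2 - l * h) * e z.2))%:E.
have mF : measurable_fun setT F.
  apply/measurable_EFinP; apply: measurable_funM.
    exact: (@lip2_measurable _ _ _ g K fst snd).
  apply: measurable_funM; last exact: measurableT_comp.
  apply: (measurableT_comp mphi).
  by apply: measurable_funB => //; exact: measurable_funD.
have F0 z : (0 <= F z)%E.
  by rewrite lee_fin !mulr_ge0//; have /andP[] := g0 z.1 z.2.
rewrite (fubini_tonelli F mF F0) /F /=; apply: eq_integral => r _.
have mG : measurable_fun setT (fun w : R => g (l * h + w - r) r * phi w).
  by apply: measurable_funM => //; case: (bw r).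
have -> : (\int[mu]_x (g x r * (phi (x + r - l * h) * e r))%:E =
    \int[mu]_x ((fun w : R => (g (l * h + w - r) r * phi w)%:E) (x + (r - l * h))%R
      * (e r)%:E))%E.
  apply: eq_integral => b _; rewrite -EFinM; congr EFin.
  rewrite (_ : l * h + (b + (r - l * h)) - r = b); last by ring.
  by rewrite addrA mulrA.
rewrite ge0_integralZr//=; last 3 first.
- by apply/measurable_EFinP; apply: (measurableT_comp mG); exact: measurable_funD.
- by move=> b _; rewrite lee_fin mulr_ge0//; case/andP: (g0 (l * h + (b + (r - l * h)) - r) r).
- by rewrite lee_fin.
rewrite (@lebesgue_integral_shift _ _ (fun w : R => (g (l * h + w - r) r * phi w)%:E)).
- by rewrite -Ev_gauss// => w; case/andP: (g0 (l * h + w - r) r).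
- exact/measurable_EFinP.
- by move=> w; rewrite lee_fin mulr_ge0//; case/andP: (g0 (l * h + w - r) r).
Qed.

(* r is the old gap; the new lower height b = l h + w0 - r has the law of l h + d - r
   on the right-hand side and, given b, the new upper height max w1 b is
   stochastically dominated by l h + d. *)
Lemma burke_step (f : R -> R -> R) (K B : R) : 0 <= K ->
  (forall x y x' y', `|f x y - f x' y'| <= K * (`|x - x'| + `|y - y'|)) ->
  (forall x y, 0 <= f x y <= B) ->
  (forall b, {homo f b : x y / x <= y}) ->
  Ev X (fun r : R => Ev Nh (fun w0 : R => Ev Nh (fun w1 =>
    f (l * h + w0 - r) (Num.max w1 (l * h + w0 - r))))) <=
  Ev X (fun r : R => Ev Nh (fun d : R => f (l * h + d - r) (l * h + d))).
Proof.
move=> K0 fl f0 fm.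
have fB x y : `|f x y| <= B by have /andP[a b] := f0 x y; rewrite ger0_norm.
pose H b := Ev Nh (fun w1 : R => f b (Num.max w1 b)).
have bf b : bmeas (f b).
  split; last by exists B.
  exact: (@lip2_measurable _ _ _ f K (fun=> b) id).
have bfm b : bmeas (fun w1 : R => f b (Num.max w1 b)).
  split; last by exists B.
  apply: (@lip2_measurable _ _ _ f K (fun=> b) (fun w : R => Num.max w b)) => //.
  exact: measurable_maxr.
have Hl (x y x' y' : R) : `|H x - H x'| <= (K *+ 2) * (`|x - x'| + `|y - y'|).
  apply: Ev_dist_le => // w; apply: le_trans (fl _ _ _ _) _.
  rewrite mulrnAl -mulrnAr ler_wpM2l// mulr2n.
  apply: (@le_trans _ _ (`|x - x'| + `|x - x'|)).
    rewrite lerD2l; apply: le_trans (distr_max _ _ _ _) _.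
    by rewrite subrr normr0 add0r.
  by apply: lerD; rewrite lerDl.
have H0 (x y : R) : 0 <= H x <= B.
  apply/andP; split; first by apply: Ev_ge0 => w; have /andP[] := f0 x (Num.max w x).
  rewrite -(Ev_cst Nh B); apply: Ev_le => // w.
  by have /andP[] := f0 x (Num.max w x).
rewrite -lee_fin.
have gl (x y x' y' : R) : `|f x (x + y) - f x' (x' + y')| <=
    (K *+ 2) * (`|x - x'| + `|y - y'|).
  apply: le_trans (fl _ _ _ _) _; rewrite mulrnAl -mulrnAr ler_wpM2l//.
  rewrite (_ : x + y - (x' + y') = (x - x') + (y - y')); last by ring.
  by have := ler_normD (x - x') (y - y'); have := normr_ge0 (y - y'); lra.
have -> : Ev X (fun r : R => Ev Nh (fun d : R => f (l * h + d - r) (l * h + d))) =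
    Ev X (fun r : R => Ev Nh (fun d : R => (fun b r : R => f b (b + r)) (l * h + d - r) r)).
  by apply: eq_Ev => r; apply: eq_Ev => d; congr f; ring.
rewrite (@Ev_height_gap (fun b _ : R => H b) _ B _ Hl H0) ?mulrn_wge0//.
rewrite (@Ev_height_gap (fun b r : R => f b (b + r)) _ B _ gl) ?mulrn_wge0//.
have mk : measurable_fun setT (fun z : measurableTypeR R * measurableTypeR R =>
    phi (z.1 + z.2 - l * h) * e z.2).
  apply: measurable_funM; last exact: measurableT_comp.
  apply: (measurableT_comp mphi).
  by apply: measurable_funB => //; exact: measurable_funD.
have mF1 : measurable_fun setT (fun z : measurableTypeR R * measurableTypeR R =>
    (H z.1 * (phi (z.1 + z.2 - l * h) * e z.2))%:E).
  apply/measurable_EFinP; apply: measurable_funM => //.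
  by apply: (@lip2_measurable _ _ _ (fun x _ => H x) (K *+ 2) fst snd) => //;
    exact: mulrn_wge0.
have mF2 : measurable_fun setT (fun z : measurableTypeR R * measurableTypeR R =>
    (f z.1 (z.1 + z.2) * (phi (z.1 + z.2 - l * h) * e z.2))%:E).
  apply/measurable_EFinP; apply: measurable_funM => //.
  by apply: (@lip2_measurable _ _ _ (fun x y => f x (x + y)) (K *+ 2) fst snd) => //;
    exact: mulrn_wge0.
have F10 z : (0 <= (H z.1 * (phi (z.1 + z.2 - l * h) * e z.2))%:E)%E.
  by rewrite lee_fin !mulr_ge0//; have /andP[] := H0 z.1 0.
have F20 z : (0 <= (f z.1 (z.1 + z.2) * (phi (z.1 + z.2 - l * h) * e z.2))%:E)%E.
  by rewrite lee_fin !mulr_ge0//; have /andP[] := f0 z.1 (z.1 + z.2).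
apply: ge0_le_integral => //.
- by move=> b _; apply: integral_ge0 => r _; exact: (F10 (b, r)).
- exact: (@measurable_fun_fubini_tonelli_F _ _ _ _ _ mu _ mF1 F10).
- exact: (@measurable_fun_fubini_tonelli_F _ _ _ _ _ mu _ mF2 F20).
move=> b _ /=.
pose I : set R := `[b, +oo[%classic.
have bI : bmeas (\1_I : R -> R) by apply: bmeas_indic; exact: measurable_itv.
pose cb := l * expR (l * b - l ^+ 2 * h / 2).
have cb0 : 0 <= cb by rewrite mulr_ge0 ?expR_ge0// ltW.
have kE r : phi (b + r - l * h) * e r = cb * (\1_I (b + r) * phi (b + r)).
  rewrite indicE /I mem_setE in_itv/= andbT lerDl /e.
  have [r0|r0] := leP 0 r; last by rewrite lt0_exponential_pdf// !(mul0r, mulr0).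
  rewrite exponential_pdfE// mul1r /phi !normal_pdfE ?gt_eqF ?sqrtr_gt0//.
  rewrite /normal_fun !sqr_sqrtr ?ltW// /cb.
  rewrite [LHS](_ : _ = normal_peak (Num.sqrt h) * l *
    (expR (- (b + r - l * h - 0) ^+ 2 / (h *+ 2)) * expR (- l * r))); last by ring.
  rewrite [RHS](_ : _ = normal_peak (Num.sqrt h) * l *
    (expR (l * b - l ^+ 2 * h / 2) * expR (- (b + r - 0) ^+ 2 / (h *+ 2)))); last by ring.
  rewrite -!expRD; congr (_ * expR _); field; exact: lt0r_neq0.
have intE (G : R -> R) : bmeas G -> (forall x, 0 <= G x) ->
    (\int[mu]_r (G (b + r)%R * (phi (b + r - l * h) * e r))%:E =
     (cb * Ev Nh (fun y : R => G y * \1_I y))%:E)%E.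
  move=> bG G0.
  have G1 y : 0 <= G y * \1_I y by rewrite mulr_ge0// indicE.
  rewrite EFinM Ev_gauss//; last exact: bmeasM.
  rewrite -(@lebesgue_integral_shift _ b (fun y : R => (G y * \1_I y * phi y)%:E)); last 2 first.
  - apply/measurable_EFinP; apply: measurable_funM => //.
    by apply: measurable_funM; [case: bG | case: bI].
  - by move=> y; rewrite lee_fin mulr_ge0.
  rewrite -ge0_integralZl//; last 2 first.
  - apply/measurable_EFinP.
    have mm : measurable_fun setT (fun y : R => G y * \1_I y * phi y).
      apply: measurable_funM => //.
      by apply: measurable_funM; [case: bG | case: bI].
    by apply: (measurableT_comp mm); exact: measurable_funD.
  - by move=> y _; rewrite lee_fin mulr_ge0.
  apply: eq_integral => r _; rewrite -EFinM; congr EFin.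
  by rewrite kE (addrC r b); ring.
have -> : (\int[mu]_y (H b * (phi (b + y - l * h) * e y))%:E =
    (cb * Ev Nh (fun y : R => H b * \1_I y))%:E)%E.
  by apply: (intE (fun=> H b)) => // y; have /andP[] := H0 b 0.
rewrite (intE (f b)) => //; last by move=> y; have /andP[] := f0 b y.
rewrite lee_fin ler_wpM2l//.
set A := Ev Nh (fun y : R => f b y * \1_I y).
pose p := Ev Nh \1_I.
have p01 : 0 <= p <= 1.
  apply/andP; split; first by apply: Ev_ge0 => y; rewrite indicE.
  rewrite -(Ev_cst Nh 1); exact: Ev_le.
have HE : H b = A + f b b * (1 - p).
  rewrite /H -[1 - p](_ : Ev Nh (fun y : R => 1 - \1_I y) = _); last first.
    by rewrite EvB// Ev_cst.
  have b1 : bmeas (fun y : R => 1 - \1_I y : R) by exact: bmeasB.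
  rewrite -EvZ// -EvD//; last 2 first.
  - exact: bmeasM.
  - exact: bmeasZ.
  apply: eq_Ev => y; rewrite indicE /I mem_setE in_itv/= andbT /Num.max.
  case: (ltP y b) => yb; last by rewrite mulr1 subrr mulr0 addr0.
  by rewrite mulr0 subr0 mulr1 add0r.
have fA : f b b * p <= A.
  rewrite -EvZ//; apply: Ev_le; [exact: bmeasZ | exact: bmeasM | move=> y].
  rewrite indicE /I mem_setE in_itv/= andbT.
  by case: (leP b y) => yb /=; [rewrite !mulr1; exact: fm | rewrite !mulr0].
rewrite EvZ// -/p HE.
have /andP[p0 p1] := p01.
have : (1 - p) * (f b b * p) <= (1 - p) * A by rewrite ler_wpM2l// subr_ge0.
nra.
Qed.

End burke_step.

Section stacks_of_lines.
Context {R : realType}.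
Implicit Types (S : seq R) (F : seq R -> R).

Fixpoint sdist S S' : R :=
  match S, S' with x :: s, y :: s' => `|x - y| + sdist s s' | _, _ => 0 end.

Lemma sdist_ge0 S S' : 0 <= sdist S S'.
Proof. by elim: S S' => [|x S IH] [|y S'] //=; rewrite addr_ge0. Qed.

Lemma sdistxx S : sdist S S = 0.
Proof. by elim: S => //= x S ->; rewrite subrr normr0 addr0. Qed.

Record slip (n : nat) (K B : R) F : Prop := SLip {
  slip_ge0 : 0 <= K;
  slip_lip : forall S S', size S = n -> size S' = n ->
    `|F S - F S'| <= K * sdist S S';
  slip_bd : forall S, size S = n -> 0 <= F S <= B }.

Definition smono n F :=
  forall S S', size S = n -> all2 <=%R S S' -> F S <= F S'.

Lemma slip_cons n K B F c : slip n.+1 K B F -> slip n K B (fun t => F (c :: t)).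
Proof.
move=> [K0 hF hB]; split => // [S S' sS sS'|S sS]; last by apply: hB; rewrite /= sS.
by have := hF (c :: S) (c :: S'); rewrite /= sS sS' subrr normr0 add0r; apply.
Qed.

Lemma lip_bmeas (f : R -> R) K B : 0 <= K ->
  (forall x y, `|f x - f y| <= K * `|x - y|) -> (forall x, 0 <= f x <= B) ->
  bmeas f.
Proof.
move=> K0 fl fB; split; last first.
  by exists B => x; have /andP[a b] := fB x; rewrite ger0_norm.
apply: (@lip2_measurable _ _ _ (fun x _ => f x) K id (fun=> 0 : R)) => //.
move=> x y x' y'; apply: le_trans (fl _ _) _.
by rewrite ler_wpM2l// lerDl.
Qed.

Variables (h l : R) (h0 : 0 < h) (l0 : 0 < l).
Local Notation Nh := (gauss h).
Local Notation X := (expo l0).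

(* [lift_up c S F] averages [F] over the new heights of the lines [S] once the
   line below them has moved to [c]; line [s] moves to [max (s + w) c]. *)
Fixpoint lift_up (c : R) S F : R :=
  if S is s :: S' then
    Ev Nh (fun w : R => lift_up (Num.max (s + w) c) S' (fun t => F (c :: t)))
  else F [:: c].

Definition column S F : R :=
  if S is s :: S' then Ev Nh (fun w : R => lift_up (s + (l * h + w)) S' F)
  else F [::].

Fixpoint gaps (n : nat) F (s : R) : R :=
  if n is n'.+1 then
    gaps n' (fun S => Ev X (fun r : R => F ((head 0 S - r) :: S))) s
  else F [:: s].

Lemma lift_up_bmeas n K B (S : seq R) F s c : 0 <= K ->
  (forall x, 0 <= lift_up x S F <= B) ->
  (forall x y, `|lift_up x S F - lift_up y S F| <= (K * n.+1%:R) * `|x - y|) ->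
  bmeas (fun w : R => lift_up (Num.max (s + w) c) S F).
Proof.
move=> K0 hb hl; apply: (@lip_bmeas _ (K * n.+1%:R) B); rewrite ?mulr_ge0//.
move=> x y; apply: le_trans (hl _ _) _.
rewrite ler_wpM2l ?mulr_ge0//; apply: le_trans (distr_max _ _ _ _) _.
by rewrite subrr normr0 addr0 (_ : _ - _ = x - y)//; ring.
Qed.

Lemma lift_up_ind n :
  (forall K B F, slip n.+1 K B F -> forall S c, size S = n ->
  (0 <= lift_up c S F <= B) /\
  forall S' c', size S' = n ->
  `|lift_up c S F - lift_up c' S' F| <= (K * n.+1%:R) * (`|c - c'| + sdist S S'))
  /\ (forall K B F1 F2 a e, slip n.+1 K B F1 -> slip n.+1 K B F2 ->
  (forall t, size t = n.+1 -> head 0 t = a -> F1 t - F2 t <= e) ->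
  forall S, size S = n -> lift_up a S F1 - lift_up a S F2 <= e).
Proof.
elim: n => [|n [IH IHd]].
  split=> [K B F clF S c|K B F1 F2 a e _ _ he S /size0nil -> /=]; last exact: he.
  have [K0 hF hB] := clF => /size0nil -> /=; split; first exact: hB.
  move=> S' c' /size0nil -> /=; rewrite addr0 mulr1.
  by have := hF [:: c] [:: c']; rewrite /= addr0; apply.
have bm K B F c1 S1 s1 c2 : slip n.+2 K B F -> size S1 = n ->
    bmeas (fun w : R => lift_up (Num.max (s1 + w) c2) S1 (fun t => F (c1 :: t))).
  move=> clF sS1; have IHc := IH K B _ (slip_cons c1 clF).
  apply: (@lift_up_bmeas n K B); first by case: clF.
    by move=> x; exact: (IHc S1 x sS1).1.
  move=> x y; have := (IHc S1 x sS1).2 S1 y sS1.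
  by rewrite sdistxx addr0.
split; last first.
  move=> K B F1 F2 a e cl1 cl2 he [//|s S] [sS] /=.
  have b1 := bm K B F1 a S s a cl1 sS; have b2 := bm K B F2 a S s a cl2 sS.
  rewrite -EvB// -(Ev_cst Nh e); apply: Ev_le => //; first exact: bmeasB.
  move=> w; apply: (IHd K B) sS; [exact: slip_cons..|].
  by move=> t st _; apply: he => //=; rewrite st.
move=> K B F clF S c; have [K0 hF hB] := clF.
case: S => [//|s S] [sS] /=.
have IHc c1 := IH K B _ (slip_cons c1 clF).
split.
  apply/andP; split.
    by apply: Ev_ge0 => w; have /andP[] := (IHc c S (Num.max (s + w) c) sS).1.
  rewrite -(Ev_cst Nh B); apply: Ev_le => //; first exact: (bm K B).
  by move=> w; have /andP[] := (IHc c S (Num.max (s + w) c) sS).1.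
move=> [//|s' S'] c' [sS'].
apply: Ev_dist_le; [exact: (bm K B) | exact: (bm K B) | move=> w].
set m := Num.max _ _; set m' := Num.max _ _.
have mm' : `|m - m'| <= `|s - s'| + `|c - c'|.
  apply: le_trans (distr_max _ _ _ _) _.
  by rewrite (_ : s + w - (s' + w) = s - s')//; ring.
have h1 := (IHc c S m sS).2 S' m' sS'.
have h3 a b : lift_up m' S' (fun t => F (a :: t)) -
              lift_up m' S' (fun t => F (b :: t)) <= K * `|a - b|.
  apply: (IHd K B) sS'; [exact: slip_cons..|].
  move=> t st _; apply: le_trans (ler_norm _) _; have := hF (a :: t) (b :: t).
  by rewrite /= st sdistxx addr0; apply.
have h2 : `|lift_up m' S' (fun t => F (c :: t)) -
            lift_up m' S' (fun t => F (c' :: t))| <= K * `|c - c'|.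
  by rewrite ler_norml h3 andbT lerNl opprB distrC h3.
rewrite -[X in `|X|](subrKA (lift_up m' S' (fun t => F (c :: t)))).
apply: le_trans (ler_normD _ _) _.
apply: le_trans (lerD h1 h2) _.
rewrite -[n.+2%:R]natr1.
have nK : 0 <= K * n.+1%:R by rewrite mulr_ge0.
have := ler_wpM2l nK mm'.
have : 0 <= K * (`|s - s'| + sdist S S') by rewrite mulr_ge0// addr_ge0// sdist_ge0.
rewrite !mulrDr !mulrDl; lra.
Qed.

Lemma lift_up_cons_bmeas n K B F c1 S s c2 : slip n.+2 K B F -> size S = n ->
  bmeas (fun w : R => lift_up (Num.max (s + w) c2) S (fun t => F (c1 :: t))).
Proof.
move=> clF sS; have IHc := (lift_up_ind n).1 K B _ (slip_cons c1 clF).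
apply: (@lift_up_bmeas n K B); first by case: clF.
  by move=> x; exact: (IHc S x sS).1.
move=> x y; have := (IHc S x sS).2 S y sS.
by rewrite sdistxx addr0.
Qed.

Lemma all2_le_refl S : all2 <=%R S S.
Proof. by elim: S => //= x S ->; rewrite lexx. Qed.

Lemma lift_up_mono n : forall K B F c c' S S', slip n.+1 K B F -> smono n.+1 F ->
  size S = n -> c <= c' -> all2 <=%R S S' -> lift_up c S F <= lift_up c' S' F.
Proof.
elim: n => [|n IH] K B F c c' S S' clF mF.
  by move=> /size0nil -> cc'; case: S' => //= _; apply: mF; rewrite //= cc'.
case: S S' => [//|s S] [//|s' S'] [sS] cc' /= /andP[ss' SS'].
have sS' : size S' = n by move: SS'; rewrite all2E => /andP[/eqP <-].
apply: Ev_le; [exact: (@lift_up_cons_bmeas n K B)..|move=> w].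
set m := Num.max _ _; set m' := Num.max _ _.
have mm' : m <= m'.
  by rewrite /m ge_max !le_max lerD2r ss' cc' orbT.
apply: (@le_trans _ _ (lift_up m' S' (fun t => F (c :: t)))).
  apply: (IH K B _ _ _ _ _ (slip_cons c clF)) => //.
  by move=> t t' st tt'; apply: mF; rewrite /= ?st// lexx.
rewrite -subr_le0; apply: (lift_up_ind n).2 sS'; [exact: slip_cons clF..|].
by move=> t st _; rewrite subr_le0; apply: mF; rewrite /= ?st// cc' all2_le_refl.
Qed.

Lemma lift_up_shift n : forall K B F1 F2 x a c S, slip n.+1 K B F1 ->
  slip n.+1 K B F2 -> 
  (forall t, size t = n.+1 -> F1 (map (+%R^~ x) t) <= a * F2 t) -> size S = n ->
  lift_up (c + x) (map (+%R^~ x) S) F1 <= a * lift_up c S F2.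
Proof.
elim: n => [|n IH] K B F1 F2 x a c S cl1 cl2 hF.
  by move=> /size0nil -> /=; exact: (hF [:: c]).
case: S => [//|s S] [sS] /=.
rewrite -EvZ; last exact: (@lift_up_cons_bmeas n K B).
apply: Ev_le.
- by apply: (@lift_up_cons_bmeas n K B) => //; rewrite size_map.
- by apply: bmeasZ; exact: (@lift_up_cons_bmeas n K B).
move=> w; rewrite (_ : Num.max (s + x + w) (c + x) = Num.max (s + w) c + x); last first.
  by rewrite addr_maxl; congr Num.max; ring.
apply: (IH K B) => //; [exact: slip_cons..|].
by move=> t st; apply: (hF (c :: t)); rewrite /= st.
Qed.

Lemma lift_up_Ev n : forall K B (F : R -> seq R -> R) c S,
  (forall r, slip n.+1 K B (F r)) ->
  (forall r r' t, size t = n.+1 -> F r t - F r' t <= K * `|r - r'|) ->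
  size S = n ->
  lift_up c S (fun t => Ev X (F ^~ t)) = Ev X (fun r : R => lift_up c S (F r)).
Proof.
elim: n => [|n IH] K B F c S clF lF; first by move=> /size0nil ->.
have [K0 _ _] := clF 0.
case: S => [//|s S] [sS] /=.
transitivity (Ev Nh (fun w : R => Ev X (fun r : R =>
    lift_up (Num.max (s + w) c) S (fun t => F r (c :: t))))).
  apply: eq_Ev => w; apply: (IH K B) => //.
  - by move=> r; exact: slip_cons.
  - by move=> r r' t st; apply: lF; rewrite /= st.
apply: Ev_swap.
have IHc r := (lift_up_ind n).1 K B _ (slip_cons c (clF r)).
split; last first.
  exists B => -[w r] /=.
  by have /andP[h1 h2] := (IHc r S (Num.max (s + w) c) sS).1; rewrite ger0_norm.
apply: (@lip2_measurable _ _ _ (fun w r =>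
  lift_up (Num.max (s + w) c) S (fun t => F r (c :: t))) (K * n.+1%:R + K) fst snd) => //.
  by rewrite addr_ge0// mulr_ge0.
move=> w r w' r'; set m := Num.max _ _; set m' := Num.max _ _.
have mm' : `|m - m'| <= `|w - w'|.
  apply: le_trans (distr_max _ _ _ _) _.
  by rewrite subrr normr0 addr0 (_ : _ - _ = w - w')//; ring.
have h1 := (IHc r S m sS).2 S m' sS.
have h3 a b : lift_up m' S (fun t => F a (c :: t)) -
              lift_up m' S (fun t => F b (c :: t)) <= K * `|a - b|.
  apply: ((lift_up_ind n).2 K B) sS; [exact: slip_cons..|].
  by move=> t st _; apply: lF; rewrite /= st.
have h2 : `|lift_up m' S (fun t => F r (c :: t)) -
            lift_up m' S (fun t => F r' (c :: t))| <= K * `|r - r'|.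
  by rewrite ler_norml h3 andbT lerNl opprB distrC h3.
rewrite -[X in `|X|](subrKA (lift_up m' S (fun t => F r (c :: t)))).
apply: le_trans (ler_normD _ _) _; apply: le_trans (lerD h1 h2) _.
rewrite sdistxx addr0.
have nK : 0 <= K * n.+1%:R by rewrite mulr_ge0.
have := ler_wpM2l nK mm'.
have := mulr_ge0 nK (normr_ge0 (r - r')); have := mulr_ge0 K0 (normr_ge0 (w - w')).
rewrite !mulrDr !mulrDl; lra.
Qed.

Lemma gap_slip n K B F : slip n.+2 K B F ->
  (forall S, size S = n.+1 -> bmeas (fun r : R => F ((head 0 S - r) :: S))) /\
  slip n.+1 (K *+ 2) B (fun S => Ev X (fun r : R => F ((head 0 S - r) :: S))).
Proof.
move=> [K0 hF hB].
have bF S : size S = n.+1 -> bmeas (fun r : R => F ((head 0 S - r) :: S)).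
  move=> sS; apply: (@lip_bmeas _ K B) => // [x y|x]; last by apply: hB; rewrite /= sS.
  apply: le_trans (hF _ _ _ _) _; rewrite ?/= ?sS// sdistxx addr0 ler_wpM2l//.
  by rewrite (_ : _ - _ = y - x) 1?distrC//; ring.
split => //; split; first exact: mulrn_wge0.
  move=> S S' sS sS'; apply: Ev_dist_le => [||r]; [exact: bF..|].
  apply: le_trans (hF _ _ _ _) _; rewrite ?/= ?sS ?sS'//.
  rewrite mulrnAl -mulrnAr ler_wpM2l// mulr2n lerD2r.
  case: S S' sS sS' => [//|s S] [//|s' S'] _ _ /=.
  by rewrite (_ : _ - _ = s - s') ?lerDl ?sdist_ge0//; ring.
move=> S sS; apply/andP; split.
  by apply: Ev_ge0 => r; have /andP[] := hB (head 0 S - r :: S) (congr1 succn sS).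
rewrite -(Ev_cst X B); apply: Ev_le => // [|r]; first exact: bF.
by have /andP[] := hB (head 0 S - r :: S) (congr1 succn sS).
Qed.

Lemma gap_mono n K B F : slip n.+2 K B F -> smono n.+2 F ->
  smono n.+1 (fun S => Ev X (fun r : R => F ((head 0 S - r) :: S))).
Proof.
move=> clF mF S S' sS SS'; have [bF _] := gap_slip clF.
have sS' : size S' = n.+1 by move: SS'; rewrite all2E => /andP[/eqP <-].
apply: Ev_le => [||r]; [exact: bF..|].
apply: mF; rewrite /= ?sS// SS' andbT.
by case: S S' SS' sS {sS'} => [//|s S] [//|s' S'] /= /andP[ss' _] _; rewrite lerD2r.
Qed.

Lemma gaps_le n : forall K B F F' s, slip n.+1 K B F -> slip n.+1 K B F' ->
  (forall S, size S = n.+1 -> F S <= F' S) -> gaps n F s <= gaps n F' s.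
Proof.
elim: n => [|n IH] K B F F' s cl cl' FF' /=; first exact: FF'.
have [bF clG] := gap_slip cl; have [bF' clG'] := gap_slip cl'.
apply: (IH _ _ _ _ _ clG clG') => S sS; apply: Ev_le => [||r]; [exact: bF|exact: bF'|].
by apply: FF'; rewrite /= sS.
Qed.

End stacks_of_lines.

Section burke_columns.
Context {R : realType}.
Implicit Types (S : seq R) (F : seq R -> R).
Variables (h l : R) (h0 : 0 < h) (l0 : 0 < l).
Local Notation Nh := (gauss h).
Local Notation X := (expo l0).
Local Notation lift_up := (lift_up h).
Local Notation column := (column h l).
Local Notation gaps := (gaps l0).

Lemma eq_lift_up n : forall F1 F2 a S, size S = n ->
  (forall t, size t = n.+1 -> head 0 t = a -> F1 t = F2 t) ->
  lift_up a S F1 = lift_up a S F2.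
Proof.
elim: n => [|n IH] F1 F2 a S; first by move=> /size0nil -> hF /=; exact: hF.
case: S => [//|s S] [sS] hF /=; apply: eq_Ev => w; apply: IH => // t st _.
by apply: hF; rewrite //= st.
Qed.

Lemma lift_up_start_bmeas n K B F S s : slip n.+1 K B F -> size S = n ->
  bmeas (fun w : R => lift_up (s + (l * h + w)) S F).
Proof.
move=> clF sS; have [K0 _ _] := clF; have IH := (lift_up_ind h n).1 K B F clF S.
apply: (@lip_bmeas _ _ (K * n.+1%:R) B); first by rewrite mulr_ge0.
  move=> x y; have := (IH (s + (l * h + x)) sS).2 S (s + (l * h + y)) sS.
  by rewrite sdistxx addr0 (_ : s + _ - _ = x - y)//; ring.
by move=> x; exact: (IH _ sS).1.
Qed.

Lemma column_slip n K B F : slip n.+1 K B F ->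
  slip n.+1 (K * n.+1%:R) B (column ^~ F).
Proof.
move=> clF; have [K0 _ _] := clF.
have IH := (lift_up_ind h n).1 K B F clF.
split; first by rewrite mulr_ge0.
  move=> [//|s S] [//|s' S'] [sS] [sS'] /=.
  apply: Ev_dist_le => [||w]; [exact: lift_up_start_bmeas clF _..|].
  have := (IH S (s + (l * h + w)) sS).2 S' (s' + (l * h + w)) sS'.
  by rewrite (_ : s + _ - _ = s - s')//; ring.
move=> [//|s S] [sS] /=; apply/andP; split.
  by apply: Ev_ge0 => w; have /andP[] := (IH S (s + (l * h + w)) sS).1.
rewrite -(Ev_cst Nh B); apply: Ev_le => // [|w]; first exact: lift_up_start_bmeas clF _.
by have /andP[] := (IH S (s + (l * h + w)) sS).1.
Qed.

Lemma column_mono n K B F : slip n.+1 K B F -> smono n.+1 F ->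
  smono n.+1 (column ^~ F).
Proof.
move=> clF mF; case=> [//|s S] [//|s' S'] [sS]; rewrite /=; move=> /andP[ss' SS'].
have sS' : size S' = n by move: SS'; rewrite all2E => /andP[/eqP <-].
apply: Ev_le => [||w]; [exact: lift_up_start_bmeas clF _..|].
by apply: (lift_up_mono h clF) => //; rewrite lerD2r.
Qed.

Lemma gaps_ind n : forall K B F, slip n.+1 K B F -> exists2 K', 0 <= K' &
  forall s s', 0 <= gaps n F s <= B /\ `|gaps n F s - gaps n F s'| <= K' * `|s - s'|.
Proof.
elim: n => [|n IH] K B F clF.
  have [K0 hF hB] := clF; exists K => // s s' /=; split; first exact: hB.
  by have := hF [:: s] [:: s']; rewrite /= addr0; apply.
by have [_ clG] := gap_slip l0 clF; exact: IH clG.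
Qed.

Lemma gaps_bmeas n K B F s : slip n.+1 K B F ->
  bmeas (fun d : R => gaps n F (s + (l * h + d))).
Proof.
move=> clF; have [K' K'0 hK'] := gaps_ind clF.
apply: (@lip_bmeas _ _ K' B) => // [x y|x]; last exact: (hK' _ 0).1.
apply: le_trans (hK' _ _).2 _.
by rewrite (_ : s + _ - _ = x - y)//; ring.
Qed.

Lemma burke_column n : forall K B F s, slip n.+1 K B F ->
  smono n.+1 F ->
  gaps n (column ^~ F) s <= Ev Nh (fun d : R => gaps n F (s + (l * h + d))).
Proof.
elim: n => [//|n IH] K B F s clF mF.
have [bF clG] := gap_slip l0 clF.
set G := fun S => Ev X (fun r : R => F (head 0 S - r :: S)) in clG *.
rewrite [gaps n.+1 _ _]/=.
have clC := column_slip clF; have [bC clGC] := gap_slip l0 clC.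
have clCG := column_slip clG.
have mG : smono n.+1 G by exact: gap_mono clF mF.
have wid k K1 K2 B1 H : K1 <= K2 -> slip k K1 B1 H -> slip k K2 B1 H.
  move=> K12 [K10 hH hB1]; split => //; first exact: le_trans K12.
  move=> S S' sS sS'; apply: le_trans (hH _ _ sS sS') _.
  by rewrite ler_wpM2r// sdist_ge0.
pose K3 := Num.max ((K * n.+2%:R) *+ 2) ((K *+ 2) * n.+1%:R).
apply: le_trans (IH _ _ _ s clG mG).
apply: (gaps_le l0 (K := K3) (B := B)).
- by apply: wid clGC; rewrite le_max lexx.
- by apply: wid clCG; rewrite le_max lexx orbT.
case=> [//|s1 S] [sS] /=.
have [K0 hF hB] := clF.
pose f b d := lift_up (s1 + d) S (fun t => F (s1 + b :: t)).
have ind c := (lift_up_ind h n).1 K B _ (slip_cons c clF).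
have fl x y x' y' : `|f x y - f x' y'| <=
    (K * n.+1%:R + K) * (`|x - x'| + `|y - y'|).
  have h1 := (ind (s1 + x) S (s1 + y) sS).2 S (s1 + y') sS.
  have h3 a b : lift_up (s1 + y') S (fun t => F (a :: t)) -
      lift_up (s1 + y') S (fun t => F (b :: t)) <= K * `|a - b|.
    apply: ((lift_up_ind h n).2 K B) sS; [exact: slip_cons clF..|].
    move=> t st _; apply: le_trans (ler_norm _) _; have := hF (a :: t) (b :: t).
    by rewrite /= st sdistxx addr0; apply.
  have h2 : `|lift_up (s1 + y') S (fun t => F (s1 + x :: t)) -
      lift_up (s1 + y') S (fun t => F (s1 + x' :: t))| <= K * `|x - x'|.
    rewrite (_ : x - x' = (s1 + x) - (s1 + x')); last by ring.
    by rewrite ler_norml h3 andbT lerNl opprB distrC h3.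
  rewrite /f -[X in `|X|](subrKA (lift_up (s1 + y') S (fun t => F (s1 + x :: t)))).
  apply: le_trans (ler_normD _ _) _; apply: le_trans (lerD h1 h2) _.
  rewrite sdistxx addr0 (_ : s1 + y - _ = y - y'); last by ring.
  have nK : 0 <= K * n.+1%:R by rewrite mulr_ge0.
  have := mulr_ge0 nK (normr_ge0 (x - x')); have := mulr_ge0 K0 (normr_ge0 (y - y')).
  rewrite !mulrDr !mulrDl; lra.
have f0 x y : 0 <= f x y <= B by exact: (ind _ _ _ sS).1.
have fm b : {homo f b : x y / x <= y}.
  move=> x y xy; apply: (lift_up_mono h (slip_cons _ clF)) => //.
  - by move=> t t' st tt'; apply: mF; rewrite /= ?st// lexx.
  - by rewrite lerD2l.
  - exact: all2_le_refl.
have := burke_step h0 l0 (addr_ge0 (mulr_ge0 K0 (ler0n _ _)) K0) fl f0 fm.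
have -> : Ev X (fun r : R => Ev Nh (fun w0 : R => Ev Nh (fun w1 : R =>
    f (l * h + w0 - r) (Num.max w1 (l * h + w0 - r))))) =
  Ev X (fun r : R => Ev Nh (fun w : R => Ev Nh (fun w1 : R =>
    lift_up (Num.max (s1 + w1) (s1 - r + (l * h + w))) S
      (fun t => F (s1 - r + (l * h + w) :: t))))).
  apply: eq_Ev => r; apply: eq_Ev => w0; apply: eq_Ev => w1; rewrite /f addr_maxr.
  by rewrite (_ : s1 + (l * h + w0 - r) = s1 - r + (l * h + w0)); last by ring.
move/le_trans; apply.
rewrite Ev_swap; last first.
  split; last first.
    exists B => -[r d] /=.
    by have /andP[h1 h2] := f0 (l * h + d - r) (l * h + d); rewrite ger0_norm.
  apply: (@lip2_measurable _ _ _ f (K * n.+1%:R + K)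
    (fun z : R * R => l * h + z.2 - z.1) (fun z : R * R => l * h + z.2)) => //.
  - by rewrite addr_ge0// mulr_ge0.
  - by apply: measurable_funB => //; exact: measurable_funD.
  - exact: measurable_funD.
rewrite le_eqVlt; apply/orP; left; apply/eqP; apply: eq_Ev => d.
rewrite /f addrA.
transitivity (Ev X (fun r : R => lift_up (s1 + l * h + d) S
    (fun t => F (s1 + l * h + d - r :: t)))).
  by apply: eq_Ev => r; rewrite !addrA.
have cl1 r : slip n.+1 K B (fun t => F (s1 + l * h + d - r :: t)).
  exact: slip_cons clF.
rewrite -(@lift_up_Ev _ h _ l0 n K B (fun r t => F (s1 + l * h + d - r :: t)))//; last first.
  move=> r r' t st; apply: le_trans (ler_norm _) _.
  apply: le_trans (hF _ _ _ _) _; rewrite /= ?st//.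
  by rewrite sdistxx addr0 (_ : _ - _ - _ = r' - r) 1?distrC//; ring.
by apply: eq_lift_up sS _ => t _ ht; rewrite /G ht.
Qed.

Lemma Ev_gauss_exp (g : R -> R) (a t : R) : 0 <= a -> bmeas g ->
  (forall x, 0 <= g x <= a * expR (t * x)) -> Ev Nh g <= a * expR (t ^+ 2 * h / 2).
Proof.
move=> a0 bg g0.
have g0' x : 0 <= g x by case/andP: (g0 x).
rewrite -lee_fin Ev_gauss//.
apply: (@le_trans _ _ (\int[lebesgue_measure]_x
   ((a * expR (t ^+ 2 * h / 2))%:E * (normal_pdf (t * h) (Num.sqrt h) x)%:E))%E).
  apply: ge0_le_integral => //.
  - by move=> x _; rewrite lee_fin mulr_ge0// normal_pdf_ge0.
  - apply/measurable_EFinP; apply: measurable_funM; first by case: bg.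
    exact: measurable_normal_pdf.
  - apply/measurable_EFinP; apply: measurable_funM => //.
    exact: measurable_normal_pdf.
  - move=> x _; rewrite -EFinM lee_fin.
    have s0 : Num.sqrt h != 0 by rewrite gt_eqF// sqrtr_gt0.
    apply: (@le_trans _ _ (a * expR (t * x) * normal_pdf 0 (Num.sqrt h) x)).
      by rewrite ler_wpM2r// ?normal_pdf_ge0//; case/andP: (g0 x).
    rewrite !normal_pdfE// /normal_fun !(sqr_sqrtr (ltW h0)).
    rewrite [leLHS](_ : _ = a * normal_peak (Num.sqrt h) *
      (expR (t * x) * expR (- (x - 0) ^+ 2 / (h *+ 2)))); last by ring.
    rewrite [leRHS](_ : _ = a * normal_peak (Num.sqrt h) *
      (expR (t ^+ 2 * h / 2) * expR (- (x - t * h) ^+ 2 / (h *+ 2)))); last by ring.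
    rewrite -!expRD le_eqVlt; apply/orP; left; apply/eqP.
    by congr (_ * expR _); field; exact: lt0r_neq0.
rewrite integralZl//; last exact: integrable_normal_pdf.
by rewrite integral_normal_pdf mule1.
Qed.

Definition qcov n (t : R) F := forall S x, 0 <= x -> size S = n ->
  F (map (+%R^~ x) S) <= expR (t * x) * F S.

Lemma column_qcov n K B t F : slip n.+1 K B F -> qcov n.+1 t F ->
  qcov n.+1 t (column ^~ F).
Proof.
move=> clF cF [//|s S] x x0 [sS] /=.
rewrite -EvZ; last exact: lift_up_start_bmeas clF _.
apply: Ev_le => [||w].
- by apply: lift_up_start_bmeas clF _; rewrite size_map.
- by apply: bmeasZ; exact: lift_up_start_bmeas clF _.
rewrite (_ : s + x + (l * h + w) = s + (l * h + w) + x); last by ring.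
apply: (@lift_up_shift _ h n K B F F x _ _ S clF clF) => // u su.
exact: cF.
Qed.

Lemma iter_column_class n m K B t F : slip n.+1 K B F -> smono n.+1 F ->
  qcov n.+1 t F -> let G := iter m (fun G S => column S G) F in
  [/\ exists K', slip n.+1 K' B G, smono n.+1 G & qcov n.+1 t G].
Proof.
move=> clF mF cF /=; elim: m => [|m [[K' clG] mG cG]]; first by split=> //; exists K.
by split; [exists (K' * n.+1%:R); exact: column_slip | exact: column_mono clG _
  | exact: column_qcov clG _].
Qed.

Lemma gaps_iter_column n m K B t F s : 0 <= t -> slip n.+1 K B F ->
  smono n.+1 F -> qcov n.+1 t F ->
  (forall S, size S = n.+1 -> F S <= expR (t * last 0 S)) ->
  gaps n (iter m (fun G S => column S G) F) s <=
  expR (t * l * h + t ^+ 2 * h / 2) ^+ m * expR (t * s).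
Proof.
move=> t0 clF mF cF eF; elim: m s => [|m IH] s.
  rewrite expr0 mul1r /=.
  have gl k : forall K F, slip k.+1 K B F ->
      (forall S, size S = k.+1 -> F S <= expR (t * last 0 S)) ->
      gaps k F s <= expR (t * s).
    elim: k => [|k IHk] K1 F1 cl1 e1 /=; first exact: (e1 [:: s]).
    have [b1 clG] := gap_slip l0 cl1.
    apply: (IHk _ _ clG) => -[//|s1 S] [sS].
    rewrite -(Ev_cst X (expR _)); apply: Ev_le => [||r] //; first by apply: b1; rewrite /= sS.
    by have := e1 (s1 - r :: s1 :: S); rewrite /= sS => /(_ erefl).
  exact: gl clF eF.
have [[K' clG] mG cG] := iter_column_class m clF mF cF.
rewrite iterS; apply: le_trans (burke_column s clG mG) _.
set A := expR (_ + _).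
have A0 : 0 <= A ^+ m by rewrite exprn_ge0// expR_ge0.
apply: le_trans (@Ev_gauss_exp _ (A ^+ m * expR (t * (s + l * h))) t _ _ _) _.
- by rewrite mulr_ge0// expR_ge0.
- exact: gaps_bmeas clG.
- move=> d; have [K1 _ hG] := gaps_ind clG.
  have [/andP[-> _] _] := hG (s + (l * h + d)) 0.
  apply: le_trans (IH _) _.
  by rewrite -[leRHS]mulrA ler_wpM2l// -expRD ler_expR -mulrDr addrA.
rewrite [A ^+ m.+1]exprSr -mulrA -[leRHS]mulrA ler_wpM2l// -!expRD ler_expR.
by lra.
Qed.

Lemma Ev_expo_exp (t : R) : 0 <= t ->
  bmeas (fun r : R => expR (- (t * Num.max r 0))) /\
  l / (l + t) <= Ev X (fun r : R => expR (- (t * Num.max r 0))).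
Proof.
move=> t0.
have lt0 : 0 < l + t by rewrite ltr_pwDl.
have bg : bmeas (fun r : R => expR (- (t * Num.max r 0))).
  split.
    apply: (measurableT_comp (@measurable_expR R)).
    by apply: measurable_funN; apply: measurable_funM => //; exact: measurable_maxr.
  exists 1 => r; rewrite ger0_norm ?expR_ge0// -[leRHS]expR0 ler_expR.
  by rewrite oppr_le0 mulr_ge0// le_max lexx orbT.
split => //.
rewrite -lee_fin Ev_expo//.
have -> : (\int[lebesgue_measure]_x
      (expR (- (t * Num.max x 0)) * exponential_pdf l x)%:E)%E =
    (\int[lebesgue_measure]_x ((l / (l + t))%:E * (exponential_pdf (l + t) x)%:E))%E.
  apply: eq_integral => r _; rewrite -EFinM; congr EFin.
  have [r0|r0] := leP 0 r; last by rewrite !lt0_exponential_pdf// !mulr0.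
  rewrite !exponential_pdfE// [RHS]mulrA divfK ?gt_eqF// mulrCA -expRD.
  by congr (_ * expR _); ring.
rewrite integralZl//; last exact: integrable_exponential_pdf.
by rewrite integral_exponential_pdf// mule1.
Qed.

Lemma flat_start n t : forall K B F s, 0 <= t -> slip n.+1 K B F ->
  smono n.+1 F -> qcov n.+1 t F ->
  F (nseq n.+1 s) <= ((l + t) / l) ^+ n * gaps n F s.
Proof.
elim: n => [|n IH] K B F s t0 clF mF cF; first by rewrite expr0 mul1r.
have [b1 clG] := gap_slip l0 clF.
have F0 : 0 <= F (nseq n.+2 s).
  by have [_ _ /(_ (nseq n.+2 s))] := clF; rewrite size_nseq => /(_ erefl) /andP[].
set G := fun S => Ev X (fun r : R => F (head 0 S - r :: S)) in clG.
have mG : smono n.+1 G by exact: gap_mono clF mF.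
have cG : qcov n.+1 t G.
  move=> S x x0 sS; rewrite /G -EvZ; last exact: b1.
  apply: Ev_le => [||r].
  - by apply: b1; rewrite size_map.
  - by apply: bmeasZ; exact: b1.
  have := cF (head 0 S - r :: S) x x0; rewrite /= sS => /(_ erefl).
  case: S sS => [//|s1 S] _ /=.
  by rewrite (_ : s1 - r + x = s1 + x - r)//; ring.
have lt0 : 0 < l + t by rewrite ltr_pwDl.
have c0 : 0 <= (l + t) / l by rewrite divr_ge0// ltW.
have step : F (nseq n.+2 s) <= (l + t) / l * G (nseq n.+1 s).
  have [bg hg] := Ev_expo_exp t0.
  have : Ev X (fun r : R => expR (- (t * Num.max r 0))) * F (nseq n.+2 s) <=
      G (nseq n.+1 s).
    rewrite mulrC -EvZ// /G; apply: Ev_le => [||r].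
    - exact: bmeasZ.
    - by apply: b1; rewrite size_nseq.
    have map_nseq k x y : map (+%R^~ x) (nseq k y) = nseq k (y + x : R).
      by elim: k => //= k ->.
    have le_nseq k (x y : R) : x <= y -> all2 <=%R (nseq k x) (nseq k y).
      by move=> xy; elim: k => //= k ->; rewrite xy.
    have [r0|r0] := leP 0 r.
      have := cF (nseq n.+2 (s - r)) r r0; rewrite size_nseq => /(_ erefl).
      rewrite map_nseq subrK => h1.
      rewrite mulrC expRN ler_pdivrMl ?expR_gt0//; apply: le_trans h1 _.
      rewrite ler_wpM2l ?expR_ge0//; apply: mF; first by rewrite size_nseq.
      by rewrite /= lexx /= lerBlDr lerDl r0 le_nseq// lerBlDr lerDl.
    rewrite mulr0 oppr0 expR0 mulr1; apply: mF; first by rewrite size_nseq.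
    by rewrite /= lerBrDr gerDl ltW// lexx/= le_nseq.
  move=> h1; rewrite mulrC -ler_pdivrMr; last by rewrite divr_gt0.
  rewrite invf_div; apply: le_trans h1.
  by rewrite mulrC ler_wpM2r.
apply: le_trans step _; rewrite exprS -[leRHS]mulrA ler_wpM2l//.
exact: IH clG mG cG.
Qed.

End burke_columns.

(** * Last passage percolation and its grid approximation *)

Section last_passage.
Context {R : realType}.
Implicit Types (W : int -> R -> R) (a : int) (d : nat).

Definition lppn W a d (z : nat -> R) : R :=
  \sum_(i < d) (W (a + i.+1%:Z) (z i.+1) - W (a + i.+1%:Z) (z i)).

Definition npath d (u v : R) : set (nat -> R) :=
  [set z | [/\ z 0%N = u, z d = v & forall i, (i < d)%N -> z i <= z i.+1]].

Definition LPP W a d (u v : R) : R := sup (lpp_values W a (a + d%:Z) u v).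

Lemma lpp_valuesE W a d u v :
  lpp_values W a (a + d%:Z) u v = [set lppn W a d z | z in npath d u v].
Proof.
have dE : absz (a + d%:Z - a)%R = d by rewrite addrC addKr absz_nat.
apply/seteqP; split => r [z [z0 zd zi] <-].
  exists (fun i : nat => z (a + i%:Z)); last by rewrite /lppn /lpp_value dE.
  split; [by rewrite addr0|by []|move=> i id'].
  have := zi (a + i%:Z); rewrite -addrA -PoszD addn1 => -> //.
  by rewrite lerDl ltrD2l ltz_nat id' andbT.
exists (fun j : int => z (absz (j - a)%R)).
  split.
  - by rewrite subrr.
  - by rewrite dE.
  - move=> j /andP[aj jd]; have -> : absz (j + 1 - a)%R = (absz (j - a)%R).+1 by lia.
    by apply: zi; lia.
rewrite /lpp_value dE; apply: eq_bigr => i _.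
by rewrite !(addrC a) !addrK !absz_nat.
Qed.

Lemma npath_le d u v z i j : npath d u v z -> (i <= j)%N -> (j <= d)%N -> z i <= z j.
Proof.
move=> [_ _ zi]; elim: j => [|j IH]; first by rewrite leqn0 => /eqP ->.
rewrite leq_eqVlt => /predU1P[->//|]; rewrite ltnS => ij jd.
by apply: le_trans (IH ij (ltnW jd)) _; exact: zi.
Qed.

Lemma npath_itv d u v z i : npath d u v z -> (i <= d)%N -> u <= z i <= v.
Proof.
move=> hz id'; have [z0 zd _] := hz.
by apply/andP; split; [rewrite -z0|rewrite -zd]; exact: npath_le hz _ _.
Qed.

Lemma npath_ex d u v : (0 < d)%N -> u <= v ->
  npath d u v (fun i => if i == 0%N then u else v).
Proof. by case: d => // d _ uv; split => //= i _; case: eqP. Qed.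

Lemma sup_le_add (A B : set R) e : A !=set0 -> has_ubound B ->
  (forall x, A x -> exists2 y, B y & x <= y + e) -> sup A <= sup B + e.
Proof.
move=> A0 hB AB; apply: ge_sup => // x /AB[y By xy]; apply: le_trans xy _.
by rewrite lerD2r; exact: ub_le_sup.
Qed.

Lemma sup_dist (I : Type) (G : set I) (f g : I -> R) e : G !=set0 ->
  has_ubound [set f i | i in G] -> has_ubound [set g i | i in G] ->
  (forall i, G i -> `|f i - g i| <= e) ->
  `|sup [set f i | i in G] - sup [set g i | i in G]| <= e.
Proof.
move=> [i0 Gi0] uf ug fg.
have h1 : sup [set f i | i in G] <= sup [set g i | i in G] + e.
  apply: sup_le_add => //; first by exists (f i0), i0.
  move=> _ [i Gi <-]; exists (g i); first by exists i.
  by have := fg i Gi; rewrite ler_norml => /andP[_ ?]; lra.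
have h2 : sup [set g i | i in G] <= sup [set f i | i in G] + e.
  apply: sup_le_add => //; first by exists (g i0), i0.
  move=> _ [i Gi <-]; exists (f i); first by exists i.
  by have := fg i Gi; rewrite ler_norml => /andP[? _]; lra.
by rewrite ler_norml; apply/andP; split; lra.
Qed.

Lemma continuous_modulus (f : R -> R) (u v e : R) : continuous f -> 0 < e ->
  exists2 dl, 0 < dl & forall x y, u <= x <= v -> `|x - y| < dl -> `|f x - f y| <= e.
Proof.
move=> cf e0.
have /compact_near_coveringP cK := @segment_compact R u v.
have {}cK := cK R (0%R : R)^'+ (fun dl x => forall y, `|x - y| < dl -> `|f x - f y| <= e) _.
have [] := cK _.
  move=> x _.
  have e20 : 0 < e / 2 by rewrite divr_gt0.
  have /cvgrPdist_le /(_ _ e20) := cf x; rewrite near_nbhs.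
  move=> /nbhs_ballP[r /= r0 hr].
  exists (ball x (r / 2), [set dl | 0 < dl < r / 2]) => /=.
    split; first by apply/nbhs_ballP; exists (r / 2) => //=; rewrite divr_gt0.
    near=> dl; rewrite /=; apply/andP; split.
      by near: dl; exact: nbhs_right_gt.
    by near: dl; apply: nbhs_right_lt; rewrite divr_gt0.
  move=> [x' dl] /= [bx /andP[dl0 dlr]] y xy.
  have h1 : `|f x - f x'| <= e / 2.
    by apply: hr; apply: le_ball bx; rewrite ler_pdivrMr// ler_peMr ?ltW// ltr1n.
  have h2 : `|f x - f y| <= e / 2.
    apply: hr; rewrite /ball/=; rewrite /ball/= in bx.
    rewrite -(subrK x' x) -addrA (le_lt_trans (ler_normD _ _))//.
    by rewrite [ltRHS]splitr ltrD// (lt_trans xy).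
  rewrite -(subrK (f x) (f x')) -addrA (le_trans (ler_normD _ _))//.
  by rewrite [leRHS]splitr lerD// distrC.
move=> dl /= dl0 h; exists (dl / 2); first by rewrite divr_gt0.
move=> x y xuv xy; have := h (dl / 2); apply.
- by rewrite /ball/= sub0r normrN gtr0_norm ?divr_gt0// ltr_pdivrMr// ltr_pMr// ltr1n.
- by rewrite divr_gt0.
- by rewrite /= in_itv.
- by [].
Unshelve. all: by end_near. Qed.

Lemma modulus W a d (u v e : R) : (forall j, continuous (W j)) -> 0 < e ->
  exists2 dl, 0 < dl & forall i x y, (i < d)%N -> u <= x <= v -> `|x - y| < dl ->
    `|W (a + i.+1%:Z) x - W (a + i.+1%:Z) y| <= e.
Proof.
move=> cW e0; elim: d => [|d [dl dl0 IH]]; first by exists 1.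
have [dl' dl'0 h] := continuous_modulus u v (cW (a + d.+1%:Z)) e0.
exists (Num.min dl dl'); first by rewrite lt_min dl0.
move=> i x y; rewrite ltnS leq_eqVlt => /predU1P[->|id'] xuv; rewrite lt_min => /andP[h1 h2].
  exact: h.
exact: IH.
Qed.

Lemma lppn_bounded W a d u v : (forall j, continuous (W j)) ->
  has_ubound [set lppn W a d z | z in npath d u v].
Proof.
move=> cW.
have [C hC] : exists C, forall i x, (i < d)%N -> u <= x <= v ->
    `|W (a + i.+1%:Z) x| <= C.
  elim: d => [|d [C IH]]; first by exists 0.
  have [uv|uv] := leP u v; last first.
    by exists 0 => i x _ /andP[ux xv]; have := le_trans ux xv; rewrite leNgt uv.
  have cl : {within `[u, v], continuous (fun x => `|W (a + d.+1%:Z) x|)}.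
    apply: continuous_subspaceT => x.
    exact: (continuous_comp (cW _ x) (@norm_continuous _ _ _)).
  have [c _ hc] := EVT_max uv cl.
  exists (Num.max C `|W (a + d.+1%:Z) c|) => i x.
  rewrite ltnS leq_eqVlt => /predU1P[->|id'] xuv; rewrite le_max.
    by rewrite hc ?orbT// in_itv.
  by rewrite IH.
exists (\sum_(i < d) (C + C)) => _ [z hz <-]; apply: ler_sum => i _.
apply: le_trans (ler_norm _) _; apply: le_trans (ler_normB _ _) _.
by rewrite lerD// hC//; apply: npath_itv hz _; rewrite // ltnW.
Qed.

Lemma LPP_ge W a d u v z : (forall j, continuous (W j)) -> npath d u v z ->
  lppn W a d z <= LPP W a d u v.
Proof.
by move=> cW hz; rewrite /LPP lpp_valuesE; apply: ub_le_sup; [exact: lppn_bounded|exists z].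
Qed.

Lemma LPP_le W a d u v c : (0 < d)%N -> u <= v ->
  (forall z, npath d u v z -> lppn W a d z <= c) -> LPP W a d u v <= c.
Proof.
move=> d0 uv h; rewrite /LPP lpp_valuesE; apply: ge_sup.
  by eexists; eexists; [exact: npath_ex|reflexivity].
by move=> _ [z hz <-]; exact: h.
Qed.

Lemma lppn_cat W a d d' z :
  lppn W a (d + d') z = lppn W a d z + lppn W (a + d%:Z) d' (fun i => z (d + i)%N).
Proof.
rewrite /lppn big_split_ord/=; congr (_ + _); apply: eq_bigr => i _.
by rewrite -addrA -PoszD !addnS.
Qed.

Lemma lppn_split W a d d' u v z : (forall j, continuous (W j)) ->
  npath (d + d') u v z ->
  lppn W a (d + d') z <= LPP W a d u (z d) + LPP W (a + d%:Z) d' (z d) v.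
Proof.
move=> cW [z0 zd zi]; rewrite lppn_cat; apply: lerD; apply: LPP_ge => //; split => //.
- by move=> i id'; apply: zi; rewrite ltn_addr.
- by rewrite addn0.
- by move=> i id'; rewrite addnS; apply: zi; rewrite ltn_add2l.
Qed.

Lemma LPP_superadditive W a d d' u v w : (forall j, continuous (W j)) ->
  (0 < d)%N -> (0 < d')%N -> u <= v -> v <= w ->
  LPP W a d u v + LPP W (a + d%:Z) d' v w <= LPP W a (d + d') u w.
Proof.
move=> cW d0 d'0 uv vw; rewrite -lerBrDr; apply: LPP_le => // z [z0 zd zi].
rewrite lerBrDr -lerBrDl; apply: LPP_le => // y [y0 yd yi]; rewrite lerBrDl.
pose x i := if (i < d)%N then z i else y (i - d)%N.
have xz i : (i <= d)%N -> x i = z i.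
  by rewrite leq_eqVlt /x => /predU1P[->|-> //]; rewrite ltnn subnn y0 zd.
have xy i : x (d + i)%N = y i by rewrite /x ltnNge leq_addr/= addKn.
have -> : lppn W a d z + lppn W (a + d%:Z) d' y = lppn W a (d + d') x.
  rewrite lppn_cat; congr (_ + _); apply: eq_bigr => i _; last by rewrite !xy.
  by rewrite !xz// ltnW.
apply: LPP_ge => //; split; [by rewrite xz|by rewrite xy|move=> i id'].
have [h|h] := ltnP i d; first by rewrite !xz ?zi// ltnW.
by rewrite -(subnKC h) -addnS !xy; apply: yi; rewrite ltn_subLR.
Qed.

End last_passage.

Section grid.
Context {R : realType}.
Implicit Types (W : int -> R -> R) (a : int) (d : nat) (xi : int * nat -> R).

Definition gin W m : int * nat -> R := incr W (- m.+1%:R) m.+1%:R^-1.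
Definition tick m k : R := - m.+1%:R + m.+1%:R^-1 * k%:R.
Definition idx m (x : R) : nat := `|Num.floor ((x + m.+1%:R) * m.+1%:R)|%N.

Lemma idxP m x : - m.+1%:R <= x -> tick m (idx m x) <= x < tick m (idx m x) + m.+1%:R^-1.
Proof.
move=> mx; have m0 : 0 < m.+1%:R :> R by rewrite ltr0n.
have y0 : 0 <= (x + m.+1%:R) * m.+1%:R by rewrite mulr_ge0// -lerBlDr sub0r.
have f0 : (0 <= Num.floor ((x + m.+1%:R) * m.+1%:R))%R by rewrite floor_ge0.
have := floor_itv ((x + m.+1%:R) * m.+1%:R).
rewrite intrD1 -{1 2}(gez0_abs f0) -/(idx m x) => /andP[h1 h2].
rewrite /tick -lerBrDl opprK ler_pdivrMl// mulrC h1/= -addrA -ltrBlDl opprK.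
by rewrite -[X in _ < _ + X]mulr1 -mulrDr ltr_pdivlMl// mulrC.
Qed.

Lemma idx_mono m x y : - m.+1%:R <= x -> x <= y -> (idx m x <= idx m y)%N.
Proof.
move=> mx xy; have f0 z : - m.+1%:R <= z -> (0 <= Num.floor ((z + m.+1%:R) * m.+1%:R : R))%R.
  by move=> h; rewrite floor_ge0 mulr_ge0// -lerBlDr sub0r.
rewrite -lez_nat /idx !gez0_abs ?f0//; last exact: le_trans xy.
by apply: le_floor; rewrite ler_wpM2r// lerD2r.
Qed.

Definition gpath d (k0 k1 : nat) : set (nat -> nat) :=
  [set k | [/\ k 0%N = k0, k d = k1 & forall i, (i < d)%N -> (k i <= k i.+1)%N]].

Lemma gpath_le d k0 k1 k i j : gpath d k0 k1 k -> (i <= j)%N -> (j <= d)%N -> (k i <= k j)%N.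
Proof.
move=> [_ _ zi]; elim: j => [|j IH]; first by rewrite leqn0 => /eqP ->.
rewrite leq_eqVlt => /predU1P[->//|]; rewrite ltnS => ij jd.
by apply: leq_trans (IH ij (ltnW jd)) _; exact: zi.
Qed.

Lemma gpath_itv d k0 k1 k i : gpath d k0 k1 k -> (i <= d)%N -> (k0 <= k i <= k1)%N.
Proof.
move=> hz id'; have [z0 zd _] := hz.
by apply/andP; split; [rewrite -z0|rewrite -zd]; exact: gpath_le hz _ _.
Qed.

Definition gval a d (k : nat -> nat) xi : R :=
  \sum_(i < d) \sum_(k i <= c < k i.+1) xi (a + i.+1%:Z, c).

Lemma gval_lppn W a d k0 k1 k m : gpath d k0 k1 k ->
  gval a d k (gin W m) = lppn W a d (tick m \o k).
Proof.
move=> hk; apply: eq_bigr => i _; rewrite /gin /incr /=.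
have ki : (k i <= k i.+1)%N by have [_ _ ->] := hk.
by rewrite (telescope_sumr (fun c => W (a + i.+1%:Z) (- m.+1%:R + m.+1%:R^-1 * c%:R)) ki).
Qed.

Definition gcells (D : nat -> nat -> bool) a d (k0 k1 : nat) : seq (int * nat) :=
  flatten [seq [seq (a + i.+1%:Z, c) | c <- index_iota k0 k1 & D i c] | i <- index_iota 0 d].

Lemma mem_gcells D a d k0 k1 c : c \in gcells D a d k0 k1 ->
  exists i, [/\ (i < d)%N, c.1 = a + i.+1%:Z, (k0 <= c.2 < k1)%N & D i c.2].
Proof.
move=> /flattenP[s /mapP[i]]; rewrite mem_index_iota => /andP[_ id'] ->.
move=> /mapP[x]; rewrite mem_filter mem_index_iota => /andP[Dx x01] ->.
by exists i.
Qed.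

Definition fits (D : nat -> nat -> bool) d (k : nat -> nat) :=
  forall i c, (i < d)%N -> (k i <= c < k i.+1)%N -> D i c.

Lemma gval_cells_le D a d k0 k1 k (F : int * nat -> R) : (forall c, 0 <= F c) ->
  gpath d k0 k1 k -> fits D d k -> gval a d k F <= \sum_(c <- gcells D a d k0 k1) F c.
Proof.
move=> F0 hk Dk; rewrite /gcells big_flatten/= big_map big_mkord.
apply: ler_sum => i _; rewrite big_map big_filter.
have /andP[k0i _] := gpath_itv hk (ltnW (ltn_ord i)).
have /andP[_ k1i] := gpath_itv hk (ltn_ord i).
have ki : (k i <= k i.+1)%N by have [_ _ ->] := hk.
rewrite (big_cat_nat (n := k i) (p := k1) k0i (leq_trans ki k1i))/=.
rewrite (big_cat_nat (n := k i.+1) (p := k1) ki k1i)/= addrCA.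
have -> : \sum_(k i <= c < k i.+1 | D i c) F (a + i.+1%:Z, c) =
    \sum_(k i <= c < k i.+1) F (a + i.+1%:Z, c).
  by rewrite big_nat_cond [RHS]big_nat; apply: eq_bigl => c; case h : (_ <= _ < _)%N; rewrite // (Dk i c).
by rewrite lerDl addr_ge0// sumr_ge0.
Qed.

Definition gsup (G : set (nat -> nat)) a d xi : R := sup [set gval a d k xi | k in G].

Lemma gval_ubound D (G : set (nat -> nat)) a d k0 k1 xi :
  G `<=` gpath d k0 k1 -> (forall k, G k -> fits D d k) ->
  has_ubound [set gval a d k xi | k in G].
Proof.
move=> GG GD; exists (\sum_(c <- gcells D a d k0 k1) `|xi c|) => _ [k Gk <-].
apply: le_trans (_ : gval a d k (fun c => `|xi c|) <= _).
  by apply: ler_sum => i _; apply: ler_sum => c _; exact: ler_norm.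
by apply: gval_cells_le => //; [exact: GG|exact: GD].
Qed.

Lemma gsup_lipK D (G : set (nat -> nat)) a d k0 k1 : G !=set0 ->
  G `<=` gpath d k0 k1 -> (forall k, G k -> fits D d k) ->
  lipK (gcells D a d k0 k1) 1 (gsup G a d).
Proof.
move=> G0 GG GD; split => // u v; rewrite mul1r.
apply: sup_dist => //; [exact: gval_ubound GG GD|exact: gval_ubound GG GD|].
move=> k Gk; rewrite /gval -sumrB; apply: le_trans (ler_norm_sum _ _ _) _.
apply: (@le_trans _ _ (gval a d k (fun c => `|u c - v c|))); last first.
  by apply: gval_cells_le; [move=> c; exact: normr_ge0|exact: GG|exact: GD].
by apply: ler_sum => i _; rewrite -sumrB; apply: ler_norm_sum.
Qed.

Lemma gsup_mono D (G : set (nat -> nat)) a d k0 k1 u v : G !=set0 ->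
  G `<=` gpath d k0 k1 -> (forall k, G k -> fits D d k) ->
  (forall c, u c <= v c) -> gsup G a d u <= gsup G a d v.
Proof.
move=> [k0' Gk0] GG GD uv; apply: ge_sup; first by exists (gval a d k0' u), k0'.
move=> _ [k Gk <-]; apply: (@le_trans _ _ (gval a d k v)).
  by apply: ler_sum => i _; apply: ler_sum => c _.
by apply: ub_le_sup; [exact: gval_ubound GG GD|exists k].
Qed.

Lemma grid_close W a d u v e : (forall j, continuous (W j)) -> (0 < d)%N -> u <= v ->
  0 < e -> \forall m \near \oo,
  (forall z, npath d u v z -> gpath d (idx m u) (idx m v) (idx m \o z) /\
     lppn W a d z <= gval a d (idx m \o z) (gin W m) + e) /\
  (forall k, gpath d (idx m u) (idx m v) k -> exists2 z, npath d u v z &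
     gval a d k (gin W m) <= lppn W a d z + e).
Proof.
move=> cW d0 uv e0.
have e'0 : 0 < e / (2 * d%:R) by rewrite divr_gt0// mulr_gt0// ltr0n.
have [dl dl0 hdl] := modulus a d u v cW e'0.
have close (x y : nat -> R) : (forall i, (i <= d)%N -> u <= x i <= v) ->
    (forall i, (i <= d)%N -> `|x i - y i| < dl) ->
    `|lppn W a d x - lppn W a d y| <= e.
  move=> hx hxy; rewrite /lppn -sumrB; apply: le_trans (ler_norm_sum _ _ _) _.
  apply: (@le_trans _ _ (\sum_(i < d) (e / (2 * d%:R) + e / (2 * d%:R)))).
    apply: ler_sum => i _; rewrite opprD addrACA.
    apply: le_trans (ler_normD _ _) _; apply: lerD.
      by apply: hdl => //; [exact: hx|exact: hxy].
    by rewrite -opprD normrN; apply: hdl => //; [apply: hx|apply: hxy]; exact: ltnW.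
  rewrite sumr_const card_ord -mulr_natr -mulrDr.
  by rewrite le_eqVlt; apply/orP; left; apply/eqP; field; rewrite pnatr_eq0 -lt0n.
near=> m.
have um : - m.+1%:R <= u.
  rewrite lerNl (le_trans (ler_norm _))// normrN (@le_trans _ _ m%:R) ?ler_nat//.
  by near: m; exact: nbhs_infty_ger.
have hm : m.+1%:R^-1 < dl :> R.
  rewrite invf_plt ?posrE// (@lt_trans _ _ m%:R) ?ltr_nat//.
  by near: m; exact: nbhs_infty_gtr.
split=> [z hz|k hk].
  have zu i : (i <= d)%N -> u <= z i <= v by exact: npath_itv.
  have zm i : (i <= d)%N -> - m.+1%:R <= z i by move=> /zu /andP[h _]; exact: le_trans h.
  have gz : gpath d (idx m u) (idx m v) (idx m \o z).
    have [z0 zd zi] := hz; split; rewrite /= ?z0 ?zd// => i id'.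
    by apply: idx_mono; [apply: zm; exact: ltnW|exact: zi].
  split => //; rewrite (gval_lppn _ _ _ gz) -lerBlDl.
  apply: le_trans (ler_norm _) _; apply: close => // i id' /=.
  have /andP[h1 h2] := idxP (zm i id'); rewrite ger0_norm ?subr_ge0//.
  by rewrite ltrBlDl (lt_trans h2)// ltrD2l.
have vm : - m.+1%:R <= v by exact: le_trans uv.
have /andP[u1 u2] := idxP um; have /andP[v1 v2] := idxP vm.
have tmono k1 k2 : (k1 <= k2)%N -> tick m k1 <= tick m k2.
  by move=> h; rewrite /tick lerD2l ler_wpM2l// ler_nat.
have tk i : (i <= d)%N -> u - m.+1%:R^-1 <= tick m (k i) <= v.
  move=> /(gpath_itv hk) /andP[h1 h2]; apply/andP; split.
    by rewrite lerBlDr (le_trans (ltW u2))// lerD2r tmono.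
  by apply: le_trans v1; exact: tmono.
have [k0 kd ki] := hk.
pose z i := if (i == 0)%N then u else if (d <= i)%N then v else Num.max u (tick m (k i)).
have hz : npath d u v z.
  split; rewrite /z ?eqxx// ?leqnn; first by rewrite gtn_eqF.
  move=> i id'; rewrite (leqNgt d i) id'/=.
  case: eqP => [_|i0]; first by case: ifP => // _; rewrite le_max lexx.
  case: ifP => _; first by rewrite ge_max uv; have /andP[] := tk i (ltnW id').
  by rewrite ge_max le_max lexx/= le_max tmono ?orbT// ki.
exists z => //; rewrite (gval_lppn _ _ _ hk) -lerBlDl.
apply: le_trans (ler_norm _) _; rewrite distrC; apply: close => [i|i id' /=].
  exact: npath_itv.
apply: (le_lt_trans _ hm); rewrite /z; case: eqP => [->|i0].
  by rewrite k0 ger0_norm ?subr_ge0// lerBlDl ltW.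
case: ifP => [di|_].
  have -> : i = d by apply/eqP; rewrite eqn_leq id'.
  by rewrite kd ger0_norm ?subr_ge0// lerBlDl ltW.
have /andP[h1 h2] := tk i id'.
have [h|h] := leP u (tick m (k i)); first by rewrite subrr normr0.
by rewrite ger0_norm; [rewrite lerBlDl -lerBlDr|rewrite subr_ge0 ltW].
Unshelve. all: by end_near. Qed.

Lemma gpath_ex d k0 k1 : (0 < d)%N -> (k0 <= k1)%N ->
  gpath d k0 k1 (fun i => if i == 0%N then k0 else k1).
Proof. by case: d => // d _ uv; split => //= i _; case: eqP. Qed.

Lemma gsup_LPP W a d u v : (forall j, continuous (W j)) -> (0 < d)%N -> u <= v ->
  gsup (gpath d (idx m u) (idx m v)) a d (gin W m) @[m --> \oo] --> LPP W a d u v.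
Proof.
move=> cW d0 uv; apply/cvgrPdist_le => e e0; near=> m.
have [] : (forall z, npath d u v z -> gpath d (idx m u) (idx m v) (idx m \o z) /\
     lppn W a d z <= gval a d (idx m \o z) (gin W m) + e) /\
  (forall k, gpath d (idx m u) (idx m v) k -> exists2 z, npath d u v z &
     gval a d k (gin W m) <= lppn W a d z + e).
  by near: m; exact: grid_close.
move=> h1 h2.
have um : - m.+1%:R <= u.
  rewrite lerNl (le_trans (ler_norm _))// normrN (@le_trans _ _ m%:R) ?ler_nat//.
  by near: m; exact: nbhs_infty_ger.
have hub : has_ubound [set gval a d k (gin W m) | k in gpath d (idx m u) (idx m v)].
  apply: (gval_ubound (D := fun _ _ => true)); first exact: subset_refl.
  by move=> k _ i c.
have h3 : gsup (gpath d (idx m u) (idx m v)) a d (gin W m) <= LPP W a d u v + e.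
  apply: sup_le_add.
  - by eexists; eexists; [apply: gpath_ex => //; exact: idx_mono|reflexivity].
  - by rewrite lpp_valuesE; exact: lppn_bounded.
  - move=> _ [k /h2[z hz hk] <-]; exists (lppn W a d z) => //.
    by rewrite lpp_valuesE; exists z.
have h4 : LPP W a d u v <= gsup (gpath d (idx m u) (idx m v)) a d (gin W m) + e.
  apply: sup_le_add => //.
    by rewrite lpp_valuesE; eexists; eexists; [exact: npath_ex|reflexivity].
  rewrite lpp_valuesE => _ [z /h1[hz1 hz2] <-].
  by exists (gval a d (idx m \o z) (gin W m)) => //; exists (idx m \o z).
by rewrite ler_norml; apply/andP; split; lra.
Unshelve. all: by end_near. Qed.

End grid.

Section admissible_functionals.
Context {R : realType}.
Implicit Types (W : int -> R -> R) (D : nat -> int * nat -> bool).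

Lemma lipK_cvg (J : eqType) (l : seq J) (K : R) (g : (J -> R) -> R)
    (u_ : nat -> J -> R) (u : J -> R) : lipK l K g ->
  (forall c, c \in l -> u_ m c @[m --> \oo] --> u c) -> g (u_ m) @[m --> \oo] --> g u.
Proof.
move=> [K0 hg] hu; apply/subr_cvg0/norm_cvg0P.
apply: (@squeeze_cvgr _ _ _ _ (cst 0) (fun m => K * \sum_(c <- l) `|u_ m c - u c|)).
- by near=> m; rewrite normr_ge0 hg.
- exact: cvg_cst.
- rewrite -[X in _ --> X](mulr0 K); apply: cvgMr.
  elim: l hu {hg} => [|c l IH] hu; first by under eq_fun do rewrite big_nil; exact: cvg_cst.
  have h1 : `|u_ m c - u c| @[m --> \oo] --> (0 : R).
    by apply/norm_cvg0P/subr_cvg0; apply: hu; rewrite mem_head.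
  have h2 := IH (fun c' c'l => hu c' (mem_behead (s := c :: l) c'l)).
  have h3 := cvgD h1 h2; rewrite addr0 in h3.
  rewrite (_ : (fun x => _) = (fun m => `|u_ m c - u c|) \+
    (fun m => \sum_(c' <- l) `|u_ m c' - u c'|)).
    exact: h3.
  by apply/funext => m; rewrite big_cons.
Unshelve. all: by end_near. Qed.

(* Phi is a limit of functionals of the grid increments in the cells D: laws,
   independence and positive association pass from the increments to Phi(W). *)
Record adm_by (anti : bool) D (Phi : (int -> R -> R) -> R) (m0 : nat)
    (l_ : nat -> seq (int * nat)) (G_ : nat -> (int * nat -> R) -> R) (B : R) : Prop := Adm_by {
  adm_blip : forall m, (m0 <= m)%N -> blip (l_ m) (G_ m);
  adm_mem : forall m, (m0 <= m)%N -> forall c, c \in l_ m -> D m c;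
  adm_bd : forall m, (m0 <= m)%N -> forall xi, `|G_ m xi| <= B;
  adm_anti : forall m, (m0 <= m)%N -> anti -> antitone (G_ m) /\ forall xi, 0 <= G_ m xi;
  adm_lim : forall W, (forall j, continuous (W j)) -> G_ m (gin W m) @[m --> \oo] --> Phi W }.

Definition adm anti D Phi := exists m0 l_ G_ B, @adm_by anti D Phi m0 l_ G_ B.

Definition admF_by D (Phi : (int -> R -> R) -> R)
    (s : nat * (nat -> seq (int * nat)) * (nat -> (int * nat -> R) -> R)) :=
  (forall m, (s.1.1 <= m)%N -> [/\ flip (s.1.2 m) (s.2 m), forall c, c \in s.1.2 m -> D m c &
     forall u v : int * nat -> R, (forall c, u c <= v c) -> s.2 m u <= s.2 m v]) /\
  forall W, (forall j, continuous (W j)) -> s.2 m (gin W m) @[m --> \oo] --> Phi W.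

Definition admF D Phi := exists s, admF_by D Phi s.

Lemma admF_sub D D' Phi : (forall m c, D m c -> D' m c) -> admF D Phi -> admF D' Phi.
Proof.
move=> DD [[[m0 l_] G_] [h1 h2]]; exists (m0, l_, G_); split => // m mm.
by have [b1 b2 b3] := h1 m mm; split => // c /b2; exact: DD.
Qed.

Lemma admF_affine D Phi (a b : R) : 0 <= a -> admF D Phi -> admF D (fun W => a * Phi W + b).
Proof.
move=> a0 [[[m0 l_] G_] [h1 h2]]; exists (m0, l_, fun m xi => a * G_ m xi + b); split.
  move=> m mm; have [b1 b2 b3] := h1 m mm; split => //.
    by apply: flipD; [exact: flipZ|exact: flip_cst].
  by move=> u v uv; rewrite lerD2r ler_wpM2l// b3.
by move=> W cW; apply: cvgD; [apply: cvgMr; exact: h2|exact: cvg_cst].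
Qed.

Lemma admF_LPP a d u v : (0 < d)%N -> u <= v ->
  admF (fun m c => (a < c.1 <= a + d%:Z) && (idx m u <= c.2 < idx m v)%N) (fun W => LPP W a d u v).
Proof.
move=> d0 uv; have [m0 hm0] : exists m0 : nat, forall m, (m0 <= m)%N -> - m.+1%:R <= u.
  exists (Num.truncn `|u|).+1 => m mm; rewrite lerNl (le_trans (ler_norm _))// normrN.
  apply: (@le_trans _ _ (Num.truncn `|u|).+1%:R); first by rewrite ltW// truncnS_gt.
  by rewrite ler_nat (leq_trans mm).
exists (m0, fun m => gcells (fun _ _ => true) a d (idx m u) (idx m v),
  fun m => gsup (gpath d (idx m u) (idx m v)) a d); split; last first.
  by move=> W cW; exact: gsup_LPP.
move=> m mm; have uvm : (idx m u <= idx m v)%N by apply: idx_mono => //; exact: hm0.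
have G0 : gpath d (idx m u) (idx m v) !=set0 by eexists; exact: gpath_ex.
split.
- by exists 1; apply: gsup_lipK => //; exact: subset_refl.
- move=> c /mem_gcells[i [id' -> -> _]]; rewrite andbT ltrDl lerD2l lez_nat id'.
  by rewrite ltz_nat.
- by move=> x y xy; apply: (gsup_mono (D := fun _ _ => true)) xy; [|exact: subset_refl|].
Qed.

Lemma adm_comp (J : eqType) D (anti : bool) (l : seq J) (g : (J -> R) -> R)
    (Phi : J -> (int -> R -> R) -> R) : blip l g -> (forall p, p \in l -> admF D (Phi p)) ->
  (anti -> antitone g /\ forall u, 0 <= g u) ->
  adm anti D (fun W => g (fun p => Phi p W)).
Proof.
move=> [[K hK] [B hB]] hPhi hanti.
have /choice[S hS] : forall p, exists s, p \in l -> admF_by D (Phi p) s.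
  move=> p; have [/hPhi[s hs]|_] := boolP (p \in l); first by exists s.
  by exists (0%N, fun=> [::], fun=> fun=> 0).
pose H m xi p : R := if p \in l then (S p).2 m xi else 0.
have gH m xi : g (H m xi) = g (fun p => (S p).2 m xi).
  by apply: (flip_agree (l := l)); [exists K|move=> c cl; rewrite /H cl].
exists (\max_(p <- l) (S p).1.1)%N, (fun m => flatten [seq (S p).1.2 m | p <- l]),
  (fun m xi => g (H m xi)), B.
have Sm m p : (\max_(p <- l) (S p).1.1 <= m)%N -> p \in l -> ((S p).1.1 <= m)%N.
  by move=> mm pl; apply: leq_trans mm; rewrite (big_rem p pl)/= leq_maxl.
split => [m mm|m mm|m mm|m mm|W cW]; last first.
- under eq_fun do rewrite gH.
  by apply: lipK_cvg hK _ => p pl; apply: (hS p pl).2.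
- move=> /hanti[ag g0]; split => // u v uv; apply: ag => p; rewrite /H.
  by case: ifP => // pl; have [_ _] := (hS p pl).1 m (Sm m p mm pl); apply.
- by move=> xi.
- move=> c /flattenP[s /mapP[p pl ->] cs].
  by have [_ + _] := (hS p pl).1 m (Sm m p mm pl); apply.
- split; last by exists B.
  have [K0 hg] := hK.
  have aux l' : {subset l' <= l} -> exists2 C : R, 0 <= C & forall u v,
      \sum_(p <- l') `|H m u p - H m v p| <=
      C * \sum_(c <- flatten [seq (S p).1.2 m | p <- l']) `|u c - v c|.
    elim: l' => [|p l' IH] hl; first by exists 0 => // u v; rewrite big_nil mul0r.
    have [C C0 hC] := IH (fun x xl => hl x (mem_behead (s := p :: l') xl)).
    have pl : p \in l by apply: hl; rewrite mem_head.
    have [[C' [C'0 hC']] _ _] := (hS p pl).1 m (Sm m p mm pl).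
    exists (C' + C) => [|u v]; first exact: addr_ge0.
    rewrite big_cons /= big_cat/= mulrDr !mulrDl -addrA; apply: lerD.
      by rewrite /H pl.
    apply: le_trans (hC u v) _; by rewrite addrA lerDr addr_ge0// mulr_ge0// sumr_ge0.
  have [C C0 hC] := aux l (fun x xl => xl).
  exists (K * C); split; first by rewrite mulr_ge0.
  by move=> u v; apply: le_trans (hg _ _) _; rewrite -mulrA ler_wpM2l.
Qed.

Lemma adm_by_mul anti1 anti2 D1 D2 Phi1 Phi2 m1 m2 l1 l2 G1 G2 B1 B2 :
  adm_by anti1 D1 Phi1 m1 l1 G1 B1 -> adm_by anti2 D2 Phi2 m2 l2 G2 B2 ->
  adm_by (anti1 && anti2) (fun m c => D1 m c || D2 m c) (fun W => Phi1 W * Phi2 W)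
    (maxn m1 m2) (fun m => l1 m ++ l2 m) (fun m xi => G1 m xi * G2 m xi) (B1 * B2).
Proof.
move=> [a1 a2 a3 a4 a5] [b1 b2 b3 b4 b5]; split.
- move=> m; rewrite geq_max => /andP[mm1 mm2].
  apply: blipM; [apply: blip_sub (a1 m mm1)|apply: blip_sub (b1 m mm2)] => x.
    by rewrite mem_cat => ->.
  by rewrite mem_cat orbC => ->.
- move=> m; rewrite geq_max => /andP[mm1 mm2] c.
  by rewrite mem_cat => /orP[/(a2 m mm1) ->//|/(b2 m mm2) ->]; rewrite orbT.
- move=> m; rewrite geq_max => /andP[mm1 mm2] xi.
  by rewrite normrM ler_pM ?a3 ?b3.
- move=> m; rewrite geq_max => /andP[mm1 mm2] /andP[an1 an2].
  have [x1 x2] := a4 m mm1 an1; have [y1 y2] := b4 m mm2 an2; split => [u v uv|xi].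
    by rewrite ler_pM ?x1 ?y1.
  by rewrite mulr_ge0.
- by move=> W cW; apply: cvgM; [exact: a5|exact: b5].
Qed.

Section expectations.
Context {d : measure_display} {T : measurableType d} (Q : probability T R)
  (W : int -> T -> R -> R).
Hypothesis gW : genv Q W.
Let Wat w : int -> R -> R := fun j => W j w.

Lemma gin_measurable m c : measurable_fun setT (fun w => gin (Wat w) m c).
Proof. by apply: measurable_funB; exact: (genv_meas gW). Qed.

Lemma adm_by_cvg anti D Phi m0 l_ G_ B : adm_by anti D Phi m0 l_ G_ B ->
  bmeas (fun w => Phi (Wat w)) /\
  forall s : nat -> seq (int * nat), (forall m, uniq (s m)) ->
    (forall m, {subset l_ m <= s m}) ->
    Ex (gauss m.+1%:R^-1) (s m) (G_ m) (fun=> 0) @[m --> \oo] --> Ev Q (fun w => Phi (Wat w)).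
Proof.
move=> [h1 h2 h3 h4 h5].
have [||w|b1 _ b3] := @Ev_cvg _ _ _ Q (fun m w => G_ (m + m0)%N (gin (Wat w) (m + m0)%N))
    (fun w => Phi (Wat w)) B.
- move=> m; have [fG _] := h1 _ (leq_addl m m0).
  by apply: (flip_measurable fG) => c _; exact: gin_measurable.
- by move=> m w; apply: h3; exact: leq_addl.
- have := h5 (Wat w) (fun j => @genv_cont _ _ _ _ _ gW j w).
  by rewrite -(cvg_shiftn m0).
split => // s us ls; rewrite -(cvg_shiftn m0) /=.
apply: cvg_trans b3; apply: near_eq_cvg; near=> m => /=.
have bG := h1 _ (leq_addl m m0).
have := @genv_law _ _ _ _ _ gW (- (m + m0).+1%:R) (m + m0).+1%:R^-1 (s (m + m0)%N)
  (l_ (m + m0)%N) (G_ (m + m0)%N) (fun=> 0).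
by apply => //; rewrite invr_gt0.
Unshelve. all: by end_near. Qed.

Lemma adm_bmeas anti D Phi : adm anti D Phi -> bmeas (fun w => Phi (Wat w)).
Proof. by move=> [m0 [l_ [G_ [B /adm_by_cvg[]]]]]. Qed.

Section products.
Variables (anti1 anti2 : bool) (D1 D2 : nat -> int * nat -> bool)
  (Phi1 Phi2 : (int -> R -> R) -> R).
Hypotheses (a1 : adm anti1 D1 Phi1) (a2 : adm anti2 D2 Phi2).

Let products_cvg : exists m0 l_ l1 l2 G1 G2,
  [/\ forall m, (m0 <= m)%N -> [/\ blip (l1 m) (G1 m), blip (l2 m) (G2 m),
        (forall c, c \in l1 m -> D1 m c), (forall c, c \in l2 m -> D2 m c) &
        (anti1 -> antitone (G1 m) /\ forall xi, 0 <= G1 m xi) /\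
        (anti2 -> antitone (G2 m) /\ forall xi, 0 <= G2 m xi)],
    Ex (gauss m.+1%:R^-1) (l_ m) (G1 m) (fun=> 0) @[m --> \oo] --> Ev Q (fun w => Phi1 (Wat w)),
    Ex (gauss m.+1%:R^-1) (l_ m) (G2 m) (fun=> 0) @[m --> \oo] --> Ev Q (fun w => Phi2 (Wat w)) &
    Ex (gauss m.+1%:R^-1) (l_ m) (fun xi => G1 m xi * G2 m xi) (fun=> 0) @[m --> \oo] -->
      Ev Q (fun w => Phi1 (Wat w) * Phi2 (Wat w))].
Proof.
have [m1 [l1 [G1 [B1 h1]]]] := a1; have [m2 [l2 [G2 [B2 h2]]]] := a2.
exists (maxn m1 m2), (fun m => undup (l1 m ++ l2 m)), l1, l2, G1, G2.
have ul m : uniq (undup (l1 m ++ l2 m)) by exact: undup_uniq.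
split.
- move=> m; rewrite geq_max => /andP[mm1 mm2]; have [? ? ? ? _] := h1; have [? ? ? ? _] := h2.
  by split; [auto|auto|auto|auto|split; auto].
- by apply: (adm_by_cvg h1).2 => // m x xl; rewrite mem_undup mem_cat xl.
- by apply: (adm_by_cvg h2).2 => // m x xl; rewrite mem_undup mem_cat xl orbT.
- by apply: (adm_by_cvg (adm_by_mul h1 h2)).2 => // m x xl; rewrite mem_undup.
Qed.

Lemma adm_prod : (forall m c, D1 m c -> D2 m c -> False) ->
  Ev Q (fun w => Phi1 (Wat w) * Phi2 (Wat w)) =
  Ev Q (fun w => Phi1 (Wat w)) * Ev Q (fun w => Phi2 (Wat w)).
Proof.
move=> D12; have [m0 [l_ [l1 [l2 [G1 [G2 [h c1 c2 c12]]]]]]] := products_cvg.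
apply: (@cvg_unique _ (@norm_hausdorff _ _) _ _ _ _ c12).
apply: cvg_trans (cvgM c1 c2); apply: near_eq_cvg; near=> m => /=.
have mm : (m0 <= m)%N by near: m; exact: nbhs_infty_ge.
have [b1 b2 b3 b4 _] := h m mm.
by rewrite (Ex_prod _ _ _ b1 b2)// => c /b3 + /b4; exact: D12.
Unshelve. all: by end_near. Qed.

Lemma adm_fkg : anti1 -> anti2 ->
  Ev Q (fun w => Phi1 (Wat w)) * Ev Q (fun w => Phi2 (Wat w)) <=
  Ev Q (fun w => Phi1 (Wat w) * Phi2 (Wat w)).
Proof.
move=> an1 an2; have [m0 [l_ [l1 [l2 [G1 [G2 [h c1 c2 c12]]]]]]] := products_cvg.
apply: (ler_cvg_to (cvgM c1 c2) c12); near=> m.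
have mm : (m0 <= m)%N by near: m; exact: nbhs_infty_ge.
have [b1 b2 _ _ [/(_ an1)[? ?] /(_ an2)[? ?]]] := h m mm.
exact: Ex_harris b1 b2 _ _ _ _.
Unshelve. all: by end_near. Qed.

End products.
End expectations.

Lemma adm_law {d d' : measure_display} {T : measurableType d} {T' : measurableType d'}
    (Q : probability T R) (Q' : probability T' R) (W : int -> T -> R -> R)
    (W' : int -> T' -> R -> R) anti D Phi : genv Q W -> genv Q' W' -> adm anti D Phi ->
  Ev Q (fun w => Phi (fun j => W j w)) = Ev Q' (fun w => Phi (fun j => W' j w)).
Proof.
move=> gW gW' [m0 [l_ [G_ [B h]]]].
have ul m : uniq (undup (l_ m)) by exact: undup_uniq.
have sl m : {subset l_ m <= undup (l_ m)} by move=> x xl; rewrite mem_undup.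
have h1 := (adm_by_cvg gW h).2 _ ul sl; have h2 := (adm_by_cvg gW' h).2 _ ul sl.
exact: (@cvg_unique _ (@norm_hausdorff _ _) _ _ _ _ h1 h2).
Qed.

Section affine_environments.
Context {d : measure_display} {T : measurableType d} (Q : probability T R).

Lemma lip_continuous (f : R -> R) K : (forall x y, `|f x - f y| <= K * `|x - y|) -> continuous f.
Proof.
move=> hf x; apply/subr_cvg0/norm_cvg0P.
apply: (@squeeze_cvgr _ _ _ _ (cst 0) (fun y => `|K| * `|y - x|)).
- by near=> y; rewrite normr_ge0/= (le_trans (hf _ _))// ler_wpM2r// ler_norm.
- exact: cvg_cst.
- rewrite -[X in _ --> X](mulr0 `|K|); apply: cvgMr; apply/norm_cvg0P/subr_cvg0.
  exact: cvg_id.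
Unshelve. all: by end_near. Qed.

Lemma Ex_rescale (J J' : eqType) (s : J -> J') (h k : R) (l l0 : seq J)
    (G : (J -> R) -> R) (u : J' -> R) : 0 < h -> 0 < k -> injective s -> blip l0 G ->
  Ex (gauss (h / k ^+ 2)) (map s l) (fun xi => G (fun c => k * xi (s c))) u =
  Ex (gauss h) l G (fun c => k * u (s c)).
Proof.
move=> h0 k0 si bG; elim: l u => [//|c l IH] u /=.
have [[K hK] [B hB]] := bG.
have [hlip hbd] := Ex_lip (gauss h) l hK hB.
pose v := fun c => k * u (s c); pose f x := Ex (gauss h) l G (upd v c x).
have cf : continuous f.
  have [K0 hl] := hlip.
  apply: (@lip_continuous _ (K * (size l0)%:R)) => x y; apply: le_trans (hl _ _) _.
  rewrite -mulrA ler_wpM2l// -sum1_size natr_sum mulr_suml.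
  by apply: ler_sum => i _; rewrite /upd mul1r; case: eqP => // _; rewrite subrr normr0.
have bf : exists B, forall x, `|f x| <= B by exists B => x; exact: hbd.
apply: (etrans _ (Ev_gauss_scale h0 k0 cf bf)); apply: eq_Ev => x; rewrite IH /f; congr Ex; apply/funext => c'; rewrite /upd /v.
by rewrite (inj_eq si); case: eqP.
Qed.

Lemma genv_affine (W : int -> T -> R -> R) (j0 : int) (al be ka : R) : genv Q W ->
  0 < al -> 0 < ka -> ka ^+ 2 * al = 1 ->
  genv Q (fun j w u => ka * W (j + j0) w (al * u + be)).
Proof.
move=> [mW cW lW] al0 ka0 kal; split.
- by move=> j u; apply: measurable_funM => //; exact: mW.
- move=> j w u; apply: cvgMr.
  apply: (@continuous_comp _ _ _ (fun v : R => al * v + be) (W (j + j0) w) u); last exact: cW.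
  by apply: cvgD; [apply: cvgMr; exact: cvg_id|exact: cvg_cst].
move=> A h l l0 G u h0 ul sl bG.
pose s (c : int * nat) := (c.1 + j0, c.2).
have si : injective s by move=> [a1 a2] [b1 b2] [/addIr -> ->].
pose G' xi := G (fun c => ka * xi (s c)).
have [[K [K0 hK]] [B hB]] := bG.
have bG' : blip (map s l0) G'.
  split; last by exists B => xi; exact: hB.
  exists (K * ka); split; first by rewrite mulr_ge0// ltW.
  move=> x y; apply: le_trans (hK _ _) _; rewrite big_map -mulrA ler_wpM2l// mulr_sumr.
  by apply: ler_sum => c _; rewrite -mulrBr normrM gtr0_norm.
have hal : al * h = h / ka ^+ 2.
  have ka2 : ka ^+ 2 != 0 by rewrite expf_neq0// gt_eqF.
  by apply: (mulfI ka2); rewrite mulrA kal mul1r mulrCA divff// mulr1.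
pose u' c := ka^-1 * u (c.1 - j0, c.2).
transitivity (Ev Q (fun w => G' (incr (fun j => W j w) (al * A + be) (al * h)))).
  apply: eq_Ev => w; congr G; apply/funext => c; rewrite /incr /s /= -mulrBr.
  by congr (_ * (W _ w _ - W _ w _)); ring.
rewrite (lW _ _ (map s l) (map s l0) G' u') ?mulr_gt0 ?map_inj_uniq//; last first.
  by move=> _ /mapP[c cl ->]; apply: map_f; exact: sl.
rewrite hal; apply: (etrans (Ex_rescale _ _ h0 ka0 si bG)); congr Ex; apply/funext => c.
by rewrite /u' /s /= addrK mulrA divff ?gt_eqF// mul1r; case: c.
Qed.

End affine_environments.
End admissible_functionals.

(** * Symmetries of the prelimit and of the limit *)

Arguments landscape_n : simpl never.

Section prelimit_landscape.
Context {R : realType}.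
Implicit Types (W : int -> R -> R) (p : R4 R).

Definition rt6 n : R := n%:R `^ (1 / 6).
Definition lo n (s : R) : int := Num.floor (n%:R * s).
Definition cx n (q : R * R) : R := q.2 + 2 * q.1 / rt6 n ^+ 2.
Definition dl n p : nat := absz (lo n p.2.2 - lo n p.1.2)%R.
Definition pok n p := (lo n p.1.2 < lo n p.2.2) && (cx n p.1 <= cx n p.2).

Lemma rt6_ge0 n : 0 <= rt6 n. Proof. exact: powR_ge0. Qed.

Lemma rt6_gt0 n : (0 < n)%N -> 0 < rt6 n.
Proof. by move=> n0; apply: powR_gt0; rewrite ltr0n. Qed.

Lemma rt6X n : rt6 n ^+ 6 = n%:R.
Proof.
rewrite -powR_mulrn ?rt6_ge0// /rt6 -powRrM.
by rewrite (_ : 1 / 6 * 6%:R = 1 :> R) ?powRr1//; field.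
Qed.

Lemma rt6N2 n : n%:R `^ (- (1 / 3)) = (rt6 n ^+ 2)^-1 :> R.
Proof.
rewrite powRN -powR_mulrn ?rt6_ge0// /rt6 -powRrM.
by rewrite (_ : 1 / 6 * 2%:R = 1 / 3 :> R)//; field.
Qed.

Lemma rt6_sqrt n : Num.sqrt n%:R = rt6 n ^+ 3 :> R.
Proof.
by rewrite -rt6X (_ : rt6 n ^+ 6 = (rt6 n ^+ 3) ^+ 2) ?sqrtr_sqr ?ger0_norm ?exprn_ge0 ?rt6_ge0// -exprM.
Qed.

Lemma rt6_unique n (x : R) : 0 <= x -> x ^+ 6 = n%:R -> rt6 n = x.
Proof. by move=> x0 xn; apply: (@pexpIrn _ 6) => //; rewrite ?nnegrE ?rt6_ge0// rt6X. Qed.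

Lemma rt6_ge_near (C : R) : \forall n \near \oo, C <= rt6 n.
Proof.
near=> n; apply: contraT; rewrite -ltNge => nC.
have C0 : 0 <= C by apply: le_trans (ltW nC); exact: rt6_ge0.
have : rt6 n ^+ 6 < C ^+ 6 by rewrite ltr_pXn2r// ?nnegrE ?rt6_ge0.
rewrite rt6X ltNge => /negP[]; near: n; exact: nbhs_infty_ger.
Unshelve. all: by end_near. Qed.

Lemma landscape_nE W n p : lo n p.1.2 <= lo n p.2.2 ->
  landscape_n W n p = rt6 n * LPP W (lo n p.1.2) (dl n p) (cx n p.1) (cx n p.2)
    - rt6 n * (2 * (p.2.2 - p.1.2) * rt6 n ^+ 3 + 2 * (p.2.1 - p.1.1) * rt6 n).
Proof.
case: p => [[x s] [y t]] /= st; rewrite /landscape_n -/(rt6 n) rt6N2 rt6_sqrt /LPP /dl /=.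
have -> : lo n s + (absz (lo n t - lo n s)%R)%:Z = lo n t.
  by rewrite gez0_abs ?subr_ge0// addrC subrK.
by rewrite -/(lo n s) -/(lo n t) /cx /= -mulrBr; congr (_ * _); rewrite opprD addrA.
Qed.

Lemma pok_near p : R4up p -> \forall n \near \oo, pok n p.
Proof.
move: p => [[x s] [y t]]; rewrite /R4up/= => st.
have ts0 : 0 < t - s by rewrite subr_gt0.
near=> n; apply/andP; split; rewrite /lo /cx/=.
  rewrite -lezD1 floor_ge_int intrD1.
  apply: (@le_trans _ _ (n%:R * s + 1)); first by rewrite lerD2r floor_le.
  rewrite addrC -lerBrDr -mulrBr -ler_pdivrMr//.
  by near: n; exact: nbhs_infty_ger.
have r0 : 0 < rt6 n by apply: lt_le_trans (_ : 1 <= _) => //; near: n; exact: rt6_ge_near.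
have h : 2 * (x - y) <= (t - s) * rt6 n ^+ 2.
  rewrite -ler_pdivrMl//.
  apply: le_trans (_ : rt6 n <= _).
    by near: n; exact: rt6_ge_near.
  by rewrite expr2 ler_peMl ?rt6_ge0//; near: n; exact: rt6_ge_near.
rewrite -subr_ge0 (_ : _ - _ = ((t - s) * rt6 n ^+ 2 - 2 * (x - y)) / rt6 n ^+ 2).
  by rewrite divr_ge0 ?exprn_ge0 ?subr_ge0 ?rt6_ge0.
by field; rewrite gt_eqF.
Unshelve. all: by end_near. Qed.

Definition lines (a b : int) : nat -> int * nat -> bool := fun _ c => a < c.1 <= b.

Lemma dl_gt0 n p : pok n p -> (0 < dl n p)%N.
Proof. by move=> /andP[h _]; rewrite /dl absz_gt0 subr_eq0 gt_eqF. Qed.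

Lemma lo_dl n p : pok n p -> lo n p.1.2 + (dl n p)%:Z = lo n p.2.2.
Proof. by move=> /andP[h _]; rewrite /dl gez0_abs ?subr_ge0 ?(ltW h)// addrC subrK. Qed.

Lemma admF_landscape n p : pok n p ->
  admF (lines (lo n p.1.2) (lo n p.2.2)) (fun W => landscape_n W n p).
Proof.
move=> np; have /andP[h1 h2] := np.
have [s [s1 s2]] := admF_affine (- (rt6 n * (2 * (p.2.2 - p.1.2) * rt6 n ^+ 3 + 2 * (p.2.1 - p.1.1) * rt6 n)))
  (rt6_ge0 n) (admF_LPP (lo n p.1.2) (dl_gt0 np) h2).
exists s; split=> [m /s1[b1 b2 b3]|W cW].
  by split => // c /b2; rewrite /lines lo_dl// => /andP[].
by rewrite landscape_nE ?(ltW h1)//; exact: s2.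
Qed.

Lemma landscape_superadditive W n x y z : (forall j, continuous (W j)) ->
  pok n (x, y) -> pok n (y, z) ->
  landscape_n W n (x, y) + landscape_n W n (y, z) <= landscape_n W n (x, z).
Proof.
move=> cW xy yz; have /andP[/= xy1 xy2] := xy; have /andP[/= yz1 yz2] := yz.
have xz1 := lt_trans xy1 yz1.
rewrite (landscape_nE W (p := (x, y)) (ltW xy1)) (landscape_nE W (p := (y, z)) (ltW yz1)).
rewrite (landscape_nE W (p := (x, z)) (ltW xz1)) /=.
have /= h := LPP_superadditive (lo n x.2) cW (dl_gt0 xy) (dl_gt0 yz) xy2 yz2.
have dE : (dl n (x, y) + dl n (y, z))%N = dl n (x, z).
  by rewrite /dl /=; lia.
have := lo_dl xy; rewrite /= => xyE; rewrite xyE dE in h.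
have := ler_wpM2l (rt6_ge0 n) h; rewrite -subr_ge0 => h'; rewrite -subr_ge0.
by rewrite [X in 0 <= X](_ : _ = rt6 n * LPP W (lo n x.2) (dl n (x, z)) (cx n x) (cx n z) -
  rt6 n * (LPP W (lo n x.2) (dl n (x, y)) (cx n x) (cx n y) +
    LPP W (lo n y.2) (dl n (y, z)) (cx n y) (cx n z)))//; ring.
Qed.

Lemma LPP_affine_le W a d u v (j0 : int) (al be ka : R) : (forall j, continuous (W j)) ->
  0 < al -> 0 < ka -> (0 < d)%N -> u <= v ->
  LPP (fun j u => ka * W (j + j0) (al * u + be)) a d u v <=
  ka * LPP W (a + j0) d (al * u + be) (al * v + be).
Proof.
move=> cW al0 ka0 d0 uv; apply: LPP_le => // z [z0 zd zi].
have -> : lppn (fun j u => ka * W (j + j0) (al * u + be)) a d z =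
    ka * lppn W (a + j0) d (fun i => al * z i + be).
  by rewrite mulr_sumr; apply: eq_bigr => i _; rewrite mulrBr (addrAC a).
rewrite ler_pM2l//; apply: LPP_ge => //; split; rewrite ?z0 ?zd// => i id'.
by rewrite lerD2r ler_pM2l// zi.
Qed.

Lemma affine_continuous W (j0 : int) (al be ka : R) : (forall j, continuous (W j)) ->
  forall j, continuous (fun u => ka * W (j + j0) (al * u + be)).
Proof.
move=> cW j u; apply: cvgMr.
apply: (@continuous_comp _ _ _ (fun v : R => al * v + be) (W (j + j0)) u); last exact: cW.
by apply: cvgD; [apply: cvgMr; exact: cvg_id|exact: cvg_cst].
Qed.

Lemma LPP_affine W a d u v (j0 : int) (al be ka : R) : (forall j, continuous (W j)) ->
  0 < al -> 0 < ka -> (0 < d)%N -> u <= v ->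
  LPP (fun j u => ka * W (j + j0) (al * u + be)) a d u v =
  ka * LPP W (a + j0) d (al * u + be) (al * v + be).
Proof.
move=> cW al0 ka0 d0 uv; apply/eqP; rewrite eq_le LPP_affine_le//= -ler_pdivlMl//.
pose W' j u := ka * W (j + j0) (al * u + be).
have WE : W = (fun j u => ka^-1 * W' (j + - j0) (al^-1 * u + - (be / al))).
  apply/funext => j; apply/funext => x; rewrite /W' subrK mulrA mulVf ?gt_eqF// mul1r.
  by congr (W _ _); field; rewrite gt_eqF.
have uE w : al^-1 * (al * w + be) + - (be / al) = w by field; rewrite gt_eqF.
have cW' := @affine_continuous W j0 al be ka cW.
have al'0 : 0 < al^-1 by rewrite invr_gt0.
have ka'0 : 0 < ka^-1 by rewrite invr_gt0.
have uv' : al * u + be <= al * v + be by rewrite lerD2r ler_pM2l.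
have := @LPP_affine_le W' (a + j0) d _ _ (- j0) _ (- (be / al)) _ cW' al'0 ka'0 d0 uv'.
by rewrite -WE !uE addrK.
Qed.

Definition tau (zeta : R) (m : nat) (w : R) (k : int) p : R4 R :=
  ((zeta ^+ 2 * p.1.1 + w, m%:R * p.1.2 + k%:~R), (zeta ^+ 2 * p.2.1 + w, m%:R * p.2.2 + k%:~R)).

Lemma landscape_affine W n (zeta : R) m w (k : int) p : (forall j, continuous (W j)) ->
  (0 < n)%N -> 0 < zeta -> zeta ^+ 3 = m%:R -> pok n (tau zeta m w k p) ->
  pok (m * n)%N p ->
  landscape_n (fun j u => (Num.sqrt m%:R)^-1 *
    W (j + n%:Z * k) (m%:R * u + (k%:~R + 2 * w / rt6 n ^+ 2))) (m * n)%N p =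
  zeta^-1 * landscape_n W n (tau zeta m w k p).
Proof.
move=> cW n0 z0 zm pok1 pok2.
pose sg := Num.sqrt zeta; have sg0 : 0 < sg by rewrite sqrtr_gt0.
have zE : zeta = sg ^+ 2 by rewrite sqr_sqrtr// ltW.
have mE : m%:R = sg ^+ 6 :> R by rewrite -zm zE -exprM.
have m0 : 0 < m%:R :> R by rewrite mE exprn_gt0.
have r0 := rt6_gt0 n0.
have rE : rt6 (m * n) = sg * rt6 n.
  apply: rt6_unique; first by rewrite mulr_ge0 ?ltW.
  by rewrite exprMn rt6X -mE natrM.
have sE : Num.sqrt m%:R = sg ^+ 3 :> R.
  by rewrite mE (_ : sg ^+ 6 = (sg ^+ 3) ^+ 2) ?sqrtr_sqr ?ger0_norm ?exprn_ge0 ?ltW// -exprM.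
have loE s : lo n (m%:R * s + k%:~R) = lo (m * n) s + n%:Z * k.
  rewrite /lo (_ : n%:R * _ = (m * n)%:R * s + (n%:Z * k)%:~R :> R).
    by rewrite floorDrz ?intrKfloor ?intr_int.
  by rewrite natrM intrM; ring.
have cE q : m%:R * cx (m * n) q + (k%:~R + 2 * w / rt6 n ^+ 2) =
    cx n (zeta ^+ 2 * q.1 + w, m%:R * q.2 + k%:~R).
  by rewrite /cx/= rE mE zE; field; rewrite !gt_eqF.
have /andP[/= h1 h2] := pok1; have /andP[h3 h4] := pok2.
rewrite !landscape_nE ?ltW//.
rewrite LPP_affine// ?invr_gt0 ?sqrtr_gt0 ?dl_gt0//.
have -> : dl n (tau zeta m w k p) = dl (m * n) p.
  by rewrite /dl /= !loE opprD addrACA subrr addr0.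
have -> : LPP W (lo (m * n) p.1.2 + n%:Z * k) (dl (m * n) p)
    (m%:R * cx (m * n) p.1 + (k%:~R + 2 * w / rt6 n ^+ 2))
    (m%:R * cx (m * n) p.2 + (k%:~R + 2 * w / rt6 n ^+ 2)) =
  LPP W (lo n (tau zeta m w k p).1.2) (dl (m * n) p) (cx n (tau zeta m w k p).1)
    (cx n (tau zeta m w k p).2) by rewrite !cE /= loE.
set A := LPP _ _ _ _ _; rewrite /tau /= sE rE mE zE; field.
by rewrite gt_eqF.
Qed.

Lemma landscape_shear W n (r t y : R) : (forall j, continuous (W j)) ->
  (0 < n)%N -> 0 < t -> 0 < r -> r ^+ 2 = 1 + 2 * y / (t * rt6 n ^+ 2) ->
  pok n ((0, 0), (y, t)) -> pok n ((0, 0), (0, t)) ->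
  landscape_n (fun j u => r * W (j + 0) ((r ^+ 2)^-1 * u + 0)) n ((0, 0), (y, t)) =
  r * landscape_n W n ((0, 0), (0, t)) +
  rt6 n * (2 * t * rt6 n ^+ 3 * (r - 1) - 2 * y * rt6 n).
Proof.
move=> cW n0 t0 r0 rE p1 p2; have /andP[/= h1 h2] := p1; have /andP[/= h3 h4] := p2.
rewrite !landscape_nE/= ?ltW// LPP_affine ?invr_gt0 ?exprn_gt0 ?dl_gt0//.
have -> : dl n (0, 0, (0, t)) = dl n (0, 0, (y, t)) by [].
have c0 : (r ^+ 2)^-1 * cx n (0, 0) + 0 = cx n (0, 0).
  by rewrite /cx /= !mulr0 !mul0r !addr0 mulr0.
have ct : (r ^+ 2)^-1 * cx n (y, t) + 0 = cx n (0, t).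
  have rn0 := rt6_gt0 n0.
  have r2E : r ^+ 2 = (t + 2 * y / rt6 n ^+ 2) / t by rewrite rE; field; rewrite !gt_eqF.
  have h : t + 2 * y / rt6 n ^+ 2 != 0.
    have : r ^+ 2 != 0 by rewrite expf_neq0// gt_eqF.
    by rewrite r2E mulf_eq0 => /norP[].
  by rewrite /cx /= r2E invf_div divfK// mulr0 mul0r !addr0.
rewrite c0 ct addr0; ring.
Qed.

End prelimit_landscape.

Section limit_landscape.
Context {R : realType} {d' : measure_display} {T' : measurableType d'} (Q : probability T' R)
  (W : int -> T' -> R -> R) {d : measure_display} {T : measurableType d} (P : probability T R)
  (L : T -> R4 R -> R).
Hypothesis gW : genv Q W.
Hypothesis cvL : cvg_in_distribution Q (fun n w => landscape_n (fun j => W j w) n) P L.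
Hypothesis mL : forall p, R4up p -> measurable_fun setT (fun w => L w p).
Let Ln n w := landscape_n (fun j => W j w) n.

Lemma fam_continuous (K : set (R4 R)) (C : R) (F : (R4 R -> R) -> R) :
  compacts_R4up K ->
  (forall f g e, 0 < e -> (forall p, K p -> `|f p - g p| <= e) -> `|F f - F g| <= C * e) ->
  continuous (F : {family @compacts_R4up R, R4 R -> R} -> R).
Proof.
move=> cK hF f A /nbhs_ballP[e /= e0 hA].
have C0 : 0 < `|C| + 1 by rewrite ltr_wpDl.
have eC : 0 < e / 2 / (`|C| + 1) by rewrite !divr_gt0.
apply: filterS (fam_nbhs f (entourage_ball _ (PosNum eC)) cK) => g hg.
apply: hA; rewrite /ball/=; apply: le_lt_trans (hF f g _ eC _) _.
  by move=> p Kp; apply: ltW; exact: hg.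
rewrite mulrCA (@le_lt_trans _ _ (e / 2))//; last by rewrite ltr_pdivrMr// ltr_pMr// ltr1n.
rewrite ler_piMr ?divr_ge0 ?(ltW e0)// ler_pdivrMr// mul1r.
by rewrite (le_trans (ler_norm C))// lerDl.
Qed.

Lemma pok_all (l : seq (R4 R)) : (forall p, p \in l -> R4up p) ->
  \forall n \near \oo, forall p, p \in l -> pok n p.
Proof.
elim: l => [|p l IH] hl; first by near=> n.
have := pok_near (hl p (mem_head _ _)).
have := IH (fun q ql => hl q (mem_behead (s := p :: l) ql)).
apply: filterS2 => n h1 h2 q; rewrite inE => /predU1P[->//|]; exact: h1.
Unshelve. all: by end_near. Qed.

Lemma adm_landscape n l (g : (R4 R -> R) -> R) (D : nat -> int * nat -> bool) (anti : bool) : blip l g ->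
  (forall p, p \in l -> pok n p) ->
  (forall p m c, p \in l -> lines (lo n p.1.2) (lo n p.2.2) m c -> D m c) ->
  (anti -> antitone g /\ forall u, 0 <= g u) ->
  adm anti D (fun W => g (landscape_n W n)).
Proof.
move=> bg hp hD ha; apply: (adm_comp (Phi := fun p W => landscape_n W n p) bg) => // p pl.
by apply: admF_sub (admF_landscape (hp p pl)) => m c; exact: hD.
Qed.

Lemma landscape_bmeas n l (g : (R4 R -> R) -> R) : blip l g ->
  (forall p, p \in l -> pok n p) -> bmeas (fun w => g (Ln n w)).
Proof.
move=> bg hp.
exact: (adm_bmeas gW (adm_landscape (D := fun _ _ => true) (anti := false) bg hp _ _)).
Qed.

Lemma limit_bmeas l (g : (R4 R -> R) -> R) : blip l g ->
  (forall p, p \in l -> R4up p) -> bmeas (fun w => g (L w)).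
Proof.
move=> [fg [B hB]] lu; split; last by exists B => w; exact: hB.
by apply: (flip_measurable fg) => p /lu; exact: mL.
Qed.

Lemma blip_limit l (g : (R4 R -> R) -> R) : blip l g -> (forall p, p \in l -> R4up p) ->
  Ev Q (fun w => g (Ln n w)) @[n --> \oo] --> Ev P (fun w => g (L w)).
Proof.
move=> bg lu; have [[K [K0 hK]] [B hB]] := bg.
have cK : compacts_R4up [set` l] by split; [apply: finite_compact; exact: finite_seq|move=> p /= /lu].
have := cvL (fam_continuous (C := K * (size l)%:R) cK _) (ex_intro _ B hB).
have hg f h e : 0 < e -> (forall p, [set` l] p -> `|f p - h p| <= e) ->
    `|g f - g h| <= K * (size l)%:R * e.
  move=> e0 fh; apply: le_trans (hK _ _) _; rewrite -mulrA ler_wpM2l//.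
  rewrite -sum1_size natr_sum mulr_suml big_seq [leRHS]big_seq.
  by apply: ler_sum => p pl; rewrite mul1r fh.
move=> /(_ hg); rewrite unlock -EvE; last exact: limit_bmeas bg lu.
move=> /fine_cvg/=; apply: cvg_trans; apply: near_eq_cvg.
by apply: filterS (pok_all lu) => n hp; rewrite /= -EvE//; exact: landscape_bmeas bg hp.
Qed.

Lemma limit_functional (K : set (R4 R)) (C B : R) (F : (R4 R -> R) -> R) :
  compacts_R4up K ->
  (forall f g e, 0 < e -> (forall p, K p -> `|f p - g p| <= e) -> `|F f - F g| <= C * e) ->
  (forall f, `|F f| <= B) ->
  (\int[Q]_w (F (Ln n w))%:E @[n --> \oo] --> \int[P]_w (F (L w))%:E)%E.
Proof.
move=> cK hF hB; have := cvL (fam_continuous cK hF) (ex_intro _ B hB).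
by rewrite unlock.
Qed.

Lemma limit_indep l1 l2 (g1 g2 : (R4 R -> R) -> R) t : blip l1 g1 -> blip l2 g2 ->
  (forall p, p \in l1 -> R4up p /\ p.2.2 <= t) ->
  (forall p, p \in l2 -> R4up p /\ t <= p.1.2) ->
  Ev P (fun w => g1 (L w) * g2 (L w)) = Ev P (fun w => g1 (L w)) * Ev P (fun w => g2 (L w)).
Proof.
move=> b1 b2 h1 h2.
have u1 p : p \in l1 -> R4up p by move=> /h1[].
have u2 p : p \in l2 -> R4up p by move=> /h2[].
have b12 : blip (l1 ++ l2) (fun f => g1 f * g2 f).
  by apply: blipM; [apply: blip_sub b1|apply: blip_sub b2] => x xl; rewrite mem_cat xl ?orbT.
have u12 p : p \in l1 ++ l2 -> R4up p by rewrite mem_cat => /orP[/u1|/u2].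
apply: (@cvg_unique _ (@norm_hausdorff _ _) _ _ _ _ (blip_limit b12 u12)).
apply: cvg_trans (cvgM (blip_limit b1 u1) (blip_limit b2 u2)); apply: near_eq_cvg.
near=> n => /=.
have hp1 : forall p, p \in l1 -> pok n p by near: n; exact: pok_all.
have hp2 : forall p, p \in l2 -> pok n p by near: n; exact: pok_all.
have a1 : adm false (fun _ c => c.1 <= lo n t) (fun W => g1 (landscape_n W n)).
  apply: (adm_landscape b1 hp1) => // p m c /h1[_ pt] /andP[_ h].
  by apply: le_trans h _; apply: le_floor; rewrite ler_wpM2l.
have a2 : adm false (fun _ c => lo n t < c.1) (fun W => g2 (landscape_n W n)).
  apply: (adm_landscape b2 hp2) => // p m c /h2[_ pt] /andP[h _].
  by apply: le_lt_trans h; apply: le_floor; rewrite ler_wpM2l.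
by rewrite (adm_prod gW a1 a2)// => m c h3; rewrite ltNge h3.
Unshelve. all: by end_near. Qed.

Lemma limit_fkg l1 l2 (g1 g2 : (R4 R -> R) -> R) : blip l1 g1 -> blip l2 g2 ->
  (forall p, p \in l1 -> R4up p) -> (forall p, p \in l2 -> R4up p) ->
  antitone g1 -> antitone g2 -> (forall u, 0 <= g1 u) -> (forall u, 0 <= g2 u) ->
  Ev P (fun w => g1 (L w)) * Ev P (fun w => g2 (L w)) <= Ev P (fun w => g1 (L w) * g2 (L w)).
Proof.
move=> b1 b2 u1 u2 a1 a2 p1 p2.
have b12 : blip (l1 ++ l2) (fun f => g1 f * g2 f).
  by apply: blipM; [apply: blip_sub b1|apply: blip_sub b2] => x xl; rewrite mem_cat xl ?orbT.
have u12 p : p \in l1 ++ l2 -> R4up p by rewrite mem_cat => /orP[/u1|/u2].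
apply: (ler_cvg_to (cvgM (blip_limit b1 u1) (blip_limit b2 u2)) (blip_limit b12 u12)).
near=> n.
have hp1 : forall p, p \in l1 -> pok n p by near: n; exact: pok_all.
have hp2 : forall p, p \in l2 -> pok n p by near: n; exact: pok_all.
have A1 : adm true (fun _ _ => true) (fun W => g1 (landscape_n W n)) by exact: adm_landscape b1 hp1 _ _.
have A2 : adm true (fun _ _ => true) (fun W => g2 (landscape_n W n)) by exact: adm_landscape b2 hp2 _ _.
exact: (adm_fkg gW A1 A2).
Unshelve. all: by end_near. Qed.

Lemma limit_affine l (g : (R4 R -> R) -> R) (zeta : R) m w (k : int) : blip l g ->
  (forall p, p \in l -> R4up p) -> 0 < zeta -> zeta ^+ 3 = m%:R ->
  Ev P (fun o => g (fun p => zeta^-1 * L o (tau zeta m w k p))) = Ev P (fun o => g (L o)).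
Proof.
move=> bg lu z0 zm.
have m0 : (0 < m)%N by rewrite -(ltr0n R) -zm exprn_gt0.
pose g' f := g (fun p => zeta^-1 * f (tau zeta m w k p)).
have bg' : blip (map (tau zeta m w k) l) g'.
  have [[K [K0 hK]] [B hB]] := bg; split; last by exists B => f; exact: hB.
  exists (K * zeta^-1); split; first by rewrite mulr_ge0// invr_ge0 ltW.
  move=> f h; apply: le_trans (hK _ _) _; rewrite big_map -mulrA ler_wpM2l// mulr_sumr.
  by apply: ler_sum => p _; rewrite -mulrBr normrM ger0_norm// invr_ge0 ltW.
have lu' p : p \in map (tau zeta m w k) l -> R4up p.
  by move=> /mapP[q /lu qu ->]; rewrite /R4up /= ltrD2r ltr_pM2l ?ltr0n.
apply: (@cvg_unique _ (@norm_hausdorff _ _) _ _ _ _ (blip_limit bg' lu')).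
have mn_oo : (fun n => (m * n)%N) @ \oo --> \oo.
  move=> A [N _ hN]; exists N => // n /= Nn; apply: hN => /=.
  by rewrite (leq_trans Nn)// leq_pmull.
have := cvg_comp _ _ mn_oo (blip_limit bg lu); apply: cvg_trans; apply: near_eq_cvg.
near=> n => /=.
have n0 : (0 < n)%N by near: n; exact: nbhs_infty_gt.
have hp : forall p, p \in l -> pok (m * n) p.
  by near: n; exact: (mn_oo _ (pok_all lu)).
have hp' : forall p, p \in map (tau zeta m w k) l -> pok n p by near: n; exact: pok_all.
have A : adm false (fun _ _ => true) (fun W => g (landscape_n W (m * n)%N)) by exact: adm_landscape bg hp _ _.
have mR0 : 0 < m%:R :> R by rewrite ltr0n.
have ka0 : 0 < (Num.sqrt m%:R)^-1 :> R by rewrite invr_gt0 sqrtr_gt0.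
have kal : (Num.sqrt m%:R)^-1 ^+ 2 * m%:R = 1 :> R.
  by rewrite exprVn sqr_sqrtr ?ltW// mulVf ?gt_eqF.
have gW' := genv_affine (n%:Z * k) (k%:~R + 2 * w / rt6 n ^+ 2) gW mR0 ka0 kal.
rewrite (adm_law gW gW' A); apply: eq_Ev => o; rewrite /g'.
have bgl : flip l g by case: bg.
apply: (flip_agree bgl) => p pl; rewrite /= (landscape_affine (W := fun j => W j o) (zeta := zeta))//.
- by move=> j; exact: (genv_cont gW).
- by apply: hp'; exact: map_f.
- exact: hp.
Unshelve. all: by end_near. Qed.

Lemma limit_shear (phi : R -> R) (K B t y : R) : 0 < t -> 0 <= K -> 0 <= B ->
  (forall a b, `|phi a - phi b| <= K * `|a - b|) ->
  (forall a, phi a = phi (Num.max (- B) (Num.min B a))) ->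
  Ev P (fun w => phi (L w ((0, 0), (y, t)))) = Ev P (fun w => phi (L w ((0, 0), (0, t)) - y ^+ 2 / t)).
Proof.
move=> t0 K0 B0 hphi phiB.
have bphi x : `|phi x| <= `|phi 0| + K * B.
  rewrite -[phi x](subrK (phi 0)) addrC (le_trans (ler_normD _ _))// lerD2l.
  rewrite phiB (le_trans (hphi _ _))// ler_wpM2l// subr0 ler_norml ge_max.
  by rewrite le_max lexx/= ge_min lexx/= andbT; lra.
have bl (p : R4 R) b : blip [:: p] (fun f => phi (f p + b)).
  apply: (blip_comp (phi := fun x => phi (x + b)) K0 _ (fun x => bphi _)); last exact: flip_eval.
  by move=> a a'; apply: le_trans (hphi _ _) _; rewrite opprD addrACA subrr addr0.
pose p1 : R4 R := ((0, 0), (y, t)); pose p2 : R4 R := ((0, 0), (0, t)).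
have u1 p : p \in [:: p1] -> R4up p by rewrite inE => /eqP ->.
have u2 p : p \in [:: p2] -> R4up p by rewrite inE => /eqP ->.
have c1 := blip_limit (bl p1 0) u1; have c2 := blip_limit (bl p2 (- (y ^+ 2 / t))) u2.
transitivity (Ev P (fun w => phi (L w p1 + 0))); first by apply: eq_Ev => w; rewrite addr0.
apply: (@cvg_unique _ (@norm_hausdorff _ _) _ _ _ _ c1).
apply/cvgrPdist_le => e e0.
have [c cE c0] : exists2 c, c = y ^+ 2 / t & 0 <= c.
  by eexists; first reflexivity; rewrite divr_ge0 ?sqr_ge0 ?ltW.
rewrite -cE in c2 *.
pose M := 2 * (B + 2 * c); have M0 : 0 <= M by rewrite mulr_ge0// addr_ge0// mulr_ge0.
pose D := K * (M + 3 * c) * 2 + 1.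
have D0 : 0 < D by rewrite ltr_wpDl// !mulr_ge0// addr_ge0// mulr_ge0.
pose dt := Num.min (1 / 8) (e / 2 / D).
have dt0 : 0 < dt by rewrite lt_min !divr_gt0.
have e20 : 0 < e / 2 by rewrite divr_gt0.
move/cvgrPdist_le : c2 => /(_ _ e20) c2.
near=> n.
have n0 : (0 < n)%N by near: n; exact: nbhs_infty_gt.
have r0 : 0 < rt6 n :> R by exact: rt6_gt0.
(* the shear multiplies W by sqrt (1 + 2 x), with x of order n^{-1/3} *)
have [x xE] : exists x, x = y / (t * rt6 n ^+ 2) by eexists.
have xdt : `|x| <= dt.
  have r1 : 1 <= rt6 n :> R by near: n; exact: rt6_ge_near.
  rewrite xE normrM normfV (gtr0_norm (mulr_gt0 t0 (exprn_gt0 2 r0))).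
  rewrite ler_pdivrMr ?mulr_gt0 ?exprn_gt0// mulrA -ler_pdivrMl ?mulr_gt0//.
  apply: (@le_trans _ _ (rt6 n)); last by rewrite expr2 ler_peMr// ltW.
  by near: n; exact: rt6_ge_near.
have x8 : `|x| <= 1 / 8 by rewrite (le_trans xdt)// ge_min lexx.
have x8' : - (1 / 8) <= x <= 1 / 8 by rewrite -ler_norml.
have x2 : 0 < 1 + 2 * x by move: x8' => /andP[? ?]; lra.
have [r rr0 rE] : exists2 r, 0 < r & r ^+ 2 = 1 + 2 * x.
  by exists (Num.sqrt (1 + 2 * x)); [rewrite sqrtr_gt0|rewrite sqr_sqrtr// ltW].
have r1E : (r - 1) * (r + 1) = 2 * x.
  by have -> : (r - 1) * (r + 1) = r ^+ 2 - 1 by [ring]; rewrite rE; ring.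
have r1x : `|r - 1| <= 2 * `|x|.
  have : `|r - 1| * `|r + 1| = 2 * `|x| by rewrite -normrM r1E normrM ger0_norm.
  have r10 : 0 <= r + 1 by rewrite addr_ge0// ltW.
  by rewrite (ger0_norm r10) => <-; rewrite ler_peMr// lerDr ltW.
have rh : `|r - 1| <= 1 / 2 by lra.
have /andP[rh1 rh2] : 1 / 2 <= r <= 3 / 2.
  by move: rh; rewrite ler_norml => /andP[? ?]; apply/andP; split; lra.
pose th := (2 / (r + 1)) ^+ 2.
have rp : r + 1 != 0 by rewrite gt_eqF// ltr_wpDl// ltW.
have th0 : 0 <= th by rewrite sqr_ge0.
have thr : th * (r + 1) ^+ 2 = 4 by rewrite /th; field.
have th2 : th <= 2.
  have : th * (9 / 4) <= th * (r + 1) ^+ 2 by rewrite ler_wpM2l//; nra.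
  rewrite thr => h.
  by lra.
have th1 : `|1 - th| <= 3 * `|r - 1|.
  have h : (1 - th) * (r + 1) ^+ 2 = (r - 1) * (r + 3) by rewrite mulrBl thr; ring.
  have r20 : 0 < (r + 1) ^+ 2 by rewrite exprn_gt0//; lra.
  rewrite -(ler_pM2r r20) -{1}(gtr0_norm r20) -normrM h normrM mulrAC mulrC ler_wpM2r//.
  by rewrite ger0_norm; nra.
have betaE : rt6 n * (2 * t * rt6 n ^+ 3 * (r - 1) - 2 * y * rt6 n) = - (c * th).
  have yE : y = x * t * rt6 n ^+ 2 by rewrite xE; field; rewrite !gt_eqF.
  have rx : r - 1 = 2 * x / (r + 1) by rewrite -r1E mulfK.
  rewrite cE /th rx {1 2}yE; have {}rE : x = (r ^+ 2 - 1) / 2 by rewrite rE; field.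
  by rewrite rE; field; rewrite rp gt_eqF.
have key a : `|phi (r * a + - (c * th) + 0) - phi (a + - c)| <= e / 2.
  have [aM|aM] := leP `|a| M.
    apply: le_trans (hphi _ _) _.
    have h1 : `|r * a + - (c * th) + 0 - (a + - c)| <= (M + 3 * c) * (2 * `|x|).
      rewrite (_ : _ - _ = (r - 1) * a + c * (1 - th)); last by ring.
      apply: le_trans (ler_normD _ _) _; rewrite !normrM (ger0_norm c0).
      apply: (@le_trans _ _ (`|r - 1| * M + c * (3 * `|r - 1|))).
        by apply: lerD; [rewrite ler_wpM2l|rewrite ler_wpM2l].
      rewrite [X in X <= _](_ : _ = (M + 3 * c) * `|r - 1|); last by ring.
      by rewrite ler_wpM2l// addr_ge0// mulr_ge0.
    apply: le_trans (ler_wpM2l K0 h1) _.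
    rewrite (_ : K * _ = (D - 1) * `|x|); last by rewrite /D; ring.
    apply: (@le_trans _ _ (D * dt)).
      apply: ler_pM => //; last by rewrite gerBl.
      by rewrite /D addrK !mulr_ge0// addr_ge0// mulr_ge0.
    by rewrite mulrC -ler_pdivlMr// ge_min lexx orbT.
  have cth : 0 <= c * th <= 2 * c.
    by rewrite mulr_ge0//= mulrC ler_wpM2r.
  move: cth => /andP[ct1 ct2].
  suff -> : phi (r * a + - (c * th) + 0) = phi (a + - c).
    by rewrite subrr normr0 divr_ge0// ltW.
  rewrite phiB [RHS]phiB; congr phi.
  move: aM; rewrite lter_normr => /orP[aM|aM].
    have ra : M / 2 <= r * a by rewrite /M in aM M0 *; nra.
    have h1 : B <= r * a + - (c * th) + 0 by rewrite /M in ra; lra.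
    have h2 : B <= a + - c by rewrite /M in aM; lra.
    by rewrite !(min_idPl _).
  have ra : r * a <= - (M / 2) by rewrite /M in aM M0 *; nra.
  have h1 : r * a + - (c * th) + 0 <= - B by rewrite /M in ra; lra.
  have h2 : a + - c <= - B by rewrite /M in aM; lra.
  by rewrite !(max_idPl _)// ge_min ?h1 ?h2 orbT.
have hp1 : forall p, p \in [:: p1] -> pok n p by near: n; exact: pok_all.
have hp2 : forall p, p \in [:: p2] -> pok n p by near: n; exact: pok_all.
have al0 : 0 < (r ^+ 2)^-1 by rewrite invr_gt0 exprn_gt0.
have kal : r ^+ 2 * (r ^+ 2)^-1 = 1 by rewrite divff// expf_neq0// gt_eqF.
have gW' := genv_affine 0 0 gW al0 rr0 kal.
have A : adm false (fun _ _ => true) (fun W => phi (landscape_n W n p1 + 0)).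
  exact: adm_landscape (bl p1 0) hp1 _ _.
have h1 : `|Ev P (fun w => phi (L w p2 + - c)) - Ev Q (fun w => phi (Ln n w p2 + - c))| <= e / 2.
  by near: n; exact: c2.
have h2 : `|Ev Q (fun w => phi (Ln n w p2 + - c)) - Ev Q (fun w => phi (Ln n w p1 + 0))| <= e / 2.
  rewrite (adm_law gW gW' A); apply: Ev_dist_le.
  - exact: landscape_bmeas (bl p2 (- c)) hp2.
  - exact: (adm_bmeas gW' A).
  move=> w; rewrite (landscape_shear (W := fun j => W j w)) ?betaE 1?distrC ?key//.
  - by move=> j; exact: (genv_cont gW).
  - by rewrite rE xE mulrA.
  - by apply: hp1; rewrite mem_head.
  - by apply: hp2; rewrite mem_head.
rewrite [leRHS]splitr -[X in `|X|](subrKA (Ev Q (fun w => phi (Ln n w p2 + - c)))).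
by rewrite (le_trans (ler_normD _ _))// lerD.
Unshelve. all: by end_near. Qed.

Lemma limit_triangle x y z : x.2 < y.2 -> y.2 < z.2 ->
  {ae P, forall w, L w (x, y) + L w (y, z) <= L w (x, z)}.
Proof.
move=> xy yz; pose g f := Num.max 0 (Num.min 1 (f (x, y) + f (y, z) - f (x, z))) : R.
pose l := [:: (x, y); (y, z); (x, z)].
have fl q : q \in l -> flip l (fun f : R4 R -> R => f q).
  by move=> ql; apply: flip_sub (flip_eval q) => q'; rewrite inE => /eqP ->.
have bg : blip l g.
  apply: (@blip_comp _ _ _ (fun a => Num.max 0 (Num.min 1 a)) _ 1 1) => //.
  - move=> a b; rewrite mul1r; apply: le_trans (distr_max _ _ _ _) _.
    rewrite subrr normr0 add0r; apply: le_trans (distr_min _ _ _ _) _.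
    by rewrite subrr normr0 add0r.
  - move=> a; rewrite ger0_norm ?le_max ?lexx// ge_max ler01/=.
    by rewrite ge_min lexx.
  apply: flipB; last by apply: fl; rewrite !inE eqxx !orbT.
  by apply: flipD; apply: fl; rewrite !inE eqxx ?orbT.
have lu p : p \in l -> R4up p.
  rewrite !inE => /or3P[] /eqP -> //; exact: lt_trans yz.
have Eg0 : Ev P (fun w => g (L w)) = 0.
  apply: (@cvg_unique _ (@norm_hausdorff _ _) _ _ _ _ (blip_limit bg lu)).
  apply: cvg_near_cst; near=> n.
  have hp : forall p, p \in l -> pok n p by near: n; exact: pok_all.
  rewrite -[RHS](Ev_cst Q 0); apply: eq_Ev => w; rewrite /g.
  have := @landscape_superadditive _ (fun j => W j w) n x y z (fun j => @genv_cont _ _ _ _ _ gW j w)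
    (hp _ (mem_head _ _)) (hp (y, z) _).
  rewrite !inE eqxx orbT => /(_ erefl) h.
  by apply/max_idPl; rewrite ge_min subr_le0 h orbT.
have [mg _] := limit_bmeas bg lu.
have g0 w : 0 <= g (L w) by rewrite /g le_max lexx.
have mEg : measurable_fun setT (fun w => (g (L w))%:E) by exact/measurable_EFinP.
have [h _] := ae_eq_integral_abs P measurableT mEg.
have /h : (\int[P]_w `|(g (L w))%:E| = 0)%E.
  rewrite (eq_integral (fun w => (g (L w))%:E)); last first.
    by move=> w _; rewrite gee0_abs// lee_fin.
  by rewrite -EvE ?Eg0//; exact: limit_bmeas bg lu.
apply: filterS => w /(_ I) [gw]; rewrite -subr_le0 leNgt; apply/negP => h1.
have : 0 < g (L w) by rewrite /g lt_max lt_min ltr01 h1 orbT.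
by rewrite gw ltxx.
Unshelve. all: by end_near. Qed.

End limit_landscape.

(** * Nondegeneracy of the limit *)

Section columns_of_increments.
Context {R : realType}.
Variables (h l : R).
Implicit Types (S ws : seq R) (F : seq R -> R) (xi u : int * nat -> R).

Fixpoint up (c : R) ws S : seq R :=
  match ws, S with
  | w :: ws', s :: S' => c :: up (Num.max (s + w) c) ws' S'
  | _, _ => [:: c]
  end.

Definition colstep (js : seq int) xi (k : nat) S : seq R :=
  match js, S with
  | j :: js', s :: S' => up (s + (l * h + xi (j, k))) [seq xi (j', k) | j' <- js'] S'
  | _, _ => [::]
  end.

Fixpoint run (js : seq int) (m k : nat) xi S : seq R :=
  if m is m'.+1 then run js m' k.+1 xi (colstep js xi k S) else S.

Fixpoint ccells (js : seq int) (k m : nat) : seq (int * nat) :=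
  if m is m'.+1 then [seq (j, k) | j <- js] ++ ccells js k.+1 m' else [::].

Lemma size_up c ws S : size ws = size S -> size (up c ws S) = (size S).+1.
Proof. by elim: ws S c => [|w ws IH] [|s S] c //= [/IH ->]. Qed.

Lemma size_colstep js xi k S : size js = size S -> size (colstep js xi k S) = size S.
Proof. by case: js S => [|j js] [|s S] //= [sj]; rewrite size_up// size_map. Qed.

Lemma mem_ccells js k m c : c \in ccells js k m -> (c.1 \in js) && (k <= c.2 < k + m)%N.
Proof.
elim: m k => [//|m IH] k; rewrite /= mem_cat => /orP[/mapP[j jj ->]|/IH/andP[-> /andP[h1 h2]]].
  by rewrite jj leqnn /= addnS ltnS leq_addr.
by rewrite (ltnW h1) addnS -addSn h2.
Qed.

Lemma ccells_uniq js k m : uniq js -> uniq (ccells js k m).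
Proof.
move=> uj; elim: m k => [//|m IH] k; rewrite /= cat_uniq IH map_inj_uniq ?uj//; last by move=> a b [].
rewrite andbT; apply/hasPn => c /mem_ccells/andP[_ /andP[kc _]]; apply/negP => /mapP[j _ cE].
by rewrite cE /= ltnn in kc.
Qed.

Lemma ccells_mem js k m j k' : j \in js -> (k <= k' < k + m)%N -> (j, k') \in ccells js k m.
Proof.
move=> jj; elim: m k => [|m IH] k; first by rewrite addn0 => /andP[a b]; have := leq_trans b a; rewrite ltnn.
rewrite leq_eqVlt mem_cat => /andP[/predU1P[->|kk] k'm]; first by rewrite map_f.
by rewrite IH ?orbT// kk addSn -addnS.
Qed.

Lemma Ex_lift_up (k : nat) l2 l0 (G : (int * nat -> R) -> R) : blip l0 G ->
  forall js S c F K B u, uniq js -> size js = size S -> slip (size S).+1 K B F ->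
  (forall v, (forall c', c' \notin [seq (j, k) | j <- js] -> v c' = u c') ->
    Ex (gauss h) l2 G v <= F (up c [seq v (j, k) | j <- js] S)) ->
  Ex (gauss h) ([seq (j, k) | j <- js] ++ l2) G u <= lift_up h c S F.
Proof.
move=> bG; elim=> [|j js IH] [|s S] c F K B u //=; first by move=> _ _ _; apply.
move=> /andP[jjs uj] [sz] sF hv; apply: Ev_le.
- exact: Ex_bmeas bG.
- exact: lift_up_cons_bmeas sF _.
move=> x; apply: IH => //; first exact: slip_cons sF.
move=> v hvu; have vx : v (j, k) = x.
  rewrite hvu ?/upd ?eqxx//; apply/negP => /mapP[j' j'js [jE]].
  by rewrite jE j'js in jjs.
rewrite -{1}vx; apply: hv => c'; rewrite inE negb_or => /andP[c1 c2].
by rewrite hvu// /upd (negPf c1).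
Qed.

Lemma Ex_run l0 (G : (int * nat -> R) -> R) js n F K B t : blip l0 G ->
  uniq js -> size js = n.+1 -> slip n.+1 K B F -> smono n.+1 F -> qcov n.+1 t F ->
  forall m k S u, size S = n.+1 ->
  (forall xi, (forall c, c \notin ccells js k m -> xi c = u c) -> G xi <= F (run js m k xi S)) ->
  Ex (gauss h) (ccells js k m) G u <= iter m (fun G S => column h l S G) F S.
Proof.
move=> bG uj sj sF mF qF; elim=> [|m IH] k S u sS hG.
  by apply: hG.
have [[K' sH] _ _] := iter_column_class h l m sF mF qF.
move: sj uj hG IH; case: js => [//|j js] [sj] /= /andP[jjs uj] hG IH.
case: S sS hG => [//|s S] [sS] hG /=; apply: Ev_le.
- exact: Ex_bmeas bG.
- exact: lift_up_start_bmeas sH _.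
move=> x; apply: (Ex_lift_up bG (K := K') (B := B)); rewrite ?sS//.
move=> v hv; apply: IH; first by rewrite size_up ?size_map ?sS// sj.
move=> xi hxi.
have xk j' : j' \in j :: js -> xi (j', k) = v (j', k).
  by move=> j'j; apply: hxi; apply/negP => /mem_ccells/andP[_]; rewrite /= ltnn.
have vx : v (j, k) = x.
  rewrite hv ?/upd ?eqxx//; apply/negP => /mapP[j' j'js [jE]].
  by rewrite jE j'js in jjs.
have -> : up (s + (l * h + x)) [seq v (j0, k) | j0 <- js] S = colstep (j :: js) xi k (s :: S).
  rewrite /= xk ?mem_head// vx; congr up; apply/eq_in_map => j' j'js.
  by rewrite xk// inE j'js orbT.
apply: hG => c; rewrite inE mem_cat !negb_or => /and3P[c1 c2 c3].
by rewrite hxi// hv// /upd (negPf c1).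
Qed.

Lemma runS js m k xi S : run js m.+1 k xi S = colstep js xi (k + m) (run js m k xi S).
Proof.
elim: m k S => [|m IH] k S; first by rewrite addn0.
by rewrite [LHS]/= -[run js m k.+2 _ _]/(run js m.+1 k.+1 xi (colstep js xi k S)) IH addSnnS.
Qed.

Lemma size_run js m k xi S : size js = size S -> size (run js m k xi S) = size S.
Proof.
elim: m k S => [//|m IH] k S sz /=; rewrite IH ?size_colstep//.
Qed.

Lemma up_ge ws S c : size ws = size S -> forall i,
  [/\ nth 0 (up c ws S) 0 = c,
   (i < size S)%N -> nth 0 S i + nth 0 ws i <= nth 0 (up c ws S) i.+1 &
   (i < size S)%N -> nth 0 (up c ws S) i <= nth 0 (up c ws S) i.+1].
Proof.
elim: ws S c => [|w ws IH] [|s S] c //= [sz] i; have := IH S (Num.max (s + w) c) sz.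
case: i => [|i] h1; have [a1 a2 a3] := h1 0%N.
  by split => //= _; rewrite a1 le_max lexx ?orbT.
by have [b1 b2 b3] := h1 i; split => //=; rewrite ltnS.
Qed.

(* the last height dominates the weight of every path that starts on the first
   line, the only one with a drift *)
Lemma run_ge n (js : seq int) k0 xi (ka : nat -> nat) m : size js = n.+1 ->
  (k0 <= ka 0%N)%N -> (forall i, (i < n)%N -> (ka i <= ka i.+1)%N) -> ka n = (k0 + m)%N ->
  \sum_(k0 <= k < ka 0%N) (l * h + xi (nth 0 js 0, k)) +
  \sum_(i < n) \sum_(ka i <= k < ka i.+1) xi (nth 0 js i.+1, k) <=
  last 0 (run js m k0 xi (nseq n.+1 0)).
Proof.
move=> sj ka0 kai kan.
pose H q i := nth 0 (run js q k0 xi (nseq n.+1 0)) i.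
have sr q : size (run js q k0 xi (nseq n.+1 0)) = n.+1 by rewrite size_run ?size_nseq.
have stepE q : exists s S j js', [/\ js = j :: js', run js q k0 xi (nseq n.+1 0) = s :: S,
    size S = n, size js' = n & run js q.+1 k0 xi (nseq n.+1 0) =
    up (s + (l * h + xi (j, (k0 + q)%N))) [seq xi (j', (k0 + q)%N) | j' <- js'] S].
  have := sr q; have := runS js q k0 xi (nseq n.+1 0).
  case: (run js q k0 xi (nseq n.+1 0)) => [//|s S] -> [sS].
  by case: js sj {sr H} => [//|j js'] [sj']; exists s, S, j, js'.
have H0 q : H q 0%N + (l * h + xi (nth 0 js 0, (k0 + q)%N)) <= H q.+1 0%N.
  have [s [S [j [js' [jE rE sS sj' uE]]]]] := stepE q.
  rewrite /H rE uE; have := @up_ge [seq xi (j', (k0 + q)%N) | j' <- js'] S (s + (l * h + xi (j, (k0 + q)%N))).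
  by rewrite size_map sj' sS => /(_ erefl 0%N)[-> _ _]; rewrite jE.
have Hi q i : (i < n)%N -> H q i.+1 + xi (nth 0 js i.+1, (k0 + q)%N) <= H q.+1 i.+1.
  move=> i_n; have [s [S [j [js' [jE rE sS sj' uE]]]]] := stepE q.
  rewrite /H rE uE; have := @up_ge [seq xi (j', (k0 + q)%N) | j' <- js'] S (s + (l * h + xi (j, (k0 + q)%N))).
  rewrite size_map sj' sS => /(_ erefl i)[_ /(_ i_n) + _].
  by rewrite (nth_map 0) ?sj'// jE.
have Hup q i : (i < n)%N -> H q i <= H q i.+1.
  case: q => [|q] i_n; first by rewrite /H !nth_nseq !ltnS i_n (ltnW i_n).
  have [s [S [j [js' [jE rE sS sj' uE]]]]] := stepE q.
  rewrite /H uE; have := @up_ge [seq xi (j', (k0 + q)%N) | j' <- js'] S (s + (l * h + xi (j, (k0 + q)%N))).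
  by rewrite size_map sj' sS => /(_ erefl i)[_ _ /(_ i_n)].
have Hrow i a b : (i < n)%N -> (k0 <= a <= b)%N ->
    H (a - k0)%N i.+1 + \sum_(a <= k < b) xi (nth 0 js i.+1, k) <= H (b - k0)%N i.+1.
  move=> i_n /andP[ka_ ab]; rewrite -(subnKC ab); elim: (b - a)%N => [|q IH].
    by rewrite addn0 big_geq// addr0.
  rewrite addnS big_nat_recr ?leq_addr//= addrA.
  have -> : ((a + q).+1 - k0)%N = (a + q - k0).+1 by rewrite subSn// (leq_trans ka_)// leq_addr.
  apply: le_trans (Hi _ i i_n); rewrite subnKC ?(leq_trans ka_) ?leq_addr//.
  by rewrite lerD2r.
have Hrow0 b : (k0 <= b)%N ->
    \sum_(k0 <= k < b) (l * h + xi (nth 0 js 0, k)) <= H (b - k0)%N 0%N.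
  move=> kb; rewrite -(subnKC kb); elim: (b - k0)%N => [|q IH].
    by rewrite addn0 big_geq// /H subnn.
  rewrite addnS big_nat_recr ?leq_addr//=.
  have -> : ((k0 + q).+1 - k0)%N = (k0 + q - k0).+1 by rewrite subSn// leq_addr.
  by apply: le_trans (H0 _); rewrite subnKC ?leq_addr// lerD2r.
have kage i : (i <= n)%N -> (k0 <= ka i)%N.
  by elim: i => [//|i IH] i_n; rewrite (leq_trans (IH (ltnW i_n)))// kai.
have claim i : (i <= n)%N -> \sum_(k0 <= k < ka 0%N) (l * h + xi (nth 0 js 0, k)) +
    \sum_(i' < i) \sum_(ka i' <= k < ka i'.+1) xi (nth 0 js i'.+1, k) <= H (ka i - k0)%N i.
  elim: i => [|i IH] i_n; first by rewrite big_ord0 addr0 Hrow0.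
  rewrite big_ord_recr/= addrA.
  apply: le_trans (Hrow i (ka i) (ka i.+1) i_n _); last by rewrite kage ?kai// ltnW.
  by rewrite lerD2r (le_trans (IH (ltnW i_n)))// Hup.
by have := claim n (leqnn n); rewrite kan addKn /H -nth_last sr.
Qed.

End columns_of_increments.

Section stationary_bound.
Context {R : realType}.

Lemma expR_ge2 (y : R) : 0 <= y -> 1 + y + y ^+ 2 / 2 <= expR y.
Proof.
move=> y0; rewrite /expR; apply: limr_ge; first exact: is_cvg_series_exp_coeff.
near=> k; rewrite /series /=.
have k3 : (3 <= k)%N by near: k; exact: nbhs_infty_ge.
rewrite (big_cat_nat (n := 3))//= -[leLHS]addr0; apply: lerD.
  by rewrite !big_nat_recr//= big_geq// /exp_coeff/= expr0 expr1 !divr1 add0r.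
by apply: sumr_ge0 => i _; rewrite /exp_coeff/= divr_ge0// exprn_ge0.
Unshelve. all: by end_near. Qed.

Lemma odds_le_exp (e : R) : 0 <= e <= 1 / 2 -> (1 + e) / (1 - e) <= expR (2 * e + 4 * e ^+ 3).
Proof.
move=> /andP[e0 e2]; have e1 : 0 < 1 - e by lra.
rewrite ler_pdivrMr//.
have y0 : 0 <= 2 * e + 4 * e ^+ 3 by rewrite addr_ge0// mulr_ge0// exprn_ge0.
apply: (@le_trans _ _ ((1 + (2 * e + 4 * e ^+ 3) + (2 * e + 4 * e ^+ 3) ^+ 2 / 2) * (1 - e))).
  have e3 : 0 <= e ^+ 3 by rewrite exprn_ge0.
  have e6 : 0 <= e ^+ 6 by rewrite exprn_ge0.
  have e4 : 0 <= e ^+ 4 by rewrite exprn_ge0.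
  rewrite -subr_ge0 [X in 0 <= X](_ : _ =
    2 * e ^+ 3 * (1 - 2 * e) + (8 * e ^+ 4 + 8 * e ^+ 6) * (1 - e)); last by field.
  have h1 : 0 <= 1 - 2 * e by lra.
  apply: addr_ge0; apply: mulr_ge0 => //.
  - by rewrite mulr_ge0.
  - by rewrite addr_ge0// mulr_ge0.
  - exact: ltW.
by apply: ler_wpM2r; [exact: ltW|exact: expR_ge2].
Qed.

Section truncated_exponential.
Variables (t C : R) (t0 : 0 <= t).
Definition texp (x : R) := expR (t * Num.min C x).

Lemma texp_ge0 x : 0 <= texp x. Proof. exact: expR_ge0. Qed.

Lemma texp_le x : texp x <= expR (t * C).
Proof. by rewrite ler_expR ler_wpM2l// ge_min lexx. Qed.

Lemma texp_mono x y : x <= y -> texp x <= texp y.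
Proof. by move=> xy; rewrite ler_expR ler_wpM2l// le_min !ge_min lexx xy orbT. Qed.

Lemma texp_lip x y : `|texp x - texp y| <= t * expR (t * C) * `|x - y|.
Proof.
wlog xy : x y / y <= x.
  move=> H; have [xy|xy] := leP y x; first exact: H.
  by rewrite distrC (distrC x); apply: H; exact: ltW.
rewrite !ger0_norm ?subr_ge0 ?texp_mono//.
have h : texp x * (1 - t * (x - y)) <= texp y.
  have mm : Num.min C x - (x - y) <= Num.min C y.
    rewrite le_min; have : Num.min C x <= C by rewrite ge_min lexx.
    have : Num.min C x <= x by rewrite ge_min lexx orbT.
    by move=> h1 h2; apply/andP; split; lra.
  apply: (@le_trans _ _ (texp x * expR (- (t * (x - y))))).
    by rewrite ler_wpM2l ?texp_ge0// expR_ge1Dx.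
  by rewrite -expRD ler_expR -mulrBr ler_wpM2l.
have := ler_wpM2r (mulr_ge0 t0 (_ : 0 <= x - y)) (texp_le x).
by rewrite subr_ge0 => /(_ xy); lra.
Qed.

Lemma texp_shift x a : 0 <= a -> texp (x + a) <= expR (t * a) * texp x.
Proof.
move=> a0; rewrite -expRD ler_expR -mulrDr ler_wpM2l// -lerBlDl le_min.
have : Num.min C (x + a) <= C by rewrite ge_min lexx.
have : Num.min C (x + a) <= x + a by rewrite ge_min lexx orbT.
by move=> h1 h2; apply/andP; split; lra.
Qed.

Lemma last_slip n : slip n.+1 (t * expR (t * C)) (expR (t * C)) (fun S => texp (last 0 S)).
Proof.
split=> [|S S' sS sS'|S _]; first by rewrite mulr_ge0// expR_ge0.
  apply: le_trans (texp_lip _ _) _; rewrite ler_wpM2l ?mulr_ge0 ?expR_ge0//.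
  have aux (s s' : seq R) x x' : size s = size s' ->
      `|last x s - last x' s'| <= `|x - x'| + sdist s s'.
    elim: s s' x x' => [|a s IH] [|a' s'] x x' //=; first by rewrite addr0.
    by move=> [ss]; apply: le_trans (IH _ _ _ ss) _; rewrite lerDr.
  have := aux S S' 0 0; rewrite subrr normr0 add0r; apply.
  by rewrite sS sS'.
by rewrite texp_ge0 texp_le.
Qed.

Lemma last_smono n : smono n.+1 (fun S => texp (last 0 S)).
Proof.
move=> S S' _ SS'; apply: texp_mono.
have aux s s' (x x' : R) : x <= x' -> all2 <=%R s s' -> last x s <= last x' s'.
  elim: s s' x x' => [|a s IH] [|a' s'] x x' //= _ /andP[aa' ss']; exact: IH.
exact: aux.
Qed.

Lemma last_qcov n : qcov n.+1 t (fun S => texp (last 0 S)).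
Proof.
move=> S x x0 sS; have -> : last 0 [seq y + x | y <- S] = last 0 S + x.
  case: S sS => [//|s S] _ /=; elim: S s => [//|a S IH] s /=; exact: IH.
exact: texp_shift.
Qed.

Lemma iter_column_flat (h l : R) n m : 0 < h -> 0 < l ->
  iter m (fun G S => column h l S G) (fun S => texp (last 0 S)) (nseq n.+1 0) <=
  ((l + t) / l) ^+ n * expR (m%:R * (t * l * h + t ^+ 2 * h / 2)).
Proof.
move=> h0 l0.
have [[K' sH] mH qH] := iter_column_class h l m (last_slip n) (@last_smono n) (@last_qcov n).
apply: le_trans (flat_start l0 0 t0 sH mH qH) _.
have c0 : 0 <= ((l + t) / l) ^+ n by rewrite exprn_ge0// divr_ge0 ?addr_ge0 ?(ltW l0).
rewrite ler_wpM2l//.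
apply: le_trans (gaps_iter_column h0 l0 m 0 t0 (last_slip n) (@last_smono n) (@last_qcov n) _) _.
  by move=> S _; rewrite ler_expR ler_wpM2l// ge_min lexx orbT.
by rewrite mulr0 expR0 mulr1 expRM_natl.
Qed.

End truncated_exponential.

Lemma idx_nat m k : idx m (k%:R : R) = ((k + m.+1) * m.+1)%N.
Proof. rewrite /idx -natrD -natrM -[X in Num.floor X]/((Posz ((k + m.+1) * m.+1)%N)%:~R).
by rewrite intrKfloor absz_nat. Qed.

Lemma max_cvg (f g : nat -> R) (a b : R) : f m @[m --> \oo] --> a -> g m @[m --> \oo] --> b ->
  Num.max (f m) (g m) @[m --> \oo] --> Num.max a b.
Proof.
move=> /cvgrPdist_le fa /cvgrPdist_le gb; apply/cvgrPdist_le => e e0.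
have e20 : 0 < e / 2 by rewrite divr_gt0.
near=> m; apply: le_trans (distr_max _ _ _ _) _; rewrite [leRHS]splitr; apply: lerD.
  by near: m; exact: fa.
by near: m; exact: gb.
Unshelve. all: by end_near. Qed.

Lemma tick_idx0 M : tick M (idx M (0 : R)) = 0 :> R.
Proof.
by rewrite (idx_nat M 0) add0n /tick natrM mulrA mulVf ?pnatr_eq0// mul1r addrC subrr.
Qed.

Lemma tick_cvg (s : R) : tick M (idx M s) @[M --> \oo] --> s.
Proof.
apply/cvgrPdist_le => e e0; near=> M.
have sm : - M.+1%:R <= s.
  rewrite lerNl (le_trans (ler_norm _))// normrN (@le_trans _ _ M%:R) ?ler_nat//.
  by near: M; exact: nbhs_infty_ger.
have /andP[h1 h2] := idxP sm; rewrite ger0_norm ?subr_ge0//.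
apply: (@le_trans _ _ M.+1%:R^-1); first by rewrite lerBlDl ltW.
rewrite invf_ple ?posrE//; apply: (@le_trans _ _ M%:R); last by rewrite ler_nat.
by near: M; exact: nbhs_infty_ger.
Unshelve. all: by end_near. Qed.

Definition burke_grid (l : R) n (s : R) M (xi : int * nat -> R) : R :=
  Num.max (gsup (gpath n (idx M (0 : R)) (idx M (1 : R))) 0 n xi)
    (gsup (gpath 1 (idx M (0 : R)) (idx M s)) (-1) 1 xi +
     l * (tick M (idx M s) - tick M (idx M (0 : R))) +
     gsup (gpath n (idx M s) (idx M (1 : R))) 0 n xi).

Lemma burke_grid_le (l : R) n s M xi : (0 < n)%N -> 0 <= s <= 1 ->
  burke_grid l n s M xi <=
  last 0 (run M.+1%:R^-1 l [seq i%:Z | i <- iota 0 n.+1] M.+1 (idx M (0 : R)) xi (nseq n.+1 0)).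
Proof.
move=> n0 /andP[s0 s1]; set js := [seq i%:Z | i <- iota 0 n.+1].
have sj : size js = n.+1 by rewrite size_map size_iota.
have jsE i : (i <= n)%N -> nth 0 js i = i%:Z.
  by move=> i_n; rewrite (nth_map 0%N) ?size_iota// nth_iota.
have i01 : idx M (1 : R) = (idx M (0 : R) + M.+1)%N.
  by rewrite (idx_nat M 1) (idx_nat M 0) mulnDl mul1n add0n addnC.
have m0 : - M.+1%:R <= 0 :> R by rewrite oppr_le0.
have k0s : (idx M (0 : R) <= idx M s)%N by exact: idx_mono.
have ks1 : (idx M s <= idx M (1 : R))%N by apply: idx_mono => //; exact: le_trans s0.
have k01 := leq_trans k0s ks1.
have path ka k1 : gpath n k1 (idx M (1 : R)) ka -> (idx M (0 : R) <= k1)%N ->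
    \sum_(idx M (0 : R) <= k < k1) (l * M.+1%:R^-1 + xi (0, k)) + gval 0 n ka xi <=
    last 0 (run M.+1%:R^-1 l js M.+1 (idx M (0 : R)) xi (nseq n.+1 0)).
  move=> [ka0 kan kai] k0k1.
  have := @run_ge R M.+1%:R^-1 l n js (idx M (0 : R)) xi ka M.+1 sj.
  rewrite ka0 kan => /(_ k0k1 kai i01); apply: le_trans; rewrite jsE// lerD2l /gval.
  by rewrite le_eqVlt; apply/orP; left; apply/eqP; apply: eq_bigr => i _; rewrite jsE// add0r.
rewrite /burke_grid ge_max; apply/andP; split.
  apply: ge_sup; first by eexists; eexists; [exact: gpath_ex|reflexivity].
  by move=> _ [ka hka <-]; have := path ka _ hka (leqnn _); rewrite big_geq// add0r.
rewrite -lerBrDl; apply: ge_sup; first by eexists; eexists; [exact: gpath_ex|reflexivity].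
move=> _ [ka hka <-]; rewrite lerBrDl -lerBrDr -lerBrDr; apply: ge_sup.
  by eexists; eexists; [exact: gpath_ex|reflexivity].
move=> _ [ka1 [a0 a1 _] <-]; rewrite lerBrDr lerBrDr; apply: le_trans (path ka _ hka k0s).
rewrite lerD2r big_split/= addrC; apply: lerD.
  by rewrite /gval big_ord_recl big_ord0 addr0 /= a0 a1.
rewrite sumr_const_nat /tick opprD addrACA subrr add0r -mulrBr -natrB// mulrA.
by rewrite mulr_natr.
Qed.

Lemma burke_grid_flip (l : R) n s M : (0 < n)%N -> 0 <= s <= 1 ->
  flip (ccells [seq i%:Z | i <- iota 0 n.+1] (idx M (0 : R)) M.+1) (burke_grid l n s M).
Proof.
move=> n0 /andP[s0 s1]; set js := [seq i%:Z | i <- iota 0 n.+1].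
have i01 : idx M (1 : R) = (idx M (0 : R) + M.+1)%N.
  by rewrite (idx_nat M 1) (idx_nat M 0) mulnDl mul1n add0n addnC.
have m0 : - M.+1%:R <= 0 :> R by rewrite oppr_le0.
have k0s : (idx M (0 : R) <= idx M s)%N by exact: idx_mono.
have ks1 : (idx M s <= idx M (1 : R))%N by apply: idx_mono => //; exact: le_trans s0.
have jmem i : (i <= n)%N -> (i%:Z : int) \in js.
  by move=> i_n; apply: map_f; rewrite mem_iota.
have fl a d k1 k2 : (0 < d)%N -> (k1 <= k2)%N -> (idx M (0 : R) <= k1)%N -> (k2 <= idx M (1 : R))%N ->
    (forall i, (i < d)%N -> a + i.+1%:Z \in js) ->
    flip (ccells js (idx M (0 : R)) M.+1) (gsup (gpath d k1 k2) a d).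
  move=> d0 k12 k01 k21 hj.
  apply: (@flip_sub _ _ (gcells (fun _ _ => true) a d k1 k2)).
    move=> c /mem_gcells[i [id' cE /andP[h1 h2] _]]; rewrite (surjective_pairing c) cE.
    by apply: ccells_mem; [exact: hj|rewrite (leq_trans k01)// -i01 (leq_trans h2)].
  by exists 1; apply: gsup_lipK => //; eexists; exact: gpath_ex.
have js1 i : (i < n)%N -> 0 + i.+1%:Z \in js by move=> i_n; rewrite add0r jmem.
apply: flip_max; first by apply: fl => //; exact: leq_trans ks1.
apply: flipD; last exact: fl.
apply: flipD; last exact: flip_cst.
by apply: fl => // -[|//] _; exact: jmem.
Qed.

Lemma burke_LPP {d : measure_display} {T : measurableType d} (Q : probability T R)
    (W : int -> T -> R -> R) n (l t C s : R) : genv Q W -> (0 < n)%N -> 0 < l -> 0 <= t ->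
  0 <= s <= 1 ->
  Ev Q (fun w => texp t C (Num.max (LPP (fun j => W j w) 0 n 0 1)
    (LPP (fun j => W j w) (-1) 1 0 s + l * s + LPP (fun j => W j w) 0 n s 1))) <=
  ((l + t) / l) ^+ n * expR (t * l + t ^+ 2 / 2).
Proof.
move=> gW n0 l0 t0 s01; have /andP[s0 s1] := s01.
have cW w j : continuous (W j w) by exact: (genv_cont gW).
pose G M xi := texp t C (burke_grid l n s M xi).
have bG M : blip (ccells [seq i%:Z | i <- iota 0 n.+1] (idx M (0 : R)) M.+1) (G M).
  apply: (blip_comp (B := expR (t * C)) _ (texp_lip C t0)) (burke_grid_flip l M n0 s01).
    by rewrite mulr_ge0// expR_ge0.
  by move=> x; rewrite ger0_norm ?texp_ge0// texp_le.
have [||w|_ _ cv] := @Ev_cvg _ _ _ Q (fun M w => G M (gin (fun j => W j w) M))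
    (fun w => texp t C (Num.max (LPP (fun j => W j w) 0 n 0 1)
    (LPP (fun j => W j w) (-1) 1 0 s + l * s + LPP (fun j => W j w) 0 n s 1))) (expR (t * C)).
- move=> M; have [fG _] := bG M; apply: (flip_measurable fG) => c _.
  exact: gin_measurable gW _ _.
- by move=> M w; rewrite ger0_norm ?texp_ge0// texp_le.
- have ct := lip_continuous (texp_lip C t0).
  apply: (continuous_cvg _ (ct _)).
  have c1 := gsup_LPP (a := 0) (cW w) n0 (ler01 : 0 <= 1 :> R).
  have c2 := gsup_LPP (a := -1) (cW w) (ltn0Sn 0) s0.
  have c3 := gsup_LPP (a := 0) (cW w) n0 s1.
  apply: max_cvg; first exact: c1.
  apply: cvgD; last exact: c3.
  apply: cvgD; first exact: c2.
  under eq_fun do rewrite tick_idx0 subr0.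
  by apply: cvgMr; exact: tick_cvg.
apply: (ler_cvg_to cv (cvg_cst _)); near=> M.
have h0 : 0 < M.+1%:R^-1 :> R by rewrite invr_gt0.
have uj : uniq [seq i%:Z | i <- iota 0 n.+1].
  by rewrite map_inj_uniq ?iota_uniq// => a b [].
have := @genv_law _ _ _ _ _ gW (- M.+1%:R) M.+1%:R^-1
  (ccells [seq i%:Z | i <- iota 0 n.+1] (idx M (0 : R)) M.+1) _ (G M) (fun=> 0) h0
  (ccells_uniq _ _ uj) (fun x xl => xl) (bG M).
move=> ->.
have sj : size [seq i%:Z | i <- iota 0 n.+1] = n.+1 by rewrite size_map size_iota.
have hG xi : (forall c, c \notin ccells [seq i%:Z | i <- iota 0 n.+1] (idx M (0 : R)) M.+1 -> xi c = 0) ->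
    G M xi <= texp t C (last 0 (run M.+1%:R^-1 l [seq i%:Z | i <- iota 0 n.+1] M.+1
      (idx M (0 : R)) xi (nseq n.+1 0))).
  by move=> _; apply: texp_mono => //; exact: burke_grid_le.
have sF := @last_slip t C t0 n; have mF := @last_smono t C t0 n.
have qF := @last_qcov t C t0 n.
have E := @Ex_run R M.+1%:R^-1 l _ (G M) _ n (fun S => texp t C (last 0 S)) _ _ t (bG M) uj sj
  sF mF qF M.+1 (idx M (0 : R)) (nseq n.+1 0) (fun=> 0) (size_nseq _ _) hG.
apply: le_trans E _.
apply: le_trans (iter_column_flat _ _ _ _ _ _) _ => //.
by rewrite (_ : M.+1%:R * _ = t * l + t ^+ 2 / 2)//; field; rewrite addrC natr1 pnatr_eq0.
Unshelve. all: by end_near. Qed.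

End stationary_bound.

Section ramp.
Context {R : realType}.
Definition ramp (x : R) : R := Num.max 0 (Num.min 1 x).

Lemma ramp_bd x : 0 <= ramp x <= 1.
Proof. by rewrite /ramp le_max lexx/= ge_max ler01/= ge_min lexx. Qed.

Lemma ramp_norm x : `|ramp x| <= 1.
Proof. by have /andP[h1 h2] := ramp_bd x; rewrite ger0_norm. Qed.

Lemma ramp_lip x y : `|ramp x - ramp y| <= `|x - y|.
Proof.
apply: le_trans (distr_max _ _ _ _) _; rewrite subrr normr0 add0r.
by apply: le_trans (distr_min _ _ _ _) _; rewrite subrr normr0 add0r.
Qed.

Lemma ramp1 x : 1 <= x -> ramp x = 1.
Proof. by move=> x1; rewrite /ramp (min_idPl x1); apply/max_idPr. Qed.

Lemma ramp0 x : x <= 0 -> ramp x = 0.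
Proof. by move=> x0; apply/max_idPl; rewrite ge_min x0 orbT. Qed.

Lemma ramp_mono x y : x <= y -> ramp x <= ramp y.
Proof.
move=> xy; rewrite /ramp ge_max le_max lexx/= le_max orbC; apply/orP; left.
by rewrite le_min !ge_min lexx xy orbT.
Qed.

Lemma ramp_affine_lip (a b x y : R) : `|ramp (a * x + b) - ramp (a * y + b)| <= `|a| * `|x - y|.
Proof.
by apply: le_trans (ramp_lip _ _) _; rewrite opprD addrACA subrr addr0 -mulrBr normrM.
Qed.

Lemma ramp_clamp (a b x : R) : 0 < a -> exists2 B, 0 <= B & forall x,
  ramp (a * x + b) = ramp (a * Num.max (- B) (Num.min B x) + b).
Proof.
move=> a0; exists ((1 + `|b|) / a) => [|{}x]; first by rewrite divr_ge0 ?ltW// addr_ge0.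
have bb : `|b| <= `|b| by []; move: bb; rewrite {1}ler_norml => /andP[b1 b2].
have aB : a * ((1 + `|b|) / a) = 1 + `|b| by rewrite mulrC divfK// gt_eqF.
have B0 : 0 <= (1 + `|b|) / a by rewrite divr_ge0 ?ltW// addr_ge0.
have [h1|h1] := leP ((1 + `|b|) / a) x.
  rewrite (max_idPr _); last by rewrite (le_trans _ B0)// oppr_le0.
  have ax : 1 + `|b| <= a * x by rewrite -aB ler_pM2l.
  by rewrite aB !ramp1//; lra.
have [h2|h2] := leP (- ((1 + `|b|) / a)) x; first by [].
have : a * x <= a * (- ((1 + `|b|) / a)) by rewrite ler_pM2l// ltW.
by rewrite mulrN aB => ax; rewrite !ramp0//; lra.
Qed.

End ramp.

Section expectation_ae.
Context {R : realType} {d : measure_display} {T : measurableType d} (P : probability T R).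

Lemma Ev_ae (X Y : T -> R) : bmeas X -> bmeas Y -> {ae P, forall w, X w = Y w} ->
  Ev P X = Ev P Y.
Proof.
move=> bX bY XY; apply: EFin_inj; rewrite !EvE//; apply: ae_eq_integral => //.
- by apply/measurable_EFinP; case: bX.
- by apply/measurable_EFinP; case: bY.
- by apply: filterS XY => w -> _.
Qed.

End expectation_ae.

Section gaussian_tail.
Context {R : realType}.

Lemma gauss_ramp_gt0 : 0 < Ev (gauss (1 : R)) (fun x => ramp (x - 3)).
Proof.
have bm : bmeas (fun x : R => ramp (x - 3)).
  split; last by exists 1 => x; exact: ramp_norm.
  apply: continuous_measurable_fun; apply: (@lip_continuous _ _ 1) => x y.
  by rewrite mul1r; have := ramp_affine_lip 1 (- 3) x y; rewrite normr1 !mul1r.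
rewrite -lte_fin Ev_gauss//; last by move=> x; have /andP[] := ramp_bd (x - 3).
have cpdf : {within `[4, 5], continuous (normal_pdf 0 (Num.sqrt (1 : R)))}.
  by apply: continuous_subspaceT => x; apply: continuous_normal_pdf; rewrite sqrtr1 oner_eq0.
have le45 : 4 <= 5 :> R by rewrite ler_nat.
have [c _ hc] := EVT_min le45 cpdf.
have c0 : 0 < normal_pdf 0 (Num.sqrt (1 : R)) c.
  rewrite normal_pdfE ?sqrtr1 ?oner_eq0// mulr_gt0 ?normal_peak_gt0 ?oner_eq0//.
  by rewrite /normal_fun expR_gt0.
apply: lt_le_trans (_ : \int[lebesgue_measure]_x (normal_pdf 0 (Num.sqrt 1) c * \1_(`[4, 5]%classic) x)%:E <= _)%E.
  under eq_integral do rewrite EFinM.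
  rewrite integralZl//; last exact: integrable_indic_itv.
  rewrite integral_indic//= setIT [X in (_ * X)%E](_ : _ = (1 : R)%:E).
    by rewrite mule1 lte_fin.
  apply: etrans (lebesgue_measure_itv _) _ => /=.
  by rewrite lte_fin ltr_nat/= -EFinD; congr EFin; lra.
apply: ge0_le_integral => //.
- by move=> x _; rewrite lee_fin mulr_ge0// ltW.
- by apply/measurable_EFinP; apply: measurable_funM.
- apply/measurable_EFinP; apply: measurable_funM; first by case: bm.
  exact: measurable_normal_pdf.
move=> x _; rewrite lee_fin indicE; case: (boolP (x \in _)) => [|_].
  rewrite inE/= in_itv/= mulr1 => /andP[x4 x5].
  by rewrite ramp1 ?mul1r ?hc ?in_itv/= ?x4//; lra.
by rewrite mulr0 mulr_ge0 ?normal_pdf_ge0//; have /andP[] := ramp_bd (x - 3).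
Qed.

End gaussian_tail.

Section nondegeneracy.
Context {R : realType} {d' : measure_display} {T' : measurableType d'} (Q : probability T' R)
  (W : int -> T' -> R -> R) {d : measure_display} {T : measurableType d} (P : probability T R)
  (L : T -> R4 R -> R).
Hypothesis gW : genv Q W.
Hypothesis cvL : cvg_in_distribution Q (fun n w => landscape_n (fun j => W j w) n) P L.
Hypothesis mL : forall p, R4up p -> measurable_fun setT (fun w => L w p).
Let Ln n w := landscape_n (fun j => W j w) n.
Let p01 : R4 R := ((0, 0), (0, 1)).
Let ph1 : R4 R := ((1 / 2, 0), (0, 1)).

Lemma LPP1 (V : int -> R -> R) a u v : (forall j, continuous (V j)) -> u <= v ->
  LPP V a 1 u v = V (a + 1) v - V (a + 1) u.
Proof.
move=> cV uv; apply/eqP; rewrite eq_le; apply/andP; split.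
  by apply: LPP_le => // z [z0 z1 _]; rewrite /lppn big_ord_recl big_ord0 addr0 /= z0 z1.
have := LPP_ge a cV (npath_ex (ltn0Sn 0) uv).
by rewrite /lppn big_ord_recl big_ord0 addr0.
Qed.

Definition tail0 : R := Ev Q (fun w => ramp (LPP (fun j => W j w) (-1) 1 0 1 - 3)).

Let cW w j : continuous (W j w). Proof. exact: (genv_cont gW). Qed.

Lemma tail0_gt0 : 0 < tail0.
Proof.
rewrite (_ : tail0 = Ev (gauss (1 : R)) (fun x => ramp (x - 3))); first exact: gauss_ramp_gt0.
pose G (xi : int * nat -> R) := ramp (xi (0, 0%N) - 3).
have bG : blip [:: (0 : int, 0%N)] G.
  apply: (@blip_comp _ _ _ (fun x => ramp (x - 3)) _ 1 1) => //.
  - by move=> x y; have := ramp_affine_lip 1 (- 3) x y; rewrite !mul1r normr1 mul1r.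
  - by move=> x; exact: ramp_norm.
  - exact: flip_eval.
have := @genv_law _ _ _ _ _ gW 0 1 [:: (0 : int, 0%N)] _ G (fun=> 0) ltr01 erefl (fun x xl => xl) bG.
rewrite /= => <-; apply: eq_Ev => w.
rewrite (LPP1 (-1) (@cW w) ler01) /G /incr /= addNr.
by congr (ramp (W 0 w _ - W 0 w _ - _)); ring.
Qed.

Lemma adm_tail (r s : R) : 0 <= r -> 0 <= s ->
  adm false (fun _ c => c.1 == 0) (fun V => ramp (r * LPP V (-1) 1 0 s - 3)).
Proof.
move=> r0 s0; have a := admF_affine (- 3) r0 (admF_LPP (-1) (ltn0Sn 0) s0).
have := @adm_comp _ unit (fun _ c => c.1 == 0) false [:: tt] (fun f => ramp (f tt))
  (fun _ V => r * LPP V (-1) 1 0 s + - 3).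
apply => //.
- apply: (@blip_comp _ _ _ ramp _ 1 1) => //.
  + by move=> x y; rewrite mul1r; exact: ramp_lip.
  + by move=> x; exact: ramp_norm.
  + exact: flip_eval.
- move=> p _; apply: admF_sub a => m c /andP[/andP[h1 h2] _]; lia.
Qed.

Lemma tail_law n : (0 < n)%N ->
  Ev Q (fun w => ramp (rt6 n * LPP (fun j => W j w) (-1) 1 0 (rt6 n ^+ 2)^-1 - 3)) = tail0.
Proof.
move=> n0; have r0 : 0 < rt6 n :> R by exact: rt6_gt0.
have al0 : 0 < (rt6 n ^+ 2)^-1 :> R by rewrite invr_gt0 exprn_gt0.
have kal : rt6 n ^+ 2 * (rt6 n ^+ 2)^-1 = 1 :> R by rewrite divff// expf_neq0// gt_eqF.
have gW' := genv_affine 0 0 gW al0 r0 kal.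
have a1 := adm_tail (ler01 : 0 <= 1 :> R) (ler01 : 0 <= 1 :> R).
transitivity (Ev Q (fun w => ramp (1 * LPP (fun j => W j w) (-1) 1 0 1 - 3))); last first.
  by apply: eq_Ev => w; rewrite mul1r.
rewrite (adm_law gW gW' a1); apply: eq_Ev => w.
by rewrite (LPP_affine (W := fun j => W j w))// addr0 mulr0 addr0 mulr1 addr0 mul1r.
Qed.

Lemma burke_landscape n (th dt : R) : (0 < n)%N -> 1 <= rt6 n :> R -> pok n p01 -> pok n ph1 ->
  0 < th <= 1 -> 0 < dt <= 1 ->
  (1 - th * dt) * Ev Q (fun w => ramp (dt^-1 * Ln n w p01 + 1)) +
  th * tail0 * (Ev Q (fun w => ramp (dt^-1 * Ln n w p01 + 1)) +
    Ev Q (fun w => ramp (dt^-1 * Ln n w ph1 + (1 + dt^-1 / 4))) - 1) <= expR (th ^+ 3 / 2).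
Proof.
move=> n0 r1 o01 oh1 /andP[th0 th1] /andP[dt0 dt1].
have r0 : 0 < rt6 n :> R by exact: rt6_gt0.
set r : R := rt6 n in r0 r1 *.
pose l : R := r ^+ 3 - th * r / 2; pose t : R := th * r.
pose s : R := (r ^+ 2)^-1.
have t0 : 0 <= t by rewrite mulr_ge0// ltW.
have e12 : 0 <= th / (2 * r ^+ 2) <= 1 / 2.
  have rr : 1 <= r ^+ 2 by rewrite expr_ge1// ltW.
  rewrite divr_ge0 ?mulr_ge0 ?(ltW th0) ?exprn_ge0 ?(ltW r0)//=.
  rewrite ler_pdivrMr ?mulr_gt0 ?exprn_gt0// mulrA divfK// mul1r.
  exact: le_trans rr.
pose e : R := th / (2 * r ^+ 2).
have lE : l = r ^+ 3 * (1 - e) by rewrite /l /e; field; rewrite gt_eqF.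
have ltE : l + t = r ^+ 3 * (1 + e) by rewrite /l /e /t; field; rewrite gt_eqF.
have e1 : 0 < 1 - e by case/andP: e12 => _; rewrite -/e; lra.
have l0 : 0 < l by rewrite lE mulr_gt0// exprn_gt0.
have s01 : 0 <= s <= 1.
  by rewrite invr_ge0 exprn_ge0 ?(ltW r0)//= invf_le1 ?exprn_gt0// expr_ge1// ltW.
have /andP[s0 s1] := s01.
pose C : R := (1 + 2 * r ^+ 4) / r.
pose A w := LPP (fun j => W j w) (-1) 1 0 s.
pose M w := Num.max (LPP (fun j => W j w) 0 n 0 1) (A w + l * s + LPP (fun j => W j w) 0 n s 1).
have lo0 : lo n (0 : R) = 0 by rewrite /lo mulr0 floor0.
have lo1 : lo n (1 : R) = n%:Z.
  by rewrite /lo mulr1 -[X in Num.floor X]/((Posz n)%:~R) intrKfloor.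
have dE p : p.1.2 = 0 -> p.2.2 = 1 -> dl n (p : R4 R) = n.
  by rewrite /dl => -> ->; rewrite lo0 lo1 subr0 absz_nat.
have XE w : Ln n w p01 = r * LPP (fun j => W j w) 0 n 0 1 - 2 * r ^+ 4.
  rewrite /Ln landscape_nE/= lo0 ?lo1// dE// /cx/= !mulr0 !mul0r !addr0 -/r.
  by ring.
have LE w : Ln n w ph1 = r * LPP (fun j => W j w) 0 n s 1 - 2 * r ^+ 4 + r ^+ 2.
  rewrite /Ln landscape_nE/= lo0 ?lo1// dE// /cx/= -/r.
  rewrite (_ : 0 + 2 * (1 / 2) / r ^+ 2 = s); last by rewrite /s; field; rewrite gt_eqF.
  by rewrite mulr0 mul0r addr0; field.
have YE w : expR (- (2 * t * r ^+ 3)) * texp t C (M w) =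
    expR (th * Num.min 1 (Num.max (Ln n w p01) ((r * A w - th / 2) + Ln n w ph1))).
  rewrite /texp -expRD; congr expR.
  have rM : Num.max (Ln n w p01) ((r * A w - th / 2) + Ln n w ph1) = r * M w - 2 * r ^+ 4.
    rewrite /M maxr_pMr ?ltW// addr_maxl XE LE; congr Num.max.
    by rewrite /l /s; field; rewrite gt_eqF.
  have rC : 1 = r * C - 2 * r ^+ 4 by rewrite /C; field; rewrite gt_eqF.
  have mE : Num.min 1 (r * M w - 2 * r ^+ 4) = r * Num.min C (M w) - 2 * r ^+ 4.
    by rewrite {1}rC -addr_minl -minr_pMr ?ltW.
  rewrite rM mE /t; ring.
have bM : bmeas (fun w => texp t C (M w)).
  pose F i (V : int -> R -> R) := if i == 0%N then LPP V 0 n 0 1 else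
    if i == 1%N then LPP V (-1) 1 0 s else LPP V 0 n s 1.
  pose g (f : nat -> R) := texp t C (Num.max (f 0%N) (f 1%N + l * s + f 2%N)).
  have ag : adm false (fun _ _ => true) (fun V => g (fun i => F i V)).
    apply: (@adm_comp _ _ _ _ [:: 0%N; 1%N; 2%N] g F) => //.
      apply: (blip_comp (B := expR (t * C)) _ (texp_lip C t0)).
      - by rewrite mulr_ge0// expR_ge0.
      - by move=> x; rewrite ger0_norm ?texp_ge0// texp_le.
      have fe i : i \in [:: 0%N; 1%N; 2%N] -> flip [:: 0%N; 1%N; 2%N] (fun f : nat -> R => f i).
        by move=> il; apply: flip_sub (flip_eval i) => j; rewrite inE => /eqP ->.
      apply: flip_max; first exact: fe.
      by apply: flipD; [apply: flipD; [exact: fe|exact: flip_cst]|exact: fe].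
    move=> i; rewrite !inE => /or3P[] /eqP ->; rewrite /F /=.
    - by apply: admF_sub (admF_LPP 0 n0 ler01).
    - by apply: admF_sub (admF_LPP (-1) (ltn0Sn 0) s0).
    - by apply: admF_sub (admF_LPP 0 n0 s1).
  exact: (adm_bmeas gW ag).
have bound : Ev Q (fun w => expR (- (2 * t * r ^+ 3)) * texp t C (M w)) <= expR (th ^+ 3 / 2).
  rewrite EvZ//; apply: le_trans (ler_wpM2l (expR_ge0 _) (burke_LPP C gW n0 l0 t0 s01)) _.
  have odds : ((l + t) / l) ^+ n <= expR (n%:R * (2 * e + 4 * e ^+ 3)).
    have -> : (l + t) / l = (1 + e) / (1 - e).
      by rewrite ltE lE; field; rewrite !gt_eqF.
    rewrite expRM_natl; apply: lerXn2r; rewrite ?nnegrE ?expR_ge0 ?odds_le_exp//.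
    by rewrite divr_ge0 ?(ltW e1)// addr_ge0//; case/andP: e12.
  rewrite mulrA mulrAC; apply: le_trans (ler_wpM2l _ odds) _; first by rewrite mulr_ge0 ?expR_ge0.
  rewrite -!expRD ler_expR -(rt6X n) -/r le_eqVlt; apply/orP; left; apply/eqP.
  by rewrite /t /l /e; field; rewrite gt_eqF.
pose fX w := ramp (dt^-1 * Ln n w p01 + 1).
pose fL w := ramp (dt^-1 * Ln n w ph1 + (1 + dt^-1 / 4)).
pose fA w := ramp (r * A w - 3).
have admX (p : R4 R) b : pok n p -> p.1.2 = 0 -> p.2.2 = 1 ->
    adm false (fun _ c => 0 < c.1) (fun V => ramp (dt^-1 * landscape_n V n p + b)).
  move=> op p0 p1; apply: (adm_landscape (l := [:: p]) (g := fun f => ramp (dt^-1 * f p + b))) => //.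
  - apply: (@blip_comp _ _ _ (fun x => ramp (dt^-1 * x + b)) _ `|dt^-1| 1) => //.
    + by move=> x y; exact: ramp_affine_lip.
    + by move=> x; exact: ramp_norm.
    + exact: flip_eval.
  - by move=> q; rewrite inE => /eqP ->.
  - by move=> q m c; rewrite inE => /eqP ->; rewrite p0 lo0 => /andP[].
have aX := admX p01 1 o01 erefl erefl.
have aL := admX ph1 (1 + dt^-1 / 4) oh1 erefl erefl.
have aA := adm_tail (ltW r0) s0.
have bX : bmeas fX := adm_bmeas gW aX.
have bL : bmeas fL := adm_bmeas gW aL.
have bA : bmeas fA := adm_bmeas gW aA.
have dis (m : nat) (c : int * nat) : c.1 == 0 -> 0 < c.1 -> False by move=> /eqP ->; rewrite ltxx.
have EAX : Ev Q (fun w => fA w * fX w) = tail0 * Ev Q fX.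
  by rewrite (adm_prod gW aA aX dis) tail_law.
have EAL : Ev Q (fun w => fA w * fL w) = tail0 * Ev Q fL.
  by rewrite (adm_prod gW aA aL dis) tail_law.
have EA : Ev Q fA = tail0 by rewrite -(tail_law n0).
apply: le_trans _ bound.
rewrite -/(Ev Q fX) -/(Ev Q fL).
have -> : (1 - th * dt) * Ev Q fX + th * tail0 * (Ev Q fX + Ev Q fL - 1) =
  Ev Q (fun w => (1 - th * dt) * fX w + th * (fA w * fX w + fA w * fL w - fA w)).
  rewrite EvD ?EvZ ?EvB ?EvD ?EAX ?EAL ?EA//; first ring.
  all: rewrite ?/fX; repeat (first [apply: bmeasZ|apply: bmeasB|apply: bmeasD|apply: bmeasM|exact: bX|exact: bL|exact: bA]).
apply: Ev_le.
- repeat (first [apply: bmeasZ|apply: bmeasB|apply: bmeasD|apply: bmeasM|exact: bX|exact: bL|exact: bA]).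
- exact: bmeasZ.
move=> w; rewrite YE.
have /andP[x0 x1] := ramp_bd (dt^-1 * Ln n w p01 + 1); rewrite -/(fX w) in x0 x1.
have /andP[y0 y1] := ramp_bd (dt^-1 * Ln n w ph1 + (1 + dt^-1 / 4)); rewrite -/(fL w) in y0 y1.
have /andP[a0 a1] := ramp_bd (r * A w - 3); rewrite -/(fA w) in a0 a1.
apply: (@le_trans _ _ ((1 - th * dt) * fX w + th * (fA w * (fX w * fL w)))).
  rewrite lerD2l ler_wpM2l ?(ltW th0)// -mulrDr -[X in _ - X]mulr1 -mulrBr ler_wpM2l//.
  rewrite -subr_ge0 [X in 0 <= X](_ : _ = (1 - fX w) * (1 - fL w)); last by rewrite /fX /fL; ring.
  by rewrite mulr_ge0 ?subr_ge0.
have thdt : 0 <= 1 - th * dt by rewrite subr_ge0 mulr_ile1// ltW.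
have [X0|X0] := leP (Ln n w p01) (- dt).
  rewrite {1}/fX {1}/fX ramp0; last first.
    by rewrite -lerBrDr sub0r mulrC ler_pdivrMr// mulN1r.
  by rewrite mulr0 mul0r mulr0 mulr0 addr0 expR_ge0.
have Ymin : th * - dt <= th * Num.min 1 (Num.max (Ln n w p01) ((r * A w - th / 2) + Ln n w ph1)).
  rewrite ler_wpM2l ?(ltW th0)// le_min le_max (ltW X0) orTb andbT.
  by rewrite (@le_trans _ _ 0)// oppr_le0 ltW.
have base : 1 - th * dt <= expR (th * Num.min 1 (Num.max (Ln n w p01) ((r * A w - th / 2) + Ln n w ph1))).
  apply: (@le_trans _ _ (expR (th * - dt))); first by rewrite -mulrN expR_ge1Dx.
  by rewrite ler_expR.
have [A0|A0] := leP (r * A w) 3.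
  rewrite (_ : fA w = 0) ?mul0r ?mulr0 ?addr0; last by apply: ramp0; rewrite subr_le0.
  by apply: le_trans base; rewrite ler_piMr.
have [L0|L0] := leP (Ln n w ph1) (- (1 / 4) - dt).
  rewrite (_ : fL w = 0) ?mulr0 ?addr0; last first.
    apply: ramp0; rewrite (_ : _ + _ = dt^-1 * (Ln n w ph1 + 1 / 4 + dt)).
      by rewrite pmulr_rle0 ?invr_gt0//; lra.
    by field; rewrite gt_eqF.
  by apply: le_trans base; rewrite ler_piMr.
rewrite (_ : Num.min 1 _ = 1); last first.
  by apply/min_idPl; rewrite le_max; apply/orP; right; lra.
rewrite mulr1; apply: le_trans (expR_ge1Dx th) => //.
apply: lerD; first by rewrite mulr_ile1// gerBl mulr_ge0// ltW.
by rewrite ler_piMr ?(ltW th0)// mulr_ile1 ?mulr_ge0// mulr_ile1.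
Qed.

Lemma Ev_ramp_ae1 (p : R4 R) (a b : R) : R4up p -> {ae P, forall w, 1 <= a * L w p + b} ->
  Ev P (fun w => ramp (a * L w p + b)) = 1.
Proof.
move=> pu h; rewrite -[RHS](Ev_cst P 1); apply: Ev_ae => //.
  have bg : blip [:: p] (fun f : R4 R -> R => ramp (a * f p + b)).
    apply: (@blip_comp _ _ _ (fun x => ramp (a * x + b)) _ `|a| 1) => //.
    + by move=> x y; exact: ramp_affine_lip.
    + by move=> x; exact: ramp_norm.
    + exact: flip_eval.
  by apply: (limit_bmeas mL bg) => q; rewrite inE => /eqP ->.
by apply: filterS h => w; exact: ramp1.
Qed.

Lemma blip_ramp (p : R4 R) (a b : R) : blip [:: p] (fun f : R4 R -> R => ramp (a * f p + b)).
Proof.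
apply: (@blip_comp _ _ _ (fun x => ramp (a * x + b)) _ `|a| 1) => //.
- by move=> x y; exact: ramp_affine_lip.
- by move=> x; exact: ramp_norm.
- exact: flip_eval.
Qed.

Lemma ramp_shear (a b x y t : R) : 0 < t -> 0 < a ->
  Ev P (fun w => ramp (a * L w ((x, 0), (x + y, t)) + b)) =
  Ev P (fun w => ramp (a * (L w ((0, 0), (0, t)) - y ^+ 2 / t) + b)).
Proof.
move=> t0 a0; have [B B0 hB] := ramp_clamp b 0 a0.
have lu p : p \in [:: ((0, 0), (y, t)) : R4 R] -> R4up p by rewrite inE => /eqP ->.
have := limit_affine gW cvL mL (m := 1) x 0 (blip_ramp ((0, 0), (y, t)) a b) lu ltr01 (expr1n _ _).
rewrite -(limit_shear gW cvL mL y t0 (normr_ge0 a) B0 (ramp_affine_lip a b) hB) => <-.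
have -> : tau 1 1 x 0 ((0, 0), (y, t)) = ((x, 0), (x + y, t)).
  by rewrite /tau /= !expr1n !mul1r !addr0 add0r (addrC y).
by apply: eq_Ev => w; rewrite invr1 mul1r.
Qed.

Lemma not_ae_ge0 : ~ {ae P, forall w, 0 <= L w p01}.
Proof.
move=> h0; have p0 := tail0_gt0.
have p1 : tail0 <= 1.
  rewrite -(Ev_cst Q 1); apply: Ev_le => //.
    have := adm_bmeas gW (adm_tail (ler01 : 0 <= 1 :> R) (ler01 : 0 <= 1 :> R)).
    by under eq_fun do rewrite mul1r.
  by move=> w; have /andP[] := ramp_bd (LPP (fun j => W j w) (-1) 1 0 1 - 3).
pose dt := tail0 / 2; have dt0 : 0 < dt by rewrite divr_gt0.
have dt1 : dt <= 1 by rewrite ler_pdivrMr// mul1r (le_trans p1)// ler1n.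
pose th := tail0 / 2.
have th01 : 0 < th <= 1 by rewrite dt0 dt1.
have dt01 : 0 < dt <= 1 by rewrite dt0 dt1.
have u01 p : p \in [:: p01] -> R4up p by rewrite inE => /eqP ->; rewrite /R4up/= ltr01.
have uh1 p : p \in [:: ph1] -> R4up p by rewrite inE => /eqP ->; rewrite /R4up/= ltr01.
have c1 := blip_limit gW cvL mL (blip_ramp p01 dt^-1 1) u01.
have c2 := blip_limit gW cvL mL (blip_ramp ph1 dt^-1 (1 + dt^-1 / 4)) uh1.
have e1 : Ev P (fun w => ramp (dt^-1 * L w p01 + 1)) = 1.
  apply: Ev_ramp_ae1; first by apply: u01; rewrite mem_head.
  by apply: filterS h0 => w h; rewrite lerDr mulr_ge0// invr_ge0 ltW.
have e2 : Ev P (fun w => ramp (dt^-1 * L w ph1 + (1 + dt^-1 / 4))) = 1.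
  have := ramp_shear (1 + dt^-1 / 4) (1 / 2) (- (1 / 2)) ltr01 (_ : 0 < dt^-1).
  rewrite invr_gt0 subrr => /(_ dt0) ->.
  rewrite (_ : (fun w => _) = (fun w => ramp (dt^-1 * L w p01 + 1))) //.
  by apply/funext => w; congr ramp; field; rewrite gt_eqF.
rewrite {}e1 in c1; rewrite {}e2 in c2.
have thp : 0 <= th * tail0 by rewrite mulr_ge0// ltW// divr_gt0.
have c3 : (1 - th * dt) * Ev Q (fun w => ramp (dt^-1 * Ln n w p01 + 1)) +
    th * tail0 * (Ev Q (fun w => ramp (dt^-1 * Ln n w p01 + 1)) +
    Ev Q (fun w => ramp (dt^-1 * Ln n w ph1 + (1 + dt^-1 / 4))) - 1) @[n --> \oo] -->
    (1 - th * dt) * 1 + th * tail0 * (1 + 1 - 1).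
  apply: cvgD; first by apply: cvgM c1; exact: cvg_cst.
  apply: cvgM; first exact: cvg_cst.
  by apply: cvgB; [exact: cvgD c1 c2|exact: cvg_cst].
have : (1 - th * dt) * 1 + th * tail0 * (1 + 1 - 1) <= expR (th ^+ 3 / 2).
  apply: (ler_cvg_to c3 (cvg_cst _)); near=> n.
  apply: (burke_landscape _ _ _ _ th01 dt01).
  - by near: n; exact: nbhs_infty_gt.
  - by near: n; exact: rt6_ge_near.
  - by near: n; apply: pok_near; rewrite /R4up/= ltr01.
  - by near: n; apply: pok_near; rewrite /R4up/= ltr01.
have th3 : 0 <= th ^+ 3 / 2 by rewrite divr_ge0// exprn_ge0// ltW.
have th31 : th ^+ 3 / 2 <= 1 / 2.
  by rewrite ler_pM2r ?invr_gt0// exprn_ile1// ltW.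
have : expR (th ^+ 3 / 2) <= 1 + th ^+ 3.
  have := expR_ge1Dx (- (th ^+ 3 / 2)); rewrite expRN => h.
  have e0 := expR_gt0 (th ^+ 3 / 2).
  have : (1 - th ^+ 3 / 2) * expR (th ^+ 3 / 2) <= 1.
    by apply: le_trans (ler_wpM2r (ltW e0) h) _; rewrite mulVf// gt_eqF.
  set E := expR _; set y := th ^+ 3 / 2 => hh.
  have -> : th ^+ 3 = 2 * y by rewrite /y; field.
  have : 0 <= (1 + 2 * y) * (1 - y) - 1 by rewrite -/y in th3 th31; nra.
  by rewrite -/y in th3 th31; nra.
move=> h1 h2; have := le_trans h2 h1.
rewrite !mulr1 addrK mulr1 /th /dt => h.
have : tail0 ^+ 2 / 4 <= tail0 ^+ 3 / 8 by lra.
have : tail0 ^+ 3 <= tail0 ^+ 2 by rewrite exprS ler_piMl// sqr_ge0.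
have : 0 < tail0 ^+ 2 by rewrite exprn_gt0.
by lra.
Unshelve. all: by end_near. Qed.

End nondegeneracy.

(** * Functionals of the limit *)

Section boxes.
Context {R : realType}.
Implicit Types (lo hi p : R4 R) (f : R4 R -> R).

Definition box lo hi : set (R4 R) :=
  (`[lo.1.1, hi.1.1] `*` `[lo.1.2, hi.1.2]) `*` (`[lo.2.1, hi.2.1] `*` `[lo.2.2, hi.2.2]).

Definition box_ok lo hi := [/\ lo.1.1 <= hi.1.1, lo.1.2 <= hi.1.2, lo.2.1 <= hi.2.1 &
  lo.2.2 <= hi.2.2] /\ hi.1.2 < lo.2.2.

Definition cont_up f := forall p, R4up p -> {for p, continuous f}.

Lemma box_up lo hi : box_ok lo hi -> box lo hi `<=` @R4up R.
Proof.
move=> [_ h] [[x s] [y t]] [[_ hs] [_ ht]].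
move: hs ht; rewrite /= !in_itv/= => /andP[_ hs] /andP[ht _].
exact: le_lt_trans hs (lt_le_trans h ht).
Qed.

Lemma compact_box lo hi : compact (box lo hi).
Proof. by do 2 ?apply: compact_setX; exact: segment_compact. Qed.

Lemma box_compacts lo hi : box_ok lo hi -> compacts_R4up (box lo hi).
Proof. by move=> ok; split; [exact: compact_box|exact: box_up]. Qed.

Lemma box_lo lo hi : box_ok lo hi -> box lo hi lo.
Proof. by move=> [[h1 h2 h3 h4] _]; split; split; rewrite /= in_itv/= lexx. Qed.

Definition itv_pt (a b : R) (v : nat * nat) : R := a + (b - a) * (v.1%:R / (v.1 + v.2).+1%:R).

Lemma itv_pt_in a b v : a <= b -> `[a, b]%classic (itv_pt a b v).
Proof.
move=> ab; have h0 : 0 <= v.1%:R / (v.1 + v.2).+1%:R :> R by rewrite divr_ge0.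
have h1 : v.1%:R / (v.1 + v.2).+1%:R <= 1 :> R.
  by rewrite ler_pdivrMr ?ltr0n// mul1r ler_nat -addnS leq_addr.
have ba : 0 <= b - a by rewrite subr_ge0.
rewrite /= in_itv/= /itv_pt lerDl mulr_ge0//= -lerBrDl -[leRHS]mulr1.
by rewrite ler_wpM2l.
Qed.

Lemma itv_pt_dense a b x (e : R) : `[a, b]%classic x -> 0 < e -> exists v, `|x - itv_pt a b v| < e.
Proof.
rewrite /= in_itv/= => /andP[ax xb] e0; have ab := le_trans ax xb.
pose D := (b - a) / e; pose N := (Num.truncn D).+1.
have ba : 0 <= b - a by rewrite subr_ge0.
have DN : D < N%:R by rewrite truncnS_gt.
have N0 : 0 < N%:R :> R by rewrite ltr0n.
have small : (b - a) / N%:R < e by rewrite ltr_pdivrMr// mulrC -ltr_pdivrMr.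
have [ba0|ba0] := eqVneq a b.
  have xa : x = a by apply/eqP; rewrite eq_le ax ba0 xb.
  by exists (0%N, 0%N); rewrite xa /itv_pt /= mul0r mulr0 addr0 subrr normr0.
have ab' : a < b by rewrite lt_neqAle ba0.
have ba' : 0 < b - a by rewrite subr_gt0.
pose y := (x - a) / (b - a) * N%:R.
have y0 : 0 <= y by rewrite mulr_ge0// divr_ge0// subr_ge0.
have yN : y <= N%:R by rewrite ler_piMl// ler_pdivrMr// mul1r lerD2r.
have key k : (k < N)%N -> `|y - k%:R| <= 1 -> exists v, `|x - itv_pt a b v| < e.
  move=> kN yk; exists (k, (N.-1 - k)%N); rewrite /itv_pt /= subnKC//.
  rewrite (_ : x - _ = (b - a) / N%:R * (y - k%:R)); last first.
    by rewrite /y /N /=; field; rewrite !gt_eqF.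
  rewrite normrM ger0_norm ?divr_ge0//; apply: le_lt_trans small.
  by rewrite ler_piMr// divr_ge0.
have [yN1|yN1] := ltP y N.-1%:R.
  have /andP[h1 h2] := Num.Theory.truncn_itv y0.
  apply: (key (Num.truncn y)).
    by rewrite -(ltr_nat R) (le_lt_trans h1)// (lt_le_trans yN1)// ler_nat leq_pred.
  by rewrite ger0_norm ?subr_ge0// lerBlDl natr1 ltW.
apply: (key N.-1); first by [].
by rewrite ger0_norm ?subr_ge0// lerBlDl natr1.
Qed.

Definition quad := ((nat * nat) * (nat * nat) * ((nat * nat) * (nat * nat)))%type.
Definition box_pt lo hi (v : quad) : R4 R :=
  ((itv_pt lo.1.1 hi.1.1 v.1.1, itv_pt lo.1.2 hi.1.2 v.1.2),
   (itv_pt lo.2.1 hi.2.1 v.2.1, itv_pt lo.2.2 hi.2.2 v.2.2)).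
Definition enum_pt lo hi (k : nat) : R4 R :=
  if @choice.unpickle quad k is Some v then box_pt lo hi v else lo.

Lemma enum_pt_in lo hi k : box_ok lo hi -> box lo hi (enum_pt lo hi k).
Proof.
move=> ok; have [[h1 h2 h3 h4] _] := ok; rewrite /enum_pt; case: choice.unpickle => [v|]; last exact: box_lo.
by split; split; exact: itv_pt_in.
Qed.

Lemma enum_pt_dense lo hi p (A : set (R4 R)) : box lo hi p -> nbhs p A -> exists k, A (enum_pt lo hi k).
Proof.
case: p => [[x s] [y t]] [[/= hx hs] [hy ht]] /nbhs_ballP[e /= e0 hA].
have [v1 h1] := itv_pt_dense hx e0; have [v2 h2] := itv_pt_dense hs e0.
have [v3 h3] := itv_pt_dense hy e0; have [v4 h4] := itv_pt_dense ht e0.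
exists (@choice.pickle quad (v1, v2, (v3, v4))); rewrite /enum_pt choice.pickleK; apply: hA.
by split; split.
Qed.

Lemma enum_pt_le lo hi f c : box_ok lo hi -> cont_up f ->
  (forall k, f (enum_pt lo hi k) <= c) -> forall p, box lo hi p -> f p <= c.
Proof.
move=> ok cf h p bp; rewrite leNgt; apply/negP => cp.
have up := box_up ok bp.
have : nbhs p [set q | c < f q] by exact: (cf p up _ (lt_nbhsr cp)) || exact: cvgr_gt (cf p up) _ cp.
by move=> /(enum_pt_dense bp)[k /=]; rewrite ltNge h.
Qed.

(* A substitute for the indicator of {exists p in box, a f p + b >= 1} which is
   continuous for the uniform convergence on the box, as convergence in
   distribution requires. *)
Definition bs (a b : R) lo hi f : R := sup [set ramp (a * f p + b) | p in box lo hi].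

Lemma bs_ubound a b lo hi f : has_ubound [set ramp (a * f p + b) | p in box lo hi].
Proof. by exists 1 => _ [p _ <-]; have /andP[] := ramp_bd (a * f p + b). Qed.

Lemma bs_ge a b lo hi f p : box lo hi p -> ramp (a * f p + b) <= bs a b lo hi f.
Proof. by move=> bp; apply: ub_le_sup; [exact: bs_ubound|exists p]. Qed.

Lemma bs_le a b lo hi f c : box_ok lo hi -> (forall p, box lo hi p -> ramp (a * f p + b) <= c) ->
  bs a b lo hi f <= c.
Proof.
move=> ok h; apply: ge_sup; first by eexists; exists lo; [exact: box_lo|].
by move=> _ [p bp <-]; exact: h.
Qed.

Lemma bs_bd a b lo hi f : box_ok lo hi -> 0 <= bs a b lo hi f <= 1.
Proof.
move=> ok; apply/andP; split.
  apply: le_trans (bs_ge a b f (box_lo ok)); by have /andP[] := ramp_bd (a * f lo + b).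
by apply: bs_le => // p _; have /andP[] := ramp_bd (a * f p + b).
Qed.

Lemma bs_lip a b lo hi f g e : box_ok lo hi -> (forall p, box lo hi p -> `|f p - g p| <= e) ->
  `|bs a b lo hi f - bs a b lo hi g| <= `|a| * e.
Proof.
move=> ok h; apply: sup_dist; [by exists lo; exact: box_lo|exact: bs_ubound|exact: bs_ubound|].
by move=> p bp; apply: le_trans (ramp_affine_lip _ _ _ _) _; rewrite ler_wpM2l// h.
Qed.

Fixpoint pmax (phi : R -> R) (e : nat -> R4 R) (m : nat) f : R :=
  if m is m'.+1 then Num.max (pmax phi e m' f) (phi (f (e m'))) else 0.

Lemma pmax_ge phi e m f k : (k < m)%N -> phi (f (e k)) <= pmax phi e m f.
Proof.
elim: m => [//|m IH] /=; rewrite ltnS leq_eqVlt le_max => /predU1P[->|/IH ->//].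
by rewrite lexx orbT.
Qed.

Lemma pmax_le phi e m f c : 0 <= c -> (forall k, (k < m)%N -> phi (f (e k)) <= c) -> pmax phi e m f <= c.
Proof.
move=> c0; elim: m => [//|m IH] h /=; rewrite ge_max h// andbT.
by apply: IH => k km; apply: h; rewrite ltnS ltnW.
Qed.

Lemma pmax_ge0 phi e m f : 0 <= pmax phi e m f.
Proof. by elim: m => [//|m IH] /=; rewrite le_max IH. Qed.

Lemma pmax_flip a b e m : flip (map e (iota 0 m)) (pmax (fun x => ramp (a * x + b)) e m).
Proof.
elim: m => [|m IH]; first exact: flip_cst.
rewrite -addn1 iotaD map_cat /= add0n addn1; apply: flip_max.
  by apply: flip_sub IH => x; rewrite mem_cat => ->.
apply: (@flip_sub _ _ [:: e m]); first by move=> x; rewrite mem_cat orbC => ->.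
apply: (flip_comp (normr_ge0 a) (phi := fun x => ramp (a * x + b))); last exact: flip_eval.
by move=> x y; exact: ramp_affine_lip.
Qed.

Lemma pmax_bs a b lo hi f : box_ok lo hi -> cont_up f ->
  pmax (fun x => ramp (a * x + b)) (enum_pt lo hi) m f @[m --> \oo] --> bs a b lo hi f.
Proof.
move=> ok cf; apply/cvgrPdist_le => e e0.
have /andP[b0 b1] := bs_bd a b f ok.
have [k hk] : exists k, bs a b lo hi f - e <= ramp (a * f (enum_pt lo hi k) + b).
  apply: contrapT => /forallNP h.
  have cg : cont_up (fun p => ramp (a * f p + b)).
    move=> p up; apply: (@continuous_comp _ _ _ f (fun x => ramp (a * x + b))); first exact: cf.
    by apply: (@lip_continuous _ _ `|a|) => x y; exact: ramp_affine_lip.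
  have : bs a b lo hi f <= bs a b lo hi f - e.
    apply: bs_le => //; apply: (enum_pt_le ok cg) => k.
    by rewrite ltW// ltNge; apply/negP; exact: h.
  by rewrite lerBrDl gerDr leNgt e0.
near=> m.
have mk : (k < m)%N by near: m; exact: nbhs_infty_gt.
have h1 := pmax_ge (fun x => ramp (a * x + b)) (enum_pt lo hi) f mk.
have h2 : pmax (fun x => ramp (a * x + b)) (enum_pt lo hi) m f <= bs a b lo hi f.
  by apply: pmax_le => // k' _; apply: bs_ge; exact: enum_pt_in.
by rewrite ger0_norm ?subr_ge0// lerBlDl -lerBlDr (le_trans hk).
Unshelve. all: by end_near. Qed.

End boxes.

Section limit_functionals.
Context {R : realType}.
Implicit Types (f : R4 R -> R) (Phi : (R4 R -> R) -> R) (U : set (R4 R)).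

(* The analogue of [adm_by] for functionals of the values of L on U. *)
Record clf_by (anti : bool) U Phi (l_ : nat -> seq (R4 R)) (g_ : nat -> (R4 R -> R) -> R)
    (B : R) : Prop := Clf_by {
  clf_blip : forall m, blip (l_ m) (g_ m);
  clf_mem : forall m p, p \in l_ m -> U p;
  clf_bd : forall m f, `|g_ m f| <= B;
  clf_anti : forall m, anti -> antitone (g_ m) /\ forall f, 0 <= g_ m f;
  clf_lim : forall f, cont_up f -> g_ m f @[m --> \oo] --> Phi f }.

Definition clf anti U Phi := exists l_ g_ B, @clf_by anti U Phi l_ g_ B.

Lemma clf_sub anti U U' Phi : U `<=` U' -> clf anti U Phi -> clf anti U' Phi.
Proof.
by move=> UU [l_ [g_ [B [h1 h2 h3 h4 h5]]]]; exists l_, g_, B; split => // m p /h2/UU.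
Qed.

Lemma eq_clf anti U Phi Phi' : (forall f, cont_up f -> Phi f = Phi' f) ->
  clf anti U Phi -> clf anti U Phi'.
Proof.
move=> PP [l_ [g_ [B [h1 h2 h3 h4 h5]]]]; exists l_, g_, B; split => // f cf.
by rewrite -PP//; exact: h5.
Qed.

Lemma clf_mul anti U1 U2 Phi1 Phi2 : clf anti U1 Phi1 -> clf anti U2 Phi2 ->
  clf anti (U1 `|` U2) (fun f => Phi1 f * Phi2 f).
Proof.
move=> [l1 [g1 [B1 [a1 a2 a3 a4 a5]]]] [l2 [g2 [B2 [b1 b2 b3 b4 b5]]]].
exists (fun m => l1 m ++ l2 m), (fun m f => g1 m f * g2 m f), (B1 * B2); split.
- move=> m; apply: blipM; [apply: blip_sub (a1 m)|apply: blip_sub (b1 m)] => x xl.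
    by rewrite mem_cat xl.
  by rewrite mem_cat xl orbT.
- by move=> m p; rewrite mem_cat => /orP[/a2|/b2]; [left|right].
- by move=> m f; rewrite normrM ler_pM.
- move=> m an; have [x1 x2] := a4 m an; have [y1 y2] := b4 m an; split => [u v uv|f].
    by rewrite ler_pM ?x1 ?y1.
  by rewrite mulr_ge0.
- by move=> f cf; apply: cvgM; [exact: a5|exact: b5].
Qed.

Lemma clf_lin U1 U2 Phi1 Phi2 (c : R) : clf false U1 Phi1 -> clf false U2 Phi2 ->
  clf false (U1 `|` U2) (fun f => Phi1 f + c * Phi2 f).
Proof.
move=> [l1 [g1 [B1 [a1 a2 a3 a4 a5]]]] [l2 [g2 [B2 [b1 b2 b3 b4 b5]]]].
exists (fun m => l1 m ++ l2 m), (fun m f => g1 m f + c * g2 m f), (B1 + `|c| * B2).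
have B20 : 0 <= B2 by apply: le_trans (b3 0%N (fun=> 0)).
split => //.
- move=> m; have [fa _] := a1 m; have [fb _] := b1 m; split.
    apply: flipD; first by apply: flip_sub fa => x xl; rewrite mem_cat xl.
    by apply: flipZ; apply: flip_sub fb => x xl; rewrite mem_cat xl orbT.
  exists (B1 + `|c| * B2) => f; apply: le_trans (ler_normD _ _) _.
  by rewrite lerD// normrM ler_wpM2l.
- by move=> m p; rewrite mem_cat => /orP[/a2|/b2]; [left|right].
- by move=> m f; apply: le_trans (ler_normD _ _) _; rewrite lerD// normrM ler_wpM2l.
- by move=> f cf; apply: cvgD; [exact: a5|apply: cvgMr; exact: b5].
Qed.

Lemma clf_bs (a b : R) (lo hi : R4 R) : box_ok lo hi -> clf false (box lo hi) (bs a b lo hi).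
Proof.
move=> ok; exists (fun m => map (enum_pt lo hi) (iota 0 m)),
  (pmax (fun x => ramp (a * x + b)) (enum_pt lo hi)), 1.
have hb m f : `|pmax (fun x => ramp (a * x + b)) (enum_pt lo hi) m f| <= 1.
  rewrite ger0_norm ?pmax_ge0//; apply: pmax_le => // k _.
  by have /andP[] := ramp_bd (a * f (enum_pt lo hi k) + b).
split => //.
- by move=> m; split; [exact: pmax_flip|exists 1].
- by move=> m _ /mapP[k _ ->]; exact: enum_pt_in.
- by move=> f; exact: pmax_bs.
Qed.

Definition bev (a c : R) (lo hi : R4 R) f : R := (`[<forall p, box lo hi p -> a * f p <= c>])%:R.

Lemma clf_bev (anti : bool) (a c : R) (lo hi : R4 R) : box_ok lo hi -> (anti -> 0 <= a) ->
  clf anti (box lo hi) (bev a c lo hi).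
Proof.
move=> ok ha.
pose g m f := 1 - pmax (fun x => ramp ((m%:R * a) * x + - (m%:R * c))) (enum_pt lo hi) m f.
have pm m f : 0 <= pmax (fun x => ramp ((m%:R * a) * x + - (m%:R * c))) (enum_pt lo hi) m f <= 1.
  rewrite pmax_ge0/=; apply: pmax_le => // k _.
  by have /andP[] := ramp_bd (m%:R * a * f (enum_pt lo hi k) + - (m%:R * c)).
have g01 m f : 0 <= g m f <= 1.
  by have /andP[h1 h2] := pm m f; rewrite /g subr_ge0 h2 gerBl.
exists (fun m => map (enum_pt lo hi) (iota 0 m)), g, 1; split.
- move=> m; split; last by exists 1 => f; have /andP[h1 h2] := g01 m f; rewrite ger0_norm.
  by apply: flipB; [exact: flip_cst|exact: pmax_flip].
- by move=> m _ /mapP[k _ ->]; exact: enum_pt_in.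
- by move=> m f; have /andP[h1 h2] := g01 m f; rewrite ger0_norm.
- move=> m an; split => [u v uv|f]; last by have /andP[] := g01 m f.
  rewrite /g lerD2l lerN2; apply: pmax_le; first exact: pmax_ge0.
  move=> k km; apply: le_trans (pmax_ge _ _ _ km); apply: ramp_mono.
  by rewrite lerD2r ler_wpM2l// mulr_ge0// ha.
move=> f cf; rewrite /bev; case: asboolP => h.
  apply: cvg_near_cst; near=> m; rewrite /g.
  suff -> : pmax (fun x => ramp ((m%:R * a) * x + - (m%:R * c))) (enum_pt lo hi) m f = 0 by rewrite subr0.
  apply/eqP; rewrite eq_le pmax_ge0 andbT; apply: pmax_le => // k _.
  rewrite ramp0// -mulrA -mulrBr mulr_ge0_le0// subr_le0.
  by apply: h; exact: enum_pt_in.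
have [k hk] : exists k, c < a * f (enum_pt lo hi k).
  apply: contrapT => /forallNP h'; apply: h.
  have cg : cont_up (fun p => a * f p).
    by move=> p up; apply: cvgMr; exact: cf.
  by apply: (enum_pt_le ok cg) => k; rewrite leNgt; apply/negP; exact: h'.
have d0 : 0 < a * f (enum_pt lo hi k) - c by rewrite subr_gt0.
apply: cvg_near_cst; near=> m.
have mk : (k < m)%N by near: m; exact: nbhs_infty_gt.
have h1 := pmax_ge (fun x => ramp ((m%:R * a) * x + - (m%:R * c))) (enum_pt lo hi) f mk.
rewrite ramp1 in h1; last first.
  rewrite -mulrA -mulrBr -ler_pdivrMr//.
  by near: m; exact: nbhs_infty_ger.
have /andP[_ h2] := pm m f.
by rewrite /g (_ : pmax _ _ _ _ = 1) ?subrr//; apply/eqP; rewrite eq_le h1 h2.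
Unshelve. all: by end_near. Qed.

End limit_functionals.

Section expectations_of_limit_functionals.
Context {R : realType} {d' : measure_display} {T' : measurableType d'} (Q : probability T' R)
  (W : int -> T' -> R -> R) {d : measure_display} {T : measurableType d} (P : probability T R)
  (L : T -> R4 R -> R).
Hypothesis gW : genv Q W.
Hypothesis cvL : cvg_in_distribution Q (fun n w => landscape_n (fun j => W j w) n) P L.
Hypothesis mL : forall p, R4up p -> measurable_fun setT (fun w => L w p).
Hypothesis cL : forall w, cont_up (L w).
Implicit Types (Phi : (R4 R -> R) -> R) (U : set (R4 R)).

Lemma clf_cvg anti U Phi l_ g_ B : U `<=` @R4up R -> clf_by anti U Phi l_ g_ B ->
  bmeas (fun w => Phi (L w)) /\
  Ev P (fun w => g_ m (L w)) @[m --> \oo] --> Ev P (fun w => Phi (L w)).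
Proof.
move=> Uup [h1 h2 h3 h4 h5].
have [||w|b1 _ b3] := @Ev_cvg _ _ _ P (fun m w => g_ m (L w)) (fun w => Phi (L w)) B => //.
- by move=> m; have [] := limit_bmeas mL (h1 m) (fun p pl => Uup p (h2 m p pl)).
- exact: h5.
Qed.

Lemma clf_bmeas anti U Phi : U `<=` @R4up R -> clf anti U Phi -> bmeas (fun w => Phi (L w)).
Proof. by move=> Uup [l_ [g_ [B /(clf_cvg Uup)[]]]]. Qed.

Lemma clf_indep U1 U2 Phi1 Phi2 t : clf false U1 Phi1 -> clf false U2 Phi2 ->
  (forall p, U1 p -> R4up p /\ p.2.2 <= t) -> (forall p, U2 p -> R4up p /\ t <= p.1.2) ->
  Ev P (fun w => Phi1 (L w) * Phi2 (L w)) = Ev P (fun w => Phi1 (L w)) * Ev P (fun w => Phi2 (L w)).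
Proof.
move=> h1 h2 u1 u2.
have [l1 [g1 [B1 c1]]] := h1; have [l2 [g2 [B2 c2]]] := h2.
have U1up : U1 `<=` @R4up R by move=> p /u1[].
have U2up : U2 `<=` @R4up R by move=> p /u2[].
have [_ e1] := clf_cvg U1up c1; have [_ e2] := clf_cvg U2up c2.
have [a1 a2 a3 a4 a5] := c1; have [b1 b2 b3 b4 b5] := c2.
have [||w|_ _ e12] := @Ev_cvg _ _ _ P (fun m w => g1 m (L w) * g2 m (L w))
  (fun w => Phi1 (L w) * Phi2 (L w)) (B1 * B2).
- move=> m; apply: measurable_funM.
    by have [] := limit_bmeas mL (a1 m) (fun p pl => U1up p (a2 m p pl)).
  by have [] := limit_bmeas mL (b1 m) (fun p pl => U2up p (b2 m p pl)).
- by move=> m w; rewrite normrM ler_pM.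
- by apply: cvgM; [exact: a5|exact: b5].
apply: (@cvg_unique _ (@norm_hausdorff _ _) _ _ _ _ e12).
apply: cvg_trans (cvgM e1 e2); apply: near_eq_cvg; near=> m => /=.
by rewrite (limit_indep gW cvL mL (t := t) (a1 m) (b1 m))// => p; [move=> /a2/u1|move=> /b2/u2].
Unshelve. all: by end_near. Qed.

Lemma clf_fkg U1 U2 Phi1 Phi2 : clf true U1 Phi1 -> clf true U2 Phi2 ->
  U1 `<=` @R4up R -> U2 `<=` @R4up R ->
  Ev P (fun w => Phi1 (L w)) * Ev P (fun w => Phi2 (L w)) <= Ev P (fun w => Phi1 (L w) * Phi2 (L w)).
Proof.
move=> h1 h2 U1up U2up.
have [l1 [g1 [B1 c1]]] := h1; have [l2 [g2 [B2 c2]]] := h2.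
have [_ e1] := clf_cvg U1up c1; have [_ e2] := clf_cvg U2up c2.
have [a1 a2 a3 a4 a5] := c1; have [b1 b2 b3 b4 b5] := c2.
have [||w|_ _ e12] := @Ev_cvg _ _ _ P (fun m w => g1 m (L w) * g2 m (L w))
  (fun w => Phi1 (L w) * Phi2 (L w)) (B1 * B2).
- move=> m; apply: measurable_funM.
    by have [] := limit_bmeas mL (a1 m) (fun p pl => U1up p (a2 m p pl)).
  by have [] := limit_bmeas mL (b1 m) (fun p pl => U2up p (b2 m p pl)).
- by move=> m w; rewrite normrM ler_pM.
- by apply: cvgM; [exact: a5|exact: b5].
apply: (ler_cvg_to (cvgM e1 e2) e12); near=> m.
have [x1 x2] := a4 m isT; have [y1 y2] := b4 m isT.
apply: (limit_fkg gW cvL mL (a1 m) (b1 m)) => // p; first by move=> /a2/U1up.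
by move=> /b2/U2up.
Unshelve. all: by end_near. Qed.

Lemma tau_continuous (zeta : R) m w (k : int) : continuous (tau zeta m w k).
Proof.
have aff (a b : R) : continuous (fun x : R => a * x + b).
  by move=> x; apply: cvgD; [apply: cvgMr; exact: cvg_id|exact: cvg_cst].
move=> p; rewrite /tau.
apply: (@cvg_pair _ _ _ _ (nbhs _) (nbhs _)).
  apply: (@cvg_pair _ _ _ _ (nbhs _) (nbhs _)).
    apply: (@continuous_comp _ _ _ (fun p : R4 R => p.1.1) (fun x => zeta ^+ 2 * x + w)); last exact: aff.
    by apply: (@continuous_comp _ _ _ fst fst); [exact: cvg_fst|exact: cvg_fst].
  apply: (@continuous_comp _ _ _ (fun p : R4 R => p.1.2) (fun x => m%:R * x + k%:~R)); last exact: aff.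
  by apply: (@continuous_comp _ _ _ fst snd); [exact: cvg_fst|exact: cvg_snd].
apply: (@cvg_pair _ _ _ _ (nbhs _) (nbhs _)).
  apply: (@continuous_comp _ _ _ (fun p : R4 R => p.2.1) (fun x => zeta ^+ 2 * x + w)); last exact: aff.
  by apply: (@continuous_comp _ _ _ snd fst); [exact: cvg_snd|exact: cvg_fst].
apply: (@continuous_comp _ _ _ (fun p : R4 R => p.2.2) (fun x => m%:R * x + k%:~R)); last exact: aff.
by apply: (@continuous_comp _ _ _ snd snd); [exact: cvg_snd|exact: cvg_snd].
Qed.

Definition retau (zeta : R) m w (k : int) (f : R4 R -> R) p := zeta^-1 * f (tau zeta m w k p).

Lemma tau_up (zeta : R) m w (k : int) p : 0 < zeta -> zeta ^+ 3 = m%:R ->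
  R4up (tau zeta m w k p) <-> R4up p.
Proof.
by move=> z0 zm; rewrite /R4up /= ltrD2r ltr_pM2l// -zm exprn_gt0.
Qed.

Lemma cont_up_retau (zeta : R) m w (k : int) f : 0 < zeta -> zeta ^+ 3 = m%:R ->
  cont_up f -> cont_up (retau zeta m w k f).
Proof.
move=> z0 zm cf p up; apply: cvgMr.
apply: (@continuous_comp _ _ _ (tau zeta m w k) f); first exact: tau_continuous.
by apply: cf; apply/tau_up.
Qed.

Lemma clf_affine anti U Phi (zeta : R) m w (k : int) : clf anti U Phi -> U `<=` @R4up R ->
  0 < zeta -> zeta ^+ 3 = m%:R ->
  Ev P (fun o => Phi (retau zeta m w k (L o))) = Ev P (fun o => Phi (L o)).
Proof.
move=> [l_ [g_ [B c]]] Uup z0 zm; have [_ e1] := clf_cvg Uup c; have [a1 a2 a3 a4 a5] := c.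
have [||o|_ _ e2] := @Ev_cvg _ _ _ P (fun i o => g_ i (retau zeta m w k (L o)))
  (fun o => Phi (retau zeta m w k (L o))) B => //.
- move=> i; have [fg _] := a1 i; apply: (flip_measurable fg) => p /a2/Uup up.
  by apply: measurable_funM => //; apply: mL; apply/tau_up.
- by apply: a5; exact: cont_up_retau.
apply: (@cvg_unique _ (@norm_hausdorff _ _) _ _ _ _ e2).
apply: cvg_trans e1; apply: near_eq_cvg; near=> i => /=.
by rewrite -(limit_affine gW cvL mL w k (a1 i) (fun p pl => Uup p (a2 i p pl)) z0 zm).
Unshelve. all: by end_near. Qed.

End expectations_of_limit_functionals.

(** * Tubes *)

Section exits.
Context {R : realType}.
Implicit Types (V : int -> R -> R) (f : R4 R -> R).

Definition entry := (R * R * (R4 R * R4 R))%type.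
Definition ebs (j : entry) f : R := bs j.1.1 j.1.2 j.2.1 j.2.2 f.
Definition eok (j : entry) : Prop := box_ok j.2.1 j.2.2.
Definition badS (s : seq entry) f : R := \sum_(j <- s) ebs j f.

Definition pt_entry (a b : R) (p : R4 R) : entry := (a, b, (p, p)).

(* If badS (exits w C th) < 1, a path from (w, 0) to (w, 1) that leaves the tube of
   width th around w is much shorter than the optimal one: by superadditivity, the
   lengths from (w, 0) to an exit point q and from q to (w, 1) are bounded by
   completing them with paths from time -1 and to time 2. *)
Definition exits (w C th : R) : seq entry :=
  flatten [seq [:: pt_entry 1 (th ^+ 2 / 3 - C) ((w, -1), (w + e, 2));
      pt_entry 1 (th ^+ 2 / 3 - C) ((w + e, -1), (w, 2));
      (-1, - C, (((w + e - 1, 0), (w + e, 2)), ((w + e + 1, 1), (w + e, 2))));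
      (-1, - C, (((w + e, -1), (w + e - 1, 0)), ((w + e, -1), (w + e + 1, 1))))] | e <- [:: th; - th]]
  ++ [:: pt_entry (-1) (- C) ((w, -1), (w, 0)); pt_entry (-1) (- C) ((w, 1), (w, 2));
      pt_entry (-1) (- C) ((w, 0), (w, 1))].

Lemma pt_eok a b (p : R4 R) : R4up p -> eok (pt_entry a b p).
Proof. by move=> up; split; [split|]. Qed.

Lemma exits_ok w C th j : List.In j (exits w C th) -> eok j.
Proof.
rewrite /exits /=.
have h1 (x y : R) : R4up ((x, -1), (y, 2)) by rewrite /R4up/=; lra.
have h2 (x y : R) : R4up ((x, -1), (y, 0)) by rewrite /R4up/=; lra.
have h3 (x y : R) : R4up ((x, 1), (y, 2)) by rewrite /R4up/=; lra.
have h4 (x y : R) : R4up ((x, 0), (y, 1)) by rewrite /R4up/=; lra.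
by do 11 (case=> [<-|]; first by
  (exact: pt_eok || (rewrite /eok /box_ok /=; split; [split|]; lra))).
Qed.

Lemma badS_lt s f j : List.In j s -> (forall j, List.In j s -> eok j) -> badS s f < 1 ->
  forall p, box j.2.1 j.2.2 p -> j.1.1 * f p + j.1.2 < 1.
Proof.
move=> js sok bf p bp; rewrite ltNge; apply/negP => h.
have hj : 1 <= ebs j f by rewrite -(ramp1 h); exact: bs_ge.
have : ebs j f <= badS s f.
  elim: s js sok {bf} => [//|j' s IH] /= [->|js] sok; rewrite /badS big_cons.
    rewrite lerDl; have {sok} : forall k, List.In k s -> eok k by move=> k ks; apply: sok; right.
    elim: s {IH} => [|j'' s IH] sok; first by rewrite big_nil.
    rewrite big_cons addr_ge0//; first by have /andP[] := bs_bd j''.1.1 j''.1.2 f (sok j'' (or_introl erefl)).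
    by apply: IH => k ks; apply: sok; right.
  apply: le_trans (IH js _) _; first by move=> k ks; apply: sok; right.
  by rewrite lerDr; have /andP[] := bs_bd j'.1.1 j'.1.2 f (sok j' (or_introl erefl)).
by move=> /(le_trans hj); rewrite leNgt bf.
Qed.

Definition xco n i (u : R) : R := (u - i%:R / n%:R) * rt6 n ^+ 2 / 2.

Lemma cx_xco n i u : (0 < n)%N -> cx n (xco n i u, i%:R / n%:R) = u.
Proof.
move=> n0; have := rt6_gt0 (R := R) n0 => r0; rewrite /cx /xco /=.
by field; rewrite !gt_eqF// ltr0n.
Qed.

Lemma lo_ratio n i : (0 < n)%N -> lo n (i%:R / n%:R : R) = i%:Z.
Proof.
move=> n0; rewrite /lo mulrC divfK ?pnatr_eq0 -?lt0n//.
by rewrite -[X in Num.floor X]/((Posz i)%:~R) intrKfloor.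
Qed.

Lemma lo_int n (k : int) : lo n (k%:~R : R) = n%:Z * k.
Proof. by rewrite /lo -[n%:R]/((Posz n)%:~R) -intrM intrKfloor. Qed.

Lemma lo0 n : lo n (0 : R) = 0. Proof. by have := lo_int n 0; rewrite mulr0. Qed.
Lemma lo1 n : lo n (1 : R) = n%:Z. Proof. by have := lo_int n 1; rewrite mulr1. Qed.

Lemma xco_step n i (z : nat -> R) : (0 < n)%N -> 1 <= rt6 n :> R -> z i <= z i.+1 ->
  xco n i (z i) - 1 <= xco n i.+1 (z i.+1).
Proof.
move=> n0 r1 zi; have r0 := rt6_gt0 (R := R) n0.
have n0R : 0 < n%:R :> R by rewrite ltr0n.
have h : rt6 n ^+ 2 / n%:R <= 1 :> R.
  rewrite ler_pdivrMr// mul1r -rt6X; apply: ler_weXn2l => //.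
rewrite /xco (_ : i.+1%:R / n%:R = i%:R / n%:R + 1 / n%:R); last by rewrite -natr1 mulrDl.
have : (z i - i%:R / n%:R) * rt6 n ^+ 2 <= (z i.+1 - i%:R / n%:R) * rt6 n ^+ 2.
  by rewrite ler_wpM2r ?exprn_ge0 ?(ltW r0)// lerD2r.
have -> : (z i.+1 - (i%:R / n%:R + 1 / n%:R)) * rt6 n ^+ 2 / 2 =
  (z i.+1 - i%:R / n%:R) * rt6 n ^+ 2 / 2 - rt6 n ^+ 2 / n%:R / 2 by field; rewrite gt_eqF.
move: h; set A := rt6 n ^+ 2 / n%:R => h; set B := _ * rt6 n ^+ 2; set B' := _ * rt6 n ^+ 2 => BB.
lra.
Qed.

Lemma exit_index n (z : nat -> R) (w th : R) : (0 < n)%N -> 1 <= rt6 n :> R ->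
  (forall i, (i < n)%N -> z i <= z i.+1) -> 0 <= th ->
  xco n 0 (z 0%N) = w -> xco n n (z n) = w ->
  (exists2 i, (i <= n)%N & th < `|xco n i (z i) - w|) ->
  exists i e, [/\ (0 < i < n)%N, e = th \/ e = - th & w + e - 1 <= xco n i (z i) <= w + e + 1].
Proof.
move=> n0 r1 zi th0 x0 xn [i i_n]; rewrite lter_normr => /orP[hi|hi].
  have ex : exists k, (i + k <= n)%N && (th < xco n (i + k) (z (i + k)%N) - w).
    by exists 0%N; rewrite addn0 i_n hi.
  have ub k : (i + k <= n)%N && (th < xco n (i + k) (z (i + k)%N) - w) -> (k <= n)%N.
    by move=> /andP[h _]; apply: leq_trans h; rewrite leq_addl.
  case: (ex_maxnP ex ub) => k /andP[k1 k2] kmax; exists (i + k)%N, th.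
  have kn : (i + k < n)%N.
    rewrite ltn_neqAle k1 andbT; apply/eqP => e; move: k2.
    by rewrite e xn subrr ltNge th0.
  have i0 : (0 < i + k)%N.
    rewrite lt0n; apply/eqP => e; move: k2.
    by rewrite e x0 subrr ltNge th0.
  split; [by rewrite i0|by left|].
  have nx : xco n (i + k).+1 (z (i + k).+1) - w <= th.
    rewrite leNgt; apply/negP => h; have := kmax k.+1; rewrite addnS kn h => /(_ isT).
    by rewrite ltnn.
  have := xco_step n0 r1 (zi _ kn).
  by move=> hs; apply/andP; split; lra.
have ex : exists k, (k <= n)%N && (th < - (xco n k (z k) - w)).
  by exists i; rewrite i_n hi.
case: (ex_minnP ex) => k /andP[k1 k2] kmin; exists k, (- th).
have k0 : (0 < k)%N.
  rewrite lt0n; apply/eqP => e; move: k2.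
  by rewrite e x0 subrr oppr0 ltNge th0.
have kn : (k < n)%N.
  rewrite ltn_neqAle k1 andbT; apply/eqP => e; move: k2.
  by rewrite e xn subrr oppr0 ltNge th0.
split; [by rewrite k0|by right|].
have hp : - (xco n k.-1 (z k.-1) - w) <= th.
  rewrite leNgt; apply/negP => h; have := kmin k.-1.
  rewrite h andbT (leq_trans (leq_pred _) k1) => /(_ isT).
  by rewrite leqNgt prednK// leqnn.
have := xco_step n0 r1 (zi k.-1 _); rewrite prednK// => /(_ k1) hs.
by apply/andP; split; lra.
Qed.

Lemma path_value_split V n i z (w : R) : (forall j, continuous (V j)) -> (0 < i < n)%N ->
  npath n (cx n (w, 0)) (cx n (w, 1)) z ->
  let q : R * R := (xco n i (z i), i%:R / n%:R) in
  [/\ pok n ((w, 0), q), pok n (q, (w, 1)) &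
  rt6 n * lppn V 0 n z - 2 * rt6 n ^+ 4 <=
    landscape_n V n ((w, 0), q) + landscape_n V n (q, (w, 1))].
Proof.
move=> cV /andP[i0 i_n] hz q; have n0 : (0 < n)%N by exact: leq_trans i_n.
have hi := npath_itv hz (ltnW i_n); have /andP[hi1 hi2] := hi.
have pok1 : pok n ((w, 0), q).
  by rewrite /pok /= lo0 lo_ratio// ltz_nat i0 cx_xco.
have pok2 : pok n (q, (w, 1)).
  by rewrite /pok /= lo1 lo_ratio// ltz_nat i_n cx_xco.
split => //; rewrite !landscape_nE/= ?lo0 ?lo1 ?lo_ratio//; [|by rewrite lez_nat ltnW..].
have d1 : dl n ((w, 0), q) = i by rewrite /dl /= lo0 lo_ratio// subr0 absz_nat.
have d2 : dl n (q, (w, 1)) = (n - i)%N.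
  by rewrite /dl /= lo1 lo_ratio//; lia.
rewrite d1 d2 cx_xco//.
have := @lppn_split _ V 0 i (n - i) (cx n (w, 0)) (cx n (w, 1)) z cV.
rewrite subnKC ?(ltnW i_n)// add0r => /(_ hz) h.
have := ler_wpM2l (rt6_ge0 n) h; rewrite mulrDr -subr_ge0.
set A := rt6 n * lppn _ _ _ _; set B1 := LPP _ _ _ _ _; set B2 := LPP _ _ _ _ _ => hh.
rewrite -subr_ge0 (_ : _ - _ = rt6 n * B1 + rt6 n * B2 - A)//; by ring.
Qed.

Lemma exit_bound V n z (w C th : R) : (forall j, continuous (V j)) -> (0 < n)%N ->
  2 <= rt6 n :> R -> 0 <= th -> badS (exits w C th) (landscape_n V n) < 1 ->
  npath n (cx n (w, 0)) (cx n (w, 1)) z ->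
  (exists2 i, (i <= n)%N & th < `|xco n i (z i) - w|) ->
  rt6 n * lppn V 0 n z - 2 * rt6 n ^+ 4 <= landscape_n V n ((w, 0), (w, 1)) + 7 * (C + 1) - 2 * th ^+ 2 / 3.
Proof.
move=> cV n0 r2 th0 bad hz hex; have r1 : 1 <= rt6 n :> R by apply: le_trans r2; rewrite ler1n.
have r0 : 0 < rt6 n :> R by exact: rt6_gt0.
have n0R : 0 < n%:R :> R by rewrite ltr0n.
have [z0 zn zi] := hz.
have x0 : xco n 0 (z 0%N) = w by rewrite z0 /xco /cx /=; field; rewrite !gt_eqF.
have xn : xco n n (z n) = w by rewrite zn /xco /cx /=; field; rewrite !gt_eqF.
have [i [e [i01 he /andP[q1 q2]]]] := exit_index n0 r1 zi th0 x0 xn hex.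
have [pok1 pok2 hv] := path_value_split cV i01 hz.
set q : R * R := (xco n i (z i), i%:R / n%:R) in pok1 pok2 hv *.
have /andP[i0 i_n] := i01.
have qt0 : 0 <= q.2 by rewrite divr_ge0.
have qt1 : q.2 <= 1 by rewrite /q /= ler_pdivrMr// mul1r ler_nat ltnW.
have loq : lo n q.2 = i%:Z by exact: lo_ratio.
have lm1 : lo n (-1 : R) = - n%:Z by rewrite (lo_int n (-1)) mulrN1.
have l2 : lo n (2 : R) = n%:Z * 2 by rewrite (lo_int n 2).
have r22 : 0 < rt6 n ^+ 2 :> R by rewrite exprn_gt0.
have r24 : 2 <= rt6 n ^+ 2 :> R by rewrite expr2 (le_trans r2)// ler_peMr// ltW.
have cle (x s y t : R) : x - y <= 1 -> s + 1 <= t -> cx n (x, s) <= cx n (y, t).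
  move=> xy st; rewrite /cx /= -subr_ge0.
  have -> : t + 2 * y / rt6 n ^+ 2 - (s + 2 * x / rt6 n ^+ 2) = (t - s) - 2 * (x - y) / rt6 n ^+ 2.
    by field; rewrite gt_eqF.
  rewrite subr_ge0 ler_pdivrMr//; nra.
have [nA nB nC nD] : [/\ - n%:Z < 0, n%:Z < n%:Z * 2, i%:Z < n%:Z * 2 & - n%:Z < i%:Z].
  by clear -n0 i0 i_n; split; lia.
have pA : pok n ((w, -1), (w, 0)).
  by rewrite /pok /= lo0 lm1 nA cle ?subrr ?addNr.
have pB : pok n ((w, 1), (w, 2)).
  rewrite /pok /= lo1 l2 nB cle ?subrr//=; lra.
have pC : pok n (q, (w + e, 2)).
  rewrite /pok /= -/q.2 loq l2 nC /=.
  by apply: cle => /=; rewrite ?/q /= in qt1 *; lra.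
have pD : pok n ((w + e, -1), q).
  rewrite /pok /= -/q.2 loq lm1 nD /=.
  by apply: cle => /=; rewrite ?/q /= in qt0 *; lra.
have pok_trans (a b c : R * R) : pok n (a, b) -> pok n (b, c) -> pok n (a, c).
  move=> /andP[/= a1 a2] /andP[/= b1 b2].
  by rewrite /pok /= (lt_trans a1 b1) (le_trans a2 b2).
set f := landscape_n V n in bad hv *.
have sup a b c : pok n (a, b) -> pok n (b, c) -> f (a, b) + f (b, c) <= f (a, c).
  exact: landscape_superadditive.
have s1 := sup _ _ _ pA pok1; have s2 := sup _ _ _ (pok_trans _ _ _ pA pok1) pC.
have s3 := sup _ _ _ pD pok2; have s4 := sup _ _ _ (pok_trans _ _ _ pD pok2) pB.
have inE (j : entry) : List.In j (exits w C th) ->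
    forall p, box j.2.1 j.2.2 p -> j.1.1 * f p + j.1.2 < 1.
  by move=> js; apply: badS_lt js _ bad; exact: exits_ok.
have bpt (p : R4 R) : box p p p by split; split; rewrite /= in_itv/= !lexx.
have bq1 : box ((w + e - 1, 0), (w + e, 2)) ((w + e + 1, 1), (w + e, 2)) (q, (w + e, 2)).
  by split; split; rewrite /= in_itv/= ?lexx ?q1 ?q2 ?qt0 ?qt1.
have bq2 : box ((w + e, -1), (w + e - 1, 0)) ((w + e, -1), (w + e + 1, 1)) ((w + e, -1), q).
  by split; split; rewrite /= in_itv/= ?lexx ?q1 ?q2 ?qt0 ?qt1.
have e1 : f ((w, -1), (w + e, 2)) < C - th ^+ 2 / 3 + 1.
  have := inE (pt_entry 1 (th ^+ 2 / 3 - C) ((w, -1), (w + e, 2))) _ _ (bpt _).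
  rewrite /= mul1r => h; have : f ((w, -1), (w + e, 2)) + (th ^+ 2 / 3 - C) < 1.
    by apply: h; case: he => ->; tauto.
  clear; lra.
have e2 : f ((w + e, -1), (w, 2)) < C - th ^+ 2 / 3 + 1.
  have := inE (pt_entry 1 (th ^+ 2 / 3 - C) ((w + e, -1), (w, 2))) _ _ (bpt _).
  rewrite /= mul1r => h; have : f ((w + e, -1), (w, 2)) + (th ^+ 2 / 3 - C) < 1.
    by apply: h; case: he => ->; tauto.
  clear; lra.
have e3 : - C - 1 < f (q, (w + e, 2)).
  have := inE (-1, - C, (((w + e - 1, 0), (w + e, 2)), ((w + e + 1, 1), (w + e, 2)))) _ _ bq1.
  rewrite /= mulN1r => h; have : - f (q, (w + e, 2)) - C < 1.
    by apply: h; case: he => ->; tauto.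
  clear; lra.
have e4 : - C - 1 < f ((w + e, -1), q).
  have := inE (-1, - C, (((w + e, -1), (w + e - 1, 0)), ((w + e, -1), (w + e + 1, 1)))) _ _ bq2.
  rewrite /= mulN1r => h; have : - f ((w + e, -1), q) - C < 1.
    by apply: h; case: he => ->; tauto.
  clear; lra.
have e5 : - C - 1 < f ((w, -1), (w, 0)).
  have := inE (pt_entry (-1) (- C) ((w, -1), (w, 0))) _ _ (bpt _); rewrite /= mulN1r => h.
  have : - f ((w, -1), (w, 0)) - C < 1 by apply: h; tauto.
  clear; lra.
have e6 : - C - 1 < f ((w, 1), (w, 2)).
  have := inE (pt_entry (-1) (- C) ((w, 1), (w, 2))) _ _ (bpt _); rewrite /= mulN1r => h.
  have : - f ((w, 1), (w, 2)) - C < 1 by apply: h; tauto.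
  clear; lra.
have e7 : - C - 1 < f ((w, 0), (w, 1)).
  have := inE (pt_entry (-1) (- C) ((w, 0), (w, 1))) _ _ (bpt _); rewrite /= mulN1r => h.
  have : - f ((w, 0), (w, 1)) - C < 1 by apply: h; tauto.
  clear; lra.
by apply: le_trans hv _; lra.
Qed.

End exits.

Section exit_boxes.
Context {R : realType}.

Lemma tau1_pt (x s y t x0 : R) (k : int) x' s' y' t' : x' = x + x0 -> s' = s + k%:~R ->
  y' = y + x0 -> t' = t + k%:~R ->
  ((x', s'), (y', t')) = tau 1 1 x0 k ((x, s), (y, t)) :> R4 R.
Proof. by move=> -> -> -> ->; rewrite /tau/= !expr1n !mul1r. Qed.

Lemma exit_boxes_ok : [/\ box_ok (((0, 0), (0, 3)) : R4 R) ((0, 0), (0, 3)),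
  box_ok (((- 1, 0), (0, 2)) : R4 R) ((1, 1), (0, 2)), box_ok (((0, - 1), (- 1, 0)) : R4 R) ((0, - 1), (1, 1)) &
  box_ok (((0, 0), (0, 1)) : R4 R) ((0, 0), (0, 1))].
Proof. by split; (split; [split|]); rewrite /=; lra. Qed.

End exit_boxes.

Import HBNNSimple.

Section exit_events.
Context {R : realType} {d' : measure_display} {T' : measurableType d'} (Q : probability T' R)
  (W : int -> T' -> R -> R) {d : measure_display} {T : measurableType d} (P : probability T R)
  (L : T -> R4 R -> R).
Hypothesis gW : genv Q W.
Hypothesis cvL : cvg_in_distribution Q (fun n w => landscape_n (fun j => W j w) n) P L.
Hypothesis mL : forall p, R4up p -> measurable_fun setT (fun w => L w p).
Hypothesis cL : forall w, cont_up (L w).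
Let Ln n w := landscape_n (fun j => W j w) n.

Lemma box_pt_set (p : R4 R) : box p p = [set p].
Proof.
apply/seteqP; split=> [[[x s] [y t]]|_ ->]; last by split; split; rewrite /= in_itv/= !lexx.
case: p => [[x' s'] [y' t']] /= [[/= h1 h2] [/= h3 h4]]; move: h1 h2 h3 h4.
by rewrite !in_itv/= => /le_anti <- /le_anti <- /le_anti <- /le_anti <-.
Qed.

Lemma bs_point a b (p : R4 R) f : bs a b p p f = ramp (a * f p + b).
Proof. by rewrite /bs box_pt_set image_set1 sup1. Qed.

Lemma box_tau1 w k (lo hi p : R4 R) : box (tau 1 1 w k lo) (tau 1 1 w k hi) (tau 1 1 w k p) <->
  box lo hi p.
Proof.
case: lo hi p => [[? ?] [? ?]] [[? ?] [? ?]] [[? ?] [? ?]].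
rewrite /box /tau /= !expr1n !mul1r.
by split=> -[[/= h1 h2] [/= h3 h4]]; (split; split); rewrite /= in_itv/=; move: h1 h2 h3 h4; rewrite /= !in_itv/= !lerD2r.
Qed.

Lemma bs_retau a b w k (lo hi : R4 R) f :
  bs a b lo hi (retau 1 1 w k f) = bs a b (tau 1 1 w k lo) (tau 1 1 w k hi) f.
Proof.
congr sup; apply/seteqP; split=> _ [p bp <-].
  by exists (tau 1 1 w k p); [exact/box_tau1|rewrite /retau invr1 mul1r].
have e : tau 1 1 w k (tau 1 1 (- w) (- k) p) = p.
  case: p bp => [[x s] [y t]] _; rewrite /tau/= !expr1n !mul1r.
  by rewrite mulrNz !subrK.
exists (tau 1 1 (- w) (- k) p); last by rewrite /retau invr1 mul1r e.
by apply/(box_tau1 w k); rewrite e.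
Qed.

Lemma Ev_bs_shift a b w k (lo hi lo' hi' : R4 R) : box_ok lo hi ->
  lo' = tau 1 1 w k lo -> hi' = tau 1 1 w k hi ->
  Ev P (fun o => bs a b lo' hi' (L o)) = Ev P (fun o => bs a b lo hi (L o)).
Proof.
move=> ok -> ->.
rewrite -(clf_affine gW cvL mL cL (m := 1) w k (clf_bs a b ok) (box_up ok) ltr01 (expr1n _ _)).
by apply: eq_Ev => o; rewrite bs_retau.
Qed.

Lemma bs_bmeas a b lo hi : box_ok lo hi -> bmeas (fun o => bs a b lo hi (L o)).
Proof. by move=> ok; exact: (clf_bmeas P mL cL (box_up ok) (clf_bs a b ok)). Qed.

Lemma bs_decay a lo hi e : box_ok lo hi -> 0 < e ->
  \forall N \near \oo, Ev P (fun o => bs a (- N%:R) lo hi (L o)) < e.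
Proof.
move=> ok e0; have [||w|_ _ h] := @Ev_cvg _ _ _ P (fun N o => bs a (- N%:R) lo hi (L o)) (fun=> 0) 1.
- by move=> N; have [] := bs_bmeas a (- N%:R) ok.
- by move=> N w; have /andP[h1 h2] := bs_bd a (- N%:R) (L w) ok; rewrite ger0_norm.
- have : compact (L w @` box lo hi).
    apply: continuous_compact; last exact: compact_box.
    apply: continuous_in_subspaceT => p /set_mem bp; apply: cL; exact: box_up bp.
  move=> /compact_bounded[B [_ /(_ (B + 1) _)]]; rewrite ltrDl ltr01 => /(_ isT) hB.
  apply: cvg_near_cst; near=> N; apply/eqP; rewrite eq_le.
  have /andP[-> _] := bs_bd a (- N%:R) (L w) ok; rewrite andbT.
  apply: bs_le => // p bp; rewrite ramp0// subr_le0.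
  have hp : `|L w p| <= B + 1 by apply: hB; exists p.
  apply: (@le_trans _ _ (`|a| * (B + 1))).
    by apply: le_trans (ler_norm _) _; rewrite normrM ler_wpM2l.
  by near: N; exact: nbhs_infty_ger.
by rewrite Ev_cst in h; exact: (cvgr_lt _ h).
Unshelve. all: by end_near. Qed.

Lemma bs_null a b lo hi : box_ok lo hi ->
  (forall p, box lo hi p -> Ev P (fun o => ramp (a * L o p + b)) = 0) ->
  Ev P (fun o => bs a b lo hi (L o)) = 0.
Proof.
move=> ok h0; pose g m f := pmax (fun x => ramp (a * x + b)) (enum_pt lo hi) m f.
have rb p : box lo hi p -> bmeas (fun o => ramp (a * L o p + b)).
  move=> bp; apply: (limit_bmeas mL (blip_ramp p a b)) => q; rewrite inE => /eqP ->.
  exact: box_up bp.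
have gb m f : 0 <= g m f <= 1.
  rewrite /g pmax_ge0/=; apply: pmax_le => // k _.
  by have /andP[] := ramp_bd (a * f (enum_pt lo hi k) + b).
have gS m f : g m f <= \sum_(k < m) ramp (a * f (enum_pt lo hi k) + b).
  elim: m => [|m IH]; rewrite /g /= ?big_ord0// big_ord_recr/= ge_max.
  have r0 : 0 <= ramp (a * f (enum_pt lo hi m) + b) by have /andP[] := ramp_bd (a * f (enum_pt lo hi m) + b).
  rewrite (le_trans IH) ?lerDl// lerDr; apply: le_trans IH; exact: pmax_ge0.
have gm m : measurable_fun setT (fun o => g m (L o)).
  apply: (flip_measurable (pmax_flip a b (enum_pt lo hi) m)) => p /mapP[k _ ->].
  by apply: mL; apply: box_up (enum_pt_in k ok).
have gB m : bmeas (fun o => g m (L o)).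
  by split => //; exists 1 => o; have /andP[h1 h2] := gb m (L o); rewrite ger0_norm.
have g0 m : Ev P (fun o => g m (L o)) = 0.
  apply/eqP; rewrite eq_le Ev_ge0 ?andbT; last by move=> o; have /andP[] := gb m (L o).
  apply: le_trans (Ev_le _ (gB m) (Y := fun o => \sum_(k < m) ramp (a * L o (enum_pt lo hi k) + b)) _ _) _.
  - by apply: (bmeas_sum m (F := fun k o => ramp (a * L o (enum_pt lo hi k) + b))) => k; exact/rb/enum_pt_in.
  - by move=> o; exact: gS.
  - by rewrite (Ev_sum P m (F := fun k o => ramp (a * L o (enum_pt lo hi k) + b))) ?big1// => k; [move=> _; exact/h0/enum_pt_in|exact/rb/enum_pt_in].
have [||w|_ _ h] := @Ev_cvg _ _ _ P (fun m o => g m (L o)) (fun o => bs a b lo hi (L o)) 1.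
- by [].
- by move=> m o; have /andP[h1 h2] := gb m (L o); rewrite ger0_norm.
- exact: pmax_bs.
by apply: (@cvg_unique _ (@norm_hausdorff _ _) _ _ _ _ h); rewrite (_ : (fun m => _) = fun=> 0); [exact: cvg_cst|exact/funext].
Qed.

Lemma badS_bmeas s : (forall j, List.In j s -> eok j) -> bmeas (fun o => badS s (L o)).
Proof.
elim: s => [|j s IH] sok; first by under eq_fun do rewrite /badS big_nil.
under eq_fun do rewrite /badS big_cons.
apply: bmeasD; first by apply: bs_bmeas; apply: sok; left.
by apply: IH => k ks; apply: sok; right.
Qed.

Lemma Ev_badS_le s e : (forall j, List.In j s -> eok j /\ Ev P (fun o => ebs j (L o)) <= e) ->
  Ev P (fun o => badS s (L o)) <= (size s)%:R * e.
Proof.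
elim: s => [|j s IH] h.
  by under eq_fun do rewrite /badS big_nil; rewrite Ev_cst mul0r.
under eq_fun do rewrite /badS big_cons.
have [oj ej] := h j (or_introl erefl).
have h' k : List.In k s -> eok k /\ Ev P (fun o => ebs k (L o)) <= e by move=> ks; apply: h; right.
rewrite EvD; first last.
- by apply: badS_bmeas => k /h'[].
- exact: bs_bmeas.
by rewrite -natr1 mulrDl mul1r addrC; apply: lerD => //; exact: IH.
Qed.

Lemma bad_small e : 0 < e -> exists C : nat, forall w th,
  Ev P (fun o => badS (exits w C%:R th) (L o)) <= e.
Proof.
move=> e0; have e1 : 0 < e / 11 by rewrite divr_gt0.
pose B0 : R4 R * R4 R := (((0, 0), (0, 3)), ((0, 0), (0, 3))).
pose B1 : R4 R * R4 R := (((- 1, 0), (0, 2)), ((1, 1), (0, 2))).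
pose B2 : R4 R * R4 R := (((0, - 1), (- 1, 0)), ((0, - 1), (1, 1))).
pose B3 : R4 R * R4 R := (((0, 0), (0, 1)), ((0, 0), (0, 1))).
have [k0 k1 k2 k3] := @exit_boxes_ok R.
have [N [h0 h1 h2 h3]] : exists N : nat, [/\
    Ev P (fun o => bs 1 (- N%:R) B0.1 B0.2 (L o)) < e / 11,
    Ev P (fun o => bs (- 1) (- N%:R) B1.1 B1.2 (L o)) < e / 11,
    Ev P (fun o => bs (- 1) (- N%:R) B2.1 B2.2 (L o)) < e / 11 &
    Ev P (fun o => bs (- 1) (- N%:R) B3.1 B3.2 (L o)) < e / 11].
  have d0 := bs_decay 1 k0 e1; have d1 := bs_decay (- 1) k1 e1.
  have d2 := bs_decay (- 1) k2 e1; have d3 := bs_decay (- 1) k3 e1.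
  have [N _ /(_ N (leqnn N)) [a0 [a1 [a2 a3]]]] := filterI d0 (filterI d1 (filterI d2 d3)).
  by exists N; split; [exact: a0|exact: a1|exact: a2|exact: a3].
exists N => w th.
have key (b : R) : b = th \/ b = - th ->
    (forall x y, y = x + b -> Ev P (fun o => ebs (pt_entry 1 (th ^+ 2 / 3 - N%:R) ((x, -1), (y, 2))) (L o)) <= e / 11).
  move=> hb x y ->; rewrite /ebs /=.
  have sE := @Ev_bs_shift 1 (th ^+ 2 / 3 - N%:R) 0 (- 1) ((x, 0), (x + b, 3)) ((x, 0), (x + b, 3)).
  rewrite (sE ((x, -1), (x + b, 2)) ((x, -1), (x + b, 2))); first last.
  - by apply: tau1_pt; ring.
  - by apply: tau1_pt; ring.
  - by apply: pt_eok (1 : R) (0 : R) _ _; rewrite /R4up/= ltr0n.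
  apply: le_trans (ltW h0); rewrite (_ : (fun o => _) = (fun o => ramp (1 * L o ((x, 0), (x + b, 3)) + (th ^+ 2 / 3 - N%:R)))); last first.
    by apply/funext => o; rewrite bs_point.
  rewrite (ramp_shear gW cvL mL) // le_eqVlt; apply/orP; left; apply/eqP; apply: eq_Ev => o.
  rewrite bs_point /=; congr ramp.
  by case: hb => ->; rewrite ?sqrrN; ring.
have size11 : (size (exits w N%:R th))%:R * (e / 11) = e by rewrite /= mulrC divfK// pnatr_eq0.
rewrite -[leRHS]size11; apply: Ev_badS_le => j js; split; first exact: exits_ok js.
have shf a lo hi x k : box_ok lo hi -> Ev P (fun o => bs a (- N%:R) lo hi (L o)) < e / 11 ->
    forall lo' hi', lo' = tau 1 1 x k lo -> hi' = tau 1 1 x k hi ->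
    Ev P (fun o => ebs (a, - N%:R, (lo', hi')) (L o)) <= e / 11.
  by move=> ok h lo' hi' el eh; rewrite /ebs /= (Ev_bs_shift _ _ ok el eh) ltW.
move: js; rewrite /exits /=.
case=> [<-|]; first by apply: (key th); [left|].
case=> [<-|]; first by apply: (key (- th)); [right|rewrite addrK].
case=> [<-|]; first by apply: (shf _ _ _ (w + th) 0 k1 h1); apply: tau1_pt; ring.
case=> [<-|]; first by apply: (shf _ _ _ (w + th) 0 k2 h2); apply: tau1_pt; ring.
case=> [<-|]; first by apply: (key (- th)); [right|].
case=> [<-|]; first by apply: (key th); [left|rewrite subrK].
case=> [<-|]; first by apply: (shf _ _ _ (w - th) 0 k1 h1); apply: tau1_pt; ring.
case=> [<-|]; first by apply: (shf _ _ _ (w - th) 0 k2 h2); apply: tau1_pt; ring.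
case=> [<-|]; first by apply: (shf _ _ _ w (- 1) k3 h3); apply: tau1_pt; ring.
case=> [<-|]; first by apply: (shf _ _ _ w 1 k3 h3); apply: tau1_pt; ring.
by case=> [<-|//]; apply: (shf _ _ _ w 0 k3 h3); apply: tau1_pt; ring.
Qed.

Lemma badS_lip (s : seq (@entry R)) : (forall j, List.In j s -> eok j) ->
  exists K C, [/\ compacts_R4up K, 0 <= C & forall f g e, 0 < e ->
    (forall p, K p -> `|f p - g p| <= e) -> `|badS s f - badS s g| <= C * e].
Proof.
elim: s => [|j s IH] sok.
  exists set0, 0; split => //; first by split; [exact: compact0|].
  by move=> f g e e0 _; rewrite /badS !big_nil subrr normr0 mul0r.
have [k ks|K [C [[K1 K2] C0 h]]] := IH; first by apply: sok; right.
have ok := sok j (or_introl erefl).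
have [B1 B2] := box_compacts ok.
exists (box j.2.1 j.2.2 `|` K), (`|j.1.1| + C); split.
- by split; [exact: compactU|move=> p [/B2|/K2]].
- by rewrite addr_ge0.
move=> f g e e0 fg; rewrite /badS !big_cons opprD addrACA mulrDl.
apply: le_trans (ler_normD _ _) _; apply: lerD.
  by apply: bs_lip => // p bp; apply: fg; left.
by apply: h => // p Kp; apply: fg; right.
Qed.

(* The events {badS s (L_n) < 1} need not be measurable, hence the minorant h. *)
Lemma good_event s e : (forall j, List.In j s -> eok j) -> Ev P (fun o => badS s (L o)) < e ->
  \forall n \near \oo, exists h : T' -> R, [/\ bmeas h, forall w, 0 <= h w <= 1,
    forall w, 0 < h w -> badS s (Ln n w) < 1 & 1 - e < Ev Q h].
Proof.
move=> sok se; have [K [C [cK C0 lF]]] := badS_lip sok.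
have b0 f : 0 <= badS s f.
  rewrite /badS; elim: s sok {se lF} => [|j s IH] sok; first by rewrite big_nil.
  rewrite big_cons addr_ge0//.
    by have /andP[] := bs_bd j.1.1 j.1.2 f (sok j (or_introl erefl)).
  by apply: IH => k ks; apply: sok; right.
pose F f : R := Num.max 0 (1 - badS s f).
have F01 f : 0 <= F f <= 1 by rewrite /F le_max lexx/= ge_max ler01/= gerBl.
have := limit_functional cvL (K := K) (C := C) (B := 1) (F := F) cK _ _.
have h1 f g e' : 0 < e' -> (forall p, K p -> `|f p - g p| <= e') -> `|F f - F g| <= C * e'.
  move=> e0 fg; rewrite /F; apply: le_trans (distr_max _ _ _ _) _.
  rewrite subrr normr0 add0r (_ : 1 - badS s f - _ = badS s g - badS s f); last by ring.
  by rewrite distrC; exact: lF.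
have h2 f : `|F f| <= 1 by have /andP[f0 f1] := F01 f; rewrite ger0_norm.
move=> /(_ h1 h2) cF.
have bF : bmeas (fun o => 1 - badS s (L o)) by apply: bmeasB => //; exact: badS_bmeas.
have mF : bmeas (fun o => F (L o)).
  by split; [apply: measurable_maxr => //; case: bF|exists 1 => o; exact: h2].
have lt1 : ((1 - e)%:E < \int[P]_w (F (L w))%:E)%E.
  rewrite -(EvE _ mF) lte_fin; apply: lt_le_trans (Ev_le _ bF mF _); last first.
    by move=> o; rewrite le_max lexx orbT.
  by rewrite EvB ?Ev_cst ?ltrD2l ?ltrN2//; exact: badS_bmeas.
have : \forall n \near \oo, ((1 - e)%:E < \int[Q]_w (F (Ln n w))%:E)%E.
  exact: (cF _ (open_nbhs_nbhs (conj (@open_ereal_gt_ereal _ (1 - e)%:E) lt1))).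
apply: filterS => n.
rewrite ge0_integralTE; last by move=> w; rewrite lee_fin; have /andP[] := F01 (Ln n w).
move=> /ereal_sup_gt[_ [h hF <-] hs].
have h01 w : 0 <= h w <= 1.
  by rewrite fun_ge0/=; have := hF w; rewrite lee_fin => /le_trans; apply; have /andP[] := F01 (Ln n w).
have bh : bmeas (h : T' -> R).
  by split => //; exists 1 => w; have /andP[a b] := h01 w; rewrite ger0_norm.
exists h; split => //.
  move=> w hw; have := hF w; rewrite lee_fin => /(lt_le_trans hw).
  by rewrite /F lt_max ltxx/= subr_gt0.
by move: hs; rewrite -integralT_nnsfun -(EvE _ bh) lte_fin.
Qed.

End exit_events.

Section products_over_sequences.
Context {R : realType}.

Lemma cvg_prod_seq (I : eqType) (s : seq I) (f : I -> nat -> R) (l : I -> R) :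
  (forall i, i \in s -> f i m @[m --> \oo] --> l i) ->
  \prod_(i <- s) f i m @[m --> \oo] --> \prod_(i <- s) l i.
Proof.
elim: s => [|i s IH] h.
  by rewrite big_nil; under eq_fun do rewrite big_nil; exact: cvg_cst.
rewrite big_cons; under eq_fun do rewrite big_cons.
apply: cvgM; first by apply: h; rewrite mem_head.
by apply: IH => j js; apply: h; rewrite inE js orbT.
Qed.

Lemma bmeas_prod (d : measure_display) (T : measurableType d) (I : eqType) (s : seq I)
    (f : I -> T -> R) : (forall i, i \in s -> bmeas (f i)) ->
  bmeas (fun w => \prod_(i <- s) f i w).
Proof.
elim: s => [|i s IH] h; first by under eq_fun do rewrite big_nil.
under eq_fun do rewrite big_cons.
apply: bmeasM; first by apply: h; rewrite mem_head.
by apply: IH => j js; apply: h; rewrite inE js orbT.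
Qed.

Lemma prod_itv01 (I : eqType) (s : seq I) (f : I -> R) :
  (forall i, i \in s -> 0 <= f i <= 1) -> 0 <= \prod_(i <- s) f i <= 1.
Proof.
move=> h; rewrite big_seq; elim/big_ind: _ => [|x y /andP[x0 x1] /andP[y0 y1]|i /h//].
  by rewrite ler01 lexx.
by rewrite mulr_ge0//= mulr_ile1.
Qed.

Lemma blip_prod_seq (J I : eqType) (s : seq I) (cells : I -> seq J) (G : I -> (J -> R) -> R) :
  (forall i, i \in s -> blip (cells i) (G i)) ->
  blip (flatten (map cells s)) (fun v => \prod_(i <- s) G i v).
Proof.
elim: s => [|i s IH] h; first by under eq_fun do rewrite big_nil; exact: blip_cst.
under eq_fun do rewrite big_cons.
apply: blipM.
  apply: (blip_sub (l := cells i)); last by apply: h; rewrite mem_head.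
  by move=> c ci; rewrite /= mem_cat ci.
apply: (blip_sub (l := flatten (map cells s))); first by move=> c ci; rewrite /= mem_cat ci orbT.
by apply: IH => j js; apply: h; rewrite inE js orbT.
Qed.

Lemma Ex_prod_seq (J I : eqType) (N : probability R R) (l : seq J) (s : seq I)
    (cells : I -> seq J) (G : I -> (J -> R) -> R) u :
  (forall i, i \in s -> blip (cells i) (G i)) ->
  pairwise (fun i j => ~~ has (mem (cells i)) (cells j)) s ->
  Ex N l (fun v => \prod_(i <- s) G i v) u = \prod_(i <- s) Ex N l (G i) u.
Proof.
elim: s => [|i s IH] h.
  by move=> _; rewrite big_nil; under eq_fun do rewrite big_nil; rewrite Ex_cst.
rewrite pairwise_cons => /andP[/allP hi hs]; rewrite big_cons.
have hs' j : j \in s -> blip (cells j) (G j) by move=> js; apply: h; rewrite inE js orbT.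
under eq_fun do rewrite big_cons.
rewrite (@Ex_prod _ _ N l _ _ (G i) _ u (h i (mem_head _ _)) (blip_prod_seq hs')) ?IH//.
move=> c ci /flattenP[_ /mapP[j js ->] cj].
by have /negP := hi j js; apply; apply/hasP; exists c.
Qed.

End products_over_sequences.

Section tubes.
Context {R : realType}.
Implicit Types (V : int -> R -> R) (n m : nat) (w th : R).

Lemma pok01 n w : (0 < n)%N -> pok n ((w, 0), (w, 1)).
Proof. by move=> n0; rewrite /pok /= lo0 lo1 ltz_nat n0 /cx /= lerD2r ler01. Qed.

Lemma cx01 n w : cx n (w, 0) <= cx n (w, 1).
Proof. by rewrite /cx /= lerD2r ler01. Qed.

Lemma landscape01 V n w : landscape_n V n ((w, 0), (w, 1)) =
  rt6 n * LPP V 0 n (cx n (w, 0)) (cx n (w, 1)) - 2 * rt6 n ^+ 4.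
Proof.
rewrite landscape_nE /= ?lo0 ?lo1 ?lez_nat//.
have -> : dl n ((w, 0), (w, 1)) = n by rewrite /dl /= lo0 lo1 subr0.
by congr (_ - _); rewrite !subr0 subrr; ring.
Qed.

Lemma xco_le n i (u v : R) : u <= v -> xco n i u <= xco n i v.
Proof.
move=> uv; rewrite /xco ler_wpM2r// ler_wpM2r ?exprn_ge0 ?rt6_ge0//.
by rewrite lerD2r.
Qed.

Definition tubeG n m w th : set (nat -> nat) :=
  [set k | gpath n (idx m (cx n (w, 0))) (idx m (cx n (w, 1))) k /\
    forall i, (i <= n)%N -> `|xco n i (tick m (k i)) - w| <= th + 1].

Definition tubeD n m w th (i c : nat) : bool :=
  - (th + 1) <= xco n i (tick m c) - w <= th + 2.

Definition tube_cells n m w th :=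
  gcells (tubeD n m w th) 0 n (idx m (cx n (w, 0))) (idx m (cx n (w, 1))).

Definition tubeY n m w th xi : R := rt6 n * gsup (tubeG n m w th) 0 n xi - 2 * rt6 n ^+ 4.

Lemma tube_fits n m w th k : (0 < n)%N -> 1 <= rt6 n :> R -> tubeG n m w th k ->
  fits (tubeD n m w th) n k.
Proof.
move=> n0 r1 [hk ht] i c i_n /andP[c1 c2]; rewrite /tubeD.
have tm k1 k2 : (k1 <= k2)%N -> tick m k1 <= tick m k2 :> R.
  by move=> h; rewrite /tick lerD2l ler_wpM2l// ler_nat.
have := ht i (ltnW i_n); rewrite ler_norml => /andP[h1 _].
have := ht i.+1 i_n; rewrite ler_norml => /andP[_ h2].
have h3 : xco n i (tick m c) <= xco n i (tick m (k i.+1)) :> R by apply/xco_le/tm/ltnW.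
have h4 := @xco_step _ n i (fun=> tick m (k i.+1)) n0 r1 (lexx _).
have h5 : xco n i (tick m (k i)) <= xco n i (tick m c) :> R by apply/xco_le/tm.
apply/andP; split.
  by apply: le_trans h1 _; rewrite lerD2r.
by move: h2 h3 h4; lra.
Qed.

Lemma tube_disjoint n m w w' th : w + (2 * th + 3) < w' ->
  ~~ has (mem (tube_cells n m w th)) (tube_cells n m w' th).
Proof.
move=> ww; apply/hasPn => c /mem_gcells[i [_ e1 _ /andP[h1 h2]]].
apply/negP => /mem_gcells[j [_ e2 _ /andP[h3 h4]]].
have ij : i = j by move: e1; rewrite e2 !add0r => -[].
by move: h1 h2 h3 h4; rewrite ij; lra.
Qed.

Lemma tube_path_near n w th : (0 < n)%N -> \forall m \near \oo,
  forall z, npath n (cx n (w, 0)) (cx n (w, 1)) z ->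
  (forall i, (i <= n)%N -> `|xco n i (z i) - w| <= th) ->
  forall i, (i <= n)%N -> `|xco n i (tick m (idx m (z i))) - w| <= th + 1.
Proof.
move=> n0; near=> m => z hz hth i i_n.
have zm : - m.+1%:R <= z i.
  have /andP[h _] := npath_itv hz i_n; apply: le_trans h.
  rewrite lerNl (le_trans (ler_norm _))// normrN (@le_trans _ _ m%:R) ?ler_nat//.
  by near: m; exact: nbhs_infty_ger.
have hm : rt6 n ^+ 2 <= m%:R :> R by near: m; exact: nbhs_infty_ger.
have /andP[h1 h2] := idxP zm.
have d0 : 0 <= z i - tick m (idx m (z i)) <= m.+1%:R^-1.
  by rewrite subr_ge0 h1 lerBlDl ltW.
have -> : xco n i (tick m (idx m (z i))) - w = xco n i (z i) - w -
    (z i - tick m (idx m (z i))) * rt6 n ^+ 2 / 2 by rewrite /xco; ring.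
apply: le_trans (ler_normB _ _) _; apply: lerD; first exact: hth.
have /andP[d1 d2] := d0.
rewrite ger0_norm; last by rewrite divr_ge0// mulr_ge0// exprn_ge0// rt6_ge0.
rewrite ler_pdivrMr// mul1r.
apply: (@le_trans _ _ (m.+1%:R^-1 * m%:R)).
  by apply: ler_pM => //; rewrite exprn_ge0// rt6_ge0.
rewrite ler_pdivrMl// mulr_natr; apply: (@le_trans _ _ m.+1%:R); first by rewrite ler_nat.
by rewrite mulr2n lerDl.
Unshelve. all: by end_near. Qed.

Lemma tubeG_neq0 n w th : (0 < n)%N -> 0 <= th -> \forall m \near \oo, tubeG n m w th !=set0.
Proof.
move=> n0 th0; have r0 := rt6_gt0 (R := R) n0.
have n0R : 0 < n%:R :> R by rewrite ltr0n.
pose z (i : nat) : R := i%:R / n%:R + 2 * w / rt6 n ^+ 2.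
have hz : npath n (cx n (w, 0)) (cx n (w, 1)) z.
  split; rewrite /z /cx /= ?mul0r// ?divff ?gt_eqF// => i _.
  by rewrite lerD2r ler_wpM2r ?invr_ge0 ?(ltW n0R)// ler_nat.
have xz i : xco n i (z i) = w by rewrite /xco /z; field; rewrite !gt_eqF.
have gc := @grid_close _ (fun _ _ => 0) 0 n _ _ _ (fun _ => @cst_continuous _ _ 0) n0 (cx01 n w) ltr01.
apply: filterS2 gc (tube_path_near w th n0) => m [h1 _] h2.
have [h3 _] := h1 z hz; exists (idx m \o z); split => // i i_n.
by apply: h2 => // j _; rewrite xz subrr normr0.
Qed.

Lemma near_optimal_path V n w (C th e : R) : (forall j, continuous (V j)) -> (0 < n)%N ->
  2 <= rt6 n :> R -> 0 <= th -> 7 * (C + 1) + 1 < 2 * th ^+ 2 / 3 ->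
  badS (exits w C th) (landscape_n V n) < 1 -> 0 < e <= 1 ->
  exists z, [/\ npath n (cx n (w, 0)) (cx n (w, 1)) z,
    landscape_n V n ((w, 0), (w, 1)) - e < rt6 n * lppn V 0 n z - 2 * rt6 n ^+ 4 &
    forall i, (i <= n)%N -> `|xco n i (z i) - w| <= th].
Proof.
move=> cV n0 r2 th0 hth bad /andP[e0 e1]; have r0 := rt6_gt0 (R := R) n0.
set X := landscape_n V n _.
have XE : X = _ := landscape01 V n w; set A := LPP V 0 n _ _ in XE.
have dt0 : 0 < e / rt6 n by rewrite divr_gt0.
have [z hz Az] : exists2 z, npath n (cx n (w, 0)) (cx n (w, 1)) z & A - e / rt6 n < lppn V 0 n z.
  apply: contrapT => h; have : A <= A - e / rt6 n.
    apply: LPP_le => //; first exact: cx01.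
    by move=> z hz; rewrite leNgt; apply/negP => h'; apply: h; exists z.
  by rewrite lerDl oppr_ge0 leNgt dt0.
have rA : rt6 n * A - e < rt6 n * lppn V 0 n z.
  by move: Az; rewrite -(ltr_pM2l r0) mulrBr mulrCA divff ?gt_eqF// mulr1.
exists z; split => //; first by rewrite XE addrAC ltrD2r.
move=> i i_n; rewrite leNgt; apply/negP => h.
have := exit_bound cV n0 r2 th0 bad hz (ex_intro2 _ _ i i_n h).
rewrite -/X; move: XE rA hth; set a := rt6 n * A; set c := rt6 n * lppn _ _ _ _.
by set q := th ^+ 2; set r4 := rt6 n ^+ 4; lra.
Qed.

Lemma tubeY_ge_near V n w (C th e : R) : (forall j, continuous (V j)) -> (0 < n)%N ->
  2 <= rt6 n :> R -> 0 <= th -> 7 * (C + 1) + 1 < 2 * th ^+ 2 / 3 ->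
  badS (exits w C th) (landscape_n V n) < 1 -> 0 < e -> \forall m \near \oo,
  landscape_n V n ((w, 0), (w, 1)) <= tubeY n m w th (gin V m) + e.
Proof.
move=> cV n0 r2 th0 hth bad e0; have r0 := rt6_gt0 (R := R) n0.
have r1 : 1 <= rt6 n :> R by apply: le_trans r2; rewrite ler1n.
pose M := Num.min (e / 2) 1.
have M01 : 0 < M <= 1 by rewrite lt_min divr_gt0// ltr01/= ge_min lexx orbT.
have [z [hz Xz zth]] := near_optimal_path cV n0 r2 th0 hth bad M01.
have dt0 : 0 < e / 2 / rt6 n by rewrite !divr_gt0.
have gc := grid_close 0 cV n0 (cx01 n w) dt0.
apply: filterS2 gc (tube_path_near w th n0) => m [/(_ z hz)[h1 h1'] _] h2.
have Gz : tubeG n m w th (idx m \o z) by split => //; exact: h2.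
have ub : gval 0 n (idx m \o z) (gin V m) <= gsup (tubeG n m w th) 0 n (gin V m).
  apply: ub_le_sup; last by exists (idx m \o z).
  apply: (gval_ubound (D := tubeD n m w th) 0 _ (k0 := idx m (cx n (w, 0))) (k1 := idx m (cx n (w, 1)))).
    by move=> k [].
  by move=> k; exact: tube_fits.
have h3 : rt6 n * lppn V 0 n z <= rt6 n * gsup (tubeG n m w th) 0 n (gin V m) + e / 2.
  have -> : e / 2 = rt6 n * (e / 2 / rt6 n) by rewrite mulrCA divff ?gt_eqF// mulr1.
  by rewrite -mulrDr ler_pM2l// (le_trans h1')// lerD2r.
have : M <= e / 2 by rewrite ge_min lexx.
rewrite /tubeY; move: Xz h3; set X := landscape_n V n _; set c := rt6 n * lppn _ _ _ _.
by set r4 := rt6 n ^+ 4; set g := rt6 n * gsup _ _ _ _; lra.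
Qed.

Lemma tubeY_le_near V n w (th e : R) : (forall j, continuous (V j)) -> (0 < n)%N -> 0 <= th ->
  0 < e -> \forall m \near \oo, tubeY n m w th (gin V m) <= landscape_n V n ((w, 0), (w, 1)) + e.
Proof.
move=> cV n0 th0 e0; have r0 := rt6_gt0 (R := R) n0.
have dt0 : 0 < e / rt6 n by rewrite divr_gt0.
have gc := grid_close 0 cV n0 (cx01 n w) dt0.
apply: filterS2 gc (tubeG_neq0 w n0 th0) => m [_ h1] G0.
rewrite landscape01 /tubeY -[leRHS]addrAC lerD2r -ler_pdivlMl//.
apply: ge_sup; first by case: G0 => k Gk; exists (gval 0 n k (gin V m)); exists k.
move=> _ [k [hk _] <-]; have [z hz h2] := h1 k hk.
rewrite mulrDr mulKf ?gt_eqF// [_^-1 * e]mulrC (le_trans h2)// lerD2r.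
exact: LPP_ge.
Qed.

Lemma tube_blip n w th (a b : R) : (0 < n)%N -> 1 <= rt6 n :> R -> 0 <= th ->
  \forall m \near \oo, blip (tube_cells n m w th) (fun xi => ramp (a * tubeY n m w th xi + b)).
Proof.
move=> n0 r1 th0; apply: filterS (tubeG_neq0 w n0 th0) => m G0.
apply: (blip_comp (phi := fun x => ramp (a * x + b)) (k := `|a|) (B := 1)) => //.
- by move=> x y; exact: ramp_affine_lip.
- by move=> x; exact: ramp_norm.
apply: flipB; last exact: flip_cst.
apply: flipZ; exists 1; apply: gsup_lipK => //; first by move=> k [].
by move=> k; exact: tube_fits.
Qed.

End tubes.

Section tube_products.
Context {R : realType} {d' : measure_display} {T' : measurableType d'} (Q : probability T' R)
  (W : int -> T' -> R -> R).
Hypothesis gW : genv Q W.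
Let Ln n w := landscape_n (fun j => W j w) n.
Let X n (w : R) o := Ln n o ((w, 0), (w, 1)).

Lemma tube_products n (a b C th e : R) (ws : seq R) (h : R -> T' -> R) : (0 < n)%N ->
  2 <= rt6 n :> R -> 0 <= a -> 0 <= th -> 7 * (C + 1) + 1 < 2 * th ^+ 2 / 3 ->
  pairwise (fun w w' => w + (2 * th + 3) < w') ws ->
  (forall w, w \in ws -> [/\ bmeas (h w), forall o, 0 <= h w o <= 1,
    forall o, 0 < h w o -> badS (exits w C th) (Ln n o) < 1 & 1 - e < Ev Q (h w)]) ->
  Ev Q (fun o => \prod_(w <- ws) ramp (- a * X n w o + b)) <=
  \prod_(w <- ws) (Ev Q (fun o => ramp (- a * X n w o + b)) + e).
Proof.
move=> n0 r2 a0 th0 hth pw hh.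
have r1 : 1 <= rt6 n :> R by apply: le_trans r2; rewrite ler1n.
pose phi x : R := ramp (- a * x + b).
pose Y m w o := tubeY n m w th (gin (fun j => W j o) m).
have cW o j : continuous (W j o) by exact: (genv_cont gW).
have phi01 x : 0 <= phi x <= 1 by exact: ramp_bd.
have phil x y : `|phi x - phi y| <= `|- a| * `|x - y| by exact: ramp_affine_lip.
have bX w : bmeas (fun o => phi (X n w o)).
  apply: (landscape_bmeas gW (blip_ramp ((w, 0), (w, 1)) (- a) b)) => p.
  by rewrite inE => /eqP ->; exact: pok01.
have bY w : \forall m \near \oo, bmeas (fun o => phi (Y m w o)).
  apply: filterS (tube_blip w (- a) b n0 r1 th0) => m [fY _]; split.
    by apply: (flip_measurable fY) => c _; exact: (gin_measurable gW).
  by exists 1 => o; exact: ramp_norm.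
have [m1 bY1] : exists m1, forall m, (m1 <= m)%N -> forall w, w \in ws -> bmeas (fun o => phi (Y m w o)) /\
    blip (tube_cells n m w th) (fun xi => phi (tubeY n m w th xi)).
  elim: (ws) => [|w s [m1 IH]]; first by exists 0%N.
  have [m2 _ h2] := filterI (bY w) (tube_blip w (- a) b n0 r1 th0).
  exists (maxn m1 m2) => m; rewrite geq_max => /andP[l1 l2] w'; rewrite inE => /orP[/eqP ->|ws'].
    exact: h2.
  exact: IH.
pose lo m w o := Num.min (phi (X n w o)) (phi (Y m w o)).
pose up m w o := Num.max (phi (X n w o)) (phi (Y m w o)) * h w o.
have del e' : 0 < e' -> exists2 dt, 0 < dt & `|- a| * dt <= e'.
  move=> e0; exists (e' / (`|a| + 1)); first by rewrite divr_gt0// ltr_wpDl.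
  rewrite normrN mulrCA; apply: ler_piMr; first exact: ltW.
  by rewrite ler_pdivrMr ?ltr_wpDl// mul1r lerDl.
have phi_anti x y : x <= y -> phi y <= phi x.
  by move=> xy; apply: ramp_mono; rewrite lerD2r !mulNr lerN2 ler_wpM2l.
have phi_step x y dt e' : 0 < dt -> `|- a| * dt <= e' -> x <= y + dt -> phi y <= phi x + e'.
  move=> dt0 de xy; apply: le_trans (phi_anti _ _ (_ : x - dt <= y)) _; first by rewrite lerBlDr.
  rewrite -lerBlDl; apply: le_trans (ler_norm _) _; apply: le_trans (phil _ _) _.
  rewrite (_ : x - dt - x = - dt); last by ring.
  by rewrite (normrN dt) (gtr0_norm dt0).
have lo_cvg w o : lo m w o @[m --> \oo] --> phi (X n w o).
  apply/cvgrPdist_le => e' e0; have [dt dt0 de] := del e' e0.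
  apply: filterS (tubeY_le_near w (cW o) n0 th0 dt0) => m h1.
  have h2 := phi_step _ _ _ _ dt0 de h1.
  rewrite /lo ger0_norm ?subr_ge0 ?ge_min ?lexx// lerBlDr -lerBlDl le_min.
  by rewrite lerBlDr lerDl (ltW e0)/= lerBlDr.
have up_cvg w o : w \in ws -> up m w o @[m --> \oo] --> phi (X n w o) * h w o.
  move=> ws_w; have [_ h01 hbad _] := hh w ws_w; have /andP[] := h01 o.
  rewrite le_eqVlt => /orP[/eqP h0 _|h0 _].
    by rewrite /up -h0 mulr0; under eq_fun do rewrite mulr0; exact: cvg_cst.
  apply: cvgMl; apply/cvgrPdist_le => e' e0; have [dt dt0 de] := del e' e0.
  apply: filterS (tubeY_ge_near (cW o) n0 r2 th0 hth (hbad o h0) dt0) => m h1.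
  have h2 := phi_step _ _ _ _ dt0 de h1.
  have hm : phi (X n w o) <= Num.max (phi (X n w o)) (phi (Y m w o)) by rewrite le_max lexx.
  rewrite distrC ger0_norm ?subr_ge0//.
  by rewrite lerBlDl ge_max lerDl (ltW e0)/=.
have mlo m w : (m1 <= m)%N -> w \in ws -> bmeas (fun o => lo m w o).
  move=> mm ww; have [[mY _] _] := bY1 m mm w ww; split.
    by apply: measurable_minr => //; case: (bX w).
  exists 1 => o; rewrite ger0_norm; last by rewrite le_min; have /andP[-> _] := phi01 (X n w o); have /andP[-> _] := phi01 (Y m w o).
  by rewrite ge_min; have /andP[_ ->] := phi01 (X n w o).
have mmax m w : (m1 <= m)%N -> w \in ws -> bmeas (fun o => Num.max (phi (X n w o)) (phi (Y m w o))).
  move=> mm ww; have [[mY _] _] := bY1 m mm w ww; split.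
    by apply: measurable_maxr => //; case: (bX w).
  exists 1 => o; rewrite ger0_norm; last by rewrite le_max; have /andP[-> _] := phi01 (X n w o).
  by rewrite ge_max; have /andP[_ ->] := phi01 (X n w o); have /andP[_ ->] := phi01 (Y m w o).
have mup m w : (m1 <= m)%N -> w \in ws -> bmeas (fun o => up m w o).
  by move=> mm ww; apply: bmeasM; [exact: mmax|case: (hh w ww)].
have up01 m w o : w \in ws -> 0 <= up m w o <= 1.
  move=> ww; have [_ h01 _ _] := hh w ww; have /andP[h0 h1] := h01 o.
  rewrite /up mulr_ge0//=; last by rewrite le_max; have /andP[-> _] := phi01 (X n w o).
  rewrite mulr_ile1//; first by rewrite le_max; have /andP[-> _] := phi01 (X n w o).
  by rewrite ge_max; have /andP[_ ->] := phi01 (X n w o); have /andP[_ ->] := phi01 (Y m w o).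
have lo01 m w o : 0 <= lo m w o <= 1.
  rewrite /lo le_min; have /andP[-> h1] := phi01 (X n w o); have /andP[-> _] := phi01 (Y m w o).
  by rewrite /= ge_min h1.
have [||o|_ _ cL] := @Ev_cvg _ _ _ Q (fun m o => \prod_(w <- ws) lo (m + m1)%N w o)
  (fun o => \prod_(w <- ws) phi (X n w o)) 1.
- move=> m; suff [] : bmeas (fun o => \prod_(w <- ws) lo (m + m1)%N w o) by [].
  by apply: (bmeas_prod (f := fun w o => lo (m + m1)%N w o)) => w ww; apply: mlo; rewrite ?leq_addl.
- move=> m o; have /andP[p0 p1] := @prod_itv01 _ _ ws (fun w => lo (m + m1)%N w o) (fun w _ => lo01 _ w o).
  by rewrite ger0_norm.
- apply: (cvg_prod_seq (f := fun w m => lo (m + m1)%N w o)) => w ww.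
  by rewrite (cvg_shiftn m1 (fun m => lo m w o)); exact: lo_cvg.
have cU : \prod_(w <- ws) (Ev Q (fun o => up (m + m1)%N w o) + (1 - Ev Q (h w))) @[m --> \oo] -->
    \prod_(w <- ws) (Ev Q (fun o => phi (X n w o) * h w o) + (1 - Ev Q (h w))).
  apply: (cvg_prod_seq (f := fun w m => Ev Q (fun o => up (m + m1)%N w o) + (1 - Ev Q (h w)))) => w ww.
  apply: cvgD; last exact: cvg_cst.
  have [||o|_ _ //] := @Ev_cvg _ _ _ Q (fun m o => up (m + m1)%N w o)
    (fun o => phi (X n w o) * h w o) 1.
  - by move=> m; have [] := mup (m + m1)%N w (leq_addl _ _) ww.
  - by move=> m o; have /andP[u0 u1] := up01 (m + m1)%N w o ww; rewrite ger0_norm.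
  - by rewrite (cvg_shiftn m1 (fun m => up m w o)); exact: up_cvg.
have step m : Ev Q (fun o => \prod_(w <- ws) lo (m + m1)%N w o) <=
    \prod_(w <- ws) (Ev Q (fun o => up (m + m1)%N w o) + (1 - Ev Q (h w))).
  have mm : (m1 <= m + m1)%N by rewrite leq_addl.
  have bl w : w \in ws -> blip (tube_cells n (m + m1) w th) (fun xi => phi (tubeY n (m + m1) w th xi)).
    by move=> ww; have [_] := bY1 _ mm w ww.
  apply: (@le_trans _ _ (Ev Q (fun o => \prod_(w <- ws) phi (Y (m + m1)%N w o)))).
    apply: Ev_le.
    - by apply: (bmeas_prod (f := fun w o => lo (m + m1)%N w o)) => w ww; exact: mlo.
    - by apply: (bmeas_prod (f := fun w o => phi (Y (m + m1)%N w o))) => w ww; have [] := bY1 _ mm w ww.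
    - move=> o; apply: ler_prod => w _; have /andP[-> _] := lo01 (m + m1)%N w o.
      by rewrite /lo /= ge_min lexx orbT.
  pose l := undup (flatten (map (fun w => tube_cells n (m + m1) w th) ws)).
  have law l0 (G : (int * nat -> R) -> R) : blip l0 G -> {subset l0 <= l} ->
      Ev Q (fun o => G (gin (fun j => W j o) (m + m1))) = Ex (gauss (m + m1).+1%:R^-1) l G (fun=> 0).
    by move=> bG sl; apply: (genv_law gW _ _ _ _ sl bG); [rewrite invr_gt0 ltr0n|exact: undup_uniq].
  have pw' : pairwise (fun w w' => ~~ has (mem (tube_cells n (m + m1) w th)) (tube_cells n (m + m1) w' th)) ws.
    by apply: sub_pairwise pw => w w'; exact: tube_disjoint.
  rewrite (law _ _ (blip_prod_seq bl)); last by move=> c; rewrite mem_undup.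
  rewrite (Ex_prod_seq _ _ _ bl pw') big_seq [leRHS]big_seq.
  apply: ler_prod => w ww; rewrite -(law _ _ (bl w ww)); last first.
    by move=> c cw; rewrite mem_undup; apply/flattenP; exists (tube_cells n (m + m1) w th) => //; apply/mapP; exists w.
  rewrite Ev_ge0 /=; last by move=> o; have /andP[] := phi01 (Y (m + m1)%N w o).
  have [bh h01 _ _] := hh w ww.
  have b1h : bmeas (fun o => 1 - h w o) by apply: bmeasB.
  rewrite -[X in _ <= _ + (X - _)](Ev_cst Q 1) -EvB// -EvD//; last exact: mup.
  apply: Ev_le; first by have [] := bY1 _ mm w ww.
    by apply: bmeasD => //; exact: mup.
  move=> o; rewrite /up; have /andP[h0 h1] := h01 o.
  have /andP[y0 y1] := phi01 (Y (m + m1)%N w o).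
  apply: (@le_trans _ _ (phi (Y (m + m1)%N w o) * h w o + (1 - h w o))).
    rewrite -subr_ge0 (_ : _ - _ = (1 - phi (Y (m + m1)%N w o)) * (1 - h w o)); last by rewrite /Y; ring.
    by rewrite mulr_ge0// subr_ge0.
  by rewrite lerD2r ler_wpM2r// le_max lexx orbT.
apply: le_trans (ler_cvg_to cL cU _) _; first by near=> m; exact: step.
rewrite big_seq [leRHS]big_seq; apply: ler_prod => w ww.
have [bh h01 _ he] := hh w ww.
have eh1 : Ev Q (h w) <= 1.
  by rewrite -[leRHS](Ev_cst Q 1); apply: Ev_le => // o; have /andP[] := h01 o.
rewrite addr_ge0 ?subr_ge0//=; last by apply: Ev_ge0 => o; rewrite mulr_ge0//; [have /andP[] := phi01 (X n w o)|have /andP[] := h01 o].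
apply: lerD; last by rewrite lerBlDr addrC -lerBlDr ltW.
apply: (Ev_le _ (Y := fun o => phi (X n w o))); [exact: bmeasM|exact: bX|].
by move=> o; rewrite ler_piMr//; [have /andP[] := phi01 (X n w o)|have /andP[] := h01 o].
Unshelve. all: by end_near. Qed.

End tube_products.

Lemma near_seq (I : eqType) (s : seq I) (A : I -> nat -> Prop) :
  (forall i, i \in s -> \forall n \near \oo, A i n) ->
  \forall n \near \oo, forall i, i \in s -> A i n.
Proof.
elim: s => [|i s IH] h; first by near=> n.
have h1 := h i (mem_head _ _).
have h2 := IH (fun j js => h j (mem_behead (s := i :: s) js)).
apply: filterS2 h1 h2 => n a1 a2 j.
by rewrite inE => /orP[/eqP ->|/a2].
Unshelve. all: by end_near. Qed.

Lemma wide_tube (R : realType) (c : R) : 0 <= c ->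
  7 * (c + 1) + 1 < 2 * (4 * (c + 1)) ^+ 2 / 3.
Proof.
move=> c0; have : 0 <= c * c by rewrite mulr_ge0.
have -> : (4 * (c + 1)) ^+ 2 = 16 * (c * c) + 32 * c + 16 by ring.
by set c2 := c * c => h; lra.
Qed.

Section null_expectations.
Context {R : realType} {d : measure_display} {T : measurableType d} (P : probability T R).

Lemma Ev0_ae (X : T -> R) : bmeas X -> (forall w, 0 <= X w) -> Ev P X = 0 ->
  {ae P, forall w, X w = 0}.
Proof.
move=> bX X0 h; have mX : measurable_fun setT (EFin \o X) by apply/measurable_EFinP; case: bX.
have := (ae_eq_integral_abs P measurableT mX).1.
rewrite (_ : (\int[P]_x _)%E = 0%E); last first.
  rewrite -[RHS]/(0%:E) -h (EvE _ bX); apply: eq_integral => w _ /=.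
  by rewrite ger0_norm.
move=> /(_ erefl); rewrite /ae_eq; apply: filterS => w /(_ Logic.I) /= [].
by [].
Qed.

Definition cdf (X : T -> R) (c : R) : R := Ev P (fun w => (X w <= c)%R%:R).

Lemma bmeas_le (X : T -> R) c : measurable_fun setT X -> bmeas (fun w => (X w <= c)%R%:R : R).
Proof.
move=> mX; rewrite (_ : (fun w => _) = \1_[set w | X w <= c]); last first.
  by apply/funext => w; rewrite indicE mem_setE.
apply: bmeas_indic; rewrite -[X in measurable X]setTI.
exact: (measurable_fun_le measurableT mX (measurable_cst c)).
Qed.

Lemma cdf_ge0 X c : 0 <= cdf X c. Proof. by apply: Ev_ge0. Qed.

Lemma cdf_le1 X c : measurable_fun setT X -> cdf X c <= 1.
Proof.
move=> mX; rewrite -[leRHS](Ev_cst P 1); apply: Ev_le => //; first exact: bmeas_le.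
by move=> w; case: (X w <= c)%R.
Qed.

Lemma cdf_ex (X : T -> R) : measurable_fun setT X ->
  (exists c, 0 < cdf X c) /\ exists c, cdf X c < 1.
Proof.
move=> mX; have bd c w : `|(X w <= c)%R%:R : R| <= 1 by case: (X w <= c)%R; rewrite ?normr1 ?normr0.
have mm c : measurable_fun setT (fun w => (X w <= c)%R%:R : R) by case: (bmeas_le c mX).
have tr (x : R) : \forall j \near \oo, `|x| < j%:R by near=> j; near: j; exact: nbhs_infty_gtr.
split.
- have [||w|_ _ h] := @Ev_cvg _ _ _ P (fun j w => (X w <= j%:R)%R%:R) (fun=> 1) 1.
  + by move=> j; exact: mm.
  + by move=> j w; exact: bd.
  + apply: cvg_near_cst; apply: filterS (tr (X w)) => j hj.
    by rewrite (le_trans (ler_norm _) (ltW hj)).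
  rewrite Ev_cst in h; have [j _ hj] := cvgr_gt _ h _ (ltr01 : (0 : R) < 1).
  by exists j%:R; exact: (hj j (leqnn _)).
- have [||w|_ _ h] := @Ev_cvg _ _ _ P (fun j w => (X w <= - j%:R)%R%:R) (fun=> 0) 1.
  + by move=> j; exact: mm.
  + by move=> j w; exact: bd.
  + apply: cvg_near_cst; apply: filterS (tr (X w)) => j; rewrite -normrN => hj.
    by rewrite leNgt ltrNl (le_lt_trans (ler_norm _) hj).
  rewrite Ev_cst in h; have [j _ hj] := cvgr_lt _ h _ (ltr01 : (0 : R) < 1).
  by exists (- j%:R); exact: (hj j (leqnn _)).
Unshelve. all: by end_near. Qed.

Lemma two_values (X : T -> R) : measurable_fun setT X ->
  (forall k, ~ {ae P, forall w, X w = k}) ->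
  exists c1 c2, [/\ c1 < c2, 0 < cdf X c1 & cdf X c2 < 1].
Proof.
move=> mX nk; apply: contrapT => hn.
have dich c c' : c < c' -> 0 < cdf X c -> cdf X c' = 1.
  move=> cc h; apply/eqP; rewrite eq_le cdf_le1//= leNgt; apply/negP => h'.
  by apply: hn; exists c, c'.
have [[c0 h0] [c1 h1]] := cdf_ex mX.
pose A := [set c | 0 < cdf X c].
have lbA : lbound A c1.
  move=> c Ac; rewrite leNgt; apply/negP => cc.
  by move: h1; rewrite (dich _ _ cc Ac) ltxx.
have iA : has_inf A by split; [exists c0|exists c1].
apply: (nk (inf A)).
have j0 j : 0 < j.+1%:R^-1 :> R by rewrite invr_gt0.
have up : {ae P, forall w, forall j : nat, X w <= inf A + j.+1%:R^-1}.
  apply: ae_foralln => j; have [c Ac lc] := inf_adherent (j0 j) iA.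
  have := Ev0_ae (X := fun w => 1 - (X w <= inf A + j.+1%:R^-1)%R%:R) _ _ _.
  rewrite EvB//; last exact: bmeas_le.
  rewrite -/(cdf X _) (dich _ _ lc Ac) Ev_cst subrr.
  have b1 : bmeas (fun w => 1 - (X w <= inf A + j.+1%:R^-1)%R%:R : R).
    by apply: bmeasB => //; exact: bmeas_le.
  have p1 w : 0 <= 1 - (X w <= inf A + j.+1%:R^-1)%R%:R :> R by case: (X w <= _)%R; rewrite ?subrr ?subr0.
  move=> /(_ b1 p1 erefl); apply: filterS => w.
  by case: (_ <= _)%R => // /eqP; rewrite subr0 oner_eq0.
have lw : {ae P, forall w, forall j : nat, inf A - j.+1%:R^-1 < X w}.
  apply: ae_foralln => j.
  have h : cdf X (inf A - j.+1%:R^-1) = 0.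
    apply/eqP; rewrite eq_le cdf_ge0 andbT leNgt; apply/negP => h.
    have : inf A <= inf A - j.+1%:R^-1 by apply: ge_inf => //; case: iA.
    by rewrite lerDl oppr_ge0 leNgt j0.
  have p1 w : 0 <= (X w <= inf A - j.+1%:R^-1)%R%:R :> R by case: (X w <= _)%R.
  have := Ev0_ae (bmeas_le _ mX) p1 h; apply: filterS => w.
  by rewrite ltNge; case: (_ <= _)%R => // /eqP; rewrite oner_eq0.
apply: filterS2 up lw => w hu hl; apply/eqP; rewrite eq_le; apply/andP; split.
  apply/ler_addgt0Pr => e e0; have [j] := ltr_add_invr e0.
  by rewrite add0r => /ltW je; apply: le_trans (hu j) _; rewrite lerD2l.
apply/ler_addgt0Pr => e e0; have [j] := ltr_add_invr e0.
rewrite add0r => /ltW je; have := ltW (hl j); rewrite lerBlDr => h.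
by apply: le_trans h _; rewrite lerD2l.
Qed.

End null_expectations.

Section half_times.
Context {R : realType}.

Lemma badS_cons (j : @entry R) s f : badS (j :: s) f = ebs j f + badS s f.
Proof. by rewrite /badS big_cons. Qed.

Lemma half_add : 1 / 2 + 1 / 2 = 1 :> R.
Proof. by lra. Qed.

Lemma half_boxes_ok (K b th : R) : 0 <= th ->
  eok (K, b, (((0, 0), (- th, 1 / 2)), ((0, 0), (th, 1 / 2)))) /\
  eok (K, b, (((- th, 1 / 2), (0, 1)), ((th, 1 / 2), (0, 1)))).
Proof. by move=> th0; split; (split; [split|]); rewrite /=; lra. Qed.

Lemma half_split (V : int -> R -> R) j (C th c : R) : (forall j, continuous (V j)) -> (0 < j)%N ->
  2 <= rt6 (j * 2) :> R -> 0 <= th -> 7 * (C + 1) + 1 < 2 * th ^+ 2 / 3 ->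
  badS (exits 0 C th) (landscape_n V (j * 2)) < 1 ->
  (forall x, `|x| <= th -> landscape_n V (j * 2) ((0, 0), (x, 1 / 2)) <= c /\
    landscape_n V (j * 2) ((x, 1 / 2), (0, 1)) <= c) ->
  landscape_n V (j * 2) ((0, 0), (0, 1)) <= 2 * c.
Proof.
move=> cV j0 r2 th0 hth bad hc; rewrite leNgt; apply/negP => h.
have n0 : (0 < j * 2)%N by rewrite muln_gt0 j0.
set X := landscape_n V _ _ in h; pose e := Num.min (X - 2 * c) 1.
have e01 : 0 < e <= 1 by rewrite lt_min subr_gt0 h ltr01/= ge_min lexx orbT.
have [z [hz Xz zth]] := near_optimal_path cV n0 r2 th0 hth bad e01.
have jn : (0 < j < j * 2)%N by rewrite j0 ltn_Pmulr.
have [_ _] := path_value_split cV jn hz.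
have -> : j%:R / (j * 2)%:R = 1 / 2 :> R.
  by rewrite natrM; field; rewrite pnatr_eq0 -lt0n.
have := zth j (ltnW (andP jn).2); rewrite subr0 => /hc[h1 h2] h3.
have : e <= X - 2 * c by rewrite ge_min lexx.
move: Xz h1 h2 h3; rewrite -/X; set A := _ - 2 * rt6 _ ^+ 4; lra.
Qed.

End half_times.

Section limit_tubes.
Context {R : realType} {d' : measure_display} {T' : measurableType d'} (Q : probability T' R)
  (W : int -> T' -> R -> R) {d : measure_display} {T : measurableType d} (P : probability T R)
  (L : T -> R4 R -> R).
Hypothesis gW : genv Q W.
Hypothesis cvL : cvg_in_distribution Q (fun n w => landscape_n (fun j => W j w) n) P L.
Hypothesis mL : forall p, R4up p -> measurable_fun setT (fun w => L w p).
Hypothesis cL : forall w, cont_up (L w).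
Let Ln n w := landscape_n (fun j => W j w) n.
Let p01 : R4 R := ((0, 0), (0, 1)).
Let pw (w : R) : R4 R := ((w, 0), (w, 1)).

Lemma up01 w : R4up (pw w). Proof. by rewrite /R4up /= ltr01. Qed.

Lemma Ev_ramp_shift a b w : Ev P (fun o => ramp (a * L o (pw w) + b)) =
  Ev P (fun o => ramp (a * L o p01 + b)).
Proof.
have e : pw w = tau 1 1 w 0 p01 by apply: tau1_pt; rewrite ?add0r ?addr0.
have := Ev_bs_shift gW cvL mL cL a b (pt_eok 0 0 (up01 0)) e e.
by under eq_Ev do rewrite bs_point; under [X in _ = X -> _]eq_Ev do rewrite bs_point.
Qed.

Lemma tube_bound (a b : R) : 0 <= a -> Ev P (fun o => ramp (- a * L o p01 + b)) < 1 ->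
  exists S rho, [/\ 0 < S, 0 <= rho < 1 & forall k,
    Ev P (fun o => \prod_(w <- [seq S * i%:R | i <- iota 0 k]) ramp (- a * L o (pw w) + b))
    <= rho ^+ k].
Proof.
set q := Ev P _ => a0 q1; pose e := (1 - q) / 2.
have e0 : 0 < e by rewrite divr_gt0// subr_gt0.
have q0 : 0 <= q by apply: Ev_ge0 => o; have /andP[] := ramp_bd (- a * L o p01 + b).
have e20 : 0 < e / 2 by rewrite divr_gt0.
have [C hC] := bad_small gW cvL mL cL e20.
pose th : R := 4 * (C%:R + 1); have th0 : 0 <= th by rewrite mulr_ge0// addr_ge0.
have hth := wide_tube (ler0n R C); rewrite -/th in hth.
exists (2 * th + 4), (q + e); split.
- by rewrite ltr_wpDl// mulr_ge0.
- by rewrite addr_ge0 ?(ltW e0)//= /e; move: q1; lra.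
move=> k; set ws := map _ _.
have pws : pairwise (fun w w' => w + (2 * th + 3) < w') ws.
  rewrite pairwise_map; apply: (sub_pairwise (r := fun i j => (i < j)%N)); last first.
    by rewrite -sorted_pairwise; [exact: iota_ltn_sorted|exact: ltn_trans].
  move=> i j ij /=; apply: (@lt_le_trans _ _ ((2 * th + 4) * i.+1%:R)).
    have -> : i.+1%:R = i%:R + 1 :> R by rewrite natr1.
  by rewrite [ltRHS]mulrDr mulr1 ltrD2l ltrD2l ltr_nat.
  by rewrite ler_wpM2l ?ler_nat// addr_ge0// mulr_ge0.
have bl w : blip [:: pw w] (fun f : R4 R -> R => ramp (- a * f (pw w) + b)) by exact: blip_ramp.
have lim1 : Ev Q (fun o => \prod_(w <- ws) ramp (- a * Ln n o (pw w) + b)) @[n --> \oo] -->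
    Ev P (fun o => \prod_(w <- ws) ramp (- a * L o (pw w) + b)).
  apply: (blip_limit gW cvL mL (blip_prod_seq (s := ws) (cells := fun w => [:: pw w])
    (G := fun w f => ramp (- a * f (pw w) + b)) (fun w _ => bl w))) => p.
  by move=> /flattenP[_ /mapP[w _ ->]]; rewrite inE => /eqP ->; exact: up01.
have lim2 : \prod_(w <- ws) (Ev Q (fun o => ramp (- a * Ln n o (pw w) + b)) + e) @[n --> \oo] -->
    \prod_(w <- ws) (q + e).
  apply: (cvg_prod_seq (f := fun w n => Ev Q (fun o => ramp (- a * Ln n o (pw w) + b)) + e)) => w _.
  apply: cvgD; last exact: cvg_cst.
  rewrite /q -(Ev_ramp_shift _ _ w); apply: (blip_limit gW cvL mL (bl w)) => p.
  by rewrite inE => /eqP ->; exact: up01.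
have good : \forall n \near \oo, forall w, w \in ws -> exists h : T' -> R, [/\ bmeas h,
    forall o, 0 <= h o <= 1, forall o, 0 < h o -> badS (exits w C%:R th) (Ln n o) < 1 & 1 - e < Ev Q h].
  apply: near_seq => w _; apply: (good_event cvL mL cL); first exact: exits_ok.
  by apply: le_lt_trans (hC w th) _; rewrite ltr_pdivrMr// ltr_pMr// ltr1n.
have : \prod_(w <- ws) (q + e) = (q + e) ^+ k.
  by rewrite big_map big_const_seq count_predT size_iota iter_mulr_1.
move=> <-; apply: (ler_cvg_to lim1 lim2); near=> n.
have gn : forall w, w \in ws -> exists h : T' -> R, [/\ bmeas h,
    forall o, 0 <= h o <= 1, forall o, 0 < h o -> badS (exits w C%:R th) (Ln n o) < 1 & 1 - e < Ev Q h].
  by near: n.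
have [h hh] : exists h : R -> T' -> R, forall w, w \in ws -> [/\ bmeas (h w),
    forall o, 0 <= h w o <= 1, forall o, 0 < h w o -> badS (exits w C%:R th) (Ln n o) < 1 & 1 - e < Ev Q (h w)].
  have : forall w, exists h : T' -> R, w \in ws -> [/\ bmeas h,
      forall o, 0 <= h o <= 1, forall o, 0 < h o -> badS (exits w C%:R th) (Ln n o) < 1 & 1 - e < Ev Q h].
    by move=> w; case: (boolP (w \in ws)) => [/gn[h hh]|_]; [exists h|exists (fun=> 0)].
  by move=> /choice[h hh]; exists h.
apply: (tube_products gW b _ _ a0 th0 hth pws hh).
  by near: n; exact: nbhs_infty_gt.
by near: n; exact: rt6_ge_near.
Unshelve. all: by end_near. Qed.

Section constant_limit.
Variable ka : R.
Hypothesis hka : {ae P, forall o, L o p01 = ka}.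
Let ze : R := rt6 2 ^+ 2.

Let ze3 : ze ^+ 3 = 2%:R. Proof. by rewrite /ze -exprM rt6X. Qed.
Let ze0 : 0 < ze. Proof. by rewrite exprn_gt0// rt6_gt0. Qed.

Lemma half_null (K x y s : R) (k : int) : 0 < K -> 2 * s = k%:~R ->
  Ev P (fun o => ramp (K * L o ((x, s), (y, s + 1 / 2)) + - (K * (ka / ze)))) = 0.
Proof.
move=> K0 sk; pose p : R4 R := ((x, s), (y, s + 1 / 2)); pose b := - (K * (ka / ze)).
have up : forall q, q \in [:: p] -> R4up q by move=> q; rewrite inE => /eqP ->; rewrite /R4up/= ltrDl divr_gt0.
have := limit_affine gW cvL mL (m := 2) 0 (- k) (blip_ramp p K b) up ze0 ze3 => <-.
have -> : tau ze 2 0 (- k) p = ((ze ^+ 2 * x, 0), (ze ^+ 2 * x + (ze ^+ 2 * y - ze ^+ 2 * x), 1)).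
  have e1 : 2 * s - 2 * s = 0 :> R by rewrite subrr.
  rewrite /tau /p /= mulrNz -sk !addr0 e1 [X in _ = (_, (X, _))]addrC subrK; congr (_, (_, _)).
  by rewrite mulrDr addrAC subrr add0r mulrA mulr1 divff// pnatr_eq0.
set D := ze ^+ 2 * y - _; have Kz : 0 < K / ze by rewrite divr_gt0.
under eq_Ev do rewrite mulrA.
rewrite (ramp_shear gW cvL mL) // divr1.
rewrite (Ev_ae (Y := fun=> 0)) ?Ev_cst//.
  have bl := blip_ramp p01 (K / ze) (- (K / ze * D ^+ 2) + b).
  have := limit_bmeas mL bl (_ : forall q, q \in [:: p01] -> R4up q).
  under eq_fun do rewrite addrA -mulrBr; apply.
  by move=> q; rewrite inE => /eqP ->; exact: up01.
apply: filterS hka => o ho; rewrite -/p01 ho ramp0// /b.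
rewrite (_ : _ + _ = - (K / ze * D ^+ 2)); last by ring.
by rewrite oppr_le0 mulr_ge0 ?sqr_ge0// ltW.
Qed.

Lemma constant_limit : False.
Proof.
have k2 : ka <= 2 * (ka / ze).
  apply/ler_addgt0Pr => e e0; pose K := 3 / e; have K0 : 0 < K by rewrite divr_gt0.
  have k3 : K^-1 = e / 3 by rewrite /K invf_div.
  have e40 : 0 < 1 / 4 :> R by rewrite divr_gt0.
  have [C hC] := bad_small gW cvL mL cL e40.
  pose th : R := 4 * (C%:R + 1); have th0 : 0 <= th by rewrite mulr_ge0// addr_ge0.
  have hth := wide_tube (ler0n R C); rewrite -/th in hth.
  pose b := - (K * (ka / ze)).
  pose e1 : @entry R := (K, b, (((0, 0), (- th, 1 / 2)), ((0, 0), (th, 1 / 2)))).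
  pose e2 : @entry R := (K, b, (((- th, 1 / 2), (0, 1)), ((th, 1 / 2), (0, 1)))).
  have [ok1 ok2] : eok e1 /\ eok e2 by exact: half_boxes_ok.
  have n1 : Ev P (fun o => ebs e1 (L o)) = 0.
    apply: (bs_null mL cL ok1) => -[[x s] [y t]] [[/= h1 h2] [/= _ h4]].
    move: h1 h2 h4; rewrite !in_itv/= => /le_anti <- /le_anti <- /le_anti <-.
    by have := half_null (k := 0) 0 y K0 (mulr0 2); rewrite add0r.
  have n2 : Ev P (fun o => ebs e2 (L o)) = 0.
    apply: (bs_null mL cL ok2) => -[[x s] [y t]] [[/= _ h2] [/= h3 h4]].
    move: h2 h3 h4; rewrite !in_itv/= => /le_anti <- /le_anti <- /le_anti <-.
    have h21 : 2 * (1 / 2) = 1%:~R :> R by rewrite mulrA mulr1 divff// pnatr_eq0.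
    have := half_null (k := 1) x 0 K0 h21.
    by rewrite half_add.
  have eok_all j : List.In j (e1 :: e2 :: exits 0 C%:R th) -> eok j.
    by case=> [<-//|[<-//|]]; exact: exits_ok.
  have bex : bmeas (fun o => badS (exits 0 C%:R th) (L o)) by apply: (badS_bmeas P mL cL); exact: exits_ok.
  have small : Ev P (fun o => badS (e1 :: e2 :: exits 0 C%:R th) (L o)) < 1 / 2.
    under eq_Ev do rewrite 2!badS_cons.
    have b1 := bs_bmeas P mL cL K b ok1; have b2 := bs_bmeas P mL cL K b ok2.
    rewrite EvD; [|exact: b1|by apply: bmeasD; [exact: b2|exact: bex]].
    rewrite EvD; [|exact: b2|exact: bex].
    rewrite n1 n2 !add0r.
    by apply: le_lt_trans (hC 0 th) _; rewrite ltr_pM2l// ltf_pV2 ?posrE// ltr_nat.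
  have bd j f : List.In j (e1 :: e2 :: exits 0 C%:R th) -> 0 <= ebs j f.
    by move=> js; have /andP[] := bs_bd j.1.1 j.1.2 f (eok_all j js).
  have [N _ hN] := filterI (good_event cvL mL cL eok_all small) (rt6_ge_near (2 : R)).
  pose c := 2 * (ka / ze + K^-1).
  have bX n : (0 < n)%N -> bmeas (fun o => ramp (K * Ln n o p01 + - (K * c))).
    move=> n0; apply: (landscape_bmeas gW (blip_ramp p01 K _)) => p.
    by rewrite inE => /eqP ->; exact: pok01.
  have even n : (N < n)%N -> Ev Q (fun o => ramp (K * Ln (n * 2) o p01 + - (K * c))) <= 1 / 2.
    move=> Nn; have n0 : (0 < n)%N by exact: leq_trans Nn.
    have n20 : (0 < n * 2)%N by rewrite muln_gt0 n0.
    have [|[h [bh h01 hbad he]] r2] := hN (n * 2)%N; first by rewrite /= (leq_trans (ltnW Nn))// leq_pmulr.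
    have b1h : bmeas (fun o => 1 - h o) by apply: bmeasB.
    apply: (@le_trans _ _ (Ev Q (fun o => 1 - h o))); last first.
      by rewrite EvB// Ev_cst lerBlDr -lerBlDl ltW.
    apply: Ev_le => //; first exact: bX.
    move=> o; have /andP[] := h01 o; rewrite le_eqVlt => /orP[/eqP <- _|h0 h1].
      by rewrite subr0; have /andP[] := ramp_bd (K * Ln (n * 2) o p01 + - (K * c)).
    rewrite ramp0 ?subr_ge0// -mulrBr pmulr_rle0// subr_le0 /Ln /c.
    have bad := hbad o h0.
    have cV j : continuous (W j o) by exact: (genv_cont gW).
    have inb j : List.In j (e1 :: e2 :: exits 0 C%:R th) ->
      forall p, box j.2.1 j.2.2 p -> j.1.1 * Ln (n * 2) o p + j.1.2 < 1.
      by move=> js; apply: badS_lt js _ bad; exact: eok_all.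
    have bnd x : K * x + b < 1 -> x <= ka / ze + K^-1.
      rewrite /b -mulrBr mulrC -ltr_pdivlMr// mul1r ltrBlDl => /ltW; exact.
    apply: (half_split cV n0 r2 th0 hth).
      apply: le_lt_trans bad; rewrite 2!badS_cons addrA lerDr.
      by rewrite addr_ge0// bd//; [left|right; left].
    move=> x; rewrite ler_norml => /andP[x1 x2]; split; apply: bnd.
      have h1' := inb e1 (or_introl erefl) ((0, 0), (x, 1 / 2)); apply: h1'.
      by split; split; rewrite /= in_itv/= ?lexx ?x1.
    have h2' := inb e2 (or_intror (or_introl erefl)) ((x, 1 / 2), (0, 1)); apply: h2'.
    by split; split; rewrite /= in_itv/= ?lexx ?x1.
  have lim : Ev Q (fun o => ramp (K * Ln n o p01 + - (K * c))) @[n --> \oo] -->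
      Ev P (fun o => ramp (K * L o p01 + - (K * c))).
    apply: (blip_limit gW cvL mL (blip_ramp p01 K _)) => p.
    by rewrite inE => /eqP ->; exact: up01.
  have Ec : Ev P (fun o => ramp (K * L o p01 + - (K * c))) = ramp (K * ka + - (K * c)).
    rewrite -(Ev_cst P (ramp _)); apply: Ev_ae => //.
      apply: (limit_bmeas mL (blip_ramp p01 K _)) => p.
      by rewrite inE => /eqP ->; exact: up01.
    by apply: filterS hka => o ->.
  rewrite {}Ec in lim.
  rewrite leNgt; apply/negP => hk.
  have r1 : ramp (K * ka + - (K * c)) = 1.
    rewrite ramp1// -mulrBr mulrC -ler_pdivrMr// mul1r lerBrDl ltW//.
    apply: le_lt_trans hk; rewrite /c mulrDr -addrA lerD2l k3.
    by rewrite le_eqVlt; apply/orP; left; apply/eqP; field.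
  rewrite {}r1 in lim.
  have h12 : 1 / 2 < 1 :> R by rewrite ltr_pdivrMr// mul1r ltr1n.
  have [N' _ hN'] := cvgr_gt _ lim _ h12.
  have := even (N + N').+1; rewrite ltnS leq_addr => /(_ isT); rewrite leNgt => /negP; apply.
  by apply: hN'; rewrite /= (leq_trans (leq_addl N N'))// (leq_trans (leqnSn _))// leq_pmulr.
have z2 : ze < 2.
  rewrite ltNge; apply/negP => h; have : 2 ^+ 3 <= ze ^+ 3 by apply: lerXn2r => //; rewrite nnegrE// ltW.
  by rewrite ze3 -natrX ler_nat.
apply: (not_ae_ge0 gW cvL mL); apply: filterS hka => o ->.
rewrite leNgt; apply/negP => k0.
have : ka * ze <= 2 * ka by rewrite -ler_pdivlMr// -mulrA.
by rewrite mulrC ler_nM2r// leNgt z2.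
Qed.

End constant_limit.

End limit_tubes.

(** * Events and their probabilities *)

Section event_lists.
Context {R : realType}.
Implicit Types (s : seq (@entry R)) (f : R4 R -> R) (p lo hi : R4 R).

(* In an event list the entry (a, c, (lo, hi)) is the constraint a * f <= c on box lo hi. *)
Definition holds s f := forall j, List.In j s -> forall p, box j.2.1 j.2.2 p -> j.1.1 * f p <= j.1.2.
Definition evS s f : R := (`[<holds s f>])%:R.
Definition oks s := forall j, List.In j s -> eok j.
Definition reg s : set (R4 R) := [set p | exists2 j, List.In j s & box j.2.1 j.2.2 p].

Lemma holds_cat s1 s2 f : holds (s1 ++ s2) f <-> holds s1 f /\ holds s2 f.
Proof.
split=> [h|[h1 h2] j /List.in_app_iff[|] js]; [|exact: h1|exact: h2].
by split=> j js; apply: h; apply/List.in_app_iff; [left|right].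
Qed.

Lemma holds_flatten (I : Type) (F : I -> seq (@entry R)) (l : seq I) f :
  holds (flatten (map F l)) f <-> forall i, List.In i l -> holds (F i) f.
Proof.
elim: l => [|i l IH] /=; first by split => // _ j [].
rewrite holds_cat IH; split=> [[h1 h2] k [<-//|/h2//]|h].
by split=> [|k kl]; apply: h; [left|right].
Qed.

Lemma oks_cat s1 s2 : oks s1 -> oks s2 -> oks (s1 ++ s2).
Proof. by move=> h1 h2 j /List.in_app_iff[/h1|/h2]. Qed.

Lemma oks_flatten (I : Type) (F : I -> seq (@entry R)) (l : seq I) :
  (forall i, List.In i l -> oks (F i)) -> oks (flatten (map F l)).
Proof.
elim: l => [|i l IH] h //=; apply: oks_cat; first by apply: h; left.
by apply: IH => k kl; apply: h; right.
Qed.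

Lemma evS_itv s f : 0 <= evS s f <= 1.
Proof. by rewrite /evS; case: asboolP => _; rewrite ler01 lexx. Qed.

Lemma evS_cat s1 s2 f : evS (s1 ++ s2) f = evS s1 f * evS s2 f.
Proof.
rewrite /evS -natrM mulnb; congr (nat_of_bool _)%:R; apply/idP/idP.
  by move=> /asboolP /holds_cat[h1 h2]; apply/andP; split; apply/asboolP.
by move=> /andP[/asboolP h1 /asboolP h2]; apply/asboolP/holds_cat.
Qed.

Lemma evS1 j f : evS [:: j] f = bev j.1.1 j.1.2 j.2.1 j.2.2 f.
Proof.
congr (nat_of_bool _)%:R; apply/idP/idP => /asboolP h; apply/asboolP.
  by apply: h; left.
by move=> k [<-|//].
Qed.

Lemma evS_le s1 s2 f : (holds s1 f -> holds s2 f) -> evS s1 f <= evS s2 f.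
Proof. by move=> h; rewrite /evS; case: asboolP => // /h h2; rewrite asboolT. Qed.

Lemma clf_one anti (U : set (R4 R)) : clf anti U (fun=> 1).
Proof.
exists (fun=> [::]), (fun _ _ => 1), 1; split.
- by move=> m; exact: blip_cst.
- by [].
- by move=> m f; rewrite normr1.
- by move=> m _; split.
- by move=> f _; exact: cvg_cst.
Qed.

Lemma clf_evS (anti : bool) s : oks s -> (anti -> forall j, List.In j s -> 0 <= j.1.1) ->
  clf anti (reg s) (evS s).
Proof.
elim: s => [|j s IH] sok sa.
  apply: (eq_clf (Phi := fun=> 1)); last exact: clf_one.
  by move=> f _; rewrite /evS asboolT.
apply: (eq_clf (Phi := fun f => bev j.1.1 j.1.2 j.2.1 j.2.2 f * evS s f)).
  by move=> f _; rewrite -evS1 -evS_cat.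
apply: (clf_sub (U := box j.2.1 j.2.2 `|` reg s)).
  by move=> p [bp|[k ks kp]]; [exists j; [left|]|exists k; [right|]].
apply: clf_mul; first by apply: clf_bev => [|h]; [apply: sok; left|apply: sa => //; left].
by apply: IH => [k ks|h k ks]; [apply: sok; right|apply: sa => //; right].
Qed.

Lemma reg_up s : oks s -> reg s `<=` @R4up R.
Proof. by move=> sok p [j /sok/box_up]; apply. Qed.

Definition aff (si w u : R) p : R4 R :=
  ((si ^+ 2 * p.1.1 + w, si ^+ 3 * p.1.2 + u), (si ^+ 2 * p.2.1 + w, si ^+ 3 * p.2.2 + u)).
Definition raf (si w u : R) f p := si^-1 * f (aff si w u p).
Definition affE (si w u : R) s : seq (@entry R) :=
  [seq (j.1.1, si * j.1.2, (aff si w u j.2.1, aff si w u j.2.2)) | j <- s].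

Lemma tau_aff ze m w k p : ze ^+ 3 = m%:R -> tau ze m w k p = aff ze w k%:~R p.
Proof. by move=> h; rewrite /tau /aff h. Qed.

Lemma box_aff si w u lo hi p : 0 < si ->
  box (aff si w u lo) (aff si w u hi) (aff si w u p) <-> box lo hi p.
Proof.
move=> s0; have s2 : 0 < si ^+ 2 by rewrite exprn_gt0.
have s3 : 0 < si ^+ 3 by rewrite exprn_gt0.
case: lo hi p => [[? ?] [? ?]] [[? ?] [? ?]] [[? ?] [? ?]].
rewrite /box /aff /=.
by split=> -[[/= h1 h2] [/= h3 h4]]; (split; split); rewrite /= in_itv/=; move: h1 h2 h3 h4;
  rewrite /= !in_itv/= !lerD2r ?(ler_pM2l s2) ?(ler_pM2l s3).
Qed.

Lemma aff_inv si w u p : 0 < si ->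
  aff si w u (aff si^-1 (- (w / si ^+ 2)) (- (u / si ^+ 3)) p) = p.
Proof.
move=> s0; case: p => [[x s] [y t]]; rewrite /aff /=.
have e2 z : si ^+ 2 * (si^-1 ^+ 2 * z - w / si ^+ 2) + w = z by field; rewrite gt_eqF.
have e3 z : si ^+ 3 * (si^-1 ^+ 3 * z - u / si ^+ 3) + u = z by field; rewrite gt_eqF.
by rewrite !e2 !e3.
Qed.

Lemma holds_affE si w u s f : 0 < si -> holds (affE si w u s) f <-> holds s (raf si w u f).
Proof.
move=> s0; split=> [h j js p bp|h j].
  have := h (j.1.1, si * j.1.2, (aff si w u j.2.1, aff si w u j.2.2)).
  move=> /(_ (List.in_map (fun j => (j.1.1, si * j.1.2, (aff si w u j.2.1, aff si w u j.2.2))) _ _ js)) /= /(_ (aff si w u p)).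
  move=> /(_ ((box_aff _ _ _ _ _ s0).2 bp)).
  by rewrite /raf mulrCA ler_pdivrMl.
move=> /List.in_map_iff[k [<- ks]] p /=; rewrite -{1}(aff_inv w u p s0).
move=> /(box_aff _ _ _ _ _ s0) /(h k ks); rewrite /raf aff_inv// mulrCA.
by rewrite ler_pdivrMl.
Qed.

Lemma oks_affE si w u s : 0 < si -> oks s -> oks (affE si w u s).
Proof.
move=> s0 sok j /List.in_map_iff[k [<- /sok[[h1 h2 h3 h4] h5]]]; rewrite /eok/box_ok/=.
have s2 : 0 < si ^+ 2 by rewrite exprn_gt0.
have s3 : 0 < si ^+ 3 by rewrite exprn_gt0.
by rewrite !lerD2r ltrD2r !(ler_pM2l s2) !(ler_pM2l s3) (ltr_pM2l s3).
Qed.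

Lemma affE_affE si w u si' w' u' s :
  affE si w u (affE si' w' u' s) = affE (si * si') (si ^+ 2 * w' + w) (si ^+ 3 * u' + u) s.
Proof.
rewrite /affE -map_comp; apply: eq_map => j /=; rewrite mulrA.
have e p : aff si w u (aff si' w' u' p) = aff (si * si') (si ^+ 2 * w' + w) (si ^+ 3 * u' + u) p.
  case: p => [[x s1] [y t]]; rewrite /aff /=.
  by congr (_, _); congr (_, _); ring.
by rewrite !e.
Qed.

Lemma affE1 s : affE 1 0 0 s = s.
Proof.
rewrite /affE -[RHS]map_id; apply: eq_map => -[[a c] [[[x1 s1] [y1 t1]] [[x2 s2] [y2 t2]]]].
by rewrite /aff /= !expr1n !mul1r !addr0.
Qed.

End event_lists.

Section event_probabilities.
Context {R : realType} {d' : measure_display} {T' : measurableType d'} (Q : probability T' R)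
  (W : int -> T' -> R -> R) {d : measure_display} {T : measurableType d} (P : probability T R)
  (L : T -> R4 R -> R).
Hypothesis gW : genv Q W.
Hypothesis cvL : cvg_in_distribution Q (fun n w => landscape_n (fun j => W j w) n) P L.
Hypothesis mL : forall p, R4up p -> measurable_fun setT (fun w => L w p).
Hypothesis cL : forall w, cont_up (L w).
Implicit Types s : seq (@entry R).

Definition pr s : R := Ev P (fun o => evS s (L o)).

Lemma evS_bmeas s : oks s -> bmeas (fun o => evS s (L o)).
Proof. by move=> sok; apply: (clf_bmeas P mL cL (reg_up sok) (clf_evS (anti := false) sok _)). Qed.

Lemma pr_ge0 s : 0 <= pr s.
Proof. by apply: Ev_ge0 => o; have /andP[] := evS_itv s (L o). Qed.

Lemma pr_le s1 s2 : oks s1 -> oks s2 -> (forall f, cont_up f -> holds s1 f -> holds s2 f) ->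
  pr s1 <= pr s2.
Proof. by move=> o1 o2 h; apply: Ev_le => [| |o]; [exact: evS_bmeas..|apply: evS_le; exact: h]. Qed.

Lemma pr_indep s1 s2 t : oks s1 -> oks s2 -> (forall j, List.In j s1 -> j.2.2.2.2 <= t) ->
  (forall j, List.In j s2 -> t <= j.2.1.1.2) -> pr (s1 ++ s2) = pr s1 * pr s2.
Proof.
move=> o1 o2 h1 h2; rewrite /pr; under eq_Ev do rewrite evS_cat.
apply: (clf_indep gW cvL mL cL (t := t) (clf_evS o1 _) (clf_evS o2 _)) => //.
  move=> p [j js bp]; split; first exact: (box_up (o1 j js)).
  case: bp => _ [_] /=; rewrite in_itv/= => /andP[_ h]; exact: le_trans h (h1 j js).
move=> p [j js bp]; split; first exact: (box_up (o2 j js)).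
by case: bp => -[_] /=; rewrite in_itv/= => /andP[h _] _; exact: le_trans (h2 j js) h.
Qed.

Lemma pr_fkg s1 s2 : oks s1 -> oks s2 -> (forall j, List.In j (s1 ++ s2) -> 0 <= j.1.1) ->
  pr s1 * pr s2 <= pr (s1 ++ s2).
Proof.
move=> o1 o2 a0; rewrite {3}/pr; under [in leRHS]eq_Ev do rewrite evS_cat.
apply: (clf_fkg gW cvL mL cL (clf_evS o1 _) (clf_evS o2 _)); [| |exact: reg_up..].
  by move=> _ j js; apply: a0; apply/List.in_app_iff; left.
by move=> _ j js; apply: a0; apply/List.in_app_iff; right.
Qed.

Lemma pr_fkg_flatten (I : eqType) (F : I -> seq (@entry R)) (l : seq I) :
  (forall i, i \in l -> oks (F i) /\ forall j, List.In j (F i) -> 0 <= j.1.1) ->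
  \prod_(i <- l) pr (F i) <= pr (flatten (map F l)).
Proof.
elim: l => [|i l IH] h; rewrite ?big_nil ?big_cons /=.
  by rewrite /pr; under eq_Ev do rewrite /evS asboolT//; rewrite Ev_cst.
have h' k : k \in l -> oks (F k) /\ forall j, List.In j (F k) -> 0 <= j.1.1.
  by move=> kl; apply: h; rewrite inE kl orbT.
have aux (l' : seq I) : (forall k, k \in l' -> oks (F k) /\ forall j, List.In j (F k) -> 0 <= j.1.1) ->
    oks (flatten (map F l')) /\ forall j, List.In j (flatten (map F l')) -> 0 <= j.1.1.
  elim: l' => [|k l' IH'] h0 //=.
  have [k' kl|oi ai] := IH'; first by apply: h0; rewrite inE kl orbT.
  have [ok ak] := h0 k (mem_head _ _).
  by split; [exact: oks_cat|move=> j /List.in_app_iff[/ak|/ai]].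
have [oi ai] := h i (mem_head _ _); have [ol al] := aux l h'.
apply: le_trans (pr_fkg oi ol _); last by move=> j /List.in_app_iff[/ai|/al].
by rewrite ler_wpM2l ?pr_ge0// IH.
Qed.

Lemma pr_affE ze (m : nat) w (k : int) s : oks s -> 0 < ze -> ze ^+ 3 = m%:R ->
  pr (affE ze w k%:~R s) = pr s.
Proof.
move=> sok z0 zm; rewrite /pr.
rewrite -(clf_affine gW cvL mL cL w k (clf_evS (anti := false) sok _) (reg_up sok) z0 zm)//.
apply: eq_Ev => o; congr (nat_of_bool _)%:R.
have -> : retau ze m w k (L o) = raf ze w k%:~R (L o).
  by apply/funext => p; rewrite /retau /raf tau_aff.
by apply/idP/idP => /asboolP/(holds_affE _ _ _ _ z0) h; apply/asboolP => //; apply/(holds_affE _ _ _ _ z0).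
Qed.

Lemma pr_shift w (k : int) s : oks s -> pr (affE 1 w k%:~R s) = pr s.
Proof. by move=> sok; apply: (pr_affE (m := 1) w k sok ltr01); rewrite expr1n. Qed.

Lemma pr_scale_down (n : nat) s : oks s -> (0 < n)%N -> pr (affE n%:R^-1 0 0 s) = pr s.
Proof.
move=> sok n0; have n0R : 0 < n%:R :> R by rewrite ltr0n.
have ni : 0 < n%:R^-1 :> R by rewrite invr_gt0.
rewrite -(pr_affE (m := (n ^ 3)%N) 0 0 (oks_affE (w := 0) (u := 0) ni sok) n0R); last by rewrite natrX.
by rewrite affE_affE divff ?gt_eqF// !mulr0 !addr0 affE1.
Qed.

End event_probabilities.

Lemma mem_In (I : eqType) (x : I) (l : seq I) : x \in l -> List.In x l.
Proof.
by elim: l => [//|y l IH]; rewrite inE => /orP[/eqP ->|/IH h]; [left|right].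
Qed.

Lemma In_mem (I : eqType) (x : I) (l : seq I) : List.In x l -> x \in l.
Proof. by elim: l => [//|y l IH] [->|/IH h]; rewrite inE ?eqxx// h orbT. Qed.

Section grid_points.
Context {R : realType}.

Definition grid_pt (A n i : nat) : R := - A%:R + i%:R / n.+1%:R.

Lemma grid_pt_itv A n i : (i <= A * 2 * n.+1)%N -> - A%:R <= grid_pt A n i <= A%:R.
Proof.
move=> hi; rewrite /grid_pt lerDl divr_ge0//= addrC lerBlDr ler_pdivrMr//.
by rewrite -natrD -natrM ler_nat addnn -muln2.
Qed.

Lemma grid_pt_near A n (x : R) : - A%:R <= x <= A%:R -> exists2 i, (i <= A * 2 * n.+1)%N &
  grid_pt A n i <= x <= grid_pt A n i + n.+1%:R^-1.
Proof.
move=> /andP[x1 x2]; have n0 : 0 < n.+1%:R :> R by [].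
have y0 : 0 <= (x + A%:R) * n.+1%:R by rewrite mulr_ge0// -lerBlDr sub0r.
have y1 : (x + A%:R) * n.+1%:R <= (A * 2 * n.+1)%:R by rewrite natrM ler_pM2r// muln2 -addnn natrD lerD2r.
have /andP[t1 t2] := Num.Theory.truncn_itv y0.
set i := Num.truncn _ in t1 t2; exists i.
  by rewrite -(ler_nat R) (le_trans t1).
have xE : x = - A%:R + (x + A%:R) * n.+1%:R / n.+1%:R by rewrite mulfK ?gt_eqF//; ring.
rewrite {}xE /grid_pt -addrA !lerD2l; move: t1 t2; set y := _ * _ => t1 t2.
rewrite ler_pM2r ?invr_gt0// t1/= ler_pdivrMr// mulrDl divfK ?gt_eqF// mulVf ?gt_eqF//.
by rewrite natr1 ltW.
Qed.

End grid_points.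

Section slices.
Context {R : realType} {d' : measure_display} {T' : measurableType d'} (Q : probability T' R)
  (W : int -> T' -> R -> R) {d : measure_display} {T : measurableType d} (P : probability T R)
  (L : T -> R4 R -> R).
Hypothesis gW : genv Q W.
Hypothesis cvL : cvg_in_distribution Q (fun n w => landscape_n (fun j => W j w) n) P L.
Hypothesis mL : forall p, R4up p -> measurable_fun setT (fun w => L w p).
Hypothesis cL : forall w, cont_up (L w).
Let p01 : R4 R := ((0, 0), (0, 1)).

Definition sq (c x y e : R) : @entry R := (1, c, (((x - e, 0), (y - e, 1)), ((x + e, 0), (y + e, 1)))).

Lemma sq_ok c x y e : 0 <= e -> oks [:: sq c x y e].
Proof.
move=> e0 j [<-|//]; split; last by rewrite /= ltr01.
by split; rewrite //= lerBlDr -addrA lerDl addr_ge0.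
Qed.

Let up01' x y : R4up (((x, 0), (y, 1)) : R4 R). Proof. by rewrite /R4up /= ltr01. Qed.

Lemma point_pos c e x y : 0 < cdf P (fun o => L o p01) c -> 0 < e ->
  0 < cdf P (fun o => L o ((x, 0), (y, 1))) (c + e).
Proof.
move=> hc e0; have ei : 0 < e^-1 by rewrite invr_gt0.
have h := ramp_shear gW cvL mL (- (c / e)) x (y - x) ltr01 ei.
rewrite addrC subrK divr1 in h.
have br p : R4up p -> bmeas (fun o => ramp (e^-1 * L o p + - (c / e))).
  by move=> up; apply: (limit_bmeas mL (blip_ramp p e^-1 (- (c / e)))) => q; rewrite inE => /eqP ->.
have br2 : bmeas (fun o => ramp (e^-1 * (L o p01 - (y - x) ^+ 2) + - (c / e))).
  have bl := blip_ramp p01 e^-1 (- (e^-1 * (y - x) ^+ 2) + - (c / e)).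
  have := limit_bmeas mL bl (_ : forall q, q \in [:: p01] -> R4up q).
  under eq_fun do rewrite addrA -mulrBr; apply.
  by move=> q; rewrite inE => /eqP ->; exact: up01'.
apply: lt_le_trans hc _.
apply: (@le_trans _ _ (1 - Ev P (fun o => ramp (e^-1 * (L o p01 - (y - x) ^+ 2) + - (c / e))))).
  rewrite -[X in _ <= X - _](Ev_cst P 1) -EvB//; apply: Ev_le.
  - by apply: bmeas_le; apply: mL; exact: up01'.
  - exact: bmeasB.
  move=> o; have [h1|_] := leP (L o p01) c; last by rewrite subr_ge0; have /andP[] := ramp_bd (e^-1 * (L o p01 - (y - x) ^+ 2) + - (c / e)).
  rewrite ramp0 ?subr0// [c / e]mulrC -mulrBr pmulr_rle0// subr_le0.
  by apply: le_trans h1; rewrite gerBl sqr_ge0.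
rewrite -h -[X in X - _ <= _](Ev_cst P 1) -EvB//; last by apply: br; exact: up01'.
apply: Ev_le; first by apply: bmeasB => //; apply: br; exact: up01'.
  by apply: bmeas_le; apply: mL; exact: up01'.
move=> o; have [_|h1] := leP (L o ((x, 0), (y, 1))) (c + e).
  by rewrite gerBl; have /andP[] := ramp_bd (e^-1 * L o ((x, 0), (y, 1)) + - (c / e)).
rewrite ramp1 ?subrr// [c / e]mulrC -mulrBr mulrC ler_pdivlMr// mul1r lerBrDl ltW//.
Qed.

Lemma box_pos c e x y : 0 < cdf P (fun o => L o p01) c -> 0 < e ->
  exists n : nat, 0 < pr P L [:: sq (c + e + e) x y n.+1%:R^-1].
Proof.
move=> hc e0; pose p : R4 R := ((x, 0), (y, 1)).
have j0 n : 0 <= n.+1%:R^-1 :> R by rewrite invr_ge0.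
pose g n o : R := evS [:: sq (c + e + e) x y n.+1%:R^-1] (L o) * (L o p <= c + e)%R%:R.
have bg n : bmeas (g n).
  apply: bmeasM; first exact: (evS_bmeas P mL cL (sq_ok (j0 n))).
  by apply: bmeas_le; apply: mL; exact: up01'.
have g01 n o : 0 <= g n o <= 1.
  rewrite /g; have /andP[h1 h2] := evS_itv [:: sq (c + e + e) x y n.+1%:R^-1] (L o).
  by case: (L o p <= c + e)%R; rewrite ?mulr1 ?mulr0 ?h1 ?h2 ?ler01 ?lexx.
have [||o|_ _ h] := @Ev_cvg _ _ _ P g (fun o => (L o p <= c + e)%R%:R) 1.
- by move=> n; case: (bg n).
- by move=> n o; have /andP[h1 h2] := g01 n o; rewrite ger0_norm.
- rewrite /g; have [h|h] := leP (L o p) (c + e); last first.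
    by under eq_fun do rewrite mulr0; exact: cvg_cst.
  under eq_fun do rewrite mulr1.
  have := cL (up01' x y) => /(_ o); rewrite -/p => cp.
  have : \forall q \near p, L o q < c + e + e.
    by apply: (cvgr_lt _ cp); apply: le_lt_trans h _; rewrite ltrDl.
  move=> /nbhs_ballP[r /= r0 hr].
  apply: cvg_near_cst; near=> n; rewrite /evS asboolT// => j [<-|//] q /= bq.
  rewrite mul1r ltW//; apply: hr.
  have nr : n.+1%:R^-1 < r by near: n; exact: (near_infty_natSinv_lt (PosNum r0)).
  case: q bq => [[x' s'] [y' t']] [[/= h1 h2] [/= h3 h4]]; move: h1 h2 h3 h4.
  rewrite !in_itv/=; move: (n.+1%:R^-1 : R) nr => u ur.
  move=> /andP[x1 x2] /le_anti <- /andP[y1 y2] /le_anti <-.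
  by split; split; rewrite /ball /= ?subrr ?normr0// ltr_norml; apply/andP; split; lra.
have [N _ hN] := cvgr_gt _ h _ (point_pos x y hc e0).
exists N; apply: lt_le_trans (hN N (leqnn _)) _.
apply: Ev_le; [exact: bg|exact: (evS_bmeas P mL cL (sq_ok (j0 N)))|].
move=> o; have /andP[h0 _] := evS_itv [:: sq (c + e + e) x y N.+1%:R^-1] (L o).
by rewrite /g; case: (L o p <= c + e)%R; rewrite ?mulr1 ?mulr0.
Unshelve. all: by end_near. Qed.

Lemma uniform_pos c e K : 0 < cdf P (fun o => L o p01) c -> 0 < e ->
  exists n : nat, forall x y, -1 <= x <= 1 -> - K <= y <= K ->
    0 < pr P L [:: sq (c + e + e) x y n.+1%:R^-1].
Proof.
move=> hc e0.
have cK : compact (`[-1, 1] `*` `[- K, K] : set (R * R)) by apply: compact_setX; exact: segment_compact.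
have j0 n : 0 < n.+1%:R^-1 :> R by rewrite invr_gt0.
have := (compact_near_coveringP _).1 cK nat \oo
  (fun n q => 0 < pr P L [:: sq (c + e + e) q.1 q.2 n.+1%:R^-1]) _.
case=> [[x y] _|N _ hN]; last first.
  exists N => x y xb yb; apply: (hN N (leqnn _) (x, y)).
  by split; rewrite /= in_itv.
have [n0 hn0] := box_pos x y hc e0; set r := n0.+1%:R^-1 in hn0.
have r20 : 0 < r / 2 by rewrite divr_gt0//; exact: j0.
exists (ball (x, y) (r / 2), [set i | i.+1%:R^-1 < r / 2]).
  split; first exact: nbhsx_ballx.
  exact: (near_infty_natSinv_lt (PosNum r20)).
move=> [[x' y'] i] [[/= bx by_] hi]; apply: lt_le_trans hn0 _; rewrite /=.
apply: (pr_le P mL cL); [exact: (sq_ok (ltW (j0 _)))..|].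
move=> f _ h j [<-|//] q /= bq; apply: (h _ (or_introl erefl)) => /=.
move: bx by_; rewrite /ball /= !ltr_norml => /andP[x1 x2] /andP[y1 y2].
case: q bq => [[xx s'] [yy t']] [[/= h1 h2] [/= h3 h4]]; move: h1 h2 h3 h4.
rewrite !in_itv/=; move: hi; rewrite /=; move: (i.+1%:R^-1 : R) => u hi.
move=> /andP[a1 a2] h2 /andP[a3 a4] h4; clear h; clearbody r.
by split; split; rewrite /= in_itv/= ?h2 ?h4//; apply/andP; split; lra.
Qed.

Lemma big_box_pos c e (K : nat) : 0 < cdf P (fun o => L o p01) c -> 0 < e ->
  0 < pr P L [:: (1, c + e + e, (((- 1, 0), (- K%:R, 1)), ((1, 0), (K%:R, 1))))].
Proof.
move=> hc e0; have [n hn] := uniform_pos K%:R hc e0.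
have ni : 0 <= n.+1%:R^-1 :> R by rewrite invr_ge0.
pose F (v : nat * nat) := [:: sq (c + e + e) (grid_pt 1 n v.1) (grid_pt K n v.2) n.+1%:R^-1].
pose l := [seq (i, j) | i <- iota 0 (1 * 2 * n.+1).+1, j <- iota 0 (K * 2 * n.+1).+1].
have lP v : v \in l -> (v.1 <= 1 * 2 * n.+1)%N /\ (v.2 <= K * 2 * n.+1)%N.
  by move=> /allpairsP[[i j] [hi hj ->]]; move: hi hj; rewrite !mem_iota !add0n /= !ltnS => h1 h2.
have okF v : v \in l -> oks (F v) /\ forall j, List.In j (F v) -> 0 <= j.1.1.
  by move=> _; split; [exact: sq_ok|move=> j [<-|//]].
apply: lt_le_trans (le_trans (pr_fkg_flatten gW cvL mL cL okF) _).
  rewrite big_seq; apply: prodr_gt0 => v /lP[h1 h2]; apply: hn; exact: grid_pt_itv.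
apply: (pr_le P mL cL).
- by apply: oks_flatten => v _; exact: sq_ok.
- move=> j [<-|//]; split; last by rewrite /= ltr01.
  by split => //=; rewrite -subr_ge0 opprK addr_ge0.
move=> f _ /holds_flatten h j [<-|//] [[x s] [y t]] /= [[/= hx hs] [/= hy ht]].
move: hx hs hy ht; rewrite !in_itv/= => hx hs hy ht.
have [i hi xi] := grid_pt_near n (A := 1) hx; have [k hk yk] := grid_pt_near n hy.
have ml : (i, k) \in l by apply/allpairsP; exists (i, k); split; rewrite // mem_iota add0n ltnS.
have := h (i, k) (mem_In ml) _ (or_introl erefl) ((x, s), (y, t)); apply.
have le1 u v : u <= v <= u + n.+1%:R^-1 -> u - n.+1%:R^-1 <= v <= u + n.+1%:R^-1.
  by move=> /andP[h1 ->]; rewrite andbT (le_trans _ h1)// gerBl.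
by split; split; rewrite /= in_itv/= ?le1.
Qed.

Definition slice (c : R) (M N : nat) : seq (@entry R) :=
  flatten [seq affE 1 (i%:R - N%:R) 0
    [:: (1, c, (((- 1, 0), (- M%:R, 1)), ((1, 0), (M%:R, 1))))] | i <- iota 0 (N + N).+1].

Definition fast (c w : R) : seq (@entry R) := [:: pt_entry (- 1) (- c) ((w, 0), (w, 1))].

Lemma slice_ok c M N : oks (slice c M N).
Proof.
apply: oks_flatten => i _; apply: oks_affE => // j [<-|//]; split; last by rewrite /= ltr01.
by split => //=; rewrite -subr_ge0 opprK addr_ge0.
Qed.

Lemma fast_ok c w : oks (fast c w).
Proof. by move=> j [<-|//]; apply: pt_eok; exact: up01'. Qed.

Lemma slice_tube : exists c1 c2 : R, c1 < c2 /\ forall M : nat, exists D : nat, forall N : nat,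
  exists2 w, 0 <= w <= (D * N.+1)%:R & 0 < pr P L (slice c1 M N ++ fast c2 w).
Proof.
have mX : measurable_fun setT (fun o => L o p01) by apply: mL; exact: up01'.
have [c1 [c2 [c12 h1 h2]]] := two_values mX (fun ka h => constant_limit gW cvL mL cL h).
pose e := (c2 - c1) / 4; have e0 : 0 < e by rewrite divr_gt0// subr_gt0.
exists (c1 + e + e), c2; split; first by rewrite /e; lra.
move=> M; set q := pr P L [:: (1, c1 + e + e, (((- 1, 0), (- M%:R, 1)), ((1, 0), (M%:R, 1))))].
have q0 : 0 < q := big_box_pos M h1 e0.
have phi1 : Ev P (fun o => ramp (- 1 * L o p01 + (1 + c2))) < 1.
  have bphi : bmeas (fun o => ramp (- 1 * L o p01 + (1 + c2))).
    by apply: (limit_bmeas mL (blip_ramp p01 (- 1) (1 + c2))) => r; rewrite inE => /eqP ->; exact: up01'.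
  have r01 o := ramp_bd (- 1 * L o p01 + (1 + c2)).
  rewrite lt_neqAle; apply/andP; split; last first.
    by rewrite -[leRHS](Ev_cst P 1); apply: Ev_le => // o; have /andP[] := r01 o.
  apply/eqP => h; have : cdf P (fun o => L o p01) c2 = 1; last by move=> E; rewrite E ltxx in h2.
  rewrite -(Ev_cst P 1); apply: Ev_ae => //; first exact: bmeas_le.
  have b1 : bmeas (fun o => 1 - ramp (- 1 * L o p01 + (1 + c2))) by apply: bmeasB.
  have p1 o : 0 <= 1 - ramp (- 1 * L o p01 + (1 + c2)) by rewrite subr_ge0; have /andP[] := r01 o.
  have e1 : Ev P (fun o => 1 - ramp (- 1 * L o p01 + (1 + c2))) = 0 by rewrite EvB// Ev_cst h subrr.
  apply: filterS (Ev0_ae b1 p1 e1) => o /eqP; rewrite subr_eq0 => /eqP r1.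
  have [//|lt] := leP (L o p01) c2.
  suff : ramp (- 1 * L o p01 + (1 + c2)) < 1 by rewrite -r1 ltxx.
  rewrite /ramp gt_max ltr01 gt_min ltxx/= mulN1r addrC -addrA gtrDl subr_lt0 //.
have [S [rho [S0 rho01 hS]]] := tube_bound gW cvL mL cL (ler01 : 0 <= 1 :> R) phi1.
have [k0 hk0] : exists k0 : nat, rho ^+ k0 < q.
  have /andP[r0 r1] := rho01.
  have := @cvg_expr R rho; rewrite ger0_norm// => /(_ r1) hc.
  by have [k0 _ hk] := cvgr_lt _ hc _ q0; exists k0; exact: (hk k0 (leqnn _)).
exists (Num.truncn (2 * (S * k0%:R))).+1 => N.
pose k := (k0 * (N + N).+1)%N.
have sl_ge : q ^+ (N + N).+1 <= pr P L (slice (c1 + e + e) M N).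
  pose F i := affE 1 (i%:R - N%:R) 0 [:: (1, c1 + e + e, (((- 1, 0), (- M%:R, 1)), ((1, 0), (M%:R, 1))))] : seq (@entry R).
  have ok0 : oks [:: (1, c1 + e + e, (((- 1, 0), (- M%:R, 1)), ((1, 0), (M%:R, 1))))].
    move=> j [<-|//]; split; last by rewrite /= ltr01.
    by split => //=; rewrite -subr_ge0 opprK addr_ge0.
  have okF i : i \in iota 0 (N + N).+1 -> oks (F i) /\ forall j, List.In j (F i) -> 0 <= j.1.1.
    by move=> _; split; [exact: oks_affE|move=> j [<-|//]].
  apply: le_trans (pr_fkg_flatten gW cvL mL cL okF).
  rewrite (eq_bigr (fun=> q)); last by move=> i _; exact: (pr_shift gW cvL mL cL _ 0 ok0).
  by rewrite big_const_seq count_predT size_iota iter_mulr_1.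
have hN : rho ^+ k < q ^+ (N + N).+1.
  have /andP[r0 _] := rho01.
  by rewrite /k exprM ltr_pXn2r// nnegrE ?exprn_ge0// ltW.
have [i [ik ip]] : exists i : nat, (i < k)%N /\ 0 < pr P L (slice (c1 + e + e) M N ++ fast c2 (S * i%:R)).
  apply: contrapT => hn.
  have z i : (i < k)%N -> pr P L (slice (c1 + e + e) M N ++ fast c2 (S * i%:R)) = 0.
    move=> ik; apply/eqP; rewrite eq_le pr_ge0 andbT leNgt; apply/negP => h; apply: hn.
    by exists i.
  have : pr P L (slice (c1 + e + e) M N) <= rho ^+ k; last first.
    by apply/negP; rewrite -ltNge; exact: lt_le_trans sl_ge.
  pose G i o := evS (slice (c1 + e + e) M N ++ fast c2 (S * i%:R)) (L o).
  have bG i : bmeas (G i) by apply: (evS_bmeas P mL cL); apply: oks_cat; [exact: slice_ok|exact: fast_ok].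
  pose H o := \prod_(w <- [seq S * i%:R | i <- iota 0 k]) ramp (- 1 * L o ((w, 0), (w, 1)) + (1 + c2)).
  have bH : bmeas H.
    apply: (bmeas_prod (f := fun w o => ramp (- 1 * L o ((w, 0), (w, 1)) + (1 + c2)))) => w _.
    by apply: (limit_bmeas mL (blip_ramp ((w, 0), (w, 1)) (- 1) (1 + c2))) => r; rewrite inE => /eqP ->; exact: up01'.
  apply: le_trans (le_trans (Ev_le (Y := fun o => \sum_(i < k) G i o + H o) _ _ _ _) _) (hS k).
  - exact: (evS_bmeas P mL cL (@slice_ok (c1 + e + e) M N)).
  - by apply: bmeasD => //; exact: bmeas_sum.
  - move=> o; have G0 i : 0 <= G i o by rewrite /G; have /andP[] := evS_itv (slice (c1 + e + e) M N ++ fast c2 (S * i%:R)) (L o).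
    have H0 : 0 <= H o.
      by apply: prodr_ge0 => w _; have /andP[] := ramp_bd (- 1 * L o ((w, 0), (w, 1)) + (1 + c2)).
    have s0 : 0 <= \sum_(i < k) G i o by apply: sumr_ge0.
    rewrite {1}/evS; case: asboolP => hs; last by rewrite addr_ge0.
    have [[i ih]|nh] := pselect (exists i : 'I_k, c2 <= L o ((S * i%:R, 0), (S * i%:R, 1))).
      rewrite (bigD1 i)//= -addrA ler_wpDr ?addr_ge0 ?sumr_ge0//.
      rewrite /G /evS asboolT//; apply/holds_cat; split => // j [<-|//] p /=.
      by rewrite box_pt_set => ->; rewrite mulN1r lerN2.
    rewrite ler_wpDl// /H big1_seq// => w /= /mapP[i]; rewrite mem_iota add0n => /= ik ->.
    rewrite ramp1// mulN1r addrC -addrA lerDl subr_ge0 leNgt; apply/negP => h; apply: nh.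
    by exists (Ordinal ik); exact: ltW.
  - rewrite EvD//; last exact: bmeas_sum.
    by rewrite Ev_sum// big1 ?add0r// => i _; exact: z.
exists (S * i%:R) => //; rewrite mulr_ge0 ?(ltW S0)//=.
apply: (@le_trans _ _ (S * k%:R)); first by rewrite ler_pM2l// ler_nat ltnW.
have h3 : 2 * (S * k0%:R) <= (Num.truncn (2 * (S * k0%:R))).+1%:R by rewrite ltW// truncnS_gt.
apply: (@le_trans _ _ (2 * (S * k0%:R) * N.+1%:R)); last by rewrite natrM ler_wpM2r.
rewrite /k natrM; have -> : 2 * (S * k0%:R) * N.+1%:R = S * (k0%:R * (N.+1%:R * 2)) by ring.
rewrite ler_pM2l// ler_wpM2l// -natrM ler_nat muln2 -addnn addnS ltnS.
by rewrite addSn leqnSn.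
Qed.

End slices.

(** * Blocks of slices *)

Section blocks.
Context {R : realType}.
Implicit Types (s : seq (@entry R)) (f : R4 R -> R).

Definition within_times (a b : R) s := forall j, List.In j s -> a <= j.2.1.1.2 /\ j.2.2.2.2 <= b.

Lemma within_times_cat a b s1 s2 : within_times a b s1 -> within_times a b s2 ->
  within_times a b (s1 ++ s2).
Proof. by move=> h1 h2 j /List.in_app_iff[/h1|/h2]. Qed.

Lemma within_times_sub a b a' b' s : a' <= a -> b <= b' -> within_times a b s -> within_times a' b' s.
Proof. by move=> aa bb h j /h[h1 h2]; split; [exact: le_trans aa h1|exact: le_trans h2 bb]. Qed.

Lemma within_times_aff a b si w u s : 0 < si -> within_times a b s ->
  within_times (si ^+ 3 * a + u) (si ^+ 3 * b + u) (affE si w u s).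
Proof.
move=> s0 h j /List.in_map_iff[k [<- /h[h1 h2]]] /=.
by rewrite !lerD2r !ler_pM2l ?exprn_gt0.
Qed.

Lemma within_times_flatten (I : Type) (F : I -> seq (@entry R)) (l : seq I) a b :
  (forall i, List.In i l -> within_times a b (F i)) -> within_times a b (flatten (map F l)).
Proof.
elim: l => [|i l IH] h //=; apply: within_times_cat; first by apply: h; left.
by apply: IH => k kl; apply: h; right.
Qed.

Definition wall (C D : R) : seq (@entry R) :=
  [:: (1, C, (((- D, 1), (- D, 2)), ((D, 1), (D, 2))));
      (- 1, C, (((- D, 1), (- D, 2)), ((D, 1), (D, 2))))].

Lemma wall_ok C D : 0 <= D -> oks (wall C D).
Proof.
move=> D0; have h : box_ok (((- D, 1), (- D, 2)) : R4 R) ((D, 1), (D, 2)).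
  by split; [split|]; rewrite //= ?ltr1n// -subr_ge0 opprK addr_ge0.
by move=> j [<-//|[<-//|]].
Qed.

Lemma wall_times C D : within_times 1 2 (wall C D).
Proof. by move=> j [<-|[<-|]]. Qed.

Lemma wallP (nu C D u : R) f x y : 0 < nu -> holds (affE nu 0 u (wall C D)) f ->
  `|x| <= D * nu ^+ 2 -> `|y| <= D * nu ^+ 2 ->
  `|f ((x, nu ^+ 3 + u), (y, 2 * nu ^+ 3 + u))| <= nu * C.
Proof.
move=> n0 h; rewrite !ler_norml => /andP[x1 x2] /andP[y1 y2].
have e2 : 2 * nu ^+ 3 = nu ^+ 3 * 2 by rewrite mulrC.
have b : box (aff nu 0 u ((- D, 1), (- D, 2))) (aff nu 0 u ((D, 1), (D, 2)))
    ((x, nu ^+ 3 + u), (y, 2 * nu ^+ 3 + u)).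
  rewrite /aff /= !addr0 mulr1 e2 mulrN [nu ^+ 2 * D]mulrC.
  by split; split; rewrite /= in_itv/= ?lexx ?x1 ?y1.
have := h _ (or_introl erefl) _ b; rewrite /= mul1r => ->.
have := h _ (or_intror (or_introl erefl)) _ b; rewrite /= mulN1r.
by rewrite andbT lerNl.
Qed.

Lemma fastP (c2 w u : R) f : holds (affE 1 0 u (fast c2 w)) f -> c2 <= f ((w, u), (w, u + 1)).
Proof.
move=> /(holds_affE _ _ _ _ ltr01) h.
have := h _ (or_introl erefl) ((w, 0), (w, 1)); rewrite /= box_pt_set => /(_ erefl).
by rewrite /raf /aff /= !(expr1n, mul1r, mulr0, invr1, add0r, addr0) mulN1r lerN2 addrC.
Qed.

Lemma sliceP (c : R) (M N : nat) u f x y : holds (affE 1 0 u (slice c M.+1 N)) f ->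
  `|x| <= N%:R -> `|y - x| <= M%:R -> f ((x, u), (y, u + 1)) <= c.
Proof.
move=> /(holds_affE _ _ _ _ ltr01) /holds_flatten h.
rewrite !ler_norml => /andP[x1 x2] /andP[y1 y2].
have x0 : 0 <= x + N%:R by rewrite -lerBlDr sub0r.
have /andP[t1 t2] := Num.Theory.truncn_itv x0; set i := Num.truncn _ in t1 t2.
have ii : List.In i (iota 0 (N + N).+1).
  by apply: mem_In; rewrite mem_iota add0n /= ltnS -(ler_nat R) (le_trans t1)// natrD lerD2r.
have := h i ii => /(holds_affE _ _ _ _ ltr01) /(_ _ (or_introl erefl)) /=.
move=> /(_ ((x - (i%:R - N%:R), 0), (y - (i%:R - N%:R), 1))).
rewrite /raf /aff /= !(expr1n, mul1r, mulr0, invr1, add0r, addr0) !subrK [1 + u]addrC; apply.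
have t3 : x + N%:R < i%:R + 1 by rewrite natr1.
have M1 : M.+1%:R = M%:R + 1 :> R by rewrite natr1.
by split; split; rewrite /= in_itv/= ?lexx// ?M1; move: t1 t3; set a : R := i%:R => t1 t3; apply/andP; split; lra.
Qed.

Definition micro (c1 c2 w : R) (M Rr : nat) := slice c1 M.+1 Rr ++ fast c2 w.

Definition mid c1 c2 w M Rr (t n : nat) : seq (@entry R) :=
  flatten [seq affE 1 0 (t + i)%:R (micro c1 c2 w M Rr) | i <- iota 0 n].

(* Time is divided into [nu ^ 3, 2 nu ^ 3], the unit slices of [2 nu ^ 3, 3 nu ^ 3],
   and [3 nu ^ 3, 4 nu ^ 3]. *)
Definition block (C D c1 c2 w : R) (M nu : nat) : seq (@entry R) :=
  affE nu%:R 0 0 (wall C D) ++ mid c1 c2 w M (4 * M * nu ^ 2) (2 * nu ^ 3) (nu ^ 3) ++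
  affE nu%:R 0 (2 * nu ^ 3)%:R (wall C D).

Definition reverse_triangle f := forall x y z : R * R, x.2 < y.2 -> y.2 < z.2 ->
  f (x, y) + f (y, z) <= f (x, z).

Lemma fast_chain f (c w : R) (t n : nat) : reverse_triangle f -> (0 < n)%N ->
  (forall i, (i < n)%N -> c <= f ((w, (t + i)%:R), (w, (t + i).+1%:R))) ->
  n%:R * c <= f ((w, t%:R), (w, (t + n)%:R)).
Proof.
move=> tri; elim: n => [//|[|n] IH] _ h.
  by rewrite mul1r addn1; have := h 0%N isT; rewrite addn0.
have h1 := IH isT (fun i hi => h i (leqW hi)).
have h2 := h n.+1 (leqnn _); rewrite -addnS in h2.
rewrite -natr1 mulrDl mul1r; apply: le_trans (lerD h1 h2) (tri _ _ _ _ _) => /=.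
  by rewrite ltr_nat -{1}[t]addn0 ltn_add2l.
by rewrite ltr_nat ltn_add2l.
Qed.

Lemma block_contra C D c1 c2 w (M nu : nat) f (x : nat -> R) (q : R * R) :
  (0 < nu)%N -> 0 <= D -> (4 * M)%:R <= D -> `|w| <= D * nu%:R ^+ 2 -> 4 * C < nu%:R ^+ 2 * (c2 - c1) ->
  reverse_triangle f -> holds (block C D c1 c2 w M nu) f ->
  (forall n, (n <= 4 * nu ^ 3)%N -> `|x n| <= (4 * M * nu ^ 2)%:R) ->
  (forall n, (n < 4 * nu ^ 3)%N -> `|x n.+1 - x n| <= M%:R) -> (4 * nu ^ 3)%:R < q.2 ->
  let N := (nu ^ 3)%N in let X n : R * R := (x n, n%:R) in
  f (X 0%N, q) <= f (X 0%N, X N) + f (X N, X (2 * N)%N) +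
    \sum_(i < N) f (X (2 * N + i)%N, X (2 * N + i).+1) + f (X (3 * N)%N, X (4 * N)%N) +
    f (X (4 * N)%N, q) -> False.
Proof.
move=> nu0 D0 MD wD hnu tri /holds_cat[h1 /holds_cat[/holds_flatten h2 h3]] xb dx qT N X hs.
have nuR : 0 < nu%:R :> R by rewrite ltr0n.
have N0 : (0 < N)%N by rewrite expn_gt0 nu0.
have NE : nu%:R ^+ 3 = N%:R :> R by rewrite natrX.
have xD n : (n <= 4 * nu ^ 3)%N -> `|x n| <= D * nu%:R ^+ 2.
  move=> /xb hx; apply: le_trans hx _; rewrite natrM natrX ler_wpM2r// exprn_ge0// ltW.
have N14 : (N <= 4 * N)%N by rewrite leq_pmull.
have N24 : (2 * N <= 4 * N)%N by rewrite leq_mul2r orbT.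
have N34 : (3 * N <= 4 * N)%N by rewrite leq_mul2r orbT.
have w1 := wallP nuR h1 (xD N N14) (xD (2 * N)%N N24).
have w2 := wallP nuR h1 (xD N N14) wD.
have w3 := wallP nuR h3 (xD (3 * N)%N N34) (xD (4 * N)%N (leqnn _)).
have w4 := wallP nuR h3 wD (xD (4 * N)%N (leqnn _)).
rewrite !NE !addr0 in w1 w2; rewrite !NE in w3 w4.
have eN k : (k * N)%:R = k%:R * N%:R :> R by rewrite natrM.
have e3 : N%:R + (2 * N)%:R = (3 * N)%:R :> R by rewrite -natrD.
have e4 : 2 * N%:R + (2 * N)%:R = (4 * N)%:R :> R by rewrite !natrM -mulrDl -natrD.
have e2 : 2 * N%:R = (2 * N)%:R :> R by rewrite natrM.
rewrite e2 in w1 w2; rewrite -/N e3 e4 in w3 w4.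
have hm i : (i < N)%N -> holds (affE 1 0 (2 * N + i)%:R (micro c1 c2 w M (4 * M * nu ^ 2))) f.
  by move=> iN; apply: h2; apply: mem_In; rewrite mem_iota.
have hc1 i : (i < N)%N -> f (X (2 * N + i)%N, X (2 * N + i).+1) <= c1.
  move=> iN; have := hm i iN; rewrite /micro /affE map_cat => /holds_cat[hsl _].
  have i4 : (2 * N + i < 4 * N)%N.
    by rewrite -[4%N]/(2 + 2)%N mulnDl ltn_add2l (leq_trans iN)// leq_pmull.
  have := sliceP hsl (xb _ (ltnW i4)) (dx _ i4); by rewrite natr1.
have hc2 i : (i < N)%N -> c2 <= f ((w, (2 * N + i)%:R), (w, (2 * N + i).+1%:R)).
  move=> iN; have := hm i iN; rewrite /micro /affE map_cat => /holds_cat[_ hf].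
  by have := fastP hf; rewrite natr1.
have hf := fast_chain tri N0 hc2.
have e23 : (2 * N + N = 3 * N)%N by rewrite -mulSnr.
rewrite e23 in hf.
have S1 : \sum_(i < N) f (X (2 * N + i)%N, X (2 * N + i).+1) <= N%:R * c1.
  apply: (@le_trans _ _ (\sum_(i < N) c1)); first by apply: ler_sum => i _; exact: hc1.
  by rewrite sumr_const card_ord mulr_natl.
have lt a b : (a < b)%N -> a%:R < b%:R :> R by rewrite ltr_nat.
have l2 : (N < 2 * N)%N by rewrite ltn_Pmull.
have l3 : (2 * N < 3 * N)%N by rewrite ltn_mul2r N0.
have l4 : (3 * N < 4 * N)%N by rewrite ltn_mul2r N0.
have t1 := tri (X 0%N) (X N) q (lt _ _ N0) (lt_trans (lt _ _ (ltn_trans l2 (ltn_trans l3 l4))) qT).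
have t2 := tri (X N) (w, (2 * N)%:R) q (lt _ _ l2) (lt_trans (lt _ _ (ltn_trans l3 l4)) qT).
have t3 := tri (w, (2 * N)%:R) (w, (3 * N)%:R) q (lt _ _ l3) (lt_trans (lt _ _ l4) qT).
have t4 := tri (w, (3 * N)%:R) (X (4 * N)%N) q (lt _ _ l4) qT.
have key : N%:R * (c2 - c1) <= 4 * (nu%:R * C).
  move: w1 w2 w3 w4; rewrite !ler_norml => /andP[_ w1] /andP[w2 _] /andP[_ w3] /andP[w4 _].
  move: t1 t2 t3 t4 hs S1 hf w1 w2 w3 w4; rewrite /X mulrBr; clear.
  set a1 := f (_, q); set a2 := f _; set a3 := f _; set a4 := f _.
  by lra.
move: key; rewrite -NE exprS -mulrA [4 * _]mulrCA ler_pM2l// leNgt => /negP; apply.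
exact: hnu.
Qed.

End blocks.

Lemma In_cat (I : Type) (x : I) (s1 s2 : seq I) : List.In x (s1 ++ s2) -> List.In x s1 \/ List.In x s2.
Proof. by move/List.in_app_iff. Qed.

Section block_windows.
Context {R : realType}.

Lemma micro_ok c1 c2 w M Rr : oks (micro c1 c2 w M Rr : seq (@entry R)).
Proof. by apply: oks_cat; [exact: slice_ok|exact: fast_ok]. Qed.

Lemma micro_times c1 c2 w M Rr : within_times 0 1 (micro c1 c2 w M Rr : seq (@entry R)).
Proof.
apply: within_times_cat; last by move=> j [<-|//].
apply: within_times_flatten => i _.
have := @within_times_aff R 0 1 1 (i%:R - Rr%:R) 0 [:: (1, c1, (((- 1, 0), (- M.+1%:R, 1)), ((1, 0), (M.+1%:R, 1))))] ltr01.
by rewrite !(expr1n, mul1r, addr0); apply; move=> j [<-|//].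
Qed.

Lemma mid_ok c1 c2 w M Rr t n : oks (mid c1 c2 w M Rr t n : seq (@entry R)).
Proof. by apply: oks_flatten => i _; apply: oks_affE => //; exact: micro_ok. Qed.

Lemma mid_times c1 c2 w M Rr t n :
  within_times t%:R (t + n)%:R (mid c1 c2 w M Rr t n : seq (@entry R)).
Proof.
apply: within_times_flatten => i /In_mem ii; have hi : (i < n)%N by move: ii; rewrite mem_iota add0n.
have := @within_times_aff R 0 1 1 0 (t + i)%:R _ ltr01 (@micro_times c1 c2 w M Rr).
rewrite !(expr1n, mul1r, add0r); apply: within_times_sub; first by rewrite ler_nat leq_addr.
by rewrite addrC natr1 ler_nat ltn_add2l.
Qed.

Lemma wall_times_aff C D nu u : (0 < nu)%N ->
  within_times (nu%:R ^+ 3 + u) (nu%:R ^+ 3 * 2 + u) (affE nu%:R 0 u (wall C D) : seq (@entry R)).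
Proof.
move=> nu0; have n0 : 0 < nu%:R :> R by rewrite ltr0n.
have := @within_times_aff R 1 2 nu%:R 0 u _ n0 (@wall_times R C D).
by rewrite mulr1.
Qed.

Lemma block_ok C D c1 c2 w M nu : (0 < nu)%N -> 0 <= D -> oks (block C D c1 c2 w M nu : seq (@entry R)).
Proof.
move=> nu0 D0; have n0 : 0 < nu%:R :> R by rewrite ltr0n.
apply: oks_cat; first by apply: oks_affE => //; exact: wall_ok.
by apply: oks_cat; [exact: mid_ok|apply: oks_affE => //; exact: wall_ok].
Qed.

Lemma block_times C D c1 c2 w M nu : (0 < nu)%N ->
  within_times (nu%:R ^+ 3) (4 * nu%:R ^+ 3) (block C D c1 c2 w M nu : seq (@entry R)).
Proof.
move=> nu0; have n3 : 0 <= nu%:R ^+ 3 :> R by rewrite exprn_ge0.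
have eN k : (k * nu ^ 3)%:R = k%:R * nu%:R ^+ 3 :> R by rewrite natrM natrX.
apply: within_times_cat.
  by apply: (within_times_sub _ _ (@wall_times_aff C D nu _ nu0)); rewrite addr0//; move: n3; set a : R := nu%:R ^+ 3; lra.
apply: within_times_cat.
  apply: (within_times_sub _ _ (@mid_times _ _ _ _ _ _ _)); rewrite ?natrD ?eN ?natrX; move: n3; set a : R := nu%:R ^+ 3; lra.
apply: (within_times_sub _ _ (@wall_times_aff C D nu _ nu0)); rewrite eN; move: n3; set a : R := nu%:R ^+ 3; lra.
Qed.

End block_windows.

Section block_probability.
Context {R : realType} {d' : measure_display} {T' : measurableType d'} (Q : probability T' R)
  (W : int -> T' -> R -> R) {d : measure_display} {T : measurableType d} (P : probability T R)
  (L : T -> R4 R -> R).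
Hypothesis gW : genv Q W.
Hypothesis cvL : cvg_in_distribution Q (fun n w => landscape_n (fun j => W j w) n) P L.
Hypothesis mL : forall p, R4up p -> measurable_fun setT (fun w => L w p).
Hypothesis cL : forall w, cont_up (L w).

Lemma wall_pos (D : R) : 0 <= D -> exists C : R, 0 < pr P L (wall C D).
Proof.
move=> D0; have ok n : oks (wall n%:R D) by exact: wall_ok.
have [||o|_ _ h] := @Ev_cvg _ _ _ P (fun n o => evS (wall n%:R D) (L o)) (fun=> 1) 1.
- by move=> n; have [] := evS_bmeas P mL cL (ok n).
- by move=> n o; have /andP[h1 h2] := evS_itv (wall n%:R D) (L o); rewrite ger0_norm.
- have bok : box_ok (((- D, 1), (- D, 2)) : R4 R) ((D, 1), (D, 2)) by exact: (ok 0%N _ (or_introl erefl)).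
  have : compact (L o @` box ((- D, 1), (- D, 2)) ((D, 1), (D, 2))).
    apply: continuous_compact; last exact: compact_box.
    apply: continuous_in_subspaceT => p /set_mem bp; apply: cL; exact: box_up bp.
  move=> /compact_bounded[B [_ /(_ (B + 1) _)]]; rewrite ltrDl ltr01 => /(_ isT) hB.
  apply: cvg_near_cst; near=> n; rewrite /evS asboolT//.
  have Bn : B + 1 <= n%:R by near: n; exact: nbhs_infty_ger.
  have key p : box ((- D, 1), (- D, 2)) ((D, 1), (D, 2)) p -> `|L o p| <= n%:R.
    by move=> bp; apply: le_trans Bn; apply: hB; exists p.
  by move=> j [<-|[<-|//]] p /= /key; rewrite ler_norml => /andP[h1 h2]; rewrite ?mul1r// mulN1r lerNl.
rewrite Ev_cst in h; have [n _ hn] := cvgr_gt _ h _ (ltr01 : (0 : R) < 1).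
by exists n%:R; exact: (hn n (leqnn _)).
Unshelve. all: by end_near. Qed.

Lemma mid_pos c1 c2 w M Rr t n : 0 < pr P L (micro c1 c2 w M Rr) ->
  0 < pr P L (mid c1 c2 w M Rr t n).
Proof.
move=> h; elim: n => [|n IH].
  by rewrite /pr; under eq_Ev do rewrite /evS asboolT//; rewrite Ev_cst.
have -> : mid c1 c2 w M Rr t n.+1 = mid c1 c2 w M Rr t n ++ affE 1 0 (t + n)%:R (micro c1 c2 w M Rr).
  by rewrite /mid -addn1 iotaD map_cat flatten_cat /= cats0 add0n.
have ok1 : oks (mid c1 c2 w M Rr t n) by exact: mid_ok.
have ok2 : oks (affE 1 0 (t + n)%:R (micro c1 c2 w M Rr)) by apply: oks_affE => //; exact: micro_ok.
rewrite (pr_indep gW cvL mL cL (t := (t + n)%:R) ok1 ok2).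
- rewrite mulr_gt0// (pr_shift gW cvL mL cL 0 (Posz (t + n))) //; exact: micro_ok.
- by move=> j /mid_times[].
have := @within_times_aff R 0 1 1 0 (t + n)%:R _ ltr01 (@micro_times R c1 c2 w M Rr).
by rewrite !(expr1n, mul1r, add0r) => h1 j /h1[].
Qed.

Lemma block_pos (M : nat) : exists C D c1 c2 (w : R) nu, [/\ (0 < nu)%N, 0 <= D, (4 * M)%:R <= D &
  [/\ `|w| <= D * nu%:R ^+ 2, 4 * C < nu%:R ^+ 2 * (c2 - c1) & 0 < pr P L (block C D c1 c2 w M nu)]].
Proof.
have [c1 [c2 [c12 /(_ M.+1)[D0 hD0]]]] := slice_tube gW cvL mL cL.
pose D := (D0 * (4 * M).+1 + 4 * M)%N; have Dge : 0 <= D%:R :> R by [].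
have [C hC] := wall_pos Dge.
have dc : 0 < c2 - c1 by rewrite subr_gt0.
pose nu := (Num.truncn (`|4 * C| / (c2 - c1))).+1.
have nu0 : (0 < nu)%N by [].
have nuR : 0 < nu%:R :> R by rewrite ltr0n.
have [w /andP[w0 w1] hw] := hD0 (4 * M * nu ^ 2)%N.
exists C, D%:R, c1, c2, w, nu; split => //; first by rewrite ler_nat leq_addl.
split.
- rewrite ger0_norm// (le_trans w1)// -natrX -natrM ler_nat /D mulnDl.
  apply: leq_trans (leq_addr _ _); rewrite -[leqRHS]mulnA leq_mul2l; apply/orP; right.
  by rewrite [((4 * M).+1 * _)%N]mulSn -[ltnLHS]add0n ltn_add2r expn_gt0.
- apply: (le_lt_trans (ler_norm _)); rewrite -ltr_pdivrMr//.
  apply: (@lt_le_trans _ _ nu%:R); first exact: truncnS_gt.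
  by rewrite -natrX ler_nat -[X in (X <= _)%N]expn1 leq_pexp2l.
have nuX : nu%:R ^+ 3 = (nu ^ 3)%:R :> R by rewrite natrX.
have okw u : oks (affE nu%:R 0 u (wall C D%:R)) by apply: oks_affE => //; exact: wall_ok.
have N3 : 0 <= nu%:R ^+ 3 :> R by rewrite exprn_ge0.
have eN k : (k * nu ^ 3)%:R = k%:R * nu%:R ^+ 3 :> R by rewrite natrM natrX.
have tmid := @mid_times R c1 c2 w M (4 * M * nu ^ 2) (2 * nu ^ 3) (nu ^ 3).
have twall0 := @wall_times_aff R C D%:R nu 0 nu0.
have twall := @wall_times_aff R C D%:R nu (2 * nu ^ 3)%:R nu0.
rewrite /block (pr_indep gW cvL mL cL (t := (2 * nu ^ 3)%:R) (okw 0)); first last.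
- move=> j js; case: (In_cat js) => {}js; first by have [] := tmid j js.
  by have [h _] := twall j js; apply: le_trans h; rewrite lerDr.
- by move=> j /twall0[_]; rewrite addr0 eN mulrC.
- by apply: oks_cat; [exact: mid_ok|exact: okw].
have okm : oks (mid c1 c2 w M (4 * M * nu ^ 2) (2 * nu ^ 3) (nu ^ 3)) by exact: mid_ok.
rewrite (pr_indep gW cvL mL cL (t := (3 * nu ^ 3)%:R) okm (okw _)); first last.
- move=> j /twall[h _]; apply: le_trans h.
  by rewrite !eN; move: N3; set a : R := nu%:R ^+ 3; lra.
- move=> j /tmid[_ h]; apply: le_trans h _.
  by rewrite natrD !eN natrX; move: N3; set a : R := nu%:R ^+ 3; lra.
rewrite !mulr_gt0//.
- by rewrite (pr_affE gW cvL mL cL 0 0 (@wall_ok R C D%:R Dge) nuR nuX).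
- exact: mid_pos.
- by rewrite (pr_affE gW cvL mL cL 0 (Posz (2 * nu ^ 3)) (@wall_ok R C D%:R Dge) nuR nuX).
Qed.

Definition copy_scale (nu j : nat) : R := (2 ^ j.+1 * nu)%:R^-1.

Lemma copies (s : seq (@entry R)) nu : (0 < nu)%N -> oks s ->
  within_times (nu%:R ^+ 3) (4 * nu%:R ^+ 3) s -> 0 < pr P L s ->
  {ae P, forall o, exists j, holds (affE (copy_scale nu j) 0 0 s) (L o)}.
Proof.
move=> nu0 sok st sp; pose A j := affE (copy_scale nu j) 0 0 s.
have c0 j : 0 < copy_scale nu j by rewrite invr_gt0 ltr0n muln_gt0 expn_gt0.
have Aok j : oks (A j) by exact: oks_affE.
have prA j : pr P L (A j) = pr P L s.
  by apply: (pr_scale_down gW cvL mL cL sok); rewrite muln_gt0 expn_gt0.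
pose tt (j : nat) : R := (8 ^ j)%:R^-1.
have tt0 j : 0 < tt j by rewrite invr_gt0 ltr0n expn_gt0.
have ttS j : tt j.+1 * 8 = tt j.
  by rewrite /tt expnSr natrM invfM -mulrA mulVf ?mulr1 ?pnatr_eq0.
have At j : within_times (tt j.+1) (4 * tt j.+1) (A j).
  have E : copy_scale nu j ^+ 3 * nu%:R ^+ 3 = tt j.+1.
    rewrite /copy_scale /tt -exprMn natrM invfM -mulrA mulVf ?mulr1 ?pnatr_eq0 -?lt0n//.
    by rewrite exprVn -natrX -expnM mulnC expnM.
  by have := within_times_aff (w := 0) (u := 0) (c0 j) st; rewrite !addr0 [_ * (4 * _)]mulrCA !E.
pose X (J : nat) f : R := \prod_(j < J) (1 - evS (A j) f).
have X01 J f : 0 <= X J f <= 1.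
  rewrite /X; elim: J => [|J /andP[h1 h2]]; first by rewrite big_ord0 ler01 lexx.
  have /andP[h3 h4] := evS_itv (A J) f.
  by rewrite big_ord_recr/= mulr_ge0 ?subr_ge0//= mulr_ile1 ?subr_ge0 ?gerBl.
have cA j : clf false (reg (A j)) (fun f => 1 - evS (A j) f).
  apply: (eq_clf (Phi := fun f => 1 + (- 1) * evS (A j) f)); first by move=> f _; rewrite mulN1r.
  apply: (clf_sub (U := reg (A j) `|` reg (A j))); first by move=> p [].
  by apply: clf_lin; [exact: clf_one|exact: clf_evS].
pose U J : set (R4 R) := [set p | R4up p /\ tt J <= p.1.2].
have cX J : clf false (U J) (X J).
  elim: J => [|J IH].
    by apply: (eq_clf (Phi := fun=> 1)); [move=> f _; rewrite /X big_ord0|exact: clf_one].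
  apply: (eq_clf (Phi := fun f => X J f * (1 - evS (A J) f))).
    by move=> f _; rewrite /X big_ord_recr.
  apply: (clf_sub (U := U J `|` reg (A J))); last exact: clf_mul.
  move=> p [[h1 h2]|[j js bp]].
    by split => //; apply: le_trans h2; rewrite -(ttS J) ler_peMr// ?ltW// ltr1n.
  split; first exact: (reg_up (Aok J) (ex_intro2 _ _ j js bp)).
  have [h _] := At J j js; apply: le_trans h _.
  by case: bp => -[_]; rewrite /= in_itv/= => /andP[].
have Uup J : U J `<=` @R4up R by move=> p [].
have bX J : bmeas (fun o => X J (L o)) by exact: (clf_bmeas P mL cL (Uup J) (cX J)).
have EX J : Ev P (fun o => X J (L o)) = (1 - pr P L s) ^+ J.
  elim: J => [|J IH]; first by rewrite /X; under eq_Ev do rewrite big_ord0; rewrite Ev_cst.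
  rewrite exprS -IH.
  transitivity (Ev P (fun o => (1 - evS (A J) (L o)) * X J (L o))).
    by apply: eq_Ev => o; rewrite /X big_ord_recr mulrC.
  rewrite (clf_indep gW cvL mL cL (t := tt J) (cA J) (cX J)).
  - by rewrite EvB ?Ev_cst -/(pr P L (A J)) ?prA//; exact: (evS_bmeas P mL cL).
  - move=> p pA; split; first exact: (reg_up (Aok J)).
    have [j js bp] := pA; have [_ h] := At J j js.
    apply: (@le_trans _ _ (4 * tt J.+1)).
      by apply: le_trans h; case: bp => _ [_]; rewrite /= in_itv/= => /andP[].
    by rewrite -(ttS J) mulrC ler_pM2l// ler_nat.
  by move=> p [].
have [||o|bZ _ cZ] := @Ev_cvg _ _ _ P (fun J o => X J (L o))
    (fun o => (`[<forall j, ~ holds (A j) (L o)>])%:R) 1.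
- by move=> J; case: (bX J).
- by move=> J o; have /andP[h1 h2] := X01 J (L o); rewrite ger0_norm.
- case: asboolP => h.
    apply: cvg_near_cst; near=> J; rewrite /X big1// => j _.
    by rewrite /evS asboolF ?subr0//; exact: h.
  have [j hj] : exists j, holds (A j) (L o).
    by apply: contrapT => /forallNP h'; apply: h.
  apply: cvg_near_cst; near=> J.
  have jJ : (j < J)%N by near: J; exact: nbhs_infty_gt.
  by rewrite /X (bigD1 (Ordinal jJ))//= /evS asboolT// subrr mul0r.
have p1 : pr P L s <= 1.
  rewrite -[leRHS](Ev_cst P 1); apply: Ev_le => //; first exact: (evS_bmeas P mL cL).
  by move=> o; have /andP[] := evS_itv s (L o).
have Z0 : Ev P (fun o => (`[<forall j, ~ holds (A j) (L o)>])%:R) = 0.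
  apply: (@cvg_unique _ (@norm_hausdorff _ _) _ _ _ _ cZ).
  rewrite (_ : (fun J => _) = (fun J => (1 - pr P L s) ^+ J)); last exact/funext.
  by apply: cvg_expr; rewrite ger0_norm ?subr_ge0// gtrBl.
apply: filterS (Ev0_ae bZ (fun o => _) Z0) => o.
  case: asboolP => h; first by move/eqP; rewrite oner_eq0.
  by move=> _; apply: contrapT => /forallNP h'; apply: h.
by case: asboolP.
Unshelve. all: by end_near. Qed.

End block_probability.

(** * Geodesics *)

Section geodesic_contradiction.
Context {R : realType}.
Implicit Types (f : R4 R -> R) (g : R -> R).

Lemma hoelder_bound g (al : R) : hoelder01 al g -> exists M : nat, forall s t,
  s \in `[0%R, 1%R] -> t \in `[0%R, 1%R] -> s != t -> `|g t - g s| <= M%:R * `|t - s| `^ al.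
Proof.
rewrite /hoelder01; set A := [set x | _] => hA.
have [r hr] : exists r : R, forall x, A x -> (x <= r%:E)%E.
  move: hA; case E : (ereal_sup A) => [r| |] // _; last first.
    by exists 0 => x Ax; have := ereal_sup_ubound Ax; rewrite E leeNy_eq => /eqP ->; rewrite leNye.
  by exists r => x Ax; rewrite -E; exact: ereal_sup_ubound.
exists (Num.truncn `|r|).+1 => s t s01 t01 st.
have d0 : 0 < `|t - s| `^ al by rewrite powR_gt0// normr_gt0 subr_eq0 eq_sym.
have := hr _ (ex_intro _ s (ex_intro _ t (And4 s01 t01 st erefl))).
rewrite lee_fin ler_pdivrMr// => /le_trans; apply; rewrite ler_pM2r//.
by rewrite (le_trans (ler_norm _))// ltW// truncnS_gt.
Qed.

Lemma powR23 (a t : R) : 0 <= a -> 0 <= t -> t <= a ^+ 3 -> t `^ (2 / 3) <= a ^+ 2.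
Proof.
move=> a0 t0 ta; apply: (@le_trans _ _ ((a ^+ 3) `^ (2 / 3))).
  by apply: ge0_ler_powR => //; rewrite nnegrE// exprn_ge0.
rewrite -[a ^+ 3]powR_mulrn// -powRrM -[a ^+ 2]powR_mulrn//.
by rewrite mulrCA divff ?mulr1 ?pnatr_eq0.
Qed.

Lemma reverse_triangle_raf (si : R) f : 0 < si -> reverse_triangle f ->
  reverse_triangle (raf si 0 0 f).
Proof.
move=> s0 tri x y z xy yz; rewrite /raf -mulrDr ler_pM2l ?invr_gt0//.
have s3 : 0 < si ^+ 3 by rewrite exprn_gt0.
by apply: tri; rewrite /= !addr0 ltr_pM2l.
Qed.

Lemma geodesic_le_partition f g (k : nat) (r : nat -> R) : is_geodesic f (0, 0) (0, 1) g ->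
  r 0%N = 0 -> r k = 1 -> (forall i, (i < k)%N -> r i < r i.+1) ->
  f ((0, 0), (0, 1)) <= \sum_(0 <= i < k) f ((g (r i), r i), (g (r i.+1), r i.+1)).
Proof.
move=> [_ _ _ e] r0 rk rS; rewrite -lee_fin -e big_mkord; apply: ereal_inf_lbound.
by exists k, r; split.
Qed.

Lemma geodesic_contra f g (M nu j : nat) (C D c1 c2 w : R) : reverse_triangle f ->
  is_geodesic f (0, 0) (0, 1) g ->
  (forall s t, s \in `[0%R, 1%R] -> t \in `[0%R, 1%R] -> s != t ->
    `|g t - g s| <= M%:R * `|t - s| `^ (2 / 3)) ->
  (0 < nu)%N -> 0 <= D -> (4 * M)%:R <= D -> `|w| <= D * nu%:R ^+ 2 ->
  4 * C < nu%:R ^+ 2 * (c2 - c1) ->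
  holds (affE (copy_scale nu j : R) 0 0 (block C D c1 c2 w M nu)) f -> False.
Proof.
move=> tri geo hg nu0 D0 MD wD hnu; set si : R := copy_scale nu j.
have s0 : 0 < si by rewrite /si /copy_scale invr_gt0 ltr0n muln_gt0 expn_gt0.
have s2 : 0 < si ^+ 2 by rewrite exprn_gt0.
have s3 : 0 < si ^+ 3 by rewrite exprn_gt0.
move=> /(holds_affE _ _ _ _ s0) hf.
have [_ /= g0 g1 _] := geo.
have nuR : 0 < nu%:R :> R by rewrite ltr0n.
pose N := (nu ^ 3)%N; have N0 : (0 < N)%N by rewrite expn_gt0 nu0.
have sN : (4 * N)%:R < (si ^+ 3)^-1.
  rewrite /si /copy_scale exprVn invrK -natrX ltr_nat expnMn ltn_pmul2r//.
  by rewrite -expnM (@leq_trans (2 ^ 3))// leq_pexp2l// mulnC leq_pmulr.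
pose tm (n : nat) : R := si ^+ 3 * n%:R.
have tm01 n : (n <= 4 * N)%N -> 0 <= tm n < 1.
  move=> hn; rewrite mulr_ge0 ?(ltW s3)//= /tm mulrC -ltr_pdivlMr// mul1r.
  by apply: le_lt_trans sN; rewrite ler_nat.
have tmI n : (n <= 4 * N)%N -> tm n \in `[0%R, 1%R].
  by move=> /tm01/andP[h1 h2]; rewrite in_itv/= h1 ltW.
have tm_lt a b : (a < b)%N -> tm a < tm b by move=> h; rewrite /tm ltr_pM2l// ltr_nat.
have tm0 : tm 0%N = 0 by rewrite /tm mulr0.
pose x n := g (tm n) / si ^+ 2; pose q : R * R := (0, (si ^+ 3)^-1).
apply: (block_contra (x := x) (q := q) nu0 D0 MD wD hnu (reverse_triangle_raf s0 tri) hf) => //.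
- move=> n hn; rewrite /x normrM (gtr0_norm (x := (si ^+ 2)^-1)) ?invr_gt0// ler_pdivrMr//.
  have [->|n0] := posnP n; first by rewrite tm0 g0 normr0 mulr_ge0// ltW.
  have t0 : tm 0 != tm n by rewrite lt_eqF// tm_lt.
  have := hg _ _ (tmI 0%N isT) (tmI n hn) t0; rewrite tm0 g0 !subr0 => /le_trans; apply.
  have /andP[p0 _] := tm01 n hn; rewrite ger0_norm//.
  rewrite natrM natrM natrX -mulrA [4%:R * _]mulrC -!mulrA ler_wpM2l//.
  apply: le_trans (powR23 (a := 2 * nu%:R * si) _ p0 _) _.
  + by rewrite !mulr_ge0// ltW.
  + rewrite /tm !exprMn mulrC ler_pM2r//; apply: (@le_trans _ _ (4 * N)%:R); first by rewrite ler_nat.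
    by rewrite natrM natrX ler_pM2r ?exprn_gt0// -natrX ler_nat.
  + by rewrite le_eqVlt; apply/orP; left; apply/eqP; ring.
- move=> n hn; rewrite /x -mulrBl normrM (gtr0_norm (x := (si ^+ 2)^-1)) ?invr_gt0// ler_pdivrMr//.
  have t0 : tm n != tm n.+1 by rewrite lt_eqF// tm_lt.
  have := hg _ _ (tmI n (ltnW hn)) (tmI n.+1 hn) t0 => /le_trans; apply.
  rewrite ler_wpM2l//; apply: powR23; rewrite ?(ltW s0)//.
  by rewrite /tm -mulrBr -natrB// subSnn mulr1 gtr0_norm.
rewrite -/N /=.
have XE a b : raf si 0 0 f ((x a, a%:R), (x b, b%:R)) = si^-1 * f ((g (tm a), tm a), (g (tm b), tm b)).
  by rewrite /raf /aff /= /x ![si ^+ 2 * _]mulrC !divfK ?gt_eqF// !addr0.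
have qE a : raf si 0 0 f ((x a, a%:R), q) = si^-1 * f ((g (tm a), tm a), (0, 1)).
  by rewrite /raf /aff /= /x [si ^+ 2 * _]mulrC !divfK ?gt_eqF// !addr0 mulr0 divff ?gt_eqF.
rewrite !XE !qE; under eq_bigr do rewrite XE.
have si0 : 0 < si^-1 by rewrite /si /copy_scale invrK ltr0n muln_gt0 expn_gt0.
rewrite -mulr_sumr -!mulrDr (ler_pM2l si0).
pose ri i := if i is i'.+1 then if i' is i''.+1 then if (i'' <= N)%N then (2 * N + i'')%N else (4 * N)%N
  else N else 0%N.
pose r i := if (i < N.+4)%N then tm (ri i) else 1.
have riS i : (i < N.+3)%N -> (ri i < ri i.+1)%N.
  case: i => [|[|i]] //= hi.
    by rewrite addn0 ltn_Pmull.
  rewrite !ltnS in hi; rewrite hi; case: ifP => // _.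
    by rewrite addnS.
  by apply: (@leq_ltn_trans (3 * N)); rewrite ?ltn_mul2r ?N0// -[3%N]/(2 + 1)%N mulnDl mul1n leq_add2l.
have ri4 i : (ri i <= 4 * N)%N.
  case: i => [|[|i]] //=; first by rewrite leq_pmull.
  case: ifP => // hi; apply: (@leq_trans (3 * N)); rewrite ?leq_mul2r ?orbT//.
  by rewrite -[3%N]/(2 + 1)%N mulnDl mul1n leq_add2l.
have := geodesic_le_partition (k := N.+4) (r := r) geo.
rewrite {1}/r /= tm0 {1}/r ltnn => /(_ erefl erefl) h.
have {}h : f ((0, 0), (0, 1)) <= \sum_(0 <= i < N.+4) f ((g (r i), r i), (g (r i.+1), r i.+1)).
  apply: h => i hi; rewrite /r hi; case: ifP => hi'; first by apply/tm_lt/riS.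
  by have /andP[] := tm01 _ (ri4 i).
rewrite g0; apply: le_trans h _.
rewrite big_nat_recr// big_nat_recr// big_nat_recl// big_nat_recl//=.
have r0 : r 0%N = 0 by rewrite /r /= tm0.
have r1 : r 1%N = tm N by [].
have r2 i : (i <= N)%N -> r i.+2 = tm (2 * N + i)%N.
  by move=> hi; rewrite /r !ltnS (leq_trans hi)//= hi.
have r3 : r N.+3 = tm (4 * N)%N by rewrite /r ltnSn /= ltnn.
have r4 : r N.+4 = 1 by rewrite /r ltnn.
have e3 : (2 * N + N = 3 * N)%N by rewrite -mulSnr.
rewrite r0 r1 r3 r4 r2// r2// addn0 e3 g0 g1.
rewrite big_mkord; have -> : \sum_(i < N) f ((g (r i.+2), r i.+2), (g (r i.+3), r i.+3)) =
    \sum_(i < N) f ((g (tm (2 * N + i)%N), tm (2 * N + i)%N), (g (tm (2 * N + i).+1), tm (2 * N + i).+1)).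
  by apply: eq_bigr => i _; rewrite !r2 ?addnS// ltnW.
by rewrite !addrA.
Qed.

End geodesic_contradiction.

Section triangle.
Context {R : realType} {d' : measure_display} {T' : measurableType d'} (Q : probability T' R)
  (W : int -> T' -> R -> R) {d : measure_display} {T : measurableType d} (P : probability T R)
  (L : T -> R4 R -> R).
Hypothesis gW : genv Q W.
Hypothesis cvL : cvg_in_distribution Q (fun n w => landscape_n (fun j => W j w) n) P L.
Hypothesis mL : forall p, R4up p -> measurable_fun setT (fun w => L w p).
Hypothesis cL : forall w, cont_up (L w).

Definition frac_pt (m : nat) (k : int * int) : R * R := (k.1%:~R / m.+1%:R, k.2%:~R / m.+1%:R).
Definition frac_of (m : nat) (x : R * R) : int * int :=
  (Num.floor (x.1 * m.+1%:R), Num.floor (x.2 * m.+1%:R)).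

Lemma floor_cvg (x : R) : (Num.floor (x * m.+1%:R))%:~R / m.+1%:R @[m --> \oo] --> x.
Proof.
apply/cvgrPdist_lt => e e0; near=> m.
have m0 : 0 < m.+1%:R :> R by [].
have hm : m.+1%:R^-1 < e by near: m; exact: (near_infty_natSinv_lt (PosNum e0)).
apply: le_lt_trans hm; rewrite -[x in x - _](mulfK (x := m.+1%:R)) ?gt_eqF// -mulrBl normrM.
rewrite (ger0_norm (x := m.+1%:R^-1)) ?invr_ge0// ler_piMl ?invr_ge0//.
have /andP[h1 h2] := Num.Theory.floor_itv (x * m.+1%:R).
by rewrite ger0_norm ?subr_ge0// lerBlDl ltW// -intrD1.
Unshelve. all: by end_near. Qed.

Let fr m (x : R * R) := frac_pt m (frac_of m x).

Lemma frac_cvg (x : R * R) : fr m x @[m --> \oo] --> x.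
Proof.
by case: x => x1 x2; apply: (@cvg_pair _ _ _ _ (nbhs x1) (nbhs x2)); exact: floor_cvg.
Qed.

Lemma frac_pair_cvg (f : R4 R -> R) (x y : R * R) : {for (x, y), continuous f} ->
  f (fr m x, fr m y) @[m --> \oo] --> f (x, y).
Proof.
move=> cf; apply: (@cvg_comp _ _ _ (fun m => (fr m x, fr m y)) f _ (nbhs (x, y))) cf.
by apply: (@cvg_pair _ _ _ _ (nbhs x) (nbhs y)); exact: frac_cvg.
Qed.

Lemma frac_lt (x y : R * R) : x.2 < y.2 -> \forall m \near \oo, (fr m x).2 < (fr m y).2.
Proof.
move=> xy; have h : (fr m y).2 - (fr m x).2 @[m --> \oo] --> y.2 - x.2.
  by apply: cvgB; exact: floor_cvg.
have xy0 : 0 < y.2 - x.2 by rewrite subr_gt0.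
by apply: filterS (cvgr_gt _ h _ xy0) => m; rewrite subr_gt0.
Qed.

Lemma triangle_ae : {ae P, forall o, reverse_triangle (L o)}.
Proof.
pose tp := (nat * (int * int) * (int * int) * (int * int))%type.
pose A (i : nat) (o : T) := if @choice.unpickle tp i is Some (m, k1, k2, k3) then
  (frac_pt m k1).2 < (frac_pt m k2).2 -> (frac_pt m k2).2 < (frac_pt m k3).2 ->
  L o (frac_pt m k1, frac_pt m k2) + L o (frac_pt m k2, frac_pt m k3) <=
  L o (frac_pt m k1, frac_pt m k3) else True.
have hA : {ae P, forall o, forall i, A i o}.
  apply: ae_foralln => i; rewrite /A.
  case: choice.unpickle => [[[[m k1] k2] k3]|]; last by apply: aeW.
  have [h1|_] := ltP (frac_pt m k1).2 (frac_pt m k2).2; last by apply: aeW.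
  have [h2|_] := ltP (frac_pt m k2).2 (frac_pt m k3).2; last by apply: aeW.
  by apply: filterS (limit_triangle gW cvL mL h1 h2) => o h _ _.
apply: filterS hA => o hA x y z xy yz.
have c1 : L o (fr m x, fr m y) + L o (fr m y, fr m z) @[m --> \oo] --> L o (x, y) + L o (y, z).
  by apply: cvgD; apply: frac_pair_cvg; [exact: (@cL o (x, y) xy)|exact: (@cL o (y, z) yz)].
have c2 : L o (fr m x, fr m z) @[m --> \oo] --> L o (x, z).
  by apply: frac_pair_cvg; exact: (@cL o (x, z) (lt_trans xy yz)).
apply: (ler_cvg_to c1 c2); near=> m.
have := hA (choice.pickle ((m, frac_of m x, frac_of m y, frac_of m z) : tp)).
by rewrite /A choice.pickleK; apply; near: m; exact: frac_lt.
Unshelve. all: by end_near. Qed.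

End triangle.

Theorem theorem10p2 (R : realType) (d : measure_display)
    (Omega : measurableType d) (P : probability Omega R)
    (L : Omega -> R4 R -> R) (hL : directed_landscape P L)
    (pi : Omega -> R -> R)
    (hpi : {ae P, forall w, is_unique_geodesic (L w) (0, 0) (0, 1) (pi w)}) :
  {ae P, forall w, ~ hoelder01 (2 / 3) (pi w)}.
Proof.
have [cL0 mL [d' [T' [Q [W [iW cvL]]]]]] := hL.
have cL w : cont_up (L w) by move=> p; exact: cL0.
have gW := independent_BMs_genv iW.
have blocks : {ae P, forall o, forall M : nat, exists C D c1 c2 (w : R) nu j,
    [/\ (0 < nu)%N, 0 <= D, (4 * M)%:R <= D & [/\ `|w| <= D * nu%:R ^+ 2,
    4 * C < nu%:R ^+ 2 * (c2 - c1) &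
    holds (affE (copy_scale nu j : R) 0 0 (block C D c1 c2 w M nu)) (L o)]]}.
  apply: ae_foralln => M.
  have [C [D [c1 [c2 [w [nu [nu0 D0 MD [wD hnu hp]]]]]]]] := block_pos gW cvL mL cL M.
  have := copies gW cvL mL cL nu0 (@block_ok R C D c1 c2 w M nu nu0 D0)
    (@block_times R C D c1 c2 w M nu nu0) hp.
  by apply: filterS => o [j hj]; exists C, D, c1, c2, w, nu, j.
apply: filterS3 hpi blocks (triangle_ae gW cvL mL cL) => o [geo _] hb tri /hoelder_bound[M hM].
have [C [D [c1 [c2 [w [nu [j [nu0 D0 MD [wD hnu hh]]]]]]]]] := hb M.
exact: (geodesic_contra tri geo hM nu0 D0 MD wD hnu hh).
Qed.
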